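(* $\mathrm{Aut}(U)=\langle\tau_e,\tau_f\rangle$, i.e. the full automorphism group of the VOA $U$ is generated by the two Miyamoto involutions $\tau_e$ and $\tau_f$.
   Context: Everything is over $\mathbb C$. Definition of $U$. Let $A_1^5=\mathbb Z\alpha^1\oplus\cdots\oplus\mathbb Z\alpha^5$ with $\langle\alpha^i,\alpha^j\rangle=2\delta_{i,j}$, $\gamma=\frac12(\alpha^1+\alpha^2+\alpha^3+\alpha^4)$, $L=A_1^5\cup(\gamma+A_1^5)$ (an even lattice), and let $V_L$ be the associated lattice VOA with vacuum $\mathbf 1$, where for $\beta\in A_1^5$ the vectors $e^\beta$ are normalized so that $e^\beta e^{\beta'}=e^{\beta+\beta'}$ in the twisted group algebra. For $1\le j\le 5$ put $H^j=\alpha^1_{(-1)}\mathbf 1+\cdots+\alpha^j_{(-1)}\mathbf 1$, $E^j=e^{\alpha^1}+\cdots+e^{\alpha^j}$, $F^j=e^{-\alpha^1}+\cdots+e^{-\alpha^j}$, $\Omega^j=\frac1{2(j+2)}\left(\frac12H^j_{(-1)}H^j+E^j_{(-1)}F^j+F^j_{(-1)}E^j\right)$, and for $1\le i\le4$ put $\omega^i=\Omega^i+\frac14(\alpha^{i+1}_{(-1)})^2\mathbf 1-\Omega^{i+1}$. Then $U=\{v\in V_L\mid\omega^1_{(1)}v=\omega^2_{(1)}v=\Omega^5_{(1)}v=0\}$, a VOA with Virasoro vector $\omega=\omega^3+\omega^4$, $U_0=\mathbb C\mathbf 1$, $U_1=0$, $\dim U_2=4$. The invariant form on $U_2$ is $\langle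 x,y\rangle\mathbf 1=x_{(3)}y$. The vectors $e,f$. Put $e=\frac1{16}\left((\alpha^4-\alpha^5)_{(-1)}\right)^2\mathbf 1-\frac14\left(e^{\alpha^4-\alpha^5}+e^{-\alpha^4+\alpha^5}\right)$, $v_1=(9F^4-8F^5)_{(-1)}(4F^3-3F^4)_{(0)}e^{\gamma}-\frac12(9H^4-8H^5)_{(-1)}F^4_{(0)}(4F^3-3F^4)_{(0)}e^{\gamma}-\frac12(9E^4-8E^5)_{(-1)}(F^4_{(0)})^2(4F^3-3F^4)_{(0)}e^{\gamma}$, $a=\frac{105}{2^8}(\omega-e)$, $b=\frac{3^2}{2^8}(-5\omega^3+7\omega^4-4e)$, $c=kv_1$ with the scalar $k$ determined (up to sign) by $\langle c,c\rangle=3^5/2^{11}$, and $f=\frac{13}{2^8}e+a+b+c$. The vectors $e,f$ are conformal vectors of $U$ with central charge $1/2$, i.e. their modes $x_{(n+1)}$ satisfy the Virasoro relations with central charge $1/2$, and each generates a sub VOA isomorphic to $L(\frac12,0)$. For a conformal vector $x$ generating a sub VOA $\mathrm{Vir}(x)\cong L(\frac12,0)$, the Miyamoto involution $\tau_x$ is the automorphism acting as $1$ on the sum of all irreducible $\mathrm{Vir}(x)$-submodules isomorphic to $L(\frac12,0)$ or $L(\frac12,\frac12)$ and as $-1$ on the sum of those isomorphic to $L(\frac12,\frac1{16})$; here $L(c,h)$ is the irreducible highest weight Virasoro module with central charge $c$ and highest weight $h$. *)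

(* Defs.v *)
From HB Require Import structures.
From mathcomp Require Import all_boot all_order all_algebra.
From mathcomp Require Import finmap multiset monalg ring lra.
From mathcomp Require Import boolp classical_sets functions fsbigop reals complex.

Set Implicit Arguments.
Unset Strict Implicit.
Unset Printing Implicit Defensive.

Import Order.TTheory GRing.Theory Num.Theory.

Local Open Scope classical_set_scope.
Local Open Scope ring_scope.

(* ** The lattice L

   Vectors of Q (x) A_1^5 are rows of coordinates with respect to
   alpha^1, ..., alpha^5. *)

Definition dotL (x y : 'rV[rat]_5) : rat := \sum_(i < 5) 2 * x 0 i * y 0 i.

Definition gamma_row : 'rV[rat]_5 := \row_(i < 5) (if (i < 4)%N then 2^-1 else 0).

Definition inA : pred 'rV[rat]_5 := fun x => [forall i, x 0 i \is a Num.int].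

Definition inL : pred 'rV[rat]_5 := fun x => inA x || inA (x - gamma_row).

Lemma inA0 : inA 0.
Proof. by apply/forallP=> i; rewrite mxE rpred0. Qed.

Lemma inAB x y : inA x -> inA y -> inA (x - y).
Proof.
by move=> /forallP hx /forallP hy; apply/forallP=> i; rewrite !mxE rpredB.
Qed.

Lemma inA_2gamma : inA (gamma_row + gamma_row).
Proof. by apply/forallP=> i; rewrite !mxE; case: ifP. Qed.

Lemma inL_zmod_closed : zmod_closed inL.
Proof.
split=> [|x y]; first by rewrite unfold_in inA0.
have AD u v : inA u -> inA v -> inA (u + v).
  by move=> hu hv; rewrite -[v]opprK inAB // -[- v]add0r inAB // inA0.
rewrite !unfold_in => /orP[hx|hx] /orP[hy|hy]; apply/orP.
- by left; apply: inAB.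
- right; have -> : x - y - gamma_row =
     x - (y - gamma_row) - (gamma_row + gamma_row).
    by apply/matrixP=> i j; rewrite !mxE; ring.
  by apply: inAB inA_2gamma; apply: inAB.
- by right; rewrite addrAC; apply: inAB.
- left; have -> : x - y = x - gamma_row - (y - gamma_row).
    by rewrite opprB addrA addrNK.
  exact: inAB.
Qed.

HB.instance Definition _ := GRing.isZmodClosed.Build _ inL inL_zmod_closed.

Record lat := Lat { lat_row :> 'rV[rat]_5; latP : lat_row \in inL }.

HB.instance Definition _ := [isSub for lat_row].
HB.instance Definition _ := [Choice of lat by <:].
HB.instance Definition _ := [SubChoice_isSubZmodule of lat by <:].

(* alphaL i is alpha^i for 1 <= i <= 5. *)
Definition alpha_row (i : nat) : 'rV[rat]_5 := delta_mx 0 (inord i.-1).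

Lemma alpha_rowP i : alpha_row i \in inL.
Proof.
by apply/orP; left; apply/forallP=> j; rewrite mxE; case: (_ && _).
Qed.

Lemma gamma_rowP : gamma_row \in inL.
Proof.
by apply/orP; right; rewrite subrr inA0.
Qed.

Definition alphaL (i : nat) : lat := Lat (alpha_rowP i).
Definition gammaL : lat := Lat gamma_rowP.

(* The pairing is integral on L, so taking the floor loses nothing. *)
Definition dotZ (x y : lat) : int := Num.floor (dotL x y).

(* (-1)^(sgnL x y) is a bimultiplicative 2-cocycle of L with commutator
   (-1)^<x,y>: 2 x_1 is even on A_1^5 and odd on gamma + A_1^5. It is trivial
   on A_1^5 x L, so e^beta e^beta' = e^(beta + beta') for beta, beta' in A_1^5. *)
Definition sgnL (x y : lat) : int :=
  Num.floor (2 * lat_row x 0 ord0) * dotZ gammaL y.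

(* ** The lattice vertex operator algebra V_L

   A basis of V_L = M(1) (x) C{L} is given by the vectors
   (prod_((i, p) in s) alpha^(i+1)_(-p-1)) e^lambda. *)

Notation fock_basis := ({mset ('I_5 * nat)%type}%mset * lat)%type.

Notation "'VL' R" := {malg (R[i]%C)[fock_basis]} (at level 10, R at level 9).

Section LatticeVOA.
Context {R : realType}.
Local Notation C := (R[i]%C).
Local Notation V := (VL R).

Definition lin_ext (F : fock_basis -> V) (u : V) : V :=
  \sum_(b <- msupp u) u@_b *: F b.

(* alpha^(i+1)_(n), with [alpha^i_(m), alpha^j_(n)] = 2 m delta_ij delta_(m+n,0).
   Negz p is the integer -(p+1). *)
Definition heis (i : 'I_5) (n : int) : V -> V :=
  lin_ext (fun b => let: (s, lambda) := b in
    match n with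
    | Negz p => << (msetD [mset (i, p)]%mset s, lambda) >>
    | Posz 0 => (dotZ (alphaL i.+1) lambda)%:~R *: << (s, lambda) >>
    | Posz p.+1 =>
        (2 * p.+1 * s (i, p))%:R *: << (msetB s [mset (i, p)]%mset, lambda) >>
    end).

(* beta_(n) for beta in L. *)
Definition hmode (beta : lat) (n : int) (u : V) : V :=
  \sum_(i < 5) ratr (lat_row beta 0 i) *: heis i n u.

(* powcoef A r k and expcoef A k are the coefficients of z^k in X(z)^r and in
   exp(X(z)), where X(z) = sum_(n >= 1) A_n z^n. *)
Fixpoint powcoef (A : nat -> V -> V) (r k : nat) (u : V) : V :=
  match r with
  | 0 => if k == 0%N then u else 0
  | r'.+1 => \sum_(1 <= n < k.+1) A n (powcoef A r' (k - n) u)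
  end.

Definition expcoef (A : nat -> V -> V) (k : nat) (u : V) : V :=
  \sum_(r < k.+1) (r`!%:R)^-1 *: powcoef A r k u.

Definition creation (beta : lat) : nat -> V -> V :=
  expcoef (fun n u => n%:R^-1 *: hmode beta (- n%:Z) u).

Definition annihilation (beta : lat) : nat -> V -> V :=
  expcoef (fun n u => - n%:R^-1 *: hmode beta n%:Z u).

(* The coefficient of z^(-m-1) in
     Y(e^beta, z) = exp(sum_(n>0) beta_(-n) z^n / n)
                    exp(- sum_(n>0) beta_(n) z^(-n) / n) e^beta z^(beta_(0)).
   Sums over \in [set: nat] are sums over the support of their terms, which is
   finite here and below. *)
Definition exp_mode (beta : lat) (m : int) : V -> V :=
  lin_ext (fun b => let: (s, lambda) := b in
    (-1) ^ sgnL beta lambda *: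
    \sum_(l \in [set: nat])
      if l%:Z - m - 1 - dotZ beta lambda is Posz p then
        creation beta p (annihilation beta l << (s, beta + lambda) >>)
      else 0).

(* The m-th mode of a_1 (a_2 (... e^beta)), with a_j = alpha^(i+1)_(-p-1) for
   the j-th pair (i, p) in s, computed from the normally ordered product
     Y(alpha_(-p-1) b, z) = :(1/p!) (d/dz)^p Y(alpha, z) Y(b, z):. *)
Fixpoint word_mode (s : seq ('I_5 * nat)) (beta : lat) (m : int) (u : V) : V :=
  match s with
  | [::] => exp_mode beta m u
  | (i, p) :: s' =>
      \sum_(j \in [set: nat])
        'C(p + j, p)%:R *:
          (heis i (- p%:Z - 1 - j%:Z) (word_mode s' beta (m + j%:Z) u)
           + (-1) ^+ p *:
             word_mode s' beta (m - p%:Z - 1 - j%:Z) (heis i j%:Z u))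
  end.

(* nprod a n b is a_(n) b. *)
Definition nprod (a : V) (n : int) (b : V) : V :=
  \sum_(c <- msupp a) a@_c *: word_mode (enum_mset c.1) c.2 n b.

Definition expL (beta : lat) : V := << (mset0, beta) >>.

Definition vac : V := expL 0.

(* ** Subspaces, subalgebras, automorphisms *)

Definition is_subspace (S : set V) : Prop :=
  S 0 /\ forall (a : C) u v, S u -> S v -> S (a *: u + v).

Definition span (S : set V) : set V := smallest is_subspace S.

Definition is_subVA (S : set V) : Prop :=
  [/\ is_subspace S, S vac &
      forall u v (n : int), S u -> S v -> S (nprod u n v)].

Definition subVA_gen (S : set V) : set V := smallest is_subVA S.

(* A map on a sub VOA U is represented by a function V -> V whose values outside
   of U are irrelevant; Aut U omega is the automorphism group of the sub VOA U
   with Virasoro vector omega, as a set of such functions. *)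
Definition Aut (U : set V) (omega : V) : set (V -> V) :=
  [set g | [/\ set_bij U U g,
               forall (a : C) u v, U u -> U v -> g (a *: u + v) = a *: g u + g v,
               g vac = vac, g omega = omega &
               forall u v (n : int), U u -> U v ->
                 g (nprod u n v) = nprod (g u) n (g v)]].

Definition is_subgroup (U : set V) (G : set (V -> V)) : Prop :=
  [/\ G id,
      forall g h, G g -> G h -> G (g \o h),
      forall g h, G g -> {in U, cancel g h} -> {in U, cancel h g} -> G h &
      forall g h, G g -> {in U, g =1 h} -> G h].

Definition group_gen (U : set V) (T : set (V -> V)) : set (V -> V) :=
  smallest (is_subgroup U) T.

(* ** Virasoro modules and Miyamoto involutions *)

Definition is_submodule (A U W : set V) : Prop :=
  [/\ W `<=` U, is_subspace W &
      forall a w (n : int), A a -> W w -> W (nprod a n w)].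

Definition is_irr_submodule (A U W : set V) : Prop :=
  [/\ is_submodule A U W, W != [set 0] &
      forall W', is_submodule A U W' -> W' `<=` W -> W' = [set 0] \/ W' = W].

(* The operators L n make W a Virasoro module of central charge c. *)
Definition is_vir_module (L : int -> V -> V) (c : C) (W : set V) : Prop :=
  is_subspace W /\
  forall (m n : int) w, W w -> W (L m w) /\
    L m (L n w) - L n (L m w) =
      (m - n)%:~R *: L (m + n) w +
      (if m + n == 0 then ((m ^+ 3 - m)%:~R / 12 * c) *: w else 0).

(* W is isomorphic to L(c, h), the irreducible highest weight module. *)
Definition is_Lch (L : int -> V -> V) (c h : C) (W : set V) : Prop :=
  [/\ is_vir_module L c W,
      forall W', is_vir_module L c W' -> W' `<=` W -> W' = [set 0] \/ W' = W &
      exists w, [/\ W w, w != 0, L 0 w = h *: w &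
                    forall n : int, 0 < n -> L n w = 0]].

Definition Vir (x : V) : set V := subVA_gen [set x].

Definition Lop (x : V) (n : int) : V -> V := nprod x (n + 1).

Definition Vir_submodule (U : set V) (x : V) (h : C) (W : set V) : Prop :=
  is_irr_submodule (Vir x) U W /\ is_Lch (Lop x) (1 / 2) h W.

Definition tau_even (U : set V) (x : V) : set V :=
  span [set v | exists W, (Vir_submodule U x 0 W \/
                           Vir_submodule U x (1 / 2) W) /\ W v].

Definition tau_odd (U : set V) (x : V) : set V :=
  span [set v | exists W, Vir_submodule U x (1 / 16) W /\ W v].

(* U is the direct sum of tau_even U x and tau_odd U x when x is a conformal
   vector as in Miyamoto's theorem. *)
Definition tau (U : set V) (x : V) (v : V) : V :=
  let pq := xget (0, 0) [set pq : V * V |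
    [/\ tau_even U x pq.1, tau_odd U x pq.2 & v = pq.1 + pq.2]] in
  pq.1 - pq.2.

(* ** The vertex operator algebra U and the vectors e, f *)

Definition alphav (i : nat) : V := hmode (alphaL i) (-1) vac.

Definition Hv (j : nat) : V := \sum_(1 <= i < j.+1) alphav i.
Definition Ev (j : nat) : V := \sum_(1 <= i < j.+1) expL (alphaL i).
Definition Fv (j : nat) : V := \sum_(1 <= i < j.+1) expL (- alphaL i).

Definition Omega (j : nat) : V :=
  (1 / (2 * (j%:R + 2))) *:
    ((1 / 2) *: nprod (Hv j) (-1) (Hv j) + nprod (Ev j) (-1) (Fv j)
     + nprod (Fv j) (-1) (Ev j)).

Definition omegav (i : nat) : V :=
  Omega i
  + (1 / 4) *: hmode (alphaL i.+1) (-1) (hmode (alphaL i.+1) (-1) vac)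
  - Omega i.+1.

Definition U : set V :=
  [set v | [/\ nprod (omegav 1) 1 v = 0, nprod (omegav 2) 1 v = 0 &
               nprod (Omega 5) 1 v = 0]].

Definition omegaU : V := omegav 3 + omegav 4.

Definition evec : V :=
  (1 / 16) *: hmode (alphaL 4 - alphaL 5) (-1)
                (hmode (alphaL 4 - alphaL 5) (-1) vac)
  - (1 / 4) *: (expL (alphaL 4 - alphaL 5) + expL (- alphaL 4 + alphaL 5)).

Definition v1vec : V :=
  let w := nprod (4 *: Fv 3 - 3 *: Fv 4) 0 (expL gammaL) in
  nprod (9 *: Fv 4 - 8 *: Fv 5) (-1) w
  - (1 / 2) *: nprod (9 *: Hv 4 - 8 *: Hv 5) (-1) (nprod (Fv 4) 0 w)
  - (1 / 2) *: nprod (9 *: Ev 4 - 8 *: Ev 5) (-1)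
                 (nprod (Fv 4) 0 (nprod (Fv 4) 0 w)).

Definition avec : V := (105 / 2 ^+ 8) *: (omegaU - evec).

Definition bvec : V :=
  (3 ^+ 2 / 2 ^+ 8) *: (- 5 *: omegav 3 + 7 *: omegav 4 - 4 *: evec).

Definition cvec (k : C) : V := k *: v1vec.

Definition fvec (k : C) : V :=
  (13 / 2 ^+ 8) *: evec + avec + bvec + cvec k.

End LatticeVOA.

Arguments U : clear implicits.

(* Main.v *)
(* U is contained in V_L, whose compact form provides a positive definite Hermitian
   form for which e, f and the Virasoro vectors omega^i have self-adjoint modes.
   For a self-adjoint conformal vector x of central charge 1/2, the singular vector
   of weight 6 has norm zero, hence vanishes, and this forces the Vir(x)-primary
   weights 0, 1/2, 1/16 and the fusion rules modulo parity; so U is the orthogonal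
   sum of irreducible Vir(x)-modules and tau_x is an automorphism.
   Write f' for tau_e f. In the basis omega^3, omega^4, e, c of U_2 one finds that e, f, f'
   are the only conformal vectors of central charge 1/2, and that tau_e and tau_f
   exchange f with f' and e with f'. It remains to see that an automorphism fixing e, f, f'
   is trivial, that is, that e, f, f' and omega^4 generate U. A vector of weight n >= 2
   orthogonal to the generated subalgebra and minimal with this property is singular
   for e, f, f' and omega^4; computing the mean of f_(1) on its components of
   e_(1)-eigenvalue 0 and 1/2 shows that all its weights are 1/16, and then the sum
   e + f + f' = 15/32 omega^3 + 21/16 omega^4 gives a contradiction. *)
From Stdlib Require Import ZArith QArith.
Close Scope Q_scope.
Require Import Defs.
From HB Require Import structures.
From mathcomp Require Import all_boot all_order all_algebra.
From mathcomp Require Import finmap multiset monalg zify ssrZ ring lra.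
From mathcomp Require Import boolp classical_sets functions fsbigop reals complex.

Set Implicit Arguments.
Unset Strict Implicit.
Unset Printing Implicit Defensive.

Import Order.TTheory GRing.Theory Num.Theory.

Local Open Scope classical_set_scope.
Local Open Scope ring_scope.

(** V_L is given by formulas only, so its vertex algebra structure must be proved before any
    representation theory. The obstacle is that the modes of e^beta are unwieldy; the record
    [fockData] therefore exposes only their commutators with the Heisenberg algebra, their degrees
    and their leading coefficients, and every identity between modes is reduced to leading
    coefficients by induction on degree. Locality of the generators, Dong's lemma and uniqueness of
    fields then give the Borcherds identity. All numbers attached to e, f and the omega^i come from
    evaluating rational normal forms. Three points are not visible in the overview. The modes of v_1
    are anti-self-adjoint, and it is the condition <c,c> > 0 that makes k purely imaginary and hence
    c and f self-adjoint. U_1 = 0 is derived: the sum of the three operators defining U is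
    self-adjoint and onto in weight one. That U_2 is spanned by omega^3, omega^4, e, c is derived
    too, by applying to the orthogonal complement of these vectors the same argument that proves
    generation. *)

(* The trivial extensions Z (+) V and C (+) V, with V an ideal of square zero,
   let the ring tactic decide linear identities in V. *)
Definition zext (V : zmodType) : Type := (int * V)%type.

HB.instance Definition _ (V : zmodType) := GRing.Zmodule.copy (zext V) (int * V)%type.

Section ZExt.
Variable V : zmodType.
Implicit Types x y z : zext V.

Definition zext_one : zext V := (1, 0).
Definition zext_mul x y : zext V := (x.1 * y.1, y.2 *~ x.1 + x.2 *~ y.1).

Lemma zext_mulA : associative zext_mul.
Proof.
move=> x y z; congr pair; rewrite /= ?mulrA// !mulrzDl addrA -!mulrzA.
by rewrite [y.1 * x.1]mulrC [z.1 * x.1]mulrC.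
Qed.
Lemma zext_mulC : commutative zext_mul.
Proof. by move=> x y; congr pair; [exact: mulrC|exact: addrC]. Qed.
Lemma zext_mul1 : left_id zext_one zext_mul.
Proof. by move=> [a x]; rewrite /zext_mul /= mul1r mul0rz addr0 mulr1z. Qed.
Lemma zext_mulDl : left_distributive zext_mul +%R.
Proof.
by move=> x y z; congr pair; rewrite /= ?mulrDl// mulrzDr mulrzDl addrACA.
Qed.
Lemma zext_oner_neq0 : zext_one != 0.
Proof. by []. Qed.

HB.instance Definition _ := GRing.Zmodule_isComNzRing.Build (zext V)
  zext_mulA zext_mulC zext_mul1 zext_mulDl zext_oner_neq0.

Definition zin (v : V) : zext V := (0, v).

Lemma zin_inj : injective zin. Proof. by move=> u v []. Qed.
Lemma zin0 : zin 0 = 0. Proof. by []. Qed.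
Lemma zinD u v : zin (u + v) = zin u + zin v.
Proof. by congr pair. Qed.
Lemma zinN v : zin (- v) = - zin v.
Proof. by congr pair. Qed.
Lemma zinMn v n : zin (v *+ n) = zin v *+ n.
Proof. by elim: n => // n IH; rewrite !mulrS zinD IH. Qed.
Lemma zinMz v (n : int) : zin (v *~ n) = n%:~R * zin v.
Proof.
rewrite mulrzl; case: n => n; first exact: zinMn.
by rewrite !NegzE !mulrNz zinN; congr (- _); exact: zinMn.
Qed.
Definition zinE := (zin0, zinD, zinN, zinMz, zinMn).
End ZExt.

Ltac zmod := apply: zin_inj; rewrite ?zinE; ring.

Definition lext (C : comNzRingType) (V : lmodType C) : Type := (C * V)%type.

HB.instance Definition _ (C : comNzRingType) (V : lmodType C) := GRing.Zmodule.copy (lext V) (C * V)%type.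

Section LExt.
Variables (C : comNzRingType) (V : lmodType C).
Implicit Types x y z : lext V.

Definition lext_one : lext V := (1, 0).
Definition lext_mul x y : lext V := (x.1 * y.1, x.1 *: y.2 + y.1 *: x.2).

Lemma lext_mulA : associative lext_mul.
Proof.
move=> x y z; congr pair; rewrite /= ?mulrA// !scalerDr addrA !scalerA.
by rewrite [x.1 * z.1]mulrC [z.1 * y.1]mulrC.
Qed.
Lemma lext_mulC : commutative lext_mul.
Proof. by move=> x y; congr pair; [exact: mulrC|exact: addrC]. Qed.
Lemma lext_mul1 : left_id lext_one lext_mul.
Proof. by move=> [a x]; rewrite /lext_mul /= mul1r scaler0 addr0 scale1r. Qed.
Lemma lext_mulDl : left_distributive lext_mul +%R.
Proof.
by move=> x y z; congr pair; rewrite /= ?mulrDl// scalerDr scalerDl addrACA.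
Qed.
Lemma lext_oner_neq0 : lext_one != 0.
Proof. by apply/eqP => -[] /eqP; rewrite oner_eq0. Qed.

HB.instance Definition _ := GRing.Zmodule_isComNzRing.Build (lext V)
  lext_mulA lext_mulC lext_mul1 lext_mulDl lext_oner_neq0.

Definition lemb (v : V) : lext V := (0, v).
Definition lsc (c : C) : lext V := (c, 0).

Lemma lemb_inj : injective lemb. Proof. by move=> u v []. Qed.
Lemma lemb0 : lemb 0 = 0. Proof. by []. Qed.
Lemma lembD u v : lemb (u + v) = lemb u + lemb v.
Proof. by congr pair; rewrite ?addr0. Qed.
Lemma lembN v : lemb (- v) = - lemb v.
Proof. by congr pair; rewrite ?oppr0. Qed.
Lemma lembMn v n : lemb (v *+ n) = lemb v *+ n.
Proof. by elim: n => // n IH; rewrite !mulrS lembD IH. Qed.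
Lemma lembMz v (n : int) : lemb (v *~ n) = n%:~R * lemb v.
Proof.
rewrite mulrzl; case: n => n; first exact: lembMn.
by rewrite !NegzE !mulrNz lembN; congr (- _); exact: lembMn.
Qed.
Lemma lembZ c v : lemb (c *: v) = lsc c * lemb v.
Proof. by congr pair; rewrite /= ?mulr0// scale0r addr0. Qed.

Fact lsc_zmod : zmod_morphism lsc.
Proof. by move=> a b; congr pair; rewrite /= subr0. Qed.
Fact lsc_monoid : monoid_morphism lsc.
Proof. by split=> // a b; congr pair; rewrite /= !scaler0 addr0. Qed.
HB.instance Definition _ := GRing.isZmodMorphism.Build C (lext V) lsc lsc_zmod.
HB.instance Definition _ := GRing.isMonoidMorphism.Build C (lext V) lsc lsc_monoid.

Definition lextE := (lemb0, lembD, lembN, lembMz, lembMn, lembZ).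
End LExt.

Ltac lmod := apply: lemb_inj; rewrite ?lextE; ring.

(** * Sums over the natural numbers with finitely many nonzero terms *)

Section NatSums.
Variable V : zmodType.
Implicit Types (F G : nat -> V).

Definition nsum F : V := \sum_(j \in [set: nat]) F j.

Definition fins F := exists N, forall j, (N <= j)%N -> F j = 0.

Lemma nsumE N F :
  (forall j, (N <= j)%N -> F j = 0) -> nsum F = \sum_(j < N) F j.
Proof.
move=> F0; rewrite /nsum -(big_mkord xpredT) /index_iota subn0.
rewrite (@bigfs _ _ +%R nat (iota 0 N) xpredT F) ?iota_uniq//; last first.
  by move=> i _; rewrite mem_iota add0n /= -leqNgt => /F0.
by apply: eq_fsbigl; apply/seteqP; split.
Qed.

Lemma eq_nsum F G : F =1 G -> nsum F = nsum G.
Proof. by move=> /funext ->. Qed.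

Lemma nsum0 : nsum (fun=> 0) = 0.
Proof. by rewrite (@nsumE 0) ?big_ord0. Qed.

Lemma nsumD F G : fins F -> fins G -> nsum (fun j => F j + G j) = nsum F + nsum G.
Proof.
move=> [N FN] [M GM]; rewrite !(@nsumE (maxn N M)) ?big_split//.
- by move=> j; rewrite geq_max => /andP[_ /GM].
- by move=> j; rewrite geq_max => /andP[/FN].
- by move=> j; rewrite geq_max => /andP[/FN -> /GM ->]; rewrite addr0.
Qed.

Lemma nsumN F : fins F -> nsum (fun j => - F j) = - nsum F.
Proof.
by move=> [N FN]; rewrite !(@nsumE N) ?sumrN// => j /FN ->; rewrite oppr0.
Qed.

Lemma finsN F : fins F -> fins (fun j => - F j).
Proof. by move=> [N FN]; exists N => j /FN ->; rewrite oppr0. Qed.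

Lemma finsD F G : fins F -> fins G -> fins (fun j => F j + G j).
Proof.
move=> [N FN] [M GM]; exists (maxn N M) => j.
by rewrite geq_max => /andP[/FN -> /GM ->]; rewrite addr0.
Qed.

Lemma nsumB F G : fins F -> fins G -> nsum (fun j => F j - G j) = nsum F - nsum G.
Proof. by move=> fF fG; rewrite nsumD ?nsumN//; apply: finsN. Qed.

Lemma finsS F : fins F -> fins (fun j => F j.+1).
Proof. by move=> [N FN]; exists N => j lj; rewrite FN// leqW. Qed.

Lemma nsum_recl F : fins F -> nsum F = F 0%N + nsum (fun j => F j.+1).
Proof.
move=> [N FN]; rewrite (@nsumE N.+1) ?big_ord_recl; last by move=> j /ltnW/FN.
by rewrite (@nsumE N)// => j lj; rewrite FN// leqW.
Qed.

Lemma nsum1 k F : (forall j, j != k -> F j = 0) -> nsum F = F k.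
Proof.
move=> F0; rewrite (@nsumE k.+1) => [|j]; last by rewrite ltn_neqAle => /andP[kj _]; rewrite F0// eq_sym.
rewrite big_ord_recr/= big1 ?add0r// => i _.
by rewrite F0// neq_ltn ltn_ord.
Qed.

Lemma finsMz F (c : nat -> int) : fins F -> fins (fun j => F j *~ c j).
Proof. by move=> [N FN]; exists N => j /FN ->; rewrite mul0rz. Qed.

Lemma nsumMz F (c : int) : fins F -> nsum (fun j => F j *~ c) = nsum F *~ c.
Proof.
move=> [N FN]; rewrite !(@nsumE N)// => [|j /FN ->]; last by rewrite mul0rz.
by rewrite -mulrz_suml.
Qed.

Definition addv (f : V -> V) := {morph f : x y / x + y}.

Section Addv.
Variables (f : V -> V) (hf : addv f).
Lemma addv0 : f 0 = 0.
Proof. by apply: (@addrI _ (f 0)); rewrite addr0 -hf addr0. Qed.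
Lemma addvN v : f (- v) = - f v.
Proof. by apply: (@addrI _ (f v)); rewrite subrr -hf subrr addv0. Qed.
Lemma addvB u v : f (u - v) = f u - f v.
Proof. by rewrite hf addvN. Qed.
Lemma addv_sum I (r : seq I) P (F : I -> V) : f (\sum_(i <- r | P i) F i) = \sum_(i <- r | P i) f (F i).
Proof. by elim/big_rec2: _ => [|i x y _ <-]; rewrite ?addv0// hf. Qed.
Lemma addvMn v n : f (v *+ n) = f v *+ n.
Proof. by elim: n => [|n IH]; rewrite ?mulr0n ?addv0// !mulrSr hf IH. Qed.
Lemma addvMz v n : f (v *~ n) = f v *~ n.
Proof.
case: n => n; first exact: addvMn.
by rewrite NegzE !mulrNz addvN; congr (- _); apply: addvMn.
Qed.
Lemma addv_nsum F : fins F -> f (nsum F) = nsum (fun j => f (F j)).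
Proof.
move=> [N FN]; rewrite !(@nsumE N) ?addv_sum// => j /FN ->; exact: addv0.
Qed.
Lemma fins_addv F : fins F -> fins (fun j => f (F j)).
Proof. by move=> [N FN]; exists N => j /FN ->; rewrite addv0. Qed.
End Addv.

End NatSums.

(* [cz l j] is the coefficient of x^(l-j) y^j in (x - y)^l, and [binz l j] that
   of x^(l-j) y^j in (x + y)^l. *)
Definition cz (l : int) (j : nat) : int :=
  match l with
  | Posz n => (-1) ^+ j * ('C(n, j))%:Z
  | Negz p => ('C(p + j, p))%:Z
  end.

Definition sgz1 (l : int) : int := (-1) ^+ `|l|%N.

Definition binz (l : int) (j : nat) : int := (-1) ^+ j * cz l j.

Lemma cz0 l : cz l 0 = 1.
Proof. by case: l => n /=; rewrite ?bin0 ?addn0 ?binn ?mulr1. Qed.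

Lemma czS l j : cz (l + 1) j.+1 = cz l j.+1 - cz l j.
Proof.
case: l => [n|[|p]].
- by rewrite -PoszD addn1 /= binS PoszD exprS; ring.
- have -> : Negz 0 + 1 = 0%N by [].
  by rewrite /= !bin0 bin0n mulr0 subrr.
- have -> : Negz p.+1 + 1 = Negz p by rewrite !NegzE; lia.
  have H : 'C(p.+1 + j.+1, p.+1) = ('C(p + j.+1, p) + 'C(p.+1 + j, p.+1))%N.
    by rewrite addSn binS addSnnS addnC.
  by rewrite /= H PoszD; ring.
Qed.

Lemma binz0 l : binz l 0 = 1.
Proof. by rewrite /binz cz0 mulr1. Qed.

Lemma binzS l j : binz (l + 1) j.+1 = binz l j.+1 + binz l j.
Proof. by rewrite /binz czS exprS; ring. Qed.

Lemma binz0S j : binz 0 j.+1 = 0.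
Proof. by rewrite /binz /= bin0n !mulr0. Qed.

Lemma binz1 l : binz l 1 = l.
Proof.
rewrite /binz expr1 mulN1r; case: l => n /=.
  by rewrite bin1 mulN1r opprK.
by rewrite addn1 binSn NegzE.
Qed.

Lemma sgz1S l : sgz1 (l + 1) = - sgz1 l.
Proof.
rewrite /sgz1; case: l => [n|[|p]]; first by rewrite -PoszD addn1 exprS mulN1r.
  by rewrite /= expr1 opprK.
have -> : Negz p.+1 + 1 = Negz p by rewrite !NegzE; lia.
by rewrite /= [in RHS]exprS mulN1r opprK.
Qed.

Lemma int_ind2 (P : int -> Prop) :
  P 0 -> (forall m, P m -> P (m + 1)) -> (forall m, P (m + 1) -> P m) -> forall m, P m.
Proof.
move=> P0 PS PP; case=> n.
  by elim: n => // n IH; rewrite -addn1 PoszD; apply: PS.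
elim: n => [|n IH]; first by apply: PP.
by apply: PP; have -> : Negz n.+1 + 1 = Negz n by rewrite !NegzE; lia.
Qed.

(** Coefficient form of the differential equation (1 - t) g' = - l g satisfied by g = (1 - t)^l. *)
Lemma cz_rec l j : cz l j.+1 * j.+1%:Z = cz l j * (j%:Z - l).
Proof.
case: l => p /=.
  have := mul_bin_left p j => /(congr1 Posz); rewrite !PoszM => hb1.
  case: (leqP j p) => hjp.
    rewrite exprS; have -> : (j%:Z - p%:Z) = - (p - j)%N%:Z by lia.
    have hb2 : ('C(p, j))%:Z * (p - j)%N%:Z = ('C(p, j.+1))%:Z * j.+1%:Z by lia.
    by ring: hb2.
  by rewrite !bin_small ?mulr0 ?mul0r//; lia.
have := mul_bin_diag (p + j).+1 j; rewrite NegzE /=.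
have -> : 'C(p + j, p) = 'C(p + j, j) by rewrite -[RHS]bin_sub ?leq_addl// addnK.
have -> : 'C(p + j.+1, p) = 'C((p + j).+1, j.+1) by rewrite -addnS -[RHS]bin_sub ?leq_addl// addnK.
move=> /(congr1 Posz); rewrite !PoszM; have -> : (p + j).+1%:Z = p%:Z + j%:Z + 1 by lia.
have -> : p.+1%:Z = p%:Z + 1 by lia.
by move=> h; rewrite [LHS]mulrC -h; ring.
Qed.

(** * Fields on an abelian group, locality, the Borcherds identity *)

Section Fields.
Variable V : zmodType.
Implicit Types (a b c : int -> V -> V) (v : V).

Definition is_field a :=
  (forall n, addv (a n)) /\
  (forall v, exists N : int, forall n, N <= n -> a n v = 0).

Lemma is_fieldP a (ha : is_field a) v (n : int) :
  exists N : nat, forall j, (N <= j)%N -> a (n + j%:Z) v = 0.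
Proof.
case: (ha.2 v) => N HN; exists `|N - n|%N => j lj; apply: HN; lia.
Qed.

(* The (m, n)-mode of a(x) b(y) (x - y)^l - b(y) a(x) (x - y)^l, expanded in
   |x| > |y| and in |y| > |x| respectively. *)
Definition Dm a b (l m n : int) v : V :=
  nsum (fun j => a (m + l - j%:Z) (b (n + j%:Z) v) *~ cz l j)
  - nsum (fun j => b (n + l - j%:Z) (a (m + j%:Z) v) *~ cz l j) *~ sgz1 l.

Lemma fins_comp a b (f : nat -> int) n v :
  (forall k, addv (a k)) -> is_field b -> fins (fun j => a (f j) (b (n + j%:Z) v)).
Proof.
move=> ha hb; have [N HN] := is_fieldP hb v n.
by exists N => j /HN ->; rewrite addv0.
Qed.

(** One factor x - y is split off from (x - y)^(l+1); both expansions obey the same Pascal rule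
    [czS]. *)
Lemma DmS a b (ha : is_field a) (hb : is_field b) l m n v :
  Dm a b (l + 1) m n v = Dm a b l (m + 1) n v - Dm a b l m (n + 1) v.
Proof.
have key (a' b' : int -> V -> V) m' n' : is_field a' -> is_field b' ->
  nsum (fun j => a' (m' + (l + 1) - j%:Z) (b' (n' + j%:Z) v) *~ cz (l + 1) j)
  = nsum (fun j => a' (m' + 1 + l - j%:Z) (b' (n' + j%:Z) v) *~ cz l j)
    - nsum (fun j => a' (m' + l - j%:Z) (b' (n' + 1 + j%:Z) v) *~ cz l j).
  move=> ha' hb'.
  have f1 z : fins (fun j => a' (m' + (l + 1) - j%:Z) (b' (n' + j%:Z) v) *~ z j).
    by apply: finsMz; apply: fins_comp hb'; exact: ha'.1.
  have f2 z : fins (fun j => a' (m' + 1 + l - j%:Z) (b' (n' + j%:Z) v) *~ z j).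
    by apply: finsMz; apply: fins_comp hb'; exact: ha'.1.
  have f3 z : fins (fun j => a' (m' + l - j%:Z) (b' (n' + 1 + j%:Z) v) *~ z j).
    by apply: finsMz; apply: fins_comp hb'; exact: ha'.1.
  rewrite (nsum_recl (f1 _)) (nsum_recl (f2 _)) !cz0.
  rewrite -[RHS]addrA -nsumB; [|exact: finsS (f2 _)|exact: f3].
  congr (a' _ _ *~ _ + _); first by lia.
  apply: eq_nsum => j; rewrite czS mulrzBr.
  have -> : m' + (l + 1) - j.+1%:Z = m' + l - j%:Z by lia.
  have -> : m' + 1 + l - j.+1%:Z = m' + l - j%:Z by lia.
  by have -> : n' + j.+1%:Z = n' + 1 + j%:Z by lia.
rewrite /Dm (key a b m n ha hb) (key b a n m hb ha) sgz1S mulrNz opprK mulrzBl.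
by rewrite opprB [RHS]addrACA [LHS]addrACA; congr (_ + _); rewrite addrC.
Qed.

Lemma Dm0 a b (ha : is_field a) (hb : is_field b) m n v :
  Dm a b 0 m n v = a m (b n v) - b n (a m v).
Proof.
rewrite /Dm /sgz1 expr0 mulr1z; congr (_ - _); rewrite (@nsum1 _ 0%N) ?cz0 ?mulr1z ?subr0 ?addr0//.
  by case=> // j _; rewrite /= bin0n mulr0 mulr0z.
by case=> // j _; rewrite /= bin0n mulr0 mulr0z.
Qed.

Definition loc (N : nat) a b := forall m n v, Dm a b N%:Z m n v = 0.
Definition local a b := exists N, loc N a b.

Lemma locW N a b (ha : is_field a) (hb : is_field b) :
  loc N a b -> forall l m n v, N%:Z <= l -> Dm a b l m n v = 0.
Proof.
move=> h l m n v hl; have [k ->] : exists k, l = (N + k)%N%:Z.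
  by exists `|l - N%:Z|%N; lia.
elim: k m n {hl} => [|k IH] m n; first by rewrite addn0 h.
by rewrite addnS -addn1 PoszD DmS// !IH subrr.
Qed.

Lemma Dm_field a b (ha : is_field a) (hb : is_field b) l m : local a b ->
  is_field (fun n => Dm a b l m n).
Proof.
move=> [N hN]; split.
  move=> n u v; rewrite /Dm.
  have s (F G H : nat -> V) : fins F -> fins G -> (forall j, H j = F j + G j) ->
     nsum (fun j => H j *~ cz l j) = nsum (fun j => F j *~ cz l j) + nsum (fun j => G j *~ cz l j).
    move=> fF fG /funext ->; rewrite -nsumD; [|exact: finsMz..].
    by apply: eq_nsum => j; rewrite mulrzDl.
  have f1 w : fins (fun j => a (m + l - j%:Z) (b (n + j%:Z) w)).
    by apply: fins_comp hb; exact: ha.1.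
  have f2 w : fins (fun j => b (n + l - j%:Z) (a (m + j%:Z) w)).
    by apply: fins_comp ha; exact: hb.1.
  rewrite (s _ _ (fun j => a (m + l - j%:Z) (b (n + j%:Z) (u + v))) (f1 u) (f1 v)) => [|j]; last by rewrite hb.1 ha.1.
  rewrite (s _ _ (fun j => b (n + l - j%:Z) (a (m + j%:Z) (u + v))) (f2 u) (f2 v)) => [|j]; last by rewrite ha.1 hb.1.
  by rewrite mulrzDl opprD addrACA.
move=> v; have [M1 H1] := hb.2 v.
have [K HK] : exists K : nat, forall j : nat, (K <= j)%N -> a (m + j%:Z) v = 0.
  exact: is_fieldP.
(* The second sum runs over the finitely many j with a_(m+j) v nonzero, a range independent of n, so
   one bound M works for all of them. *)
suff [M HM] : exists M : int, forall n, M <= n ->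
    nsum (fun j => b (n + l - j%:Z) (a (m + j%:Z) v) *~ cz l j) = 0.
  exists (Num.max M M1) => n; rewrite ge_max => /andP[h1 h2].
  rewrite /Dm HM// mul0rz subr0 -[RHS]nsum0; apply: eq_nsum => j.
  rewrite H1 ?addv0 ?mul0rz//; [exact: ha.1|lia].
have [M HM] : exists M : int, forall n (j : 'I_K), M <= n -> b (n + l - j%:Z) (a (m + j%:Z) v) = 0.
  clear HK; elim: K => [|K [M IH]]; first by exists 0 => n [].
  have [M' HM'] := hb.2 (a (m + K%:Z) v).
  exists (Num.max M (M' - l + K%:Z)) => n j; rewrite ge_max => /andP[h1 h2].
  case: (unliftP ord_max j) => [i ->|->]; first by rewrite lift_max IH.
  by rewrite HM'//=; lia.
exists M => n hn; rewrite (@nsumE _ K) => [|j /HK ->]; last first.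
  by rewrite addv0 ?mul0rz//; exact: hb.1.
by rewrite big1// => j _; rewrite HM ?mul0rz.
Qed.

(** From x = (x - y) + y both sides satisfy X(l, m+1, n) = X(l+1, m, n) + X(l, m, n+1). They agree
    for m = 0, and both vanish for l >= N by locality; descending induction on l and two-sided
    induction on m do the rest. *)
Theorem borcherds a b (ha : is_field a) (hb : is_field b) (hl : local a b) l m n v :
  Dm a b l m n v = nsum (fun j => Dm a b (l + j%:Z) 0 (m + n - j%:Z) v *~ binz m j).
Proof.
case: hl => N hN.
have D0 := locW ha hb hN.
pose E l m n := nsum (fun j => Dm a b (l + j%:Z) 0 (m + n - j%:Z) v *~ binz m j).
have fE l' k (z : nat -> int) : fins (fun j => Dm a b (l' + j%:Z) 0 (k - j%:Z) v *~ z j).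
  by apply: finsMz; exists `|N%:Z - l'|%N => j lj; apply: D0; lia.
have ES l' m' n' : E l' (m' + 1) n' = E (l' + 1) m' n' + E l' m' (n' + 1).
  rewrite /E (nsum_recl (fE _ _ _)).
  have -> : m' + (n' + 1) = m' + 1 + n' by ring.
  rewrite [X in _ = _ + X](nsum_recl (fE _ _ _)) addrCA !binz0.
  rewrite ![_ + 0%N%:Z]addr0.
  congr (_ + _).
  rewrite -nsumD; [|exact: fE|exact: finsS (fE _ _ _)].
  apply: eq_nsum => j; rewrite binzS mulrzDr [RHS]addrC.
  have -> : l' + 1 + j%:Z = l' + j.+1%:Z by lia.
    by have -> : m' + 1 + n' - j.+1%:Z = m' + n' - j%:Z by lia.
pose F l m n := Dm a b l m n v - E l m n.
suff H : F l m n = 0 by apply/eqP; rewrite -subr_eq0; apply/eqP.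
have FS l' m' n' : F l' (m' + 1) n' = F (l' + 1) m' n' + F l' m' (n' + 1).
  by rewrite /F ES DmS// [RHS]addrACA subrK opprD.
have F0 l' n' : F l' 0 n' = 0.
  rewrite /F /E (@nsum1 _ 0%N) => [|[//|j] _]; last by rewrite binz0S mulr0z.
  by rewrite binz0 mulr1z ![_ + 0%N%:Z]addr0 add0r subrr.
have FN l' m' n' : N%:Z <= l' -> F l' m' n' = 0.
  move=> hl; rewrite /F D0// sub0r; apply/eqP; rewrite oppr_eq0; apply/eqP.
  rewrite /E -[RHS](nsum0 V).
  by apply: eq_nsum => j; rewrite D0 ?mul0rz//; lia.
have [k hk] : exists k : nat, N%:Z <= l + k%:Z by exists `|N%:Z - l|%N; lia.
elim: k l hk m n => [|k IH] l hk m n; first by apply: FN; lia.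
have Fl1 m' n' : F (l + 1) m' n' = 0 by apply: IH; lia.
elim/int_ind2: m n => [n|m IHm n|m IHm n]; first exact: F0.
  by rewrite FS Fl1 IHm addr0.
have := FS l m (n - 1); rewrite Fl1 IHm add0r => ->.
by congr F; ring.
Qed.

(** Multiplication by x - y of the double series with coefficients F. *)
Definition dXY (F : int -> int -> V) : int -> int -> V := fun m n => F (m + 1) n - F m (n + 1).

Lemma DmE a b (ha : is_field a) (hb : is_field b) N v :
  (fun m n => Dm a b N%:Z m n v) = iter N dXY (fun m n => a m (b n v) - b n (a m v)).
Proof.
elim: N => [|N IH]; first by apply/funext => m; apply/funext => n; rewrite Dm0.
rewrite iterS -IH; apply/funext => m; apply/funext => n.
by rewrite -addn1 PoszD DmS.
Qed.

Lemma locP N a b (ha : is_field a) (hb : is_field b) : loc N a b <->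
  forall v m n, iter N dXY (fun m n => a m (b n v) - b n (a m v)) m n = 0.
Proof.
split=> h; first by move=> v m n; rewrite -(DmE ha hb) h.
by move=> m n v; have := h v m n; rewrite -(DmE ha hb).
Qed.

Lemma loc_sym N a b (ha : is_field a) (hb : is_field b) : loc N a b -> loc N b a.
Proof.
move/(locP _ ha hb) => h; apply/(locP _ hb ha) => v m n.
have : forall m n, iter N dXY (fun m n => b m (a n v) - a n (b m v)) m n =
   iter N dXY (fun m n => a m (b n v) - b n (a m v)) n m *~ ((-1) ^+ N.+1).
  elim: N {h} => [|N IH] m' n'; first by rewrite /= expr1 mulrNz mulr1z opprB.
  rewrite !iterS /dXY !IH -mulrzBl [(-1) ^+ N.+2]exprS mulN1r mulrNz.
  by rewrite -mulNrz opprB.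
by move=> ->; rewrite h mul0rz.
Qed.

Lemma local_sym a b (ha : is_field a) (hb : is_field b) : local a b -> local b a.
Proof. by move=> [N h]; exists N; exact: loc_sym. Qed.

End Fields.

(** * Difference operators on coefficient functions of several variables *)

Section Shifts.
Variables (V : zmodType) (G : zmodType).
Implicit Types (F : G -> V) (x y z w : G).

(** On coefficient functions, multiplication by the difference of the two monomials of exponents x
    and y. *)
Definition dsh x y F : G -> V := fun p => F (p + x) - F (p + y).

Lemma dshC x y z w F : dsh x y (dsh z w F) = dsh z w (dsh x y F).
Proof.
apply/funext => p; rewrite /dsh (addrAC p z x) (addrAC p z y) (addrAC p w x) (addrAC p w y).
by rewrite !opprD !opprK addrACA.
Qed.

Lemma iter_dshC x y z w n k F :
  iter n (dsh x y) (iter k (dsh z w) F) = iter k (dsh z w) (iter n (dsh x y) F).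
Proof.
have H m F' : dsh x y (iter m (dsh z w) F') = iter m (dsh z w) (dsh x y F').
  by elim: m => //= m IH; rewrite dshC IH.
by elim: n => //= n IH; rewrite IH H.
Qed.

Lemma iter_dsh0 x y n : iter n (dsh x y) (fun=> 0) = (fun=> 0).
Proof. by elim: n => //= n ->; apply/funext => p; rewrite /dsh subrr. Qed.

Lemma iter_dshB x y n F F' : iter n (dsh x y) (fun p => F p - F' p) =
  (fun p => iter n (dsh x y) F p - iter n (dsh x y) F' p).
Proof.
elim: n => //= n ->; apply/funext => p; rewrite /dsh.
by rewrite !opprD !opprK addrACA.
Qed.

(** y - z is the difference of the commuting operators x - z and x - y, both nilpotent on F; an
    induction on the two exponents replaces the binomial expansion. *)
Lemma dsh_nil x y z a b F :
  iter a (dsh x z) F = (fun=> 0) -> iter b (dsh x y) F = (fun=> 0) ->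
  iter (a + b) (dsh y z) F = (fun=> 0).
Proof.
elim: a b F => [|a IHa] b F.
  by move=> /= -> _; rewrite iter_dsh0.
elim: b F => [|b IHb] F; first by move=> _ h; rewrite (_ : F = (fun=> 0)) ?iter_dsh0.
move=> ha hb; rewrite addSn iterSr.
have -> : dsh y z F = (fun p => dsh x z F p - dsh x y F p).
  by apply/funext => p; rewrite /dsh; zmod.
rewrite iter_dshB IHa -?iterSr//; last first.
  by rewrite -[dsh x z F]/(iter 1 (dsh x z) F) iter_dshC hb iter_dsh0.
rewrite addnS -addSn IHb -?iterSr//; last first.
  by rewrite -[dsh x y F]/(iter 1 (dsh x y) F) iter_dshC ha iter_dsh0.
by apply/funext => p; rewrite subrr.
Qed.

Lemma iter_dsh_nsum x y n (H : nat -> G -> V) : (forall p, fins (fun j => H j p)) ->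
  iter n (dsh x y) (fun p => nsum (fun j => H j p)) =
  (fun p => nsum (fun j => iter n (dsh x y) (H j) p)) /\
  (forall p, fins (fun j => iter n (dsh x y) (H j) p)).
Proof.
move=> fH; elim: n => //= n [-> IH]; split; last first.
  by move=> p; rewrite /dsh; apply: finsD => //; apply: finsN.
by apply/funext => p; rewrite /dsh -nsumB.
Qed.

Lemma iter_dshMz x y n F (z : int) : iter n (dsh x y) (fun p => F p *~ z) = (fun p => iter n (dsh x y) F p *~ z).
Proof. by elim: n => //= n ->; apply/funext => p; rewrite /dsh -mulrzBl. Qed.

End Shifts.

(** * Dong's lemma *)

Section Dong.
Variable V : zmodType.
Implicit Types (a b c : int -> V -> V) (v : V).

Let Z3 := (int * int * int)%type.
Let eX : Z3 := (1, 0, 0).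
Let eY : Z3 := (0, 1, 0).
Let eZ : Z3 := (0, 0, 1).

Let XY_YZ N (F : Z3 -> V) m n k :
  iter N (dsh eY eZ) F (m, n, k) = iter N (@dXY V) (fun n k => F (m, n, k)) n k.
Proof.
elim: N n k => // N IH n k; rewrite !iterS {1}/dsh {1}/dXY -!IH.
have -> : (m, n, k) + eY = (m, n + 1, k) by rewrite /eY; congr (_, _, _); rewrite /= addr0.
by have -> : (m, n, k) + eZ = (m, n, k + 1) by rewrite /eZ; congr (_, _, _); rewrite /= addr0.
Qed.

Let XY_XZ N (F : Z3 -> V) m n k :
  iter N (dsh eX eZ) F (m, n, k) = iter N (@dXY V) (fun m k => F (m, n, k)) m k.
Proof.
elim: N m k => // N IH m k; rewrite !iterS {1}/dsh {1}/dXY -!IH.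
have -> : (m, n, k) + eX = (m + 1, n, k) by rewrite /eX; congr (_, _, _); rewrite /= addr0.
by have -> : (m, n, k) + eZ = (m, n, k + 1) by rewrite /eZ; congr (_, _, _); rewrite /= addr0.
Qed.

(* Two of the three operators (x - z), (x - y) are nilpotent on the commutator,
   hence so is their difference (y - z). *)
Theorem dong a b c l : is_field a -> is_field b -> is_field c ->
  local a b -> local a c -> local b c -> local (fun n => Dm a b l 0 n) c.
Proof.
move=> ha hb hc lab lac lbc; have hD := Dm_field ha hb l 0 lab.
have [r [hac hbc]] : exists r, loc r a c /\ loc r b c.
  case: lac => r1 h1; case: lbc => r2 h2; exists (r1 + r2)%N; split=> m n v.
    by apply: (locW ha hc h1); lia.
  by apply: (locW hb hc h2); lia.
have [N hN] := lab.
pose s := `|N%:Z - l|%N.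
exists (r + s + r)%N; apply/(locP _ hD hc) => v n k.
(* The commutator with c as a function of the three mode indices. Applying x - y to it raises l by
   one, so that s applications reach the locality exponent of a and b. *)
pose Del l (p : Z3) := Dm a b l p.1.1 p.1.2 (c p.2 v) - c p.2 (Dm a b l p.1.1 p.1.2 v).
rewrite -(XY_YZ _ (Del l) 0 n k) iterD.
have F1 : iter s (dsh eX eY) (Del l) = (fun=> 0).
  have -> : iter s (dsh eX eY) (Del l) = Del (l + s%:Z).
    elim: (s) => [|t IH]; first by rewrite addr0.
    rewrite iterS IH; apply/funext => -[[m' n'] k'].
    rewrite /dsh /Del /= !addr0.
    have -> : l + t.+1%:Z = l + t%:Z + 1 by lia.
    by rewrite !(DmS ha hb) (addvB (hc.1 k') (Dm a b (l + t%:Z) (m' + 1) n' v)); zmod.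
  apply/funext => p; rewrite /Del !(locW ha hb hN) ?(addv0 (hc.1 _)) ?subrr//; lia.
(* The two halves of [Dm] differ by exchanging a and b; [i1] and [i2] select the index that each of
   the two factors carries, so that one argument covers both halves. *)
have F2 (a' b' : int -> V -> V) (e1 e2 : Z3) (i1 i2 : Z3 -> int) : 
   is_field a' -> is_field b' ->
   (forall p q, i1 (p + q) = i1 p + i1 q) -> (forall p q, i2 (p + q) = i2 p + i2 q) ->
   i1 e1 = 1 -> i1 e2 = 0 -> i1 eZ = 0 -> i2 e1 = 0 -> i2 e2 = 1 -> i2 eZ = 0 ->
   e1.2 = 0 -> e2.2 = 0 ->
   loc r a' c -> loc r b' c ->
   iter r (dsh e1 eZ) (iter r (dsh e2 eZ) (fun p =>
     nsum (fun j => a' (i1 p + l - j%:Z) (b' (i2 p + j%:Z) (c p.2 v)) *~ cz l j)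
     - c p.2 (nsum (fun j => a' (i1 p + l - j%:Z) (b' (i2 p + j%:Z) v) *~ cz l j)))) = (fun=> 0).
  move=> ha' hb' i1D i2D i11 i12 i1Z i21 i22 i2Z e1Z e2Z lac' lbc'.
  pose H (j : nat) (p : Z3) := (a' (i1 p + l - j%:Z) (b' (i2 p + j%:Z) (c p.2 v))
       - c p.2 (a' (i1 p + l - j%:Z) (b' (i2 p + j%:Z) v))) *~ cz l j.
  have f1 p w : fins (fun j => a' (i1 p + l - j%:Z) (b' (i2 p + j%:Z) w) *~ cz l j).
    by apply: finsMz; apply: fins_comp hb'; exact: ha'.1.
  have f2 p : fins (fun j => c p.2 (a' (i1 p + l - j%:Z) (b' (i2 p + j%:Z) v) *~ cz l j)).
    by apply: fins_addv (f1 p v); exact: hc.1.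
  have fH p : fins (fun j => H j p).
    have := finsD (f1 p (c p.2 v)) (finsN (f2 p)); case=> M HM; exists M => j lj.
    by rewrite /H mulrzBl -(addvMz (hc.1 _)) HM.
  rewrite (_ : (fun p => _) = (fun p => nsum (fun j => H j p))); last first.
    apply/funext => p; rewrite (addv_nsum (hc.1 _)); last exact: f1.
    rewrite -nsumB; [|exact: f1|exact: f2].
    by apply: eq_nsum => j; rewrite /H mulrzBl -(addvMz (hc.1 _)).
  rewrite (iter_dsh_nsum _ _ _ fH).1.
  rewrite (iter_dsh_nsum _ _ _ (iter_dsh_nsum _ _ _ fH).2).1.
  apply/funext => p; rewrite -[RHS](nsum0 V); apply: eq_nsum => j.
  pose H1 (p : Z3) := a' (i1 p + l - j%:Z) (b' (i2 p + j%:Z) (c p.2 v) - c p.2 (b' (i2 p + j%:Z) v)) *~ cz l j.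
  pose H2 (p : Z3) := (c p.2 (a' (i1 p + l - j%:Z) (b' (i2 p + j%:Z) v)) - a' (i1 p + l - j%:Z) (c p.2 (b' (i2 p + j%:Z) v))) *~ cz l j.
  (* [a b, c] = a [b, c] + [a, c] b: the term [H1] is killed by (x - z)^r or (y - z)^r through
     locality of b' with c, and [H2] through that of a' with c. *)
  have -> : H j = (fun p => H1 p - H2 p).
    apply/funext => p'; rewrite /H /H1 /H2 -mulrzBl (addvB (ha'.1 _)).
    by rewrite opprB addrA subrK.
  rewrite iter_dshB.
  have -> : iter r (dsh e2 eZ) H1 = (fun=> 0).
    have E t p' : iter t (dsh e2 eZ) H1 p' = a' (i1 p' + l - j%:Z)
       (iter t (@dXY V) (fun n k => b' n (c k v) - c k (b' n v)) (i2 p' + j%:Z) p'.2) *~ cz l j.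
      elim: t p' => // t IH p'; rewrite !iterS /dsh !IH /dXY (addvB (ha'.1 _)) mulrzBl.
      rewrite !i1D !i2D i12 i22 i1Z i2Z !addr0 [(p' + e2).2]/= e2Z addr0 [(p' + eZ).2]/=.
      by rewrite [i2 p' + 1 + _]addrAC.
    apply/funext => p'; rewrite E ((locP _ hb' hc).1 lbc') (addv0 (ha'.1 _)) mul0rz//.
  rewrite iter_dshB iter_dsh0 iter_dshC.
  have -> : iter r (dsh e1 eZ) H2 = (fun=> 0).
    have E t p' : iter t (dsh e1 eZ) H2 p' = 
       (iter t (@dXY V) (fun m k => a' m (c k (b' (i2 p' + j%:Z) v)) - c k (a' m (b' (i2 p' + j%:Z) v))) (i1 p' + l - j%:Z) p'.2) *~ - cz l j.
      elim: t p' => [p'|t IH p']; first by rewrite /H2 /= mulrNz -mulNrz opprB.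
      rewrite !iterS /dsh !IH /dXY mulrzBl.
      rewrite !i1D !i2D i11 i21 i1Z i2Z !addr0 [(p' + e1).2]/= e1Z addr0 [(p' + eZ).2]/=.
      by have -> : i1 p' + 1 + l - j%:Z = i1 p' + l - j%:Z + 1 by ring.
    by apply/funext => p'; rewrite E ((locP _ ha' hc).1 lac') mul0rz.
  by rewrite iter_dsh0 subrr.
have F2' : iter r (dsh eX eZ) (iter r (dsh eY eZ) (Del l)) = (fun=> 0).
  pose S (a' b' : int -> V -> V) (i1 i2 : Z3 -> int) (p : Z3) :=
     nsum (fun j => a' (i1 p + l - j%:Z) (b' (i2 p + j%:Z) (c p.2 v)) *~ cz l j)
     - c p.2 (nsum (fun j => a' (i1 p + l - j%:Z) (b' (i2 p + j%:Z) v) *~ cz l j)).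
  have -> : Del l = (fun p => S a b (fun p => p.1.1) (fun p => p.1.2) p - S b a (fun p => p.1.2) (fun p => p.1.1) p *~ sgz1 l).
    apply/funext => p; rewrite /Del /S /Dm (addvB (hc.1 _)) (addvMz (hc.1 _)) mulrzBl.
    by zmod.
  set S1 := S a b _ _; set S2 := S b a _ _.
  have E1 : iter r (dsh eX eZ) (iter r (dsh eY eZ) S1) = (fun=> 0).
    by apply: (F2 a b eX eY (fun p => p.1.1) (fun p => p.1.2)).
  have E2 : iter r (dsh eX eZ) (iter r (dsh eY eZ) S2) = (fun=> 0).
    by rewrite iter_dshC; apply: (F2 b a eY eX (fun p => p.1.2) (fun p => p.1.1)).
  rewrite (iter_dshB _ _ r S1 (fun p => S2 p *~ sgz1 l)) iter_dshB iter_dshMz iter_dshMz E1 E2.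
  by apply/funext => p; rewrite mul0rz subrr.
rewrite (@dsh_nil _ _ eX eY eZ r s)// iter_dshC F1 iter_dsh0 //.
Qed.

End Dong.

(** * Translation covariance, creativity, and uniqueness of fields *)

Section StateField.
Variables (V : zmodType) (T : V -> V) (vac : V).
Hypothesis htf : forall (x : V) n, x *+ n.+1 = 0 -> x = 0.
Hypothesis hT : addv T.
Hypothesis Tvac : T vac = 0.
Implicit Types (a b c : int -> V -> V) (v : V).

Definition tcov a := forall n v, T (a n v) = a n (T v) - a (n - 1) v *~ n.

Definition creative a := forall n, 0 <= n -> a n vac = 0.

Lemma Dm_tcov a b l m : is_field a -> is_field b -> tcov a -> tcov b ->
  forall n v, T (Dm a b l m n v) = Dm a b l m n (T v) - Dm a b l (m - 1) n v *~ m
     - Dm a b l m (n - 1) v *~ n.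
Proof.
move=> ha hb ta tb n v.
pose S a b m n v := nsum (fun j => a (m + l - j%:Z) (b (n + j%:Z) v) *~ cz l j).
have key (a' b' : int -> V -> V) m' n' : is_field a' -> is_field b' -> tcov a' -> tcov b' ->
   T (S a' b' m' n' v) = S a' b' m' n' (T v) - S a' b' (m' - 1) n' v *~ m' - S a' b' m' (n' - 1) v *~ n'.
  move=> ha' hb' ta' tb'.
  have fS (z : nat -> int) m1 n1 w : fins (fun j => a' (m1 + l - j%:Z) (b' (n1 + j%:Z) w) *~ z j).
    by apply: finsMz; apply: fins_comp hb'; exact: ha'.1.
  rewrite /S (addv_nsum hT) //.
  rewrite -!nsumMz//.
  rewrite -nsumB; [|exact: fS|by under eq_fun do rewrite -mulrzA; exact: fS].
  have fx : fins (fun j => a' (m' - 1 + l - j%:Z) (b' (n' + j%:Z) v) *~ (cz l j * (l - j%:Z))) by exact: fS.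
  have fy : fins (fun j => a' (m' + l - j%:Z) (b' (n' - 1 + j%:Z) v) *~ (cz l j * j%:Z)) by exact: fS.
  have fz : fins (fun j => a' (m' + l - j%:Z) (b' (n' - 1 + j%:Z) v) *~ cz l j *~ n').
    by under eq_fun do rewrite -mulrzA; exact: fS.
  have fw : fins (fun j => a' (m' + l - j%:Z) (b' (n' + j%:Z) (T v)) *~ cz l j - a' (m' - 1 + l - j%:Z) (b' (n' + j%:Z) v) *~ cz l j *~ m').
    apply: finsD; first exact: fS.
    by apply: finsN; under eq_fun do rewrite -mulrzA; exact: fS.
  (* Coefficient form of (d/dx + d/dy) (x - y)^l = 0, which is what remains in the Leibniz rule. *)
  have xy : nsum (fun j => a' (m' - 1 + l - j%:Z) (b' (n' + j%:Z) v) *~ (cz l j * (l - j%:Z)))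
     + nsum (fun j => a' (m' + l - j%:Z) (b' (n' - 1 + j%:Z) v) *~ (cz l j * j%:Z)) = 0.
    rewrite (nsum_recl fy) mulr0 mulr0z add0r -nsumD//; last exact: finsS fy.
    rewrite -[RHS](nsum0 V); apply: eq_nsum => j.
    have -> : m' + l - j.+1%:Z = m' - 1 + l - j%:Z by lia.
    have -> : n' - 1 + j.+1%:Z = n' + j%:Z by lia.
    rewrite -mulrzDr; suff -> : cz l j * (l - j%:Z) + cz l j.+1 * j.+1%:Z = 0 by rewrite mulr0z.
    by rewrite cz_rec; ring.
  rewrite -nsumB// -[LHS]addr0 -xy.
  rewrite addrA -!nsumD//; last 2 first.
  - by apply: finsD => //; apply: fins_addv => //; exact: fS.
  - by apply: fins_addv => //; exact: fS.
  apply: eq_nsum => j; rewrite (addvMz hT) ta' tb' (addvB (ha'.1 _)) (addvMz (ha'.1 _)).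
  have -> : m' + l - j%:Z - 1 = m' - 1 + l - j%:Z by lia.
  have -> : n' + j%:Z - 1 = n' - 1 + j%:Z by lia.
  by zmod.
rewrite /Dm -/(S a b m n v) -/(S b a n m v) (addvB hT) (addvMz hT) !key//.
rewrite -/(S a b m n (T v)) -/(S b a n m (T v)).
rewrite -/(S a b (m - 1) n v) -/(S b a n (m - 1) v) -/(S a b m (n - 1) v) -/(S b a (n - 1) m v).
by zmod.
Qed.

Lemma Dm_creative a b l : is_field a -> is_field b -> creative a -> creative b ->
  creative (fun n => Dm a b l 0 n).
Proof.
move=> ha hb ca cb n hn; rewrite /Dm.
have z (F : nat -> V) : (forall j, F j = 0) -> nsum F = 0.
  by move=> F0; rewrite (@nsumE _ 0) ?big_ord0.
rewrite !z ?mul0rz ?subrr// => j; first by rewrite ca ?(addv0 (hb.1 _)) ?mul0rz//; lia.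
by rewrite cb ?(addv0 (ha.1 _)) ?mul0rz//; lia.
Qed.

Lemma Dm_vac a b l : is_field a -> is_field b -> creative a -> creative b ->
  Dm a b l 0 (-1) vac = a l (b (-1) vac).
Proof.
move=> ha hb ca cb; rewrite /Dm.
have z (F : nat -> V) : (forall j, F j = 0) -> nsum F = 0.
  by move=> F0; rewrite (@nsumE _ 0) ?big_ord0.
rewrite [X in _ - X *~ _]z ?mul0rz ?subr0; last first.
  by move=> j; rewrite ca ?(addv0 (hb.1 _)) ?mul0rz//; lia.
rewrite (@nsum1 _ 0%N) => [|[//|j] _]; last by rewrite cb ?(addv0 (ha.1 _)) ?mul0rz//; lia.
by rewrite cz0 mulr1z add0r subr0.
Qed.

(** Covariance gives (n+1) a_(-n-2) vac = T a_(-n-1) vac, so vanishing propagates downwards as there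
    is no torsion. *)
Lemma vac_state a : is_field a -> tcov a -> creative a -> a (-1) vac = 0 -> forall n, a n vac = 0.
Proof.
move=> ha ta ca a1; case=> [n|]; first exact: ca.
elim=> [|n IH]; first exact: a1.
apply: (htf (n := n)).
have := ta (Negz n) vac; rewrite IH Tvac (addv0 (ha.1 _)) (addv0 hT) => /esym/eqP.
rewrite sub0r oppr_eq0; have -> : Negz n - 1 = Negz n.+1 by rewrite !NegzE; lia.
by move=> h; apply/eqP; rewrite -oppr_eq0.
Qed.

(* Apply (x - y)^N a(x) b(y) vac = (x - y)^N b(y) a(x) vac at y = 0. *)
Theorem field_unique a b (Ys : V -> int -> V -> V) :
  is_field a -> is_field b -> tcov a -> tcov b -> creative a -> creative b ->
  a (-1) vac = b (-1) vac ->
  (forall u, [/\ is_field (Ys u), creative (Ys u), Ys u (-1) vac = u,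
     local a (Ys u) & local b (Ys u)]) ->
  forall n u, a n u = b n u.
Proof.
move=> ha hb ta tb ca cb ab hY n u.
have [hy cy yu [N1 l1] [N2 l2]] := hY u.
pose N := (N1 + N2)%N.
have {}l1 : loc N a (Ys u) by move=> *; apply: (locW ha hy l1); lia.
have {}l2 : loc N b (Ys u) by move=> *; apply: (locW hb hy l2); lia.
have avb k : a k vac = b k vac.
  pose c k v := a k v - b k v.
  have hc : is_field c.
    split; first by move=> k' v w; rewrite /c (ha.1 k') (hb.1 k'); zmod.
    move=> v; have [M1 H1] := ha.2 v; have [M2 H2] := hb.2 v.
    by exists (Num.max M1 M2) => k'; rewrite ge_max => /andP[h1 h2]; rewrite /c H1// H2// subrr.
  apply/eqP; rewrite -subr_eq0; apply/eqP; apply: (@vac_state c hc).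
  - by move=> k' v; rewrite /c (addvB hT) ta tb; zmod.
  - by move=> k' hk; rewrite /c ca// cb// subrr.
  - by rewrite /c ab subrr.
pose F m k := a m (Ys u k vac) - b m (Ys u k vac).
have F0 m k : 0 <= k -> F m k = 0.
  by move=> hk; rewrite /F cy// (addv0 (ha.1 _)) (addv0 (hb.1 _)) subrr.
have iF K m k : 0 <= k -> iter K (@dXY V) F m k = 0.
  elim: K m k => [|K IH] m k hk; first exact: F0.
  by rewrite iterS /dXY !IH ?subrr//; lia.
have iF1 K m : iter K (@dXY V) F m (-1) = F (m + K%:Z) (-1).
  elim: K m => [|K IH] m; first by rewrite addr0.
  by rewrite iterS /dXY IH iF// subr0; congr F; lia.
have : iter N (@dXY V) F (n - N%:Z) (-1) = 0.
  have /(locP _ ha hy) h1 := l1; have /(locP _ hb hy) h2 := l2.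
  have E K m k : iter K (@dXY V) F m k =
    iter K (@dXY V) (fun m n => a m (Ys u n vac) - Ys u n (a m vac)) m k
    - iter K (@dXY V) (fun m n => b m (Ys u n vac) - Ys u n (b m vac)) m k.
    elim: K m k => [|K IH] m k; first by rewrite /F /= avb; zmod.
    by rewrite !iterS /dXY !IH; zmod.
  by rewrite E h1 h2 subrr.
by rewrite iF1 /F yu subrK => /eqP; rewrite subr_eq0 => /eqP.
Qed.

End StateField.

(** * Bilinearity and integrality of the pairing on L *)

Lemma dotLDl x y z : dotL (x + y) z = dotL x z + dotL y z.
Proof. by rewrite /dotL -big_split; apply: eq_bigr => i _; rewrite mxE mulrDr mulrDl. Qed.
Lemma dotLC x y : dotL x y = dotL y x.
Proof. by apply: eq_bigr => i _; rewrite mulrAC. Qed.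
Lemma dotLDr x y z : dotL z (x + y) = dotL z x + dotL z y.
Proof. by rewrite !(dotLC z) dotLDl. Qed.
Lemma dotLNl x z : dotL (- x) z = - dotL x z.
Proof. by rewrite /dotL -sumrN; apply: eq_bigr => i _; rewrite mxE mulrN mulNr. Qed.

Lemma dotL_int (x y : 'rV[rat]_5) : x \in inL -> y \in inL -> dotL x y \is a Num.int.
Proof.
have AA a b : inA a -> inA b -> dotL a b \is a Num.int.
  move=> /forallP ha /forallP hb; apply: rpred_sum => i _.
  by rewrite !rpredM// natr_int.
have Ag a : inA a -> dotL a gamma_row \is a Num.int.
  move=> /forallP ha; apply: rpred_sum => i _; rewrite mxE; case: ifP => _.
    by rewrite mulrAC mulfV// mul1r.
  by rewrite mulr0 rpred0.
have gg : dotL gamma_row gamma_row \is a Num.int.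
  by rewrite /dotL !big_ord_recl big_ord0 !mxE.
have dec z : z \in inL -> exists2 a, inA a & z = a \/ z = a + gamma_row.
  rewrite unfold_in => /orP[h|h]; first by exists z => //; left.
  by exists (z - gamma_row) => //; right; rewrite subrK.
move=> /dec[a ha [->|->]] /dec[b hb [->|->]].
- exact: AA.
- by rewrite dotLDr; apply: rpredD; [exact: AA|exact: Ag].
- by rewrite dotLDl; apply: rpredD; [exact: AA|rewrite dotLC; exact: Ag].
- rewrite !(dotLDl, dotLDr); apply: rpredD; apply: rpredD => //; first exact: AA.
    exact: Ag.
  by rewrite dotLC; exact: Ag.
Qed.

Lemma dotZE (x y : lat) : (dotZ x y)%:~R = dotL x y :> rat.
Proof. by apply: floorK; apply: dotL_int; exact: latP. Qed.

Lemma dotZC x y : dotZ x y = dotZ y x.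
Proof. by rewrite /dotZ dotLC. Qed.

Lemma dotZDr (x y z : lat) : dotZ z (x + y) = dotZ z x + dotZ z y.
Proof. by apply: (@intr_inj rat); rewrite rmorphD /= !dotZE dotLDr. Qed.
Lemma dotZDl (x y z : lat) : dotZ (x + y) z = dotZ x z + dotZ y z.
Proof. by rewrite !(dotZC _ z) dotZDr. Qed.
Lemma dotZ0r z : dotZ z 0 = 0.
Proof. by apply: (@addrI _ (dotZ z 0)); rewrite -dotZDr !addr0. Qed.
Lemma dotZ0l z : dotZ 0 z = 0.
Proof. by rewrite dotZC dotZ0r. Qed.
Lemma dotZNr (x z : lat) : dotZ z (- x) = - dotZ z x.
Proof. by apply: (@addrI _ (dotZ z x)); rewrite -dotZDr !subrr dotZ0r. Qed.
Lemma dotZNl (x z : lat) : dotZ (- x) z = - dotZ x z.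
Proof. by rewrite !(dotZC _ z) dotZNr. Qed.

Lemma dotZ_alpha (i : 'I_5) (y : lat) : (dotZ (alphaL i.+1) y)%:~R = 2 * lat_row y 0 i :> rat.
Proof.
rewrite dotZE /dotL (bigD1 i)//= big1 => [|j ji]; last first.
  by rewrite mxE inord_val (negPf ji) /= mulr0 mul0r.
by rewrite /alpha_row mxE inord_val !eqxx mulr1 addr0.
Qed.

(** * Linear operators as bare functions *)

Section Linear.
Context {K : comNzRingType} {V : lmodType K}.
Definition islin (f : V -> V) := forall (a : K) u v, f (a *: u + v) = a *: f u + f v.

Lemma islin_addv f : islin f -> addv f.
Proof. by move=> hf u v; have := hf 1 u v; rewrite !scale1r. Qed.
Lemma islinZ f (hf : islin f) a u : f (a *: u) = a *: f u.
Proof. by rewrite -[a *: u]addr0 hf (addv0 (islin_addv hf)) addr0. Qed.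
Lemma islin_id : islin id. Proof. by []. Qed.
Lemma islin_zero : islin (fun=> 0). Proof. by move=> a u v; rewrite scaler0 addr0. Qed.
Lemma islin_comp f g : islin f -> islin g -> islin (fun u => f (g u)).
Proof. by move=> hf hg a u v; rewrite hg hf. Qed.
Lemma islinD f g : islin f -> islin g -> islin (fun u => f u + g u).
Proof. by move=> hf hg a u v; rewrite hg hf scalerDr addrACA. Qed.
Lemma islin_scale c f : islin f -> islin (fun u => c *: f u).
Proof. by move=> hf a u v; rewrite hf scalerDr !scalerA mulrC. Qed.
Lemma islinMz c f : islin f -> islin (fun u => f u *~ c).
Proof. by move=> hf a u v; rewrite hf mulrzDl scalerMzr. Qed.
Lemma islinN f : islin f -> islin (fun u => - f u).
Proof. by move=> hf a u v; rewrite hf opprD scalerN. Qed.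
Lemma islinB f g : islin f -> islin g -> islin (fun u => f u - g u).
Proof. by move=> hf hg; apply: islinD => //; apply: islinN. Qed.
Lemma islin_sum I (r : seq I) (P : pred I) (F : I -> V -> V) :
  (forall i, P i -> islin (F i)) -> islin (fun u => \sum_(i <- r | P i) F i u).
Proof.
move=> h a u v; rewrite scaler_sumr -big_split /=; apply: eq_bigr => i Pi.
exact: h.
Qed.
Lemma islin_nsum (F : nat -> V -> V) : (forall j, islin (F j)) ->
  (forall u, fins (fun j => F j u)) -> islin (fun u => nsum (fun j => F j u)).
Proof.
move=> h fF a u v.
have [N1 h1] := fF u; have [N2 h2] := fF v; have [N3 h3] := fF (a *: u + v).
rewrite !(@nsumE _ (N1 + N2 + N3)%N).
- by rewrite scaler_sumr -big_split; apply: eq_bigr => i _; exact: h.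
- by move=> j lj; apply: h2; lia.
- by move=> j lj; apply: h1; lia.
- by move=> j lj; apply: h3; lia.
Qed.

End Linear.

(** * Heisenberg operators on V_L, and the grading by weight and lattice element *)

Section Fock.
Context {R : realType}.
Local Notation C := (R[i]%C).
Local Notation V := (VL R).

Lemma malg_sum (u : V) : u = \sum_(b <- msupp u) u@_b *: << b >>.
Proof.
rewrite {1}[u]monalgE; apply: eq_bigr => b _; apply/malgP => k.
by rewrite [LHS]mcoeffU [RHS]mcoeffZ mcoeffU mulrnAr mulr1.
Qed.

Lemma lin_extE (F : fock_basis -> V) u (d : {fset fock_basis}) :
  (msupp u `<=` d)%fset -> lin_ext F u = \sum_(b <- d) u@_b *: F b.
Proof.
move=> sd; rewrite /lin_ext (big_fset_incl _ sd)// => b _ /mcoeff_outdom ->.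
by rewrite scale0r.
Qed.

Lemma lin_ext_lin (F : fock_basis -> V) : islin (lin_ext F).
Proof.
move=> a u v; pose d := (msupp u `|` msupp v `|` msupp (a *: u + v))%fset.
rewrite !(@lin_extE _ _ d).
- rewrite scaler_sumr -big_split; apply: eq_bigr => b _ /=.
  by rewrite mcoeffD mcoeffZ scalerDl scalerA.
- by rewrite /d -fsetUA fsetUCA fsubsetUl.
- by rewrite /d -fsetUA fsubsetUl.
- by rewrite /d fsubsetUr.
Qed.

Lemma lin_extU (F : fock_basis -> V) b : lin_ext F << b >> = F b.
Proof.
rewrite (@lin_extE _ _ [fset b]%fset) ?msuppU_le// big_seq_fset1.
by rewrite mcoeffUU scale1r.
Qed.

Lemma islin_ext (f : V -> V) : islin f -> f =1 lin_ext (fun b => f << b >>).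
Proof.
move=> hf u; rewrite {1}[u]malg_sum (addv_sum (islin_addv hf)).
by apply: eq_bigr => b _; rewrite islinZ.
Qed.

Lemma eq_islin (f g : V -> V) : islin f -> islin g -> (forall b, f << b >> = g << b >>) -> f =1 g.
Proof.
move=> hf hg h u; rewrite (islin_ext hf) (islin_ext hg).
by apply: eq_bigr => b _; rewrite h.
Qed.

Lemma heis_lin i n : islin (@heis R i n). Proof. exact: lin_ext_lin. Qed.
#[local] Hint Resolve heis_lin : core.

Lemma heisN i p s l : heis i (Negz p) (<< (s, l) >> : V) = << (msetD [mset (i, p)]%mset s, l) >>.
Proof. by rewrite /heis lin_extU. Qed.
Lemma heis0 i s l : heis i 0 (<< (s, l) >> : V) = (dotZ (alphaL i.+1) l)%:~R *: << (s, l) >>.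
Proof. by rewrite /heis lin_extU. Qed.
Lemma heisP i p s l : heis i (Posz p.+1) (<< (s, l) >> : V) =
  (2 * p.+1 * s (i, p))%:R *: << (msetB s [mset (i, p)]%mset, l) >>.
Proof. by rewrite /heis lin_extU. Qed.

Opaque heis lin_ext msetD msetB msetn mset0 seq_mset mkmalgU.

Definition hcoef (i j : 'I_5) (m n : int) : int := if (i == j) && (m + n == 0) then 2 * m else 0.

Lemma heis_comm i m j n (u : V) :
  heis i m (heis j n u) - heis j n (heis i m u) = u *~ hcoef i j m n.
Proof.
(* The relation is antisymmetric under exchange of the two operators, so six of the nine sign
   patterns of (m, n) suffice. *)
have sym : forall (P : 'I_5 -> int -> 'I_5 -> int -> Prop),
    (forall i m j n, P i m j n -> P j n i m) ->
    (forall i j p q, P i (Negz p) j (Negz q)) -> (forall i j p, P i (Negz p) j 0) ->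
    (forall i j p q, P i (Negz p) j (Posz q.+1)) -> (forall i j, P i 0 j 0) ->
    (forall i j p, P i (Posz p.+1) j 0) -> (forall i j p q, P i (Posz p.+1) j (Posz q.+1)) ->
    forall i m j n, P i m j n.
  move=> P hs h1 h2 h3 h4 h5 h6 i' [[|m']|m'] j' [[|n']|n'];
    by [apply: h1|apply: h2|apply: h3|apply: h4|apply: h5|apply: h6|apply: hs; apply: h2|apply: hs; apply: h3|apply: hs; apply: h5].
move: i m j n; apply: (sym (fun i m j n => heis i m (heis j n u) - heis j n (heis i m u) = u *~ hcoef i j m n)) => {sym}.
- move=> i m j n h; rewrite -opprB h -mulrNz; congr (_ *~ _); rewrite /hcoef eq_sym addrC.
  by case: ifP => // /andP[_ /eqP]; lia.
- move=> i j p q; rewrite /hcoef ifF ?mulr0z; last by apply/negP => /andP[_ /eqP]; lia.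
  apply/eqP; rewrite subr_eq0; apply/eqP; move: u.
  apply: eq_islin; [exact: islin_comp (heis_lin _ _) (heis_lin _ _)..|].
  case=> s l; rewrite heisN [LHS]heisN [X in _ = heis _ _ X]heisN [RHS]heisN.
  by congr (<< (_, l) >>); exact: msetDCA.
- move=> i j p; rewrite /hcoef ifF ?mulr0z; last by apply/negP => /andP[_ /eqP]; lia.
  apply/eqP; rewrite subr_eq0; apply/eqP; move: u.
  apply: eq_islin; [exact: islin_comp (heis_lin _ _) (heis_lin _ _)..|].
  by case=> s l; rewrite (heis0 j) (islinZ (heis_lin _ _)) (heisN i) (heis0 j).
- move=> i j p q; move: u.
  apply: eq_islin; first by apply: islinB; apply: islin_comp.
    by apply: islinMz.
  case=> s l; rewrite [X in heis i _ X - _]heisP [X in _ - heis j _ X]heisN [X in _ - X]heisP.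
  rewrite (islinZ (heis_lin _ _)) heisN mset1DE /hcoef.
  have [[-> ->]|ne] := eqVneq (j, q) (i, p).
    rewrite eqxx msetD1K ifT ?NegzE; last by apply/andP; split=> //; apply/eqP; lia.
    have [s0|s0] := posnP (s (i, p)).
      rewrite s0 muln0 scale0r sub0r addn0 muln1 scaler_nat pmulrn -mulrNz.
      by congr (_ *~ _); lia.
    rewrite msetB1K ?in_mset// -scalerBl mulnDr natrD opprD addrCA subrr addr0 muln1.
    by rewrite scaleNr scaler_nat pmulrn -mulrNz; congr (_ *~ _); lia.
  rewrite ifF ?mulr0z; last first.
    by apply/negP => /andP[/eqP ij /eqP h]; move: ne; rewrite ij xpair_eqE eqxx /= => /eqP; lia.
  apply/eqP; rewrite subr_eq0 add0n; apply/eqP; congr (_ *: << (_, l) >>).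
  apply/msetP => x; rewrite msetB1E mset1DE mset1DE msetB1E.
  by have [->|_] := eqVneq x (j, q); [rewrite (negPf ne)|rewrite !subn0].
- move=> i j; rewrite /hcoef /= mulr0 if_same mulr0z; move: u.
  apply: eq_islin; [by apply: islinB; apply: islin_comp|exact: islin_zero|].
  case=> s l; rewrite [X in heis i _ X - _]heis0 [X in _ - heis j _ X]heis0.
  by rewrite !(islinZ (heis_lin _ _)) [X in _ *: X - _]heis0 [X in _ - _ *: X]heis0 !scalerA mulrC subrr.
- move=> i j p; rewrite /hcoef ifF ?mulr0z; last by apply/negP => /andP[_ /eqP]; lia.
  move: u; apply: eq_islin; [by apply: islinB; apply: islin_comp|exact: islin_zero|].
  case=> s l; rewrite [X in heis i _ X - _]heis0 [X in _ - heis j _ X]heisP.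
  by rewrite !(islinZ (heis_lin _ _)) [X in _ *: X - _]heisP [X in _ - _ *: X]heis0 !scalerA mulrC subrr.
- move=> i j p q; rewrite /hcoef ifF ?mulr0z; last by apply/negP => /andP[_ /eqP]; lia.
  move: u; apply: eq_islin; [by apply: islinB; apply: islin_comp|exact: islin_zero|].
  case=> s l; rewrite [X in heis i _ X - _]heisP [X in _ - heis j _ X]heisP.
  rewrite !(islinZ (heis_lin _ _)) [X in _ *: X - _]heisP [X in _ - _ *: X]heisP !scalerA.
  apply/eqP; rewrite subr_eq0; apply/eqP.
  have [[-> ->]//|ne] := eqVneq (j, q) (i, p).
  apply: (f_equal2 (fun c (t : {mset 'I_5 * nat}%mset) => c *: (<< (t, l) >> : V))); last first.
    by apply/msetP => x; rewrite !msetB1E subnAC.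
  by rewrite !msetB1E eq_sym (negPf ne) !subn0 -!natrM; congr _%:R; ring.
Qed.

Lemma mcoeff_heisP i p (u : V) t l :
  (heis i (Posz p.+1) u)@_(t, l) = (2 * p.+1 * (t (i, p)).+1)%:R * u@_(([mset (i, p)] `+` t)%mset, l).
Proof.
(* Written as multiples of [vac], the two coefficients become linear endomorphisms, which can be
   compared on the basis. *)
pose f (u : V) : V := (heis i (Posz p.+1) u)@_(t, l) *: vac.
pose g (u : V) : V := ((2 * p.+1 * (t (i, p)).+1)%:R * u@_(([mset (i, p)] `+` t)%mset, l)) *: vac.
suff h : f u = g u.
  have := congr1 (mcoeff (mset0, 0)) h; rewrite /f /g [LHS]mcoeffZ [RHS]mcoeffZ.
  by rewrite /vac /expL mcoeffUU !mulr1.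
move: u; apply: eq_islin.
- by move=> a u v; rewrite /f heis_lin mcoeffD mcoeffZ scalerDl scalerA.
- by move=> a u v; rewrite /g mcoeffD mcoeffZ mulrDr mulrCA scalerDl scalerA.
case=> s l'; rewrite /f /g heisP; congr (_ *: vac).
rewrite mcoeffZ mcoeffU [in RHS]mcoeffU !xpair_eqE.
have [_|_] := eqVneq l' l; rewrite ?andbF ?mulr0// !andbT.
have [->|ne] := eqVneq s ([mset (i, p)] `+` t)%mset.
  by rewrite mset1DE eqxx msetD1K eqxx.
have [h|_] := eqVneq (msetB s [mset (i, p)]%mset) t; last by rewrite !mulr0.
have [s0|s0] := posnP (s (i, p)); first by rewrite s0 muln0 mul0r mulr0.
by move: ne; rewrite -h msetB1K ?eqxx// in_mset.
Qed.

(** If a monomial contains the letter (i, p), its coefficient in u is a nonzero multiple of a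
    coefficient of alpha_(p+1) u. This is the test for vanishing behind all identities between
    modes. *)
Lemma heis_kernel (u : V) : (forall i p, heis i (Posz p.+1) u = 0) ->
  (forall l, u@_(mset0, l) = 0) -> u = 0.
Proof.
move=> h h0; apply/malgP => -[s l]; rewrite mcoeff0.
have : s = mset0 \/ exists x, x \in enum_mset s.
  have [->|] := eqVneq s mset0; first by left.
  move=> /eqP ns; right; apply: contrapT => nx; apply: ns; apply/msetP => x.
  by rewrite mset0E; apply/eqP; rewrite mset_eq0; apply/negP => xs; apply: nx; exists x.
case=> [->|[x xs]]; first exact: h0.
case: x xs => i p xs; have := congr1 (mcoeff (msetB s [mset (i, p)]%mset, l)) (h i p).
rewrite mcoeff0 mcoeff_heisP msetB1K// => /eqP; rewrite mulf_eq0 pnatr_eq0 => /orP[|/eqP//].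
by rewrite !muln_eq0.
Qed.

Definition fdeg (s : {mset ('I_5 * nat)%type}%mset) : nat := \sum_(x <- enum_mset s) x.2.+1.

Lemma fdegD s t : fdeg (msetD s t) = (fdeg s + fdeg t)%N.
Proof.
rewrite /fdeg -big_cat; apply: perm_big; apply/permP => P.
rewrite -[LHS]/(count P (enum_mset (msetD s t))).
have : perm_eq (enum_mset (msetD s t)) (enum_mset s ++ enum_mset t).
  by apply/allP => a _ /=; rewrite count_cat !count_mem_mset msetE2.
by move=> /permP.
Qed.

Lemma fdeg1 x : fdeg [mset x]%mset = x.2.+1.
Proof. by rewrite /fdeg enum_msetn /= big_seq1. Qed.

Lemma fdeg0 : fdeg mset0 = 0%N.
Proof. by rewrite /fdeg enum_mset0 big_nil. Qed.

(* Twice the conformal weight. *)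
Definition deg2 (b : fock_basis) : int := (2 * fdeg b.1)%N%:Z + dotZ b.2 b.2.

Definition supp_in (S : set fock_basis) (u : V) := forall b, u@_b != 0 -> S b.

Lemma supp_inD S u v : supp_in S u -> supp_in S v -> supp_in S (u + v).
Proof.
move=> hu hv b; rewrite mcoeffD => h; have [e|/hu//] := eqVneq u@_b 0.
by apply: hv; move: h; rewrite e add0r.
Qed.
Lemma supp_inZ S a u : supp_in S u -> supp_in S (a *: u).
Proof. by move=> hu b; rewrite mcoeffZ mulf_eq0 negb_or => /andP[_ /hu]. Qed.
Lemma supp_in0 S : supp_in S 0.
Proof. by move=> b; rewrite mcoeff0 eqxx. Qed.
Lemma supp_in_sum S I (r : seq I) (P : pred I) (F : I -> V) :
  (forall i, P i -> supp_in S (F i)) -> supp_in S (\sum_(i <- r | P i) F i).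
Proof.
move=> h; elim/big_ind: _ => //; [exact: supp_in0|exact: supp_inD].
Qed.
Lemma supp_inU (S : set fock_basis) b : S b -> supp_in S << b >>.
Proof. by move=> h b'; rewrite mcoeffU; have [<-|_] := eqVneq b b'; rewrite ?eqxx. Qed.
Lemma supp_in_sub S S' u : (forall b, S b -> S' b) -> supp_in S u -> supp_in S' u.
Proof. by move=> h hu b /hu /h. Qed.
Lemma supp_in_none u : supp_in set0 u -> u = 0.
Proof. by move=> h; apply/malgP => b; rewrite mcoeff0; apply/eqP/negPn/negP => /h. Qed.
Lemma supp_in_mset S u b : supp_in S u -> b \in msupp u -> S b.
Proof. by move=> h; rewrite -mcoeff_neq0 => /h. Qed.

(* A relation r on basis vectors bounds an operator f when f sends b into the
   span of the b' with r b b'. *)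
Definition maps (r : fock_basis -> fock_basis -> Prop) (f : V -> V) :=
  islin f /\ forall b, supp_in (r b) (f << b >>).

Lemma maps_supp r f S u : maps r f -> supp_in S u ->
  supp_in [set b' | exists2 b, S b & r b b'] (f u).
Proof.
move=> [hf h] hu; rewrite (islin_ext hf).
rewrite (@lin_extE _ _ (msupp u))// big_seq; apply: supp_in_sum => b /(supp_in_mset hu) Sb.
by apply: supp_inZ; apply: supp_in_sub (h b) => b' rbb'; exists b.
Qed.

Definition raises (k : int) (l : lat) (b b' : fock_basis) := deg2 b' = deg2 b + k /\ b'.2 = b.2 + l.

Lemma maps_comp k l k' l' f g : maps (raises k l) f -> maps (raises k' l') g ->
  maps (raises (k + k') (l + l')) (fun u => f (g u)).
Proof.
move=> mf mg; split; first exact: islin_comp mf.1 mg.1.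
move=> b; apply: supp_in_sub (maps_supp mf (mg.2 b)) => b' [b1 [h1 h2] [h3 h4]].
by split; [lia|rewrite h4 h2 -addrA [l' + l]addrC].
Qed.

Lemma maps0 r : maps r (fun=> 0).
Proof. by split; [exact: islin_zero|move=> b; exact: supp_in0]. Qed.
Lemma mapsZ r c f : maps r f -> maps r (fun u => c *: f u).
Proof. by move=> [h1 h2]; split; [exact: islin_scale|move=> b; exact: supp_inZ]. Qed.
Lemma maps_sum r I (s : seq I) (P : pred I) (F : I -> V -> V) : (forall i, P i -> maps r (F i)) ->
  maps r (fun u => \sum_(i <- s | P i) F i u).
Proof.
move=> h; split; first by apply: islin_sum => i Pi; exact: (h i Pi).1.
by move=> b; apply: supp_in_sum => i Pi; exact: (h i Pi).2.
Qed.

Lemma maps_id : maps (raises 0 0) id.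
Proof.
by split=> // b; apply: supp_inU; split; rewrite addr0.
Qed.

Lemma heis_maps i n : maps (raises (- 2 * n) 0) (@heis R i n).
Proof.
split=> // -[s l]; case: n => [[|p]|p].
- by rewrite heis0; apply: supp_inZ; apply: supp_inU; split; rewrite ?addr0//=; lia.
- rewrite heisP; have [->|s0] := posnP (s (i, p)); first by rewrite muln0 scale0r; exact: supp_in0.
  apply: supp_inZ; apply: supp_inU; split; rewrite ?addr0//= /deg2 /=.
  have /(congr1 fdeg) : ([mset (i, p)] `+` (s `\` [mset (i, p)]))%mset = s by rewrite msetB1K// in_mset.
  by rewrite fdegD fdeg1 /=; lia.
- rewrite heisN; apply: supp_inU; split; rewrite ?addr0//= /deg2 /= fdegD fdeg1 /=.
  by rewrite NegzE; lia.
Qed.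

Lemma deg2_ge0 b : 0 <= deg2 b.
Proof.
rewrite /deg2; apply: addr_ge0 => //.
rewrite -(@ler0z rat) dotZE; apply: sumr_ge0 => i _.
by rewrite -mulrA mulr_ge0// -expr2 sqr_ge0.
Qed.

End Fock.

(** * The modes of e^beta *)

Lemma nsum_shift (V : zmodType) k (F : nat -> V) : fins F -> (forall j, (j < k)%N -> F j = 0) ->
  nsum F = nsum (fun j => F (j + k)%N).
Proof.
elim: k F => [|k IH] F fF h; first by apply: eq_nsum => j; rewrite addn0.
rewrite (nsum_recl fF) h// add0r (IH _ (finsS fF)) => [|j jk]; last exact: h.
by apply: eq_nsum => j; rewrite addnS.
Qed.

Lemma sum_trunc (V : zmodType) N M (F : nat -> V) :
  (forall j, (N <= j)%N -> F j = 0) -> (forall j, (M <= j)%N -> F j = 0) ->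
  \sum_(i < N) F i = \sum_(i < M) F i.
Proof. by move=> h1 h2; rewrite -!nsumE. Qed.

Lemma sum_only (V : zmodType) n (F : 'I_n -> V) j : (forall i, i != j -> F i = 0) -> \sum_i F i = F j.
Proof. by move=> h; rewrite (bigD1 j)//= big1 ?addr0. Qed.

Lemma mulz0_add (V : zmodType) (x y : V) (p q : int) : p = 0 -> q = 0 -> x *~ p + y *~ q = 0.
Proof. by move=> -> ->; rewrite !mulr0z addr0. Qed.

Lemma comm_step (V : zmodType) (f : V -> V) x1 x2 y u z (p q : int) : addv f ->
  x1 - x2 = u *~ p -> f x2 - y = z *~ q -> f x1 - y = f u *~ p + z *~ q.
Proof. by move=> hf h1 h2; rewrite -h2 -(addvMz hf) -h1 (addvB hf) addrA subrK. Qed.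

Lemma tcov_step (V : zmodType) (T H H1 G G1 Gk Gk1 : V -> V) (c k m : int) :
  addv T -> addv H -> addv G ->
  (forall v, T (H v) = H (T v) - H1 v *~ k) ->
  (forall v, H (G v) = G (H v) + Gk v *~ c) ->
  (forall v, H1 (G v) = G (H1 v) + Gk1 v *~ c) ->
  (forall v, H (G1 v) = G1 (H v) + Gk1 v *~ c) ->
  forall w, H (T (G w) - G (T w) + G1 w *~ m) =
    T (G (H w)) - G (T (H w)) + G1 (H w) *~ m
    + (T (Gk w) - Gk (T w) + Gk1 w *~ (m + k)) *~ c.
Proof.
move=> hT hH hG TH HG H1G HG1 w.
rewrite hH (addvB hH) (addvMz hH) HG HG1.
have -> : H (T (G w)) = T (H (G w)) + H1 (G w) *~ k by rewrite TH subrK.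
rewrite HG H1G hT (addvMz hT) TH (addvB hG) (addvMz hG).
zmod.
Qed.

Opaque dotZ sgnL heis lin_ext msetD msetB msetn mset0 seq_mset mkmalgU.

Lemma hcoef_neq (i j : 'I_5) m n : i != j -> hcoef i j m n = 0.
Proof. by rewrite /hcoef => /negPf ->. Qed.
Lemma hcoef_eq0 (i j : 'I_5) m n : m + n != 0 -> hcoef i j m n = 0.
Proof. by rewrite /hcoef => /negPf ->; rewrite andbF. Qed.
Lemma hcoef_eq (i : 'I_5) m n : m + n = 0 -> hcoef i i m n = 2 * m.
Proof. by rewrite /hcoef eqxx => ->; rewrite eqxx. Qed.
Opaque hcoef.

Lemma half_double (K : numFieldType) (W : lmodType K) (w : W) (z : int) :
  (2%:R : K)^-1 *: (w *~ (2 * z)) = w *~ z.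
Proof.
by rewrite -[_ *~ (2 * z)]scaler_int -[RHS]scaler_int scalerA rmorphM /= mulrA mulVf ?mul1r// pnatr_eq0.
Qed.

Section ExpModes.
Context {R : realType}.
Local Notation C := (R[i]%C).
Local Notation V := (VL R).
Hint Resolve heis_lin : core.

Lemma hmode_lin be n : islin (@hmode R be n).
Proof. by apply: islin_sum => i _; apply: islin_scale. Qed.
Hint Resolve hmode_lin : core.

Lemma hmode_maps be n : maps (raises (- 2 * n) 0) (@hmode R be n).
Proof. by apply: maps_sum => i _; apply: mapsZ; exact: heis_maps. Qed.

Lemma hmode_comm i m be n (u : V) :
  heis i m (hmode be n u) - hmode be n (heis i m u)
  = u *~ (if m + n == 0 then m * dotZ (alphaL i.+1) be else 0).
Proof.
rewrite /hmode (addv_sum (islin_addv (heis_lin _ _))) -sumrB.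
under eq_bigr => j _ do rewrite (islinZ (heis_lin _ _)) -scalerBr heis_comm.
rewrite (bigD1 i)//= big1 => [|j ji]; last first.
  by rewrite hcoef_neq ?mulr0z ?scaler0// eq_sym.
rewrite addr0; case: eqP => mn; last by rewrite hcoef_eq0 ?mulr0z ?scaler0//; apply/eqP.
rewrite hcoef_eq//.
have h : (dotZ (alphaL i.+1) be)%:~R = 2 * ratr (lat_row be 0 i) :> C.
  by rewrite -[LHS](ratr_int C) dotZ_alpha rmorphM /= ratr_nat.
rewrite -[LHS]scalerMzr -[in LHS]scaler_int -[in RHS]scaler_int scalerA; congr (_ *: u).
by rewrite !rmorphM /= h; ring.
Qed.

Section Pow.
Variable A : nat -> V -> V.
Hypothesis hA : forall n, islin (A n).

Lemma powcoef_lin r k : islin (powcoef A r k).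
Proof.
elim: r k => [|r IH] k /=; first by case: (k == 0%N); [exact: islin_id|exact: islin_zero].
by apply: islin_sum => n _; apply: (islin_comp (hA _) (IH _)).
Qed.

Lemma expcoef_lin k : islin (expcoef A k).
Proof. by apply: islin_sum => r _; apply: islin_scale; exact: powcoef_lin. Qed.

Lemma powcoef_maps (s : int) : (forall n : nat, (0 < n)%N -> maps (raises (s * n%:Z) 0) (A n)) ->
  forall r (k : nat), maps (raises (s * k%:Z) 0) (powcoef A r k).
Proof.
move=> mA; elim=> [|r IH] k /=.
  case: eqP => [->|_]; last exact: maps0.
  by rewrite mulr0; exact: maps_id.
rewrite [X in maps _ X](_ : _ = fun u => \sum_(1 <= n < k.+1 | (0 < n <= k)%N) A n (powcoef A r (k - n) u)).
  apply: maps_sum => n /andP[n0 nk].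
  have := maps_comp (mA n n0) (IH (k - n)%N).
  by rewrite -mulrDr addr0 -PoszD subnKC.
by apply/funext => u; rewrite big_nat; apply: eq_bigl => n.
Qed.

Lemma expcoef_maps (s : int) : (forall n : nat, (0 < n)%N -> maps (raises (s * n%:Z) 0) (A n)) ->
  forall k : nat, maps (raises (s * k%:Z) 0) (expcoef A k).
Proof.
by move=> mA k; apply: maps_sum => r _; apply: mapsZ; exact: powcoef_maps.
Qed.

Lemma powcoef_gt r k u : (k < r)%N -> powcoef A r k u = 0.
Proof.
elim: r k => // r IH k kr /=; rewrite big_nat big1// => n /andP[n0 nk].
by rewrite IH ?(addv0 (islin_addv (hA _)))//; lia.
Qed.

Lemma powcoef_kill r k u : (forall n, (0 < n)%N -> A n u = 0) ->
  powcoef A r k u = if (r == 0)%N && (k == 0)%N then u else 0.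
Proof.
move=> h; elim: r k => // r IH k /=; rewrite big_nat big1// => n /andP[n0 _].
by rewrite IH; case: ifP => _; [exact: h|exact: (addv0 (islin_addv (hA _)))].
Qed.

Lemma expcoef_kill k u : (forall n, (0 < n)%N -> A n u = 0) ->
  expcoef A k u = if (k == 0)%N then u else 0.
Proof.
move=> h; rewrite /expcoef big_ord_recl powcoef_kill// big1 => [|r _]; last first.
  by rewrite powcoef_kill// scaler0.
by rewrite fact0 invr1 scale1r addr0.
Qed.

Lemma expcoef0 u : expcoef A 0 u = u.
Proof. by rewrite /expcoef big_ord_recl big_ord0 /= fact0 invr1 scale1r addr0. Qed.

Variables (X : V -> V) (k : nat) (c : int).
Hypothesis hX : islin X.
Hypothesis k0 : (0 < k)%N.
Hypothesis XA : forall n u, (0 < n)%N -> X (A n u) = A n (X u) + (if n == k then u *~ c else 0).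

(** Since [X, A(z)] = c z^k is central, [X, A(z)^r] = r c z^k A(z)^(r-1). Summed against 1/r! this
    becomes [X, exp A(z)] = c z^k exp A(z). *)
Lemma powcoef_comm r p u : X (powcoef A r p u) =
  powcoef A r p (X u) + (if (k <= p)%N then powcoef A r.-1 (p - k) u else 0) *~ c *+ r.
Proof.
elim: r p => [|r IH] p /=.
  by rewrite mulr0n addr0; case: ifP => // _; rewrite (addv0 (islin_addv hX)).
rewrite (addv_sum (islin_addv hX)).
pose f2 n := (if (k <= p - n)%N then A n (powcoef A r.-1 (p - n - k) u) else 0) *~ c *+ r.
pose f3 n := (if n == k then powcoef A r (p - n) u *~ c else 0).
transitivity (\sum_(1 <= n < p.+1) (A n (powcoef A r (p - n) (X u)) + f2 n + f3 n)).
  apply: eq_big_nat => n /andP[n0 np]; rewrite XA// IH (islin_addv (hA _)); congr (_ + _ + _).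
  rewrite /f2 (addvMn (islin_addv (hA _))) (addvMz (islin_addv (hA _))).
  by case: ifP => _; rewrite ?(addv0 (islin_addv (hA _))).
rewrite !big_split /= -addrA; congr (_ + _).
have -> : \sum_(1 <= n < p.+1) f3 n = (if (k <= p)%N then powcoef A r (p - k) u else 0) *~ c.
  case: ifP => kp; last first.
    rewrite mul0rz big_nat big1// => n /andP[n0 np]; rewrite /f3; case: eqP => // nk; lia.
  rewrite (bigD1_seq k) ?iota_uniq ?mem_index_iota//=; last lia.
  by rewrite big1 ?addr0 => [|n /negPf nk]; rewrite /f3 ?eqxx// nk.
rewrite mulrS addrC; congr (_ + _).
case: r {IH f3} @f2 => [|r] f2; first by rewrite mulr0n big1// => n _; rewrite /f2 mulr0n.
rewrite /f2 sumrMnl; congr (_ *+ _); rewrite -mulrz_suml; congr (_ *~ _) => /=.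
case: ifP => kp; last first.
  by rewrite big_nat big1// => n _; case: ifP => //; lia.
rewrite (@big_cat_nat _ _ _ (p - k).+1)//=; last lia.
rewrite [X in _ + X]big_nat [X in _ + X]big1 => [|n /andP[n0 np]]; last by case: ifP => //; lia.
rewrite addr0; apply: eq_big_nat => n /andP[n0 np]; rewrite ifT; last lia.
by congr (A n (powcoef A r _ u)); lia.
Qed.

Lemma expcoef_comm p u : X (expcoef A p u) =
  expcoef A p (X u) + (if (k <= p)%N then expcoef A (p - k) u else 0) *~ c.
Proof.
rewrite /expcoef (addv_sum (islin_addv hX)).
under eq_bigr => r _ do rewrite (islinZ hX) powcoef_comm scalerDr.
rewrite big_split /=; congr (_ + _).
case: (boolP (k <= p)%N) => kp; last by rewrite mul0rz big1// => r _; rewrite ?mul0rz mul0rn scaler0.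
rewrite big_ord_recl [X in X + _](_ : _ = 0) ?add0r; last by rewrite mulr0n scaler0.
transitivity ((\sum_(i < p) (i`!%:R)^-1 *: powcoef A i (p - k) u) *~ c).
  rewrite mulrz_suml; apply: eq_bigr => r _.
  have -> : lift ord0 r = r.+1 :> nat by [].
  have -> : r.+1.-1 = r :> nat by [].
  move: (powcoef A r (p - k) u) => w; rewrite -[_ *~ c *+ _]scaler_nat scalerA factS natrM invfM mulrAC.
  by rewrite mulVf ?mul1r ?pnatr_eq0// scalerMzr.
apply: (congr1 (fun x => x *~ c)); apply: (@sum_trunc _ _ _ (fun i => (i`!%:R)^-1 *: powcoef A i (p - k) u)).
  by move=> j pj; rewrite powcoef_gt ?scaler0//; lia.
by move=> j pj; rewrite powcoef_gt ?scaler0.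
Qed.

End Pow.

(** Extension by zero to negative exponents, so that shifting an exponent needs no case
    distinction. *)
Definition creZ be (p : int) (u : V) : V := if p is Posz n then creation be n u else 0.

Lemma creation_lin be p : islin (@creation R be p).
Proof. by apply: expcoef_lin => n; apply: islin_scale. Qed.
Lemma annihilation_lin be p : islin (@annihilation R be p).
Proof. by apply: expcoef_lin => n; apply: islin_scale. Qed.
Lemma creZ_lin be p : islin (creZ be p).
Proof. by case: p => p; [exact: creation_lin|exact: islin_zero]. Qed.
Hint Resolve creation_lin annihilation_lin creZ_lin : core.

Lemma creZ_maps be p : maps (raises (2 * p) 0) (creZ be p).
Proof.
case: p => p; last exact: maps0.
apply: expcoef_maps => n n0.
apply: mapsZ; have := hmode_maps be (- n%:Z).
by rewrite (_ : -2 * - n%:Z = 2 * n%:Z)//; ring.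
Qed.
Lemma annihilation_maps be p : maps (raises (- 2 * p%:Z) 0) (@annihilation R be p).
Proof.
apply: expcoef_maps => n n0.
by apply: mapsZ; exact: hmode_maps.
Qed.

Lemma hmodeC_gen i m be n (u : V) : heis i m (hmode be n u) =
  hmode be n (heis i m u) + u *~ (if m + n == 0 then m * dotZ (alphaL i.+1) be else 0).
Proof. by rewrite -(hmode_comm i m) addrC subrK. Qed.

Lemma creZ_heisP i k be p (u : V) : heis i (Posz k.+1) (creZ be p u) =
  creZ be p (heis i (Posz k.+1) u) + creZ be (p - k.+1%:Z) u *~ dotZ (alphaL i.+1) be.
Proof.
case: p => p; last first.
  have -> : Negz p - k.+1%:Z = Negz (p + k.+1) by rewrite !NegzE; lia.
  by rewrite /= (addv0 (islin_addv (heis_lin _ _))) add0r mul0rz.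
have cA n : islin (fun u : V => n%:R^-1 *: hmode be (- n%:Z) u) by apply: islin_scale.
have XA n (w : V) : (0 < n)%N -> heis i (Posz k.+1) (n%:R^-1 *: hmode be (- n%:Z) w) =
    n%:R^-1 *: hmode be (- n%:Z) (heis i (Posz k.+1) w) + (if n == k.+1 then w *~ dotZ (alphaL i.+1) be else 0).
  move=> n0; rewrite (islinZ (heis_lin _ _)) hmodeC_gen scalerDr; congr (_ + _).
  have [->|nk] := eqVneq n k.+1; last by rewrite ifF ?mulr0z ?scaler0//; apply/eqP; move/eqP: nk; lia.
  rewrite ifT; last by apply/eqP; lia.
  by rewrite -scaler_int scalerA rmorphM /= mulrA mulVf ?mul1r ?pnatr_eq0// scaler_int.
have E : heis i (Posz k.+1) (creation be p u) = creation be p (heis i (Posz k.+1) u)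
    + (if (k < p)%N then creation be (p - k.+1) u else 0) *~ dotZ (alphaL i.+1) be.
  exact: (expcoef_comm cA (heis_lin i (Posz k.+1)) (ltn0Sn k) XA p u).
apply: etrans E _; case: (ltnP k p) => kp; first by rewrite subzn.
by have -> : p%:Z - k.+1%:Z = Negz (k - p) by rewrite NegzE; lia.
Qed.

Lemma ann_heisN i q be l (u : V) : heis i (Negz q) (annihilation be l u) =
  annihilation be l (heis i (Negz q) u)
  + (if (q < l)%N then annihilation be (l - q.+1) u else 0) *~ dotZ (alphaL i.+1) be.
Proof.
have cA n : islin (fun u : V => - n%:R^-1 *: hmode be n%:Z u) by apply: islin_scale.
have XA n (w : V) : (0 < n)%N -> heis i (Negz q) (- n%:R^-1 *: hmode be n%:Z w) =
    - n%:R^-1 *: hmode be n%:Z (heis i (Negz q) w) + (if n == q.+1 then w *~ dotZ (alphaL i.+1) be else 0).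
  move=> n0; rewrite (islinZ (heis_lin _ _)) hmodeC_gen scalerDr; congr (_ + _).
  have [->|nk] := eqVneq n q.+1; last by rewrite ifF ?mulr0z ?scaler0// NegzE; apply/eqP; move/eqP: nk; lia.
  rewrite ifT; last by rewrite NegzE; apply/eqP; lia.
  rewrite NegzE -scaler_int scalerA rmorphM /= rmorphN /= mulrA mulrNN mulVf ?mul1r ?pnatr_eq0//.
  by rewrite scaler_int.
exact: (expcoef_comm cA (heis_lin i (Negz q)) (ltn0Sn q) XA l u).
Qed.

Lemma creZ_heis_le0 i n be p (u : V) : n <= 0 -> heis i n (creZ be p u) = creZ be p (heis i n u).
Proof.
move=> n0; case: p => p; last by rewrite /= (addv0 (islin_addv (heis_lin _ _))).
have cA m : islin (fun u : V => m%:R^-1 *: hmode be (- m%:Z) u) by apply: islin_scale.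
have XA m (w : V) : (0 < m)%N -> heis i n (m%:R^-1 *: hmode be (- m%:Z) w) =
    m%:R^-1 *: hmode be (- m%:Z) (heis i n w) + (if m == 1%N then w *~ 0 else 0).
  move=> m0; rewrite (islinZ (heis_lin _ _)) hmodeC_gen scalerDr mulr0z if_same; congr (_ + _).
  by rewrite ifF ?mulr0z ?scaler0//; apply/eqP; lia.
by rewrite [LHS](expcoef_comm cA (heis_lin i n) (ltn0Sn 0) XA p u) mulr0z addr0.
Qed.

Lemma ann_heis_ge0 i n be p (u : V) : 0 <= n ->
  heis i n (annihilation be p u) = annihilation be p (heis i n u).
Proof.
move=> n0.
have cA m : islin (fun u : V => - m%:R^-1 *: hmode be m%:Z u) by apply: islin_scale.
have XA m (w : V) : (0 < m)%N -> heis i n (- m%:R^-1 *: hmode be m%:Z w) =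
    - m%:R^-1 *: hmode be m%:Z (heis i n w) + (if m == 1%N then w *~ 0 else 0).
  move=> m0; rewrite (islinZ (heis_lin _ _)) hmodeC_gen scalerDr mulr0z if_same; congr (_ + _).
  by rewrite ifF ?mulr0z ?scaler0//; apply/eqP; lia.
by rewrite [LHS](expcoef_comm cA (heis_lin i n) (ltn0Sn 0) XA p u) mulr0z addr0.
Qed.

Lemma creZ_heis0 i be p (u : V) : heis i 0 (creZ be p u) = creZ be p (heis i 0 u).
Proof. exact: creZ_heis_le0. Qed.
Lemma creZ_heisN i q be p (u : V) : heis i (Negz q) (creZ be p u) = creZ be p (heis i (Negz q) u).
Proof. exact: creZ_heis_le0. Qed.
Lemma ann_heisP i n be p (u : V) :
  heis i (Posz n) (annihilation be p u) = annihilation be p (heis i (Posz n) u).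
Proof. exact: ann_heis_ge0. Qed.

Lemma creation0 be (u : V) : creation be 0 u = u.
Proof. exact: expcoef0. Qed.

Lemma ann_expL be j l : annihilation be j (expL l : V) = if j == 0%N then expL l else 0.
Proof.
apply: expcoef_kill => [n|[//|n] _]; first by apply: islin_scale.
rewrite /hmode big1 ?scaler0// => i _.
by rewrite /expL heisP mset0E muln0 scale0r scaler0.
Qed.

Opaque creation annihilation hmode.

Definition Esh (be : lat) : V -> V :=
  lin_ext (fun b => (-1) ^ sgnL be b.2 *: << (b.1, be + b.2) >>).

Lemma Esh_lin be : islin (Esh be). Proof. exact: lin_ext_lin. Qed.
Hint Resolve Esh_lin : core.

Lemma EshU be s l : Esh be << (s, l) >> = (-1) ^ sgnL be l *: << (s, be + l) >>.
Proof. by rewrite /Esh lin_extU. Qed.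

Lemma Esh_heis i n be u : heis i n (Esh be u) =
  Esh be (heis i n u) + (if n == 0 then Esh be u *~ dotZ (alphaL i.+1) be else 0).
Proof.
move: u; apply: eq_islin; first exact: islin_comp.
  apply: islinD; first exact: islin_comp.
  by case: (n == 0); [apply: islinMz|exact: islin_zero].
case=> s l; rewrite [X in heis _ _ X]EshU (islinZ (heis_lin _ _)).
case: n => [[|p]|p].
- rewrite [X in _ *: X]heis0 [X in Esh be X]heis0 (islinZ (Esh_lin _)) EshU eqxx.
  by rewrite dotZDr; move: (dotZ _ be) (dotZ _ l) ((-1) ^ _) << _ >> => x y z e; lmod.
- have -> : (Posz p.+1 == 0) = false by [].
  rewrite [X in _ *: X]heisP [X in Esh be X]heisP (islinZ (Esh_lin _)) EshU addr0.
  by rewrite !scalerA mulrC.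
- have -> : (Negz p == 0) = false by [].
  by rewrite [X in _ *: X]heisN [X in Esh be X]heisN EshU addr0.
Qed.

Opaque Esh.

Lemma Esh_heis0 i be u : heis i 0 (Esh be u) = Esh be (heis i 0 u) + Esh be u *~ dotZ (alphaL i.+1) be.
Proof. by rewrite [LHS]Esh_heis eqxx. Qed.
Lemma Esh_heisS i n be u : heis i (Posz n.+1) (Esh be u) = Esh be (heis i (Posz n.+1) u).
Proof. by rewrite [LHS]Esh_heis (_ : (Posz n.+1 == 0) = false)// addr0. Qed.
Lemma Esh_heisN i n be u : heis i (Negz n) (Esh be u) = Esh be (heis i (Negz n) u).
Proof. by rewrite [LHS]Esh_heis (_ : (Negz n == 0) = false)// addr0. Qed.

Definition inch (l : lat) := @supp_in R [set b | b.2 = l].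

Lemma deg_bounded (u : V) : exists N : int, supp_in [set b | deg2 b <= N] u.
Proof.
exists (\sum_(b <- msupp u) deg2 b) => b ub /=; rewrite (big_fsetD1 b)/=; last by rewrite -mcoeff_neq0.
by rewrite lerDl; apply: sumr_ge0 => b' _; exact: deg2_ge0.
Qed.

Lemma maps_field (a : int -> V -> V) k l :
  (forall n, maps (raises (k - 2 * n) l) (a n)) -> is_field a.
Proof.
move=> ma; split=> [n|v]; first exact: islin_addv (ma n).1.
have [N hN] := deg_bounded v; exists (Num.max 0 (N + k) + 1) => n hn.
apply: supp_in_none; apply: supp_in_sub (maps_supp (ma n) hN) => b [b' /= h [h' _]].
by have := deg2_ge0 b; rewrite h'; lia.
Qed.

(** On the summand of lattice degree l the factor z^(beta_(0)) is the scalar z^<beta,l>, so that the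
    mode of e^beta becomes a sum of composites of linear operators. *)
Definition Gm be (l : lat) m u : V :=
  nsum (fun j => creZ be (j%:Z - m - 1 - dotZ be l) (annihilation be j (Esh be u))).

Lemma ann_fins be (u : V) (f : nat -> V -> V) : (forall j, islin (f j)) -> fins (fun j => f j (annihilation be j u)).
Proof.
move=> hf; have [N hN] := deg_bounded u; exists `|N|.+1%N => j lj.
suff -> : annihilation be j u = 0 by rewrite (addv0 (islin_addv (hf j))).
apply: supp_in_none; apply: supp_in_sub (maps_supp (annihilation_maps be j) hN) => b [b' /= h [h' _]].
by have := deg2_ge0 b; rewrite h'; lia.
Qed.

Lemma cre_ann_fins be (u : V) (g : nat -> int) :
  fins (fun j => creZ be (g j) (annihilation be j u)).
Proof. by apply: (@ann_fins be u (fun j => creZ be (g j))) => j; exact: creZ_lin. Qed.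

Lemma Gm_lin be l m : islin (Gm be l m).
Proof.
apply: islin_nsum => [j|u]; last exact: cre_ann_fins.
by apply: (islin_comp (creZ_lin _ _)); exact: (islin_comp (annihilation_lin _ _) (Esh_lin _)).
Qed.

Lemma exp_mode_lin be m : islin (@exp_mode R be m).
Proof. exact: lin_ext_lin. Qed.
Hint Resolve exp_mode_lin : core.

Lemma nsumZ (c : C) (F : nat -> V) : fins F -> nsum (fun j => c *: F j) = c *: nsum F.
Proof.
move=> fF; rewrite (addv_nsum (f := fun u => c *: u))//.
by move=> u v; rewrite scalerDr.
Qed.

Lemma exp_modeU be m s l : exp_mode be m (<< (s, l) >> : V) = Gm be l m << (s, l) >>.
Proof.
rewrite /exp_mode lin_extU /Gm.
rewrite -[LHS]nsumZ; last first.
  exact: cre_ann_fins.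
apply: eq_nsum => j; rewrite [Esh be _]EshU (islinZ (annihilation_lin _ _)).
by rewrite (islinZ (creZ_lin _ _)); congr (_ *: _).
Qed.

Lemma exp_modeE be m l u : inch l u -> exp_mode be m u = Gm be l m u.
Proof.
move=> hu; rewrite [u]malg_sum (addv_sum (islin_addv (exp_mode_lin _ _))) (addv_sum (islin_addv (Gm_lin _ _ _))).
rewrite big_seq [RHS]big_seq; apply: eq_bigr => -[s l'] /(supp_in_mset hu) /= ->.
by rewrite (islinZ (exp_mode_lin _ _)) (islinZ (Gm_lin _ _ _)) exp_modeU.
Qed.

Lemma supp_in_nsum (S : set fock_basis) (F : nat -> V) : (forall j, supp_in S (F j)) -> fins F -> supp_in S (nsum F).
Proof. by move=> h [N hN]; rewrite (@nsumE _ N)//; apply: supp_in_sum => j _. Qed.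

Lemma exp_mode_maps be m : maps (raises (dotZ be be - 2 - 2 * m) be) (@exp_mode R be m).
Proof.
split=> // -[s l]; rewrite exp_modeU /Gm; apply: supp_in_nsum; last first.
  exact: cre_ann_fins.
move=> j; rewrite [Esh be _]EshU (islinZ (annihilation_lin _ _)) (islinZ (creZ_lin _ _)).
apply: supp_inZ.
have := maps_comp (creZ_maps be (j%:Z - m - 1 - dotZ be l)) (annihilation_maps be j).
move=> [_ h]; apply: supp_in_sub (h _) => b [h1 h2]; split.
  by rewrite h1 /deg2 /= !(dotZDl, dotZDr) (dotZC l be); lia.
by rewrite h2 /= !addr0 addrC.
Qed.

Lemma exp_mode_field be : is_field (@exp_mode R be).
Proof. by apply: maps_field => m; exact: exp_mode_maps. Qed.
Lemma heis_field i : is_field (@heis R i).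
Proof.
apply: (@maps_field _ 0 0) => m; rewrite (_ : 0 - 2 * m = - 2 * m); last by ring.
exact: heis_maps.
Qed.

Lemma heis_inch i n l u : inch l u -> inch l (heis i n u).
Proof.
move=> hu; apply: supp_in_sub (maps_supp (heis_maps i n) hu) => b [b' /= <- [_ ->]].
by rewrite addr0.
Qed.

(** The extra term comes from the creation exponential for k > 0, from the shift e^beta for k = 0
    and from the annihilation exponential for k < 0. *)
Lemma exp_mode_heis i k be m (u : V) : heis i k (exp_mode be m u) =
  exp_mode be m (heis i k u) + exp_mode be (m + k) u *~ dotZ (alphaL i.+1) be.
Proof.
set c := dotZ (alphaL i.+1) be.
move: u; apply: eq_islin; first exact: islin_comp.
  by apply: islinD; [exact: islin_comp|exact: islinMz].
case=> s l; set u := << (s, l) >>.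
have ul : inch l u by apply: supp_inU.
rewrite (exp_modeE _ _ ul) (exp_modeE _ (m + k) ul) (exp_modeE _ _ (@heis_inch i k l u ul)) /Gm.
have fF (f : nat -> int) w : fins (fun j => creZ be (f j) (annihilation be j w)).
  exact: cre_ann_fins.
rewrite (addv_nsum (islin_addv (heis_lin _ _))); last exact: fF.
case: k => [[|k]|q].
- rewrite -nsumMz// -nsumD//; last exact: finsMz.
  apply: eq_nsum => j; rewrite creZ_heis0 (ann_heisP i 0) Esh_heis0.
  rewrite (islin_addv (annihilation_lin _ _)) (islin_addv (creZ_lin _ _)).
  by rewrite (addvMz (islin_addv (annihilation_lin be j)) (Esh be u)) (addvMz (islin_addv (creZ_lin be _)) (annihilation be j (Esh be u))) addr0.
- rewrite -nsumMz// -nsumD//; last exact: finsMz.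
  apply: eq_nsum => j; rewrite creZ_heisP ann_heisP Esh_heisS.
  have e : j%:Z - (m + k.+1%:Z) - 1 - dotZ be l = j%:Z - m - 1 - dotZ be l - k.+1%:Z by ring.
  by rewrite e.
- pose D j := creZ be (j%:Z - m - 1 - dotZ be l) (if (q < j)%N then annihilation be (j - q.+1) (Esh be u) else 0).
  have fG : fins D.
    have [N hN] := ann_fins be (Esh be u) (f := fun j => id) (fun=> islin_id).
    exists (N + q.+1)%N => j lj; rewrite /D; case: ifP => _.
      by rewrite hN ?(addv0 (islin_addv (creZ_lin be _)))//; lia.
    exact: (addv0 (islin_addv (creZ_lin be _))).
  have e : nsum D = nsum (fun j => creZ be (j%:Z - (m + Negz q) - 1 - dotZ be l) (annihilation be j (Esh be u))).
    have D0 j : (j < q.+1)%N -> D j = 0.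
      move=> jq; rewrite /D (_ : (q < j)%N = false); first exact: (addv0 (islin_addv (creZ_lin be _))).
      by apply/negP; lia.
    apply: (etrans (@nsum_shift _ q.+1 D fG D0)).
    apply: eq_nsum => j; rewrite /D ifT ?addnK; last lia.
    have e : (j + q.+1)%N%:Z - m - 1 - dotZ be l = j%:Z - (m + Negz q) - 1 - dotZ be l.
      by rewrite NegzE; lia.
    by rewrite e.
  pose B := nsum (fun j => creZ be (j%:Z - m - 1 - dotZ be l) (annihilation be j (Esh be (heis i (Negz q) u)))).
  apply: (@etrans _ _ (B + nsum D *~ c)); last exact: (congr1 (fun x => B + x *~ c) e).
  apply: etrans _ (congr1 (fun x => B + x) (nsumMz c fG)).
  apply: etrans _ (nsumD (fF _ _) (finsMz (fun=> c) fG)).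
  apply: eq_nsum => j; rewrite creZ_heisN ann_heisN Esh_heisN.
  by rewrite (islin_addv (creZ_lin be _)) (addvMz (islin_addv (creZ_lin be _))).
Qed.

Opaque exp_mode.

Lemma exp_mode_expL be m l : exp_mode be m (expL l : V) =
  (-1) ^ sgnL be l *: creZ be (- m - 1 - dotZ be l) (expL (be + l)).
Proof.
rewrite /expL exp_modeU /Gm EshU.
have kill j : annihilation be j ((-1) ^ sgnL be l *: expL (be + l)) = if j == 0%N then (-1) ^ sgnL be l *: expL (be + l) else 0 :> V.
  by rewrite (islinZ (annihilation_lin _ _)) ann_expL; case: (j == 0%N); rewrite ?scaler0.
rewrite (@nsum1 _ 0%N) => [|j j0]; last first.
  by rewrite [X in creZ _ _ X]kill (negPf j0) (addv0 (islin_addv (creZ_lin _ _))).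
by rewrite [X in creZ _ _ X]kill eqxx (islinZ (creZ_lin _ _)) sub0r.
Qed.

Lemma creZ_top be p l l' : (creZ be p (expL l : V))@_(mset0, l') = ((p == 0) && (l == l'))%:R.
Proof.
have [->|p0] := eqVneq p 0.
  by rewrite /= creation0 /expL mcoeffU xpair_eqE eqxx.
apply/eqP/negPn/negP => h; have [/= h1 h2] := (creZ_maps be p).2 (mset0, l) _ h.
by move: h1; rewrite h2 /deg2 /= addr0; move/eqP: p0; lia.
Qed.

Lemma exp_mode_top be m l l' : (exp_mode be m (expL l : V))@_(mset0, l') =
  (-1) ^ sgnL be l * ((m == -1 - dotZ be l) && (be + l == l'))%:R.
Proof.
rewrite exp_mode_expL [LHS]mcoeffZ creZ_top; congr (_ * (_ && _)%:R).
by apply/eqP/eqP; lia.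
Qed.

Lemma heisN_top i p l (u : V) : (heis i (Negz p) u)@_(mset0, l) = 0.
Proof.
apply/eqP/negPn/negP => h.
have m : maps (fun _ b' => (i, p) \in enum_mset b'.1) (@heis R i (Negz p)).
  split=> // -[s l']; rewrite heisN; apply: supp_inU => /=.
  by rewrite in_mset mset1DE eqxx.
have hu : supp_in setT u by [].
by have [b _ /=] := maps_supp m hu h; rewrite in_mset0.
Qed.

End ExpModes.

(** * Fock space data *)
Transparent heis lin_ext msetD msetB msetn mset0 seq_mset mkmalgU dotZ sgnL hcoef creation annihilation hmode Esh exp_mode.

Lemma sgnLDr x y z : sgnL x (y + z) = sgnL x y + sgnL x z.
Proof. by rewrite /sgnL dotZDr mulrDr. Qed.
Lemma sgnL0r x : sgnL x 0 = 0.
Proof. by rewrite /sgnL dotZ0r mulr0. Qed.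
Definition gcoord (i : nat) : rat := if (i < 4)%N then 2^-1 else 0.

(* x = n_1 alpha^1 + ... + n_5 alpha^5 + t gamma *)
Definition coords (x : lat) (n : nat -> int) (t : int) :=
  forall i : 'I_5, lat_row x 0 i = (n i)%:~R + t%:~R * gcoord i.

Lemma lat_coords (x : lat) : exists n t, coords x n t.
Proof.
case: x => x /= xP; have := xP; rewrite unfold_in => /orP[/forallP h|/forallP h].
  exists (fun i => Num.floor (x 0 (inord i))), 0 => i; rewrite mul0r addr0 inord_val.
  by apply/esym/floorK/h.
exists (fun i => Num.floor (x 0 (inord i) - gcoord i)), 1 => i; rewrite mul1r inord_val.
have -> : (Num.floor (x 0 i - gcoord i))%:~R = x 0 i - gcoord i :> rat.
  by apply: floorK; have := h i; rewrite !mxE.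
by rewrite subrK.
Qed.

Lemma sgnL_coords x y n t m s : coords x n t -> coords y m s ->
  sgnL x y = (2 * n 0%N + t) * (m 0%N + m 1%N + m 2%N + m 3%N + 2 * s).
Proof.
move=> hx hy; rewrite /sgnL; congr (_ * _).
  have -> : 2 * lat_row x 0 ord0 = (2 * n 0%N + t)%:~R :> rat.
    by rewrite hx /gcoord !(rmorphD, rmorphM) /=; field.
  exact: intrKfloor.
apply: (@intr_inj rat); rewrite dotZE /dotL [lat_row gammaL]/= !big_ord_recr !big_ord0.
by rewrite !mxE !hy /gcoord /= !(rmorphD, rmorphM) /=; field.
Qed.

Lemma dotZ_coords x y n t m s : coords x n t -> coords y m s ->
  dotZ x y = 2 * (n 0%N * m 0%N + n 1%N * m 1%N + n 2%N * m 2%N + n 3%N * m 3%N + n 4%N * m 4%N)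
    + s * (n 0%N + n 1%N + n 2%N + n 3%N) + t * (m 0%N + m 1%N + m 2%N + m 3%N) + 2 * t * s.
Proof.
move=> hx hy; apply: (@intr_inj rat); rewrite dotZE /dotL !big_ord_recr !big_ord0 !hx !hy /gcoord.
by rewrite /= !(rmorphD, rmorphM) /=; field.
Qed.

Lemma sgzM (x y : int) : sgz1 (x + y) = sgz1 x * sgz1 y.
Proof.
elim/int_ind2: x => [|x IH|x IH]; first by rewrite add0r /sgz1 mul1r.
  by rewrite addrAC !sgz1S IH mulNr.
by apply: oppr_inj; rewrite -sgz1S addrAC IH sgz1S mulNr.
Qed.

Lemma sgz_double x : sgz1 (2 * x) = 1.
Proof.
rewrite mulrDl mul1r sgzM /sgz1 -exprD addnn -mul2n exprM.
by rewrite sqrrN expr1n.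
Qed.

Lemma signZ_sgz (K : numFieldType) (z : int) : (-1) ^ z = (sgz1 z)%:~R :> K.
Proof.
rewrite /sgz1; case: z => n; first by rewrite /= rmorphXn /= rmorphN1.
have -> : (-1 : K) ^ Negz n = ((-1) ^+ n.+1)^-1 by [].
by rewrite -exprVn invrN1 rmorphXn /= rmorphN1.
Qed.

Lemma sgnL_comm x y : sgz1 (sgnL x y) = sgz1 (sgnL y x) * sgz1 (dotZ x y).
Proof.
have [n [t hx]] := lat_coords x; have [m [s hy]] := lat_coords y.
rewrite -sgzM (sgnL_coords hx hy) (sgnL_coords hy hx) (dotZ_coords hx hy).
set a := n 0%N; set b := n 1%N; set c := n 2%N; set d := n 3%N.
set a' := m 0%N; set b' := m 1%N; set c' := m 2%N; set d' := m 3%N.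
set p := _ + n 4%N * _.
(* Half the difference of the two exponents; its being an integer is the commutator property of the
   cocycle. *)
pose q := a * (a' + b' + c' + d' + 2 * s) + t * s - a' * (a + b + c + d + 2 * t)
  - s * (a + b + c + d) - s * t - p - t * s.
have -> : (2 * a + t) * (a' + b' + c' + d' + 2 * s) =
  2 * q + ((2 * a' + s) * (a + b + c + d + 2 * t) + (2 * p + s * (a + b + c + d) + t * (a' + b' + c' + d') + 2 * t * s)).
  by rewrite /q; ring.
by rewrite (sgzM (2 * q)) (sgz_double q) mul1r.
Qed.

Opaque dotZ sgnL msetD msetB msetn mset0 seq_mset hcoef cz.

Section LinFacts.
Context {K : comNzRingType} {V : lmodType K}.
Variables (f : V -> V) (hf : islin f).
Lemma lin0 : f 0 = 0. Proof. exact: addv0 (islin_addv hf). Qed.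
Lemma linD u v : f (u + v) = f u + f v. Proof. exact: islin_addv hf _ _. Qed.
Lemma linN u : f (- u) = - f u. Proof. exact: addvN (islin_addv hf) _. Qed.
Lemma linB u v : f (u - v) = f u - f v. Proof. exact: addvB (islin_addv hf) _ _. Qed.
Lemma linMz u z : f (u *~ z) = f u *~ z. Proof. exact: addvMz (islin_addv hf) _ _. Qed.
Lemma linMn u z : f (u *+ z) = f u *+ z. Proof. exact: addvMn (islin_addv hf) _ _. Qed.
Lemma linZ a u : f (a *: u) = a *: f u. Proof. exact: islinZ hf _ _. Qed.
Lemma lin_sum I (r : seq I) P (F : I -> V) :
  f (\sum_(i <- r | P i) F i) = \sum_(i <- r | P i) f (F i).
Proof. exact: addv_sum (islin_addv hf) _ _ _ _. Qed.
Lemma lin_nsum F : fins F -> f (nsum F) = nsum (fun j => f (F j)).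
Proof. exact: addv_nsum (islin_addv hf) _. Qed.
End LinFacts.

Notation fmset := ({mset ('I_5 * nat)%type}%mset).

(* The operators of V_L on an abstract carrier with basis bb and coefficients cf;
   GG be are the modes of e^be. *)
Record fockData (K : numClosedFieldType) := FockData {
  fV :> lmodType K;
  hh : 'I_5 -> int -> fV -> fV;
  GG : lat -> int -> fV -> fV;
  bb : fock_basis -> fV;
  cf : fV -> fock_basis -> K;
  fs : fV -> seq fock_basis;
  hh_lin : forall i n, islin (hh i n);
  GG_lin : forall be n, islin (GG be n);
  cf_lin : forall b a u v, cf (a *: u + v) b = a * cf u b + cf v b;
  cfb : forall b b', cf (bb b) b' = (b == b')%:R;
  fexp : forall u, u = \sum_(b <- fs u) cf u b *: bb b;
  le_lin : forall X : fock_basis -> fV, islin (fun u => \sum_(b <- fs u) cf u b *: X b);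
  le_b : forall (X : fock_basis -> fV) b, \sum_(c <- fs (bb b)) cf (bb b) c *: X c = X b;
  bbS : forall i p s l, bb (msetD [mset (i, p)]%mset s, l) = hh i (Negz p) (bb (s, l));
  hh_comm : forall i m j n u, hh i m (hh j n u) - hh j n (hh i m u) = u *~ hcoef i j m n;
  hh0 : forall i s l, hh i 0 (bb (s, l)) = bb (s, l) *~ dotZ (alphaL i.+1) l;
  hhP : forall i p s l, hh i (Posz p.+1) (bb (s, l)) =
     bb (msetB s [mset (i, p)]%mset, l) *~ (2 * p.+1 * s (i, p))%N%:Z;
  hh_field : forall i, is_field (hh i);
  GG_field : forall be, is_field (GG be);
  hh_gr : forall i n d l u, (forall b, cf u b != 0 -> deg2 b = d /\ b.2 = l) ->
     forall b, cf (hh i n u) b != 0 -> deg2 b = d - 2 * n /\ b.2 = l;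
  GG_gr : forall be n d l u, (forall b, cf u b != 0 -> deg2 b = d /\ b.2 = l) ->
     forall b, cf (GG be n u) b != 0 -> deg2 b = d + (dotZ be be - 2 - 2 * n) /\ b.2 = l + be;
  GG_hh : forall i k be m u, hh i k (GG be m u) =
     GG be m (hh i k u) + GG be (m + k) u *~ dotZ (alphaL i.+1) be;
  GG_top : forall be m l l', cf (GG be m (bb (mset0, l))) (mset0, l') =
     (-1) ^ sgnL be l * ((m == -1 - dotZ be l) && (be + l == l'))%:R;
  fker : forall u, (forall i p, hh i (Posz p.+1) u = 0) -> (forall l, cf u (mset0, l) = 0) -> u = 0;
  hN_top : forall i p l u, cf (hh i (Negz p) u) (mset0, l) = 0;
  cf_hP : forall i p u t l, cf (hh i (Posz p.+1) u) (t, l) =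
     (2 * p.+1 * (t (i, p)).+1)%:R * cf u (([mset (i, p)] `+` t)%mset, l)
}.

Arguments hh_lin {K f} i n.
Arguments GG_lin {K f} be n.
Arguments hh_field {K f} i.
Arguments GG_field {K f} be.
Arguments fs {K f} u : rename.

Lemma sgz1_sq x : sgz1 x * sgz1 x = 1.
Proof. by rewrite -sgzM -[x in sgz1 (x + x)]mul1r -mulrDl sgz_double. Qed.

Section DmAbstract.
Variable V : zmodType.

(** H acts on each factor by a shift of its mode index, hence on the product by the Leibniz rule;
    multiplication by x - y commutes with such shifts. *)
Lemma Dm_shift (a b : int -> V -> V) (H : V -> V) (k c c' : int) : is_field a -> is_field b -> addv H ->
  (forall m v, H (a m v) = a m (H v) + a (m + k) v *~ c) ->
  (forall m v, H (b m v) = b m (H v) + b (m + k) v *~ c') ->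
  forall (N : nat) m n v, H (Dm a b N m n v) =
    Dm a b N m n (H v) + Dm a b N (m + k) n v *~ c + Dm a b N m (n + k) v *~ c'.
Proof.
move=> ha hb hH Ha Hb; elim=> [|N IH] m n v.
  rewrite !Dm0// (addvB hH) Ha !Hb Ha (ha.1 m) (hb.1 n) (addvMz (ha.1 m)) (addvMz (hb.1 n)).
  by zmod.
rewrite -addn1 PoszD !DmS// (addvB hH) !IH (addrAC m 1 k) (addrAC n 1 k); zmod.
Qed.

End DmAbstract.

Section Fock1.
Context {K : numClosedFieldType} {F : fockData K}.
Implicit Types (u v : F) (b : fock_basis) (l be : lat).

Local Notation h := (@hh K F).
Local Notation G := (@GG K F).
Local Notation E l := (@bb K F (mset0, l)).

Lemma cf0 b : cf (0 : F) b = 0.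
Proof. by have := cf_lin b (-1) (0 : F) 0; rewrite scaler0 addr0 mulN1r addNr. Qed.
Lemma cfZ b a u : cf (a *: u) b = a * cf u b.
Proof. by have := cf_lin b a u 0; rewrite !addr0 cf0 addr0. Qed.
Lemma cfD b u v : cf (u + v) b = cf u b + cf v b.
Proof. by have := cf_lin b 1 u v; rewrite scale1r mul1r. Qed.
Lemma cfN b u : cf (- u) b = - cf u b.
Proof. by rewrite -scaleN1r cfZ mulN1r. Qed.
Lemma cfB b u v : cf (u - v) b = cf u b - cf v b.
Proof. by rewrite cfD cfN. Qed.
Lemma cfMz b u z : cf (u *~ z) b = cf u b *~ z.
Proof. by rewrite -scaler_int cfZ mulrzl. Qed.
Lemma cf_sum b I (r : seq I) (P : pred I) (X : I -> F) :
  cf (\sum_(i <- r | P i) X i) b = \sum_(i <- r | P i) cf (X i) b.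
Proof. by elim/big_rec2: _ => [|i x y _ <-]; rewrite ?cf0// cfD. Qed.

Lemma cf_eq u v : (forall b, cf u b = cf v b) -> u = v.
Proof.
move=> e; apply/eqP; rewrite -subr_eq0; apply/eqP; rewrite [LHS]fexp big1// => b _.
by rewrite cfB e subrr scale0r.
Qed.

Lemma F_ind (P : F -> Prop) :
  (forall (a : K) u v, P u -> P v -> P (a *: u + v)) ->
  (forall l, P (E l)) ->
  (forall i p u, P u -> P (h i (Negz p) u)) -> forall u, P u.
Proof.
move=> Plin Pexp Ph u.
have P0 : P 0 by have := Plin (-1) _ _ (Pexp 0) (Pexp 0); rewrite scaleN1r addNr.
rewrite [u]fexp; elim/big_ind: _ => //.
  by move=> x y Px Py; rewrite -[x]scale1r; apply: Plin.
move=> -[s l] _; rewrite -[_ *: _]addr0; apply: Plin => //.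
rewrite -[s]seq_mset_id; elim: (enum_mset s) => [|[i p] t IH].
  have -> : seq_mset [::] = mset0 :> {mset ('I_5 * nat)%type}%mset.
    by apply/msetP => x; rewrite mset_seqE mset0E.
  exact: Pexp.
have -> : seq_mset ((i, p) :: t) = ([mset (i, p)] `+` seq_mset t)%mset :> {mset ('I_5 * nat)%type}%mset.
  by apply/msetP => x; rewrite mset1DE !mset_seqE /= eq_sym.
by rewrite bbS; apply: Ph.
Qed.

Definition hmg (d : int) u := forall b, cf u b != 0 -> deg2 b = d.
Definition grd (d : int) l u := forall b, cf u b != 0 -> deg2 b = d /\ b.2 = l.

Lemma hmg0 d : hmg d 0. Proof. by move=> b; rewrite cf0 eqxx. Qed.
Lemma hmgD d u v : hmg d u -> hmg d v -> hmg d (u + v).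
Proof.
move=> hu hv b; rewrite cfD => nz; have [e|/hu//] := eqVneq (cf u b) 0.
by apply: hv; move: nz; rewrite e add0r.
Qed.
Lemma hmgZ d a u : hmg d u -> hmg d (a *: u).
Proof. by move=> hu b; rewrite cfZ mulf_eq0 negb_or => /andP[_ /hu]. Qed.
Lemma hmgN d u : hmg d u -> hmg d (- u).
Proof. by rewrite -scaleN1r; exact: hmgZ. Qed.
Lemma hmgB d u v : hmg d u -> hmg d v -> hmg d (u - v).
Proof. by move=> hu hv; apply: hmgD => //; exact: hmgN. Qed.
Lemma hmgMz d u z : hmg d u -> hmg d (u *~ z).
Proof. by rewrite -scaler_int; exact: hmgZ. Qed.
Lemma hmg_sum d I (r : seq I) (P : pred I) (X : I -> F) :
  (forall i, P i -> hmg d (X i)) -> hmg d (\sum_(i <- r | P i) X i).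
Proof. by move=> hX; elim/big_ind: _ => //; [exact: hmg0|exact: hmgD]. Qed.
Lemma hmg_nsum d (X : nat -> F) : fins X -> (forall j, hmg d (X j)) -> hmg d (nsum X).
Proof. by move=> [N hN] hX; rewrite (@nsumE _ N)//; apply: hmg_sum => j _. Qed.
Lemma hmg_lt0 d u : hmg d u -> d < 0 -> u = 0.
Proof.
move=> hu d0; apply: cf_eq => b; rewrite cf0; apply/eqP/negPn/negP => /hu e.
by have := deg2_ge0 b; rewrite e; lia.
Qed.
Lemma hmgb b : hmg (deg2 b) (bb F b).
Proof. by move=> b'; rewrite cfb; have [->|_] := eqVneq b b'; rewrite ?eqxx. Qed.
Lemma grd_b b : grd (deg2 b) b.2 (bb F b).
Proof. by move=> b'; rewrite cfb; have [->|_] := eqVneq b b'; rewrite ?eqxx. Qed.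
Lemma hmgE l : hmg (dotZ l l) (E l).
Proof. by have := @hmgb (mset0, l); rewrite /deg2 /= fdeg0 add0r. Qed.
Arguments hmgE : clear implicits.
Arguments hmgb : clear implicits.
Arguments grd_b : clear implicits.
Arguments hmgMz : clear implicits.

Lemma hmg_map k (f : F -> F) : islin f ->
  (forall b, hmg (deg2 b + k) (f (bb F b))) -> forall d u, hmg d u -> hmg (d + k) (f u).
Proof.
move=> hf hb d u hu; rewrite [u]fexp (lin_sum hf); elim: (fs u) => [|b s IH]; first by rewrite big_nil; exact: hmg0.
rewrite big_cons (linZ hf); apply: hmgD => //.
have [->|/hu <-] := eqVneq (cf u b) 0; first by rewrite scale0r; exact: hmg0.
by apply: hmgZ; exact: hb.
Qed.

Lemma hh_hmg i n d u : hmg d u -> hmg (d - 2 * n) (h i n u).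
Proof.
move: d u; apply: hmg_map; first exact: hh_lin.
by move=> b b' /(hh_gr (grd_b b)) [-> _].
Qed.
Lemma GG_hmg be n d u : hmg d u -> hmg (d + (dotZ be be - 2 - 2 * n)) (G be n u).
Proof.
move: d u; apply: hmg_map; first exact: GG_lin.
by move=> b b' /(GG_gr (grd_b b)) [-> _].
Qed.

Arguments hh_hmg i n {d u} _ _ _.
Arguments GG_hmg be n {d u} _ _ _.

Lemma hhE i k l : h i (Posz k.+1) (E l) = 0.
Proof. by rewrite hhP mset0E muln0 mulr0z. Qed.
Lemma hh0E i l : h i 0 (E l) = E l *~ dotZ (alphaL i.+1) l.
Proof. exact: hh0. Qed.

(** Degrees are bounded below. Once all members of lower degree vanish, X j is killed by every
    positive Heisenberg mode and has no e^l component, so [fker] applies. *)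
Lemma vanish (J : Type) (X : J -> F) (D : J -> int) :
  (forall j, hmg (D j) (X j)) ->
  (forall j i p, (forall j', D j' < D j -> X j' = 0) -> h i (Posz p.+1) (X j) = 0) ->
  (forall j l, cf (X j) (mset0, l) = 0) -> forall j, X j = 0.
Proof.
move=> hX h1 h2 j; have [n hn] : exists n : nat, D j < n%:Z by exists `|D j|.+1%N; lia.
elim: n j hn => [|n IH] j hn; first exact: hmg_lt0 (hX j) hn.
apply: fker => [i p|l]; last exact: h2.
by apply: h1 => j' hj'; apply: IH; lia.
Qed.

(** The Sugawara operator L_(-1): the sum over all integer modes with factor 1/4, since <alpha^i,
    alpha^i> = 2, folded to nonnegative k. *)
Definition Tf u : F :=
  (2%:R)^-1 *: \sum_(i < 5) nsum (fun k => h i (Negz k) (h i (Posz k) u)).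

Lemma hh_fins i (f : nat -> F -> F) u : (forall j, islin (f j)) ->
  fins (fun k => f k (h i (Posz k) u)).
Proof.
move=> hf; have [N hN] := is_fieldP (hh_field i) u 0; exists N => j /hN.
by rewrite add0r => ->; rewrite (lin0 (hf _)).
Qed.

Lemma T_fins i u : fins (fun k => h i (Negz k) (h i (Posz k) u)).
Proof. apply: (hh_fins i (f := fun k => h i (Negz k))) => j; exact: hh_lin. Qed.

Lemma Tf_lin : islin Tf.
Proof.
apply: islin_scale; apply: islin_sum => i _; apply: islin_nsum => [j|u]; last exact: T_fins.
by apply: islin_comp; exact: hh_lin.
Qed.

Lemma Tf_hh j n u : Tf (h j n u) = h j n (Tf u) - h j (n - 1) u *~ n.
Proof.
suff H : Tf (h j n u) - h j n (Tf u) = - (h j (n - 1) u *~ n) by rewrite -H addrC subrK.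
rewrite /Tf (linZ (hh_lin _ _)) -scalerBr (lin_sum (hh_lin _ _)) -sumrB.
have E i : nsum (fun k => h i (Negz k) (h i (Posz k) (h j n u)))
     - h j n (nsum (fun k => h i (Negz k) (h i (Posz k) u)))
   = nsum (fun k => h i (Negz k) u *~ hcoef i j (Posz k) n + h i (Posz k) u *~ hcoef i j (Negz k) n).
  rewrite (lin_nsum (hh_lin _ _)); last exact: T_fins.
  rewrite -nsumB; [|exact: T_fins|apply: (fins_addv (islin_addv (hh_lin _ _))); exact: T_fins].
  apply: eq_nsum => k.
  have h1 := hh_comm i (Posz k) j n u; have h2 := hh_comm i (Negz k) j n (h i (Posz k) u).
  exact: (comm_step (islin_addv (hh_lin i (Negz k))) h1 h2).
under eq_bigr => i _ do rewrite E.
rewrite (@sum_only _ _ _ j) => [|i ij]; last first.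
  rewrite (@nsumE _ 0%N) ?big_ord0// => k _.
  by apply: mulz0_add; exact: hcoef_neq.
case: n {E} => [[|n]|n].
- rewrite (_ : nsum _ = 0); first by rewrite mulr0z oppr0 scaler0.
  apply: etrans (nsum0 F); apply: eq_nsum => k; rewrite (@hcoef_eq0 j j (Negz k) 0).
    have [->|k0] := eqVneq k 0%N; first by rewrite hcoef_eq// mulr0 !mulr0z addr0.
    by rewrite hcoef_eq0 ?mulr0z ?addr0//; apply/eqP; move/eqP: k0; lia.
  by apply/eqP; rewrite NegzE; lia.
- rewrite (@nsum1 _ n) => [|k kn]; last first.
    by rewrite !hcoef_eq0 ?mulr0z ?addr0//; apply/eqP; rewrite ?NegzE; move/eqP: kn; lia.
  rewrite (@hcoef_eq0 j j n n.+1); last by apply/eqP; lia.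
  rewrite (@hcoef_eq j (Negz n) n.+1); last by rewrite NegzE; lia.
  rewrite mulr0z add0r half_double NegzE mulrNz.
  by have -> : n.+1%:Z - 1 = n%:Z by lia.
rewrite (@nsum1 _ n.+1) => [|k kn]; last first.
  by rewrite !hcoef_eq0 ?mulr0z ?addr0//; apply/eqP; rewrite ?NegzE; move/eqP: kn; lia.
rewrite (@hcoef_eq j n.+1 (Negz n)); last by rewrite NegzE; lia.
rewrite (@hcoef_eq0 j j (Negz n.+1) (Negz n)); last by apply/eqP; rewrite !NegzE; lia.
rewrite mulr0z addr0 half_double.
have -> : Negz n - 1 = Negz n.+1 by rewrite !NegzE; lia.
by rewrite [Negz n]NegzE mulrNz opprK.
Qed.

Lemma Tf_hmg d u : hmg d u -> hmg (d + 2) (Tf u).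
Proof.
move=> hu; apply: hmgZ; apply: hmg_sum => i _; apply: hmg_nsum; first exact: T_fins.
move=> k; have := hh_hmg i (Negz k) (hh_hmg i (Posz k) hu).
by have -> : d - 2 * k%:Z - 2 * Negz k = d + 2 by rewrite NegzE; lia.
Qed.

Lemma Tf_top u l : cf (Tf u) (mset0, l) = 0.
Proof.
rewrite /Tf cfZ cf_sum big1 ?mulr0// => i _.
by have [N hN] := T_fins i u; rewrite (@nsumE _ N)// cf_sum big1// => k _; exact: hN_top.
Qed.

Lemma TfE l : Tf (E l) = (2%:R)^-1 *: \sum_(i < 5) h i (-1) (E l) *~ dotZ (alphaL i.+1) l.
Proof.
congr (_ *: _); apply: eq_bigr => i _; rewrite (@nsum1 _ 0%N) => [|[//|k] _].
  by rewrite hh0E (linMz (hh_lin _ _)).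
by rewrite hhE (lin0 (hh_lin _ _)).
Qed.

Lemma dotZ_sum (x y : lat) : \sum_(i < 5) dotZ (alphaL i.+1) x * dotZ (alphaL i.+1) y = 2 * dotZ x y.
Proof.
apply: (@intr_inj rat); rewrite rmorph_sum rmorphM /= dotZE /dotL mulr_sumr.
by apply: eq_bigr => i _; rewrite rmorphM /= !dotZ_alpha; ring.
Qed.

(** As l = 1/2 sum <alpha^i, l> alpha^i, the argument of [G] is l_(-1) w, which is T e^l when w =
    e^l. *)
Lemma GG_half be m l w : G be m ((2%:R)^-1 *: \sum_(i < 5) h i (-1) w *~ dotZ (alphaL i.+1) l) =
  (2%:R)^-1 *: (\sum_(i < 5) h i (-1) (G be m w) *~ dotZ (alphaL i.+1) l)
  - G be (m - 1) w *~ dotZ l be.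
Proof.
have hG := @GG_lin K F be m.
rewrite (linZ hG) (lin_sum hG) -[X in _ = _ - X]half_double -scalerBr; congr (_ *: _).
rewrite -dotZ_sum mulrz_sumr -sumrB; apply: eq_bigr => i _.
by rewrite (linMz hG) GG_hh; zmod.
Qed.

Lemma half_top be m l l' w :
  cf (G be m ((2%:R)^-1 *: \sum_(i < 5) h i (-1) w *~ dotZ (alphaL i.+1) l)) (mset0, l')
  = - cf (G be (m - 1) w) (mset0, l') *~ dotZ l be.
Proof.
rewrite GG_half cfB cfZ cf_sum big1 => [|i _]; last by rewrite cfMz (hN_top i 0) mul0rz.
by rewrite mulr0 sub0r cfMz mulNrz.
Qed.

(** The defect [X] has the same commutators with Heisenberg modes as the modes of e^be, so it is
    enough to test it on e^l. There [vanish] leaves only leading coefficients, known from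
    [GG_top]. *)
Lemma GG_tcov be : tcov Tf (G be).
Proof.
pose X m u := Tf (G be m u) - G be m (Tf u) + G be (m - 1) u *~ m.
suff X0 m u : X m u = 0.
  move=> m u; have := X0 m u; rewrite /X => /eqP; rewrite addr_eq0 => /eqP e.
  by rewrite -[LHS](subrK (G be m (Tf u))) e addrC.
have hG m' := @GG_lin K F be m'.
have Xheis m' i k (w : F) : h i k (X m' w) = X m' (h i k w) + X (m' + k) w *~ dotZ (alphaL i.+1) be.
  apply: (@tcov_step _ Tf (h i k) (h i (k - 1)) (G be m') (G be (m' - 1)) (G be (m' + k)) (G be (m' + k - 1))).
  - exact: islin_addv Tf_lin.
  - exact: islin_addv (hh_lin i k).
  - exact: islin_addv (hG _).
  - exact: Tf_hh.
  - exact: GG_hh.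
  - by move=> v; have e : m' + k - 1 = m' + (k - 1); [by rewrite addrA|by rewrite e; exact: GG_hh].
  - by move=> v; have e : m' + k - 1 = m' - 1 + k; [by rewrite addrAC|by rewrite e; exact: GG_hh].
have aX m' : islin (X m').
  apply: islinD; last by apply: islinMz.
  by apply: islinB; apply: islin_comp => //; exact: Tf_lin.
move: m; elim/F_ind: u => [a u v hu hv|l|i p u hu] m.
- by rewrite aX hu hv scaler0 addr0.
- apply: (vanish (X := fun m => X m (E l)) (D := fun m => dotZ l l + (dotZ be be - 2 - 2 * m) + 2)).
  + move=> {}m; apply: hmgD; first apply: hmgB.
    * by apply: Tf_hmg; apply: GG_hmg; exact: hmgE.
    * have := GG_hmg be m (Tf_hmg (hmgE l)).
      by have -> : dotZ l l + 2 + (dotZ be be - 2 - 2 * m) = dotZ l l + (dotZ be be - 2 - 2 * m) + 2 by ring.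
    * have := hmgMz _ _ m (GG_hmg be (m - 1) (hmgE l)).
      by have -> : dotZ l l + (dotZ be be - 2 - 2 * (m - 1)) = dotZ l l + (dotZ be be - 2 - 2 * m) + 2 by ring.
  + move=> {}m i p hlow; rewrite Xheis hhE (lin0 (aX _)) add0r.
    by rewrite hlow ?mul0rz//; lia.
  + move=> {}m l'; rewrite /X TfE cfD cfB Tf_top sub0r half_top mulNrz opprK cfMz GG_top -mulrzDr.
    have [->|mn] := eqVneq m (- dotZ l be); first by rewrite subrr mulr0z.
    rewrite (_ : (_ == _) = false) ?mulr0 ?mul0rz//.
    by apply/eqP; rewrite dotZC; move/eqP: mn; lia.
- have := Xheis m i (Negz p) u; rewrite hu (lin0 (hh_lin _ _)) hu mul0rz addr0.
  by move=> <-.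
Qed.

End Fock1.
Arguments hmgE {K F} l : rename.
Arguments hmgb {K F} b : rename.
Arguments hmgMz {K F d u} z _ : rename.
Arguments hh_hmg {K F} i n {d u} _ : rename.
Arguments GG_hmg {K F} be n {d u} _ : rename.

(** * The state-field correspondence *)
Transparent heis lin_ext msetD msetB msetn mset0 seq_mset mkmalgU dotZ sgnL hcoef creation annihilation hmode Esh exp_mode cz.

Opaque dotZ sgnL msetD msetB msetn mset0 seq_mset.

Lemma cz_m2 j : cz (-2) j = (j.+1)%:Z.
Proof. by rewrite /= bin1 add1n. Qed.

Definition czZ (l t : int) : int := if t is Posz n then cz l n else 0.

Lemma czZS l t : czZ (l + 1) t = czZ l t - czZ l (t - 1).
Proof.
case: t => [[|n]|n].
- by rewrite /= !cz0 subr0.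
- have -> : n.+1%:Z - 1 = n%:Z by lia.
  by rewrite /= czS.
- have -> : Negz n - 1 = Negz n.+1 by rewrite !NegzE; lia.
  by rewrite /= subrr.
Qed.

(** For M >= 0 the power (x - y)^M is a polynomial, so its expansions in the two domains
    coincide. *)
Lemma czZ_sym (M : nat) t : czZ M t = sgz1 M * czZ M (M%:Z - t).
Proof.
case: t => t /=; last first.
  by rewrite /= bin_small ?mulr0 ?mul0r ?mulr0//; lia.
case: (leqP t M) => tM; last first.
  have -> : M%:Z - t%:Z = Negz (t - M).-1 by rewrite NegzE; lia.
  by rewrite mulr0 bin_small ?mulr0.
have -> : M%:Z - t%:Z = (M - t)%N%:Z by lia.
rewrite /= bin_sub// mulrA /sgz1 absz_nat -exprD; congr (_ * _).
rewrite -signr_odd -[RHS]signr_odd; congr (_ ^+ _).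
by rewrite oddD oddB// addbA addbb.
Qed.
Opaque cz.

Lemma sgz1N (x : int) : sgz1 (x + 1) = - sgz1 x. Proof. exact: sgz1S. Qed.

Section Locality.
Context {K : numClosedFieldType} {F : fockData K}.
Implicit Types (u v w : F).

Local Notation h := (@hh K F).
Local Notation G := (@GG K F).
Local Notation E l := (@bb K F (mset0, l)).
Local Notation one := (@bb K F (mset0, 0)).
Local Notation T := (@Tf K F).

Lemma hmg_eq d d' u : hmg d u -> d = d' -> hmg d' u.
Proof. by move=> + <-. Qed.

Lemma Tf_one : T one = 0.
Proof. by rewrite TfE big1 ?scaler0// => i _; rewrite dotZ0r mulr0z. Qed.

Lemma hh_creative i : creative one (h i).
Proof. by case=> // -[|n] _; [rewrite hh0E dotZ0r mulr0z|rewrite hhE]. Qed.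

Lemma GE_gt be l n : -1 - dotZ be l < n -> G be n (E l) = 0.
Proof.
move=> hn; pose J := {n : int | -1 - dotZ be l < n}.
(* Only indices above the bound belong to the family; positive Heisenberg modes raise the index and
   so stay inside it. *)
apply: (vanish (J := J) (X := fun j => G be (sval j) (E l))
  (D := fun j => dotZ l l + (dotZ be be - 2 - 2 * sval j)) _ _ _ (exist _ n hn)).
- by move=> j; apply: GG_hmg; exact: hmgE.
- move=> [j hj] i p hlow; rewrite GG_hh hhE (lin0 (GG_lin be j)) add0r.
  have hj' : -1 - dotZ be l < j + p.+1%:Z by lia.
  by have /= -> := hlow (exist (fun n => is_true (-1 - dotZ be l < n)) _ hj'); rewrite ?mul0rz//; lia.
- move=> [j hj] l' /=; rewrite GG_top (_ : (j == _) = false) ?mulr0//.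
  by apply/eqP; lia.
Qed.

Lemma GG_topZ be m l l' : cf (G be m (E l)) (mset0, l') =
  (sgz1 (sgnL be l) * ((m == -1 - dotZ be l) && (be + l == l')))%:~R.
Proof. by rewrite GG_top signZ_sgz rmorphM /=; case: (_ && _). Qed.

Lemma GE_eq be l : G be (-1 - dotZ be l) (E l) = E (be + l) *~ sgz1 (sgnL be l).
Proof.
apply/eqP; rewrite -subr_eq0; apply/eqP; apply: fker => [i p|l'].
  rewrite (linB (hh_lin i _)) (linMz (hh_lin i _)) hhE mul0rz subr0 GG_hh hhE.
  by rewrite (lin0 (GG_lin be _)) add0r GE_gt ?mul0rz//; lia.
rewrite cfB cfMz GG_topZ eqxx /= cfb xpair_eqE eqxx /=.
by case: (_ == _); rewrite ?mulr0 ?mulr1 ?mul0rz ?subrr// -mulrzr mul1r subrr.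
Qed.

Lemma GE_one be : G be (-1) one = E be.
Proof. by have := GE_eq be 0; rewrite dotZ0r subr0 sgnL0r /sgz1 mulr1z addr0. Qed.

Lemma GG_creative be : creative one (G be).
Proof. by move=> n hn; rewrite GE_gt// dotZ0r; lia. Qed.

Lemma loc_hh i j : loc 2 (h i) (h j).
Proof.
apply/(locP _ (hh_field i) (hh_field j)) => v m n.
rewrite /= /dXY !hh_comm -!mulrzBr.
suff -> : hcoef i j (m + 1 + 1) n - hcoef i j (m + 1) (n + 1) -
  (hcoef i j (m + 1) (n + 1) - hcoef i j m (n + 1 + 1)) = 0 by rewrite mulr0z.
rewrite /hcoef; case: (i == j) => //=.
have -> : m + 1 + 1 + n = m + n + 2 by ring.
have -> : m + 1 + (n + 1) = m + n + 2 by ring.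
have -> : m + (n + 1 + 1) = m + n + 2 by ring.
by case: eqP => // _; ring.
Qed.

Lemma loc_hG i be : loc 1 (h i) (G be).
Proof.
apply/(locP _ (hh_field i) (GG_field be)) => v m n.
rewrite /= /dXY !GG_hh !(addrC (G be _ _)) !addrK.
have -> : n + 1 + m = n + (m + 1) by ring.
exact: subrr.
Qed.

(** The image of T has no e^l' component. Moving T through both operators onto e^l relates two
    neighbouring coefficients. *)
Lemma GG2_rec be be' l l' m n (f := fun m n => cf (G be m (G be' n (E l))) (mset0, l')) :
  f (m - 1) n *~ (m + dotZ l be) + f m (n - 1) *~ (n + dotZ l be') = 0.
Proof.
have := @Tf_top K F (G be m (G be' n (E l))) l'.
rewrite (GG_tcov be m) (GG_tcov be' n) TfE GG_half (linB (GG_lin be m)) (linB (GG_lin be m)).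
rewrite !(linMz (GG_lin be m)) 3!cfB half_top !cfMz -!/(f _ _) => e.
by apply: oppr_inj; rewrite oppr0 -[RHS]e; zmod.
Qed.

(** The correlator is (x - y)^<be,be'> up to monomials: starting from the highest nonzero mode of
    e^be' on e^l, the recursion [GG2_rec] becomes the recursion [cz_rec] of the binomial
    coefficients. *)
Lemma GG2_top be be' l l' m n : cf (G be m (G be' n (E l))) (mset0, l') =
  (sgz1 (sgnL be' l) * sgz1 (sgnL be (be' + l)) * czZ (dotZ be be') (-1 - dotZ be' l - n)
  * ((m + n == - 2 - dotZ be be' - dotZ be l - dotZ be' l) && (be + (be' + l) == l')))%:~R.
Proof.
set n0 := -1 - dotZ be' l.
have [hn|hn] := ltP n0 n.
  rewrite GE_gt// (lin0 (GG_lin be m)) cf0.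
  have -> : n0 - n = Negz `|(n - n0 - 1)%R|%N by rewrite NegzE; lia.
  by rewrite /= mulr0 mul0r.
have [t ->] : exists t : nat, n = n0 - t%:Z by exists `|n0 - n|%N; lia.
have -> : n0 - (n0 - t%:Z) = t%:Z by ring.
elim: t m {n hn} => [|t IH] m.
  rewrite subr0 GE_eq (linMz (GG_lin be m)) cfMz GG_topZ [czZ _ 0]/= cz0 mulr1 -mulrzr -rmorphM /=.
  congr (_%:~R); rewrite mulrC -mulrA; congr (_ * (_ * (_ && _)%:Z)).
  by rewrite dotZDr /n0; apply/eqP/eqP; lia.
have /= := GG2_rec be be' l l' m (n0 - t%:Z).
rewrite IH; set s := sgz1 _ * sgz1 _.
have -> : n0 - t%:Z - 1 = n0 - t.+1%:Z by lia.
have -> : n0 - t%:Z + dotZ l be' = - t.+1%:Z by rewrite /n0 dotZC; lia.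
rewrite mulrNz => /eqP; rewrite subr_eq0 => /eqP e.
apply: (@mulfI _ t.+1%:R); first by rewrite pnatr_eq0.
rewrite mulr_natl pmulrn -e -mulrzr -rmorphM -[t.+1%:R]/(t.+1%:Z%:~R) -rmorphM /=.
congr (_%:~R).
have -> : (m - 1 + (n0 - t%:Z) == - 2 - dotZ be be' - dotZ be l - dotZ be' l)
  = (m + (n0 - t.+1%:Z) == - 2 - dotZ be be' - dotZ be l - dotZ be' l).
  by congr (_ == _); lia.
case: eqP => /= hK; last by rewrite !mulr0 mul0r.
have -> : m + dotZ l be = t%:Z - dotZ be be' by rewrite (dotZC l); rewrite /n0 in hK; lia.
have hxy := cz_rec (dotZ be be') t; move: (Posz t.+1) hxy => c.
set bb : int := Posz (nat_of_bool _).
move: (cz _ t) (cz _ t.+1) => x y hxy.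
transitivity (s * bb * (y * c)); last by ring.
by rewrite hxy; ring.
Qed.

(** Heisenberg commutators and [vanish] reduce the claim to coefficients of e^l'. There the two
    orderings give the two expansions of (x - y)^(d+N) with d = <be,be'>, the cocycle supplying the
    sign (-1)^d; for N = |d| the exponent is nonnegative and they agree. *)
Lemma loc_GG be be' : loc `|dotZ be be'| (G be) (G be').
Proof.
have hG := @GG_field K F be; have hG' := @GG_field K F be'.
pose X (j : int * int) u := Dm (G be) (G be') `|dotZ be be'|%N j.1 j.2 u.
suff X0 : forall j u, X j u = 0 by move=> m n v; exact: (X0 (m, n) v).
have hX i k m n (w : F) : h i k (X (m, n) w) = X (m, n) (h i k w) + X (m + k, n) w *~ dotZ (alphaL i.+1) be
    + X (m, n + k) w *~ dotZ (alphaL i.+1) be'.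
  apply: (Dm_shift hG hG' (islin_addv (hh_lin i k))) => *; exact: GG_hh.
have lX j : islin (X j).
  rewrite /X; elim: `|_|%N j.1 j.2 => {j} [|N IH] m n.
    under eq_fun do rewrite Dm0//.
    by apply: islinB; apply: islin_comp; exact: GG_lin.
  under eq_fun do rewrite -(addn1 N) PoszD DmS//.
  exact: islinB.
move=> + u; elim/(@F_ind K F): u => [a u v hu hv|l|i p u hu] j.
- by rewrite lX hu hv scaler0 addr0.
- pose D (j : int * int) := dotZ l l + dotZ be be + dotZ be' be' - 4 - 2 * (j.1 + j.2 + `|dotZ be be'|%N%:Z).
  apply: (vanish (X := fun j => X j (E l)) (D := D)).
  + rewrite /X /D => -[m n] /=; elim: `|_|%N m n => [|N IH] m n.
      rewrite Dm0//; apply: hmgB.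
        by apply: (hmg_eq (GG_hmg be m (GG_hmg be' n (hmgE l)))); ring.
      by apply: (hmg_eq (GG_hmg be' n (GG_hmg be m (hmgE l)))); ring.
    rewrite -(addn1 N) PoszD DmS//; apply: hmgB.
      by apply: (hmg_eq (IH (m + 1) n)); lia.
    by apply: (hmg_eq (IH m (n + 1))); lia.
  + move=> [m n] i p hlow; rewrite hX hhE (lin0 (lX _)) add0r.
    by rewrite !hlow ?mul0rz ?addr0// /D /=; lia.
  + set d := dotZ be be'; rewrite /X => -[m n] l' /=; rewrite -/d.
    pose s := sgz1 (sgnL be' l) * sgz1 (sgnL be (be' + l)).
    have top (N : nat) m' n' : cf (Dm (G be) (G be') N m' n' (E l)) (mset0, l') =
      (s * ((m' + n' + N%:Z == - 2 - d - dotZ be l - dotZ be' l) && (be + (be' + l) == l')) *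
        (czZ (d + N%:Z) (-1 - dotZ be' l - n') - sgz1 (d + N%:Z) * czZ (d + N%:Z) (d + N%:Z - (-1 - dotZ be' l - n'))))%:~R.
      elim: N m' n' => [|N IH] m' n'.
        rewrite Dm0// cfB !GG2_top -rmorphB /= !addr0; congr (_%:~R).
        rewrite (addrCA be' be l) (addrC n' m') (dotZC be' be) -/d.
        have -> : - 2 - d - dotZ be' l - dotZ be l = - 2 - d - dotZ be l - dotZ be' l by ring.
        have -> : sgz1 (sgnL be l) * sgz1 (sgnL be' (be + l)) = s * sgz1 d.
          rewrite /s !sgnLDr !sgzM (sgnL_comm be' be) dotZC -/d; ring.
        case: eqP => [e|_] /=; last by rewrite !mulr0 mul0r subr0.
        have -> : -1 - dotZ be l - m' = d - (-1 - dotZ be' l - n') by lia.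
        by rewrite /s; ring.
      rewrite -(addn1 N) PoszD DmS// cfB !IH -rmorphB /=; congr (_%:~R).
      have -> : m' + 1 + n' + N%:Z = m' + n' + (N%:Z + 1) by ring.
      have -> : m' + (n' + 1) + N%:Z = m' + n' + (N%:Z + 1) by ring.
      rewrite -[Posz 1]/(1 : int) (addrA d) sgz1S !czZS.
      set t := -1 - dotZ be' l - n'.
      have -> : -1 - dotZ be' l - (n' + 1) = t - 1 by rewrite /t; ring.
      have -> : d + N%:Z + 1 - t - 1 = d + N%:Z - t by ring.
      have -> : d + N%:Z - (t - 1) = d + N%:Z + 1 - t by ring.
      by ring.
    have [M hM] : exists M : nat, d + `|d|%N%:Z = M%:Z by exists `|(d + `|d|%N%:Z)%R|%N; lia.
    by rewrite top hM -czZ_sym subrr mulr0.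
- have := hX i (Negz p) j.1 j.2 u; rewrite -surjective_pairing !hu !mul0rz !addr0.
  by rewrite (lin0 (hh_lin i _)) => <-.
Qed.

(** Locality is required only against the generating fields; Dong's lemma extends it to the fields
    of all states and keeps the class closed under n-th products. *)
Record good (a : int -> F -> F) : Prop := Good {
  good_field : is_field a;
  good_lin : forall n, islin (a n);
  good_tcov : tcov T a;
  good_creative : creative one a;
  good_h : forall i, local a (h i);
  good_G : forall be, local a (G be) }.

Lemma Dm_lin (a b : int -> F -> F) l m n : (forall n, islin (a n)) -> (forall n, islin (b n)) ->
  is_field a -> is_field b -> islin (Dm a b l m n).
Proof.
move=> la lb ha hb; apply: islinB; last apply: islinMz.
  apply: islin_nsum => [j|u]; first by apply: islinMz; apply: islin_comp.
  by apply: finsMz; apply: fins_comp hb => k; exact: islin_addv.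
apply: islin_nsum => [j|u]; first by apply: islinMz; apply: islin_comp.
by apply: finsMz; apply: fins_comp ha => k; exact: islin_addv.
Qed.

Lemma good_Dm a b l : good a -> good b -> local a b -> good (fun n => Dm a b l 0 n).
Proof.
move=> [fa la ta ca ha Ga] [fb lb tb cb hb Gb] lab; split.
- exact: Dm_field.
- by move=> n; exact: Dm_lin.
- by move=> n v; rewrite (Dm_tcov _ _ _ fa fb ta tb) ?mulr0z ?subr0//; exact: (islin_addv (@Tf_lin K F)).
- exact: Dm_creative.
- by move=> i; apply: dong => //; exact: hh_field.
- by move=> be; apply: dong => //; exact: GG_field.
Qed.

Lemma good_hh i : good (h i).
Proof.
split; [exact: hh_field|exact: hh_lin| |exact: hh_creative| | ].
- by move=> n v; exact: Tf_hh.
- by move=> j; exists 2%N; exact: loc_hh.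
- by move=> be; exists 1%N; exact: loc_hG.
Qed.

Lemma good_GG be : good (G be).
Proof.
split; [exact: GG_field|exact: GG_lin|exact: GG_tcov|exact: GG_creative| | ].
- by move=> i; apply: (local_sym (hh_field i) (GG_field be)); exists 1%N; exact: loc_hG.
- by move=> be'; exists `|dotZ be be'|%N; exact: loc_GG.
Qed.

(* The field of the state spelled by the word s acting on e^be. *)
Definition Yb (s : seq ('I_5 * nat)) be : int -> F -> F :=
  foldr (fun x b n => Dm (h x.1) b (Negz x.2) 0 n) (G be) s.

Lemma good_Yb s be : good (Yb s be).
Proof.
elim: s => [|x s IH] /=; first exact: good_GG.
apply: good_Dm => //; first exact: good_hh.
apply: (local_sym (good_field IH) (hh_field _)); exact: good_h.
Qed.

Lemma local_Yb c s be : good c -> local c (Yb s be).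
Proof.
move=> gc; elim: s => [|x s IH] /=; first exact: good_G.
have gs := good_Yb s be; have gx := good_hh x.1.
have lxs : local (h x.1) (Yb s be).
  by apply: (local_sym (good_field gs) (hh_field _)); exact: good_h.
apply: (local_sym (good_field (good_Dm (Negz x.2) gx gs lxs)) (good_field gc)).
apply: dong => //; [exact: hh_field|exact: good_field|exact: good_field| | ].
  by apply: (local_sym (good_field gc) (hh_field _)); exact: good_h.
exact: (local_sym (good_field gc) (good_field gs)).
Qed.

Lemma Yb_vac s be : Yb s be (-1) one = bb F (seq_mset s, be).
Proof.
elim: s => [|[i p] s IH] /=.
  rewrite GE_one; congr (bb F (_, be)); apply/msetP => x.
  by rewrite mset_seqE mset0E.
have gs := good_Yb s be; have gx := good_hh i.
rewrite Dm_vac; [|exact: good_field|exact: good_field|exact: good_creative|exact: good_creative].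
rewrite IH -bbS; congr (bb F (_, be)); apply/msetP => x.
by rewrite mset1DE !mset_seqE /= eq_sym.
Qed.

Definition Y u n v : F := \sum_(b <- fs u) cf u b *: Yb (enum_mset b.1) b.2 n v.

Lemma Y_linl n v : islin (fun u => Y u n v).
Proof. exact: le_lin. Qed.

Lemma Y_b b : Y (bb F b) = Yb (enum_mset b.1) b.2.
Proof. by apply/funext => n; apply/funext => v; exact: (le_b (fun b => Yb (enum_mset b.1) b.2 n v)). Qed.

Lemma b_ind (P : F -> Prop) :
  (forall (a : K) u v, P u -> P v -> P (a *: u + v)) -> (forall b, P (bb F b)) -> forall u, P u.
Proof.
move=> Plin Pb u; have b0 : fock_basis := (mset0, 0).
have P0 : P 0 by have := Plin (-1) _ _ (Pb b0) (Pb b0); rewrite scaleN1r addNr.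
rewrite [u]fexp; elim/big_ind: _ => // [x y Px Py|b _]; first by rewrite -[x]scale1r; apply: Plin.
by rewrite -[_ *: _]addr0; apply: Plin.
Qed.

Lemma Dm_lin_l (c : K) (x y z : int -> F -> F) l m n v : is_field x -> is_field y -> is_field z -> (forall n, islin (z n)) ->
  Dm (fun n v => c *: x n v + y n v) z l m n v = c *: Dm x z l m n v + Dm y z l m n v.
Proof.
move=> hx hy hz lz.
have ax k : addv (x k) by exact: hx.1.
have ay k : addv (y k) by exact: hy.1.
have az k : addv (z k) by exact: hz.1.
have f1 : fins (fun j => x (m + l - j%:Z) (z (n + j%:Z) v) *~ cz l j) by apply: finsMz; apply: fins_comp hz => k; exact: ax.
have f2 : fins (fun j => y (m + l - j%:Z) (z (n + j%:Z) v) *~ cz l j) by apply: finsMz; apply: fins_comp hz => k; exact: ay.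
have f3 : fins (fun j => z (n + l - j%:Z) (x (m + j%:Z) v) *~ cz l j) by apply: finsMz; apply: fins_comp hx => k; exact: az.
have f4 : fins (fun j => z (n + l - j%:Z) (y (m + j%:Z) v) *~ cz l j) by apply: finsMz; apply: fins_comp hy => k; exact: az.
have E (A B C : nat -> F) : fins A -> fins B -> (forall j, C j = c *: A j + B j) -> nsum C = c *: nsum A + nsum B.
  move=> [N1 h1] [N2 h2] hC; rewrite !(@nsumE _ (N1 + N2)%N).
  - by rewrite scaler_sumr -big_split; apply: eq_bigr => i _; exact: hC.
  - by move=> j lj; apply: h2; lia.
  - by move=> j lj; apply: h1; lia.
  - by move=> j lj; rewrite hC h1 ?h2 ?scaler0 ?addr0//; lia.
rewrite /Dm (E _ _ _ f1 f2) => [|j]; last by rewrite mulrzDl scalerMzr.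
rewrite [X in _ - X *~ _](E _ _ _ f3 f4) => [|j]; last by rewrite lz mulrzDl scalerMzr.
by rewrite mulrzDl scalerMzr scalerBr; zmod.
Qed.

Lemma local_lin (c : K) (x y z : int -> F -> F) : is_field x -> is_field y -> is_field z -> (forall n, islin (z n)) ->
  local x z -> local y z -> local (fun n v => c *: x n v + y n v) z.
Proof.
move=> hx hy hz lz [N1 h1] [N2 h2]; exists (N1 + N2)%N => m n v.
by rewrite Dm_lin_l// (locW hx hz h1) ?(locW hy hz h2) ?scaler0 ?addr0//; lia.
Qed.

Lemma is_field_comb (c : K) (x y : int -> F -> F) : is_field x -> is_field y -> is_field (fun n v => c *: x n v + y n v : F).
Proof.
move=> hx hy; split=> [n u v|v]; first by rewrite hx.1 hy.1 scalerDr addrACA.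
have [M1 H1] := hx.2 v; have [M2 H2] := hy.2 v.
exists (Num.max M1 M2) => k; rewrite ge_max => /andP[h1 h2].
by rewrite H1// H2// scaler0 addr0.
Qed.

Lemma good_comb (c : K) x y : good x -> good y -> good (fun n v => c *: x n v + y n v).
Proof.
move=> [fa la ta ca ha Ga] [fb lb tb cb hb Gb]; split.
- exact: is_field_comb.
- by move=> n; apply: islinD => //; exact: islin_scale.
- by move=> n v; rewrite (@Tf_lin K F) ta tb scalerBr mulrzDl scalerMzr; zmod.
- by move=> n hn; rewrite ca// cb// scaler0 addr0.
- by move=> i; apply: local_lin => //; [exact: hh_field|exact: hh_lin].
- by move=> be; apply: local_lin => //; [exact: GG_field|exact: GG_lin].
Qed.

Lemma Y_lin_fun (a : K) u v : Y (a *: u + v) = (fun n w => a *: Y u n w + Y v n w).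
Proof. by apply/funext => n; apply/funext => w; exact: Y_linl. Qed.

Lemma good_Y u : good (Y u).
Proof.
elim/b_ind: u => [a u v gu gv|b]; first by rewrite Y_lin_fun; exact: good_comb.
by rewrite Y_b; exact: good_Yb.
Qed.

Lemma local_Y c u : good c -> local c (Y u).
Proof.
move=> gc; elim/b_ind: u => [a u v gu gv|b]; last by rewrite Y_b; exact: local_Yb.
rewrite Y_lin_fun; have fu := good_field (good_Y u); have fv := good_field (good_Y v).
apply: (local_sym (is_field_comb a fu fv) (good_field gc)).
apply: local_lin => //; [exact: good_field|exact: good_lin| | ].
  exact: (local_sym (good_field gc) fu).
exact: (local_sym (good_field gc) fv).
Qed.

Lemma Y_vac u : Y u (-1) one = u.
Proof.
elim/b_ind: u => [a u v hu hv|[s l]]; first by rewrite Y_linl hu hv.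
by rewrite Y_b Yb_vac seq_mset_id.
Qed.

Lemma F_tf (x : F) n : x *+ n.+1 = 0 -> x = 0.
Proof.
move=> /eqP; rewrite -scaler_nat scaler_eq0 pnatr_eq0 /= => /eqP//.
Qed.

Lemma Y_unique a b : good a -> good b -> a (-1) one = b (-1) one -> forall n u, a n u = b n u.
Proof.
move=> ga gb e; apply: (field_unique F_tf (islin_addv (@Tf_lin K F)) Tf_one _ _ _ _ _ _ e (Ys := Y)).
- exact: good_field. - exact: good_field. - exact: good_tcov. - exact: good_tcov.
- exact: good_creative. - exact: good_creative.
move=> u; have gu := good_Y u.
by split; [exact: good_field|exact: good_creative|exact: Y_vac|exact: local_Y|exact: local_Y].
Qed.

Lemma Y_state a : good a -> forall n u, a n u = Y (a (-1) one) n u.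
Proof. by move=> ga; apply: Y_unique => //; [exact: good_Y|rewrite Y_vac]. Qed.

Lemma Y_lin u n : islin (Y u n). Proof. exact: good_lin (good_Y u) n. Qed.
Lemma Y_field u : is_field (Y u). Proof. exact: good_field (good_Y u). Qed.
Lemma Y_local u v : local (Y u) (Y v). Proof. exact: local_Y (good_Y u). Qed.
Lemma Y_tcov u n v : T (Y u n v) = Y u n (T v) - Y u (n - 1) v *~ n.
Proof. exact: good_tcov (good_Y u) n v. Qed.
Lemma Y_creative u n : 0 <= n -> Y u n one = 0. Proof. exact: good_creative (good_Y u) n. Qed.

(** Both sides are good fields that create u_(l) v from the vacuum, so uniqueness identifies them.
    With [borcherds] this is the full Borcherds identity. *)
Lemma Y_iter u v l n w : Y (Y u l v) n w = Dm (Y u) (Y v) l 0 n w.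
Proof.
have g := good_Dm l (good_Y u) (good_Y v) (Y_local u v).
rewrite (Y_state g); congr (Y _ n w).
rewrite Dm_vac ?Y_vac//; [exact: Y_field|exact: Y_field|exact: good_creative (good_Y _)|exact: good_creative (good_Y _)].
Qed.

Lemma Y_borcherds u v l m n w : Dm (Y u) (Y v) l m n w =
  nsum (fun j => Y (Y u (l + j%:Z) v) (m + n - j%:Z) w *~ binz m j).
Proof.
rewrite (borcherds (Y_field u) (Y_field v) (Y_local u v)).
by apply: eq_nsum => j; rewrite Y_iter.
Qed.

Lemma Y_comm u v m n w : Y u m (Y v n w) - Y v n (Y u m w) =
  nsum (fun j => Y (Y u j%:Z v) (m + n - j%:Z) w *~ binz m j).
Proof.
rewrite -(Dm0 (Y_field u) (Y_field v)) Y_borcherds.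
by apply: eq_nsum => j; rewrite add0r.
Qed.

Lemma Y_one n u : Y one n u = if n == -1 then u else 0.
Proof.
pose I (n : int) (u : F) : F := if n == -1 then u else 0.
have lI k : islin (I k) by rewrite /I => a x y; case: eqP; rewrite ?scaler0 ?addr0.
have fI : is_field I.
  split=> [k x y|v]; first by rewrite (islin_addv (lI k)).
  by exists 0 => k hk; rewrite /I ifF//; apply/eqP; lia.
have locI c : (forall k, addv (c k)) -> is_field c -> local I c.
  move=> ac fc; exists 0%N => m k v; rewrite Dm0//.
  by rewrite /I; case: eqP; rewrite ?(addv0 (ac k)) subrr.
have gI : good I.
  split=> //.
  - move=> k v; rewrite /I; have [->|k1] := eqVneq k (-1).
      by have -> : (-1 - 1 == -1 :> int) = false; [|rewrite mul0rz subr0].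
    rewrite (lin0 (@Tf_lin K F)) sub0r; case: eqP => [k0|_]; last by rewrite mul0rz oppr0.
    have -> : k = 0 by lia.
    by rewrite mulr0z oppr0.
  - by move=> k hk; rewrite /I ifF//; apply/eqP; lia.
  - by move=> i; apply: locI; [move=> k; exact: islin_addv (hh_lin i k)|exact: hh_field].
  - by move=> be; apply: locI; [move=> k; exact: islin_addv (GG_lin be k)|exact: GG_field].
by rewrite -[RHS](Y_unique (good_Y one) gI) ?Y_vac.
Qed.

Lemma Y_hNeg i p u n w : Y (h i (Negz p) u) n w = Dm (h i) (Y u) (Negz p) 0 n w.
Proof.
have g := good_Dm (Negz p) (good_hh i) (good_Y u) (local_Y u (good_hh i)).
rewrite (Y_state g); congr (Y _ n w); rewrite Dm_vac ?Y_vac//.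
- exact: hh_field. - exact: Y_field. - exact: hh_creative. - exact: good_creative (good_Y _).
Qed.

Lemma Y_E be n u : Y (E be) n u = G be n u.
Proof. by rewrite (Y_state (good_GG be)) GE_one. Qed.

Lemma Y_h1 i n u : Y (h i (-1) one) n u = h i n u.
Proof. exact/esym/(Y_state (good_hh i)). Qed.

Lemma T_Y u : T u = Y u (-2) one.
Proof. by have := Y_tcov u (-1) one; rewrite Y_vac Tf_one (lin0 (Y_lin _ _)) sub0r mulrNz opprK mulr1z. Qed.

Lemma Y_T u n w : Y (T u) n w = - Y u (n - 1) w *~ n.
Proof.
rewrite T_Y Y_iter /Dm.
have z (X : nat -> F) : (forall j, X j = 0) -> nsum X = 0.
  by move=> X0; rewrite (@nsumE _ 0) ?big_ord0.
have c2 := cz_m2.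
have y0 k v j : k != -1 -> Y u j (Y one k v) = 0.
  by move=> k1; rewrite Y_one (negPf k1) (lin0 (Y_lin _ _)).
have y1 k v : k != -1 -> Y one k v = 0 by move=> k1; rewrite Y_one (negPf k1).
have [n0|n0] := leP 0 n.
  rewrite z ?sub0r; last by move=> j; rewrite y0 ?mul0rz//; apply/eqP; lia.
  case: n n0 => // -[|n] _.
    rewrite z ?mul0rz ?oppr0//= => j; rewrite y1 ?mul0rz//; apply/eqP; lia.
  rewrite (@nsum1 _ n) => [|j jn]; last by rewrite y1 ?mul0rz//; apply/eqP; move/eqP: jn; lia.
  rewrite Y_one ifT ?c2; last by apply/eqP; lia.
  have -> : 0 + n%:Z = n.+1%:Z - 1 by lia.
  by rewrite /sgz1 /=; have -> : (-1) ^+ 2 = 1 :> int by []; rewrite mulr1z mulNrz.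
rewrite [X in _ - X *~ _]z; last by move=> j; rewrite y1 ?mul0rz//; apply/eqP; lia.
have [k ->] : exists k : nat, n = Negz k by exists `|(n + 1)%R|%N; rewrite NegzE; lia.
rewrite mul0rz subr0 (@nsum1 _ k) => [|j jn]; last by rewrite y0 ?mul0rz// NegzE; apply/eqP; move/eqP: jn; lia.
rewrite Y_one ifT ?c2; last by rewrite NegzE; apply/eqP; lia.
have -> : 0 + -2 - k%:Z = Negz k - 1 by rewrite NegzE; lia.
by rewrite NegzE mulrNz mulNrz opprK.
Qed.

Definition gfield (k : int) (a : int -> F -> F) := forall n d u, hmg d u -> hmg (d + k - 2 * n) (a n u).

Lemma gfield_Dm k k' a b l m : is_field a -> is_field b -> gfield k a -> gfield k' b ->
  gfield (k + k' - 2 * l - 2 * m) (Dm a b l m).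
Proof.
move=> fa fb ga gb n d u hu; apply: hmgB; last apply: hmgMz.
  apply: hmg_nsum => [|j]; first by apply: finsMz; apply: fins_comp fb; exact: fa.1.
  by apply: hmgMz; apply: (hmg_eq (ga _ _ _ (gb _ _ _ hu))); ring.
apply: hmg_nsum => [|j]; first by apply: finsMz; apply: fins_comp fa; exact: fb.1.
by apply: hmgMz; apply: (hmg_eq (gb _ _ _ (ga _ _ _ hu))); ring.
Qed.

Lemma gfield_Yb s be : gfield (deg2 (seq_mset s, be) - 2) (Yb s be).
Proof.
elim: s => [|[i p] s IH] /=.
  have -> : seq_mset [::] = mset0 :> {mset ('I_5 * nat)%type}%mset.
    by apply/msetP => x; rewrite mset_seqE mset0E.
  by move=> n d u hu; rewrite /deg2 /= fdeg0; apply: (hmg_eq (GG_hmg be n hu)); lia.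
have -> : seq_mset ((i, p) :: s) = ([mset (i, p)] `+` seq_mset s)%mset :> {mset ('I_5 * nat)%type}%mset.
  by apply/msetP => x; rewrite mset1DE !mset_seqE /= eq_sym.
have gh : gfield 0 (h i) by move=> n d u hu; apply: (hmg_eq (hh_hmg i n hu)); ring.
move=> n d u hu; have := @gfield_Dm _ _ _ _ (Negz p) 0 (hh_field i) (good_field (good_Yb s be)) gh IH n _ _ hu.
by move/hmg_eq; apply; rewrite /deg2 /= fdegD fdeg1 /= NegzE; lia.
Qed.

Lemma Y_hmg d d' u v n : hmg d u -> hmg d' v -> hmg (d + d' - 2 - 2 * n) (Y u n v).
Proof.
move=> hu hv; rewrite /Y; elim: (fs u) => [|b s IH]; first by rewrite big_nil; exact: hmg0.
rewrite big_cons; apply: hmgD => //.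
have [->|nz] := eqVneq (cf u b) 0; first by rewrite scale0r; exact: hmg0.
apply: hmgZ; have := @gfield_Yb (enum_mset b.1) b.2 n _ _ hv.
move/hmg_eq; apply.
by rewrite seq_mset_id -surjective_pairing (hu _ nz); ring.
Qed.

End Locality.

(** * The Hermitian form *)

(** [alpha_(p+1), alpha_(-p-1)] = 2 (p+1), so the s-th power of alpha_(-p-1) has squared norm (2
    (p+1))^s s!. *)
Definition mfactor (s : fmset) (x : 'I_5 * nat) : nat := (2 * x.2.+1) ^ s x * (s x)`!.

(* The squared norm of the basis vector (s, l). *)
Definition bnorm (s : fmset) : nat := \prod_(x <- enum_fset (finsupp s)) mfactor s x.

Lemma bnormE (d : {fset ('I_5 * nat)%type}%fset) (s : fmset) : (finsupp s `<=` d)%fset ->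
  bnorm s = \prod_(x <- enum_fset d) mfactor s x.
Proof.
move=> sd; rewrite /bnorm (big_fset_incl _ sd)// => x _; rewrite memNfinsupp => /eqP h.
by rewrite /mfactor h fact0 muln1.
Qed.

Lemma bnorm0 : bnorm mset0 = 1%N.
Proof. by rewrite (@bnormE fset0) ?big_nil// finsupp0. Qed.

Lemma prod_upd (I : eqType) (r : seq I) (f g : I -> nat) x c : uniq r -> x \in r ->
  f x = (c * g x)%N -> (forall y, y != x -> f y = g y) ->
  (\prod_(y <- r) f y = c * \prod_(y <- r) g y)%N.
Proof.
move=> ur xr fx fy; rewrite (bigD1_seq x)//= [in RHS](bigD1_seq x)//= fx mulnA.
by congr (_ * _)%N; apply: eq_bigr => y yx; exact: fy.
Qed.

Lemma mfactor_step c n : ((2 * c) ^ n.+1 * n.+1`! = 2 * c * n.+1 * ((2 * c) ^ n * n`!))%N.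
Proof. by rewrite expnS factS mulnACA. Qed.

Lemma bnormS x s : bnorm ([mset x] `+` s)%mset = (2 * x.2.+1 * (s x).+1 * bnorm s)%N.
Proof.
pose d := (x |` finsupp s)%fset.
rewrite (@bnormE d) ?(@bnormE d s).
- apply: (prod_upd (x := x)); first exact: fset_uniq.
  + exact: fset1U1.
  + by rewrite /mfactor mset1DE eqxx add1n; exact: mfactor_step.
  + by move=> y /negPf yx; rewrite /mfactor mset1DE yx.
- by rewrite fsubsetU1.
- apply/fsubsetP => y; rewrite !inE mem_finsupp mset1DE mem_finsupp.
  by case: (y == x).
Qed.

Lemma bnorm_gt0 s : (0 < bnorm s)%N.
Proof.
rewrite /bnorm; elim: (enum_fset _) => [|x r IH]; rewrite ?big_nil// big_cons muln_gt0 IH.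
by rewrite /mfactor muln_gt0 fact_gt0 expn_gt0.
Qed.

Lemma sgnLNl x y : sgz1 (sgnL (- x) y) = sgz1 (sgnL x y).
Proof.
have [n [t hx]] := lat_coords x; have [m [s hy]] := lat_coords y.
have hN : coords (- x) (fun i => - n i) (- t).
  by move=> i; rewrite [lat_row _]/= mxE hx !rmorphN /= opprD mulNr.
rewrite (sgnL_coords hx hy) (sgnL_coords hN hy).
set a := _ + t; set b := _ + 2 * s.
have -> : (2 * - n 0%N - t) * b = 2 * (- (a * b)) + a * b by rewrite /a; ring.
by rewrite (sgzM (2 * _)) (sgz_double (- (a * b))) mul1r.
Qed.

Lemma cz_pos (n : nat) j : cz n j = (-1) ^+ j * ('C(n, j))%:Z. Proof. by []. Qed.

Lemma opp_sgz1 (V : zmodType) (x : V) : - x *~ sgz1 (-1) = x.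
Proof. by have -> : sgz1 (-1) = -1; [|rewrite mulrNz mulr1z opprK]. Qed.

Opaque dotZ sgnL msetD msetB msetn mset0 seq_mset cz bnorm.

Section Form.
Context {K : numClosedFieldType} {F : fockData K}.
Implicit Types (u v w : F).

Local Notation h := (@hh K F).
Local Notation G := (@GG K F).
Local Notation E l := (@bb K F (mset0, l)).
Local Notation one := (@bb K F (mset0, 0)).

(** The form of the compact real form of V_L: monomials times e^l are orthogonal and every e^l has
    norm one. *)
Definition ip u v : K := \sum_(b <- fs u) cf u b * (cf v b)^* * (bnorm b.1)%:R.

Lemma ip_lin v a u u' : ip (a *: u + u') v = a * ip u v + ip u' v.
Proof.
have E0 w : ip w v = cf (\sum_(b <- fs w) cf w b *: (((cf v b)^* * (bnorm b.1)%:R) *: one)) (mset0, 0).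
  rewrite cf_sum; apply: eq_bigr => b _.
  by rewrite !cfZ cfb eqxx mulr1 mulrA.
by rewrite !E0 le_lin cf_lin.
Qed.

Lemma ip_linr u a v v' : ip u (a *: v + v') = a^* * ip u v + ip u v'.
Proof.
rewrite /ip mulr_sumr -big_split; apply: eq_bigr => b _ /=.
by rewrite cf_lin rmorphD rmorphM /=; ring.
Qed.

Lemma ip0l v : ip 0 v = 0.
Proof. by have := ip_lin v (-1) 0 0; rewrite scaler0 addr0 mulN1r addNr. Qed.
Lemma ip0r v : ip v 0 = 0.
Proof. by have := ip_linr v (-1) 0 0; rewrite scaler0 addr0 rmorphN1 mulN1r addNr. Qed.
Lemma ipDl u u' v : ip (u + u') v = ip u v + ip u' v.
Proof. by have := ip_lin v 1 u u'; rewrite scale1r mul1r. Qed.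
Lemma ipDr u v v' : ip u (v + v') = ip u v + ip u v'.
Proof. by have := ip_linr u 1 v v'; rewrite scale1r rmorph1 mul1r. Qed.
Lemma ipZl a u v : ip (a *: u) v = a * ip u v.
Proof. by have := ip_lin v a u 0; rewrite !addr0 ip0l addr0. Qed.
Lemma ipZr a u v : ip u (a *: v) = a^* * ip u v.
Proof. by have := ip_linr u a v 0; rewrite !addr0 ip0r addr0. Qed.
Lemma ipNl u v : ip (- u) v = - ip u v.
Proof. by rewrite -scaleN1r ipZl mulN1r. Qed.
Lemma ipNr u v : ip u (- v) = - ip u v.
Proof. by rewrite -scaleN1r ipZr rmorphN1 mulN1r. Qed.
Lemma ipBl u u' v : ip (u - u') v = ip u v - ip u' v.
Proof. by rewrite ipDl ipNl. Qed.
Lemma ipBr u v v' : ip u (v - v') = ip u v - ip u v'.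
Proof. by rewrite ipDr ipNr. Qed.
Lemma ipMzl u v z : ip (u *~ z) v = ip u v *~ z.
Proof. by rewrite -scaler_int ipZl mulrzl. Qed.
Lemma ipMzr u v z : ip u (v *~ z) = ip u v *~ z.
Proof. by rewrite -scaler_int ipZr rmorph_int mulrzl. Qed.

Lemma ip_b b v : ip (bb F b) v = (cf v b)^* * (bnorm b.1)%:R.
Proof.
have := le_b (fun b => ((cf v b)^* * (bnorm b.1)%:R) *: one) b.
move=> /(congr1 (fun w => cf w (mset0, 0))); rewrite cf_sum cfZ cfb eqxx mulr1 => <-.
by apply: eq_bigr => c _; rewrite !cfZ (@cfb K F (mset0, 0)) eqxx mulr1 mulrA.
Qed.

Lemma ip_sym u v : ip v u = (ip u v)^*.
Proof.
elim/(@b_ind K F): v u => [a v w hv hw|b] u; first by rewrite ip_lin ip_linr hv hw rmorphD rmorphM /= conjCK.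
elim/(@b_ind K F): u => [a v w hv hw|b']; first by rewrite ip_lin ip_linr hv hw rmorphD rmorphM.
rewrite !ip_b !cfb rmorphM !rmorph_nat eq_sym.
by have [->//|_] := eqVneq b b'; rewrite !mul0r.
Qed.

Lemma ip_br u b : ip u (bb F b) = cf u b * (bnorm b.1)%:R.
Proof. by rewrite ip_sym ip_b rmorphM /= conjCK rmorph_nat. Qed.

Lemma ip_ge0 u : 0 <= ip u u.
Proof. by apply: sumr_ge0 => b _; rewrite mulr_ge0 ?ler0n// mul_conjC_ge0. Qed.

Lemma ip_eq0 u : (ip u u == 0) = (u == 0).
Proof.
apply/eqP/eqP => [|->]; last exact: ip0l.
move/eqP; rewrite psumr_eq0 => [/allP h|b _]; last by rewrite mulr_ge0 ?ler0n// mul_conjC_ge0.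
rewrite [u]fexp big_seq big1// => b bu; have := h b bu.
by rewrite /= mulf_eq0 mul_conjC_eq0 pnatr_eq0 -[bnorm _ == _]negbK -lt0n bnorm_gt0 orbF => /eqP ->; rewrite scale0r.
Qed.

Lemma ip_nsuml (X : nat -> F) v : fins X -> ip (nsum X) v = nsum (fun j => ip (X j) v).
Proof.
move=> [N hN]; rewrite !(@nsumE _ N)// => [|j /hN ->]; last exact: ip0l.
by elim/big_rec2: _ => [|i x y _ <-]; rewrite ?ip0l// ipDl.
Qed.
Lemma ip_nsumr (X : nat -> F) v : fins X -> ip v (nsum X) = nsum (fun j => ip v (X j)).
Proof.
move=> [N hN]; rewrite !(@nsumE _ N)// => [|j /hN ->]; last exact: ip0r.
by elim/big_rec2: _ => [|i x y _ <-]; rewrite ?ip0r// ipDr.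
Qed.

Definition adj (f g : F -> F) := forall u v, ip (f u) v = ip u (g v).

Lemma adj_sym f g : adj f g -> adj g f.
Proof. by move=> h0 u v; rewrite ip_sym -h0 -ip_sym. Qed.

Lemma hh_adj i n : adj (h i n) (h i (- n)).
Proof.
have neg p : adj (h i (Negz p)) (h i (Posz p.+1)).
  move=> u v; elim/(@b_ind K F): u => [a x y hx hy|[s l]]; first by rewrite hh_lin !ip_lin hx hy.
  rewrite -bbS !ip_b cf_hP bnormS rmorphM /= rmorph_nat !natrM; ring.
case: n => [[|p]|p]; last exact: neg.
  move=> u v; elim/(@b_ind K F): u => [a x y hx hy|[s l]]; first by rewrite hh_lin !ip_lin hx hy.
  elim/(@b_ind K F): v => [a x y hx hy|[s' l']]; first by rewrite hh_lin !ip_linr hx hy.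
  rewrite oppr0 !hh0 ipMzl ipMzr ip_b cfb.
  by have [[_ ->]//|_] := eqVneq (s', l') (s, l); rewrite rmorph0 mul0r !mul0rz.
by have := adj_sym (neg p); rewrite NegzE.
Qed.

(** Heisenberg modes are moved across until both arguments are exponentials, where leading
    coefficients decide. The sign is the cocycle value in e^(-be) e^be = +-1. *)
Lemma GG_adj be m u v :
  ip (G be m u) v = ip u (G (- be) (dotZ be be - 2 - m) v) *~ sgz1 (sgnL be be).
Proof.
set eps := sgz1 _; set d := dotZ be be.
have gm i k m' w : G be m' (h i k w) = h i k (G be m' w) - G be (m' + k) w *~ dotZ (alphaL i.+1) be.
  by rewrite GG_hh addrK.
have gm' i k m' w : G (- be) m' (h i k w) = h i k (G (- be) m' w) + G (- be) (m' + k) w *~ dotZ (alphaL i.+1) be.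
  by rewrite GG_hh dotZNr mulrNz addrNK.
elim/(@F_ind K F): u m v => [a x y hx hy|l|i p u IH] m v.
- by rewrite (GG_lin be m) !ip_lin hx hy mulrzDl mulrzAr.
- elim/(@F_ind K F): v m => [a x y hx hy|l'|i p v IH] m.
  + by rewrite (GG_lin _ _) !ip_linr hx hy mulrzDl mulrzAr.
  + rewrite ip_br bnorm0 mulr1 ip_sym ip_br bnorm0 mulr1 !GG_topZ rmorph_int -[RHS]mulrzr -rmorphM /=.
    congr (_%:~R); rewrite sgnLNl.
    have e : ((m == -1 - dotZ be l) && (be + l == l')) =
       ((d - 2 - m == -1 - dotZ (- be) l') && (- be + l' == l)).
      have -> : (- be + l' == l) = (be + l == l').
        by rewrite addrC subr_eq eq_sym addrC.
      case: (eqVneq (be + l) l') => [<-|_]; last by rewrite !andbF.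
      rewrite !andbT dotZNl dotZDr -/d; apply/eqP/eqP; lia.
    rewrite e; case: eqP => /= _; last by rewrite !mulr0 mul0r.
    case: eqP => /= [e'|_]; last by rewrite !mulr0 mul0r.
    have -> : l' = be + l by rewrite -e' addrA subrr add0r.
    by rewrite sgnLDr sgzM !mulr1 -/eps mulrC mulrA sgz1_sq mul1r.
  + have A x y : ip x (h i (Negz p) y) = ip (h i (Posz p.+1) x) y.
      by rewrite (hh_adj i (Posz p.+1)) NegzE.
    rewrite A GG_hh hhE (lin0 (GG_lin be m)) add0r ipMzl IH.
    rewrite gm' ipDr A hhE ip0l add0r ipMzr -!mulrzA mulrC.
    by have -> : d - 2 - (m + p.+1%:Z) = d - 2 - m + Negz p by rewrite NegzE; ring.
- have A x y : ip (h i (Negz p) x) y = ip x (h i (Posz p.+1) y).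
    by rewrite (hh_adj i (Negz p)) NegzE opprK.
  rewrite gm ipBl ipMzl !A !IH gm' ipDr mulrzDl ipMzr.
  have -> : d - 2 - (m + Negz p) = d - 2 - m + p.+1%:Z by rewrite NegzE; ring.
  by rewrite -!mulrzA (mulrC eps) addrK.
Qed.

(** Adjunction reverses products, so the two expansions of (x - y)^l change places; this produces
    the factor [- sgz1 l]. *)
Lemma Dm_adj a b a' b' (p q l m n : int) : is_field a -> is_field b -> is_field a' -> is_field b' ->
  (forall n, adj (a n) (a' (p - n))) -> (forall n, adj (b n) (b' (q - n))) ->
  forall u v, ip (Dm a b l m n u) v = - ip u (Dm a' b' l (p - m - l) (q - n - l) v) *~ sgz1 l.
Proof.
move=> fa fb fa' fb' ha hb u v.
have f1 (x y : int -> F -> F) m' n' w : is_field x -> is_field y ->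
    fins (fun j => x (m' - j%:Z) (y (n' + j%:Z) w) *~ cz l j).
  by move=> hx hy; apply: finsMz; apply: (fins_comp (fun j => m' - j%:Z)) hy => k; exact: hx.1.
rewrite /Dm ipBl ipMzl ipBr ipMzr opprB mulrzBl -mulrzA sgz1_sq mulr1z.
have g1 := f1 _ _ (m + l) n u fa fb; have g2 := f1 _ _ (n + l) m u fb fa.
have g3 := f1 _ _ (p - m - l + l) (q - n - l) v fa' fb'; have g4 := f1 _ _ (q - n - l + l) (p - m - l) v fb' fa'.
rewrite (ip_nsuml _ g1) (ip_nsuml _ g2) (ip_nsumr _ g3) (ip_nsumr _ g4).
congr (_ - _ *~ _).
  apply: eq_nsum => j; rewrite ipMzl ipMzr ha hb.
  have -> : q - n - l + l - j%:Z = q - (n + j%:Z) by ring.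
  by have -> : p - m - l + j%:Z = p - (m + l - j%:Z) by ring.
apply: eq_nsum => j; rewrite ipMzl ipMzr hb ha.
have -> : p - m - l + l - j%:Z = p - (m + j%:Z) by ring.
by have -> : q - n - l + j%:Z = q - (n + l - j%:Z) by ring.
Qed.

(* Adjoints of the modes of a state u of weight 2: u^+_(n) = s_(2-n) + r_(1-n). *)
Definition adj2 u s r := forall n, adj (Y u n) (fun v => Y s (2 - n) v + Y r (1 - n) v).

Lemma adj2_lin a u s r u' s' r' : adj2 u s r -> adj2 u' s' r' ->
  adj2 (a *: u + u') (a^* *: s + s') (a^* *: r + r').
Proof.
move=> h1 h2 n x y; rewrite !Y_linl ip_lin h1 h2 ipDr [in RHS]ipDr !ip_linr !conjCK !ipDr; ring.
Qed.

Lemma adj2_0 : adj2 0 0 0.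
Proof.
have y0 n v : Y (0 : F) n v = 0 by exact: (lin0 (Y_linl n v)).
by move=> n u v; rewrite !y0 ip0l addr0 ip0r.
Qed.

Lemma Y_m1 (a b : F) n u : Dm (Y a) (Y b) (-1) 1 n u =
  Y (Y a (-1) b) (1 + n) u + Y (Y a 0 b) n u.
Proof.
rewrite Y_borcherds (@nsumE _ 2) => [|j lj]; last first.
  by rewrite /binz -[1 : int]/(Posz 1) cz_pos bin_small ?mulr0 ?mulr0z.
by rewrite !big_ord_recl big_ord0 binz0 binz1 !mulr1z addr0 subr0 addrAC subrr add0r addr0.
Qed.

Lemma Y_h1f i : Y (h i (-1) one) = h i.
Proof. by apply/funext => n; apply/funext => u; exact: Y_h1. Qed.

Lemma Y_Ef l : Y (E l) = G l.
Proof. by apply/funext => n; apply/funext => u; exact: Y_E. Qed.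

Lemma hh_adj0 i n : adj (h i n) (h i (0 - n)).
Proof. by rewrite sub0r; exact: hh_adj. Qed.

Lemma Y_hm1 i b n u : Y (h i (-1) b) n u = Dm (h i) (Y b) (-1) 0 n u.
Proof. exact: (Y_hNeg i 0). Qed.

Lemma Dm_h1 i b n v : Dm (h i) (Y b) (-1) 1 n v = Y (h i (-1) b) (1 + n) v + Y (h i 0 b) n v.
Proof. by have := @Y_m1 (h i (-1) one) b n v; rewrite !Y_h1 Y_h1f. Qed.

Lemma adj2_hh i j : adj2 (h i (-1) (h j (-1) one)) (h i (-1) (h j (-1) one)) 0.
Proof.
have aj n : adj (Y (h j (-1) one) n) (Y (h j (-1) one) (0 - n)) by rewrite Y_h1f; exact: hh_adj0.
have fj := @Y_field K F (h j (-1) one).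
move=> n u v; rewrite [in LHS]Y_hm1.
rewrite (Dm_adj _ _ _ (hh_field i) fj (hh_field i) fj (hh_adj0 i) aj).
rewrite opp_sgz1; congr (ip u _).
have -> : 0 - 0 - -1 = 1 :> int by [].
have -> : 0 - n - -1 = 1 - n by ring.
rewrite Dm_h1 addrA; congr (Y _ _ v + Y _ _ v).
have := hh_comm i 0 j (-1) one; rewrite hh0E dotZ0r mulr0z (lin0 (hh_lin j _)) subr0 => ->.
by rewrite hcoef_eq0 ?mulr0z.
Qed.

Lemma adj2_E l : dotZ l l = 4 -> adj2 (E l) (E (- l) *~ sgz1 (sgnL l l)) 0.
Proof.
move=> l4 n u v; rewrite Y_Ef GG_adj l4 -ipMzr; congr (ip u _).
rewrite (linMz (Y_linl _ _)) Y_Ef (lin0 (Y_linl _ _)) addr0.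
by have -> : 4 - 2 - n = 2 - n by ring.
Qed.

(** The state alpha_(-1) e^l is not annihilated by L_1, which sends it to <alpha,l> e^l; hence the
    correction of lower weight. *)
Lemma adj2_hE i l : dotZ l l = 2 -> adj2 (h i (-1) (E l)) (h i (-1) (E (- l)) *~ sgz1 (sgnL l l))
  (- E (- l) *~ (dotZ (alphaL i.+1) l * sgz1 (sgnL l l))).
Proof.
move=> l2 n u v; set eps := sgz1 _.
have lin n' : islin (G l n') by exact: GG_lin.
have fG : is_field (fun n v => G (- l) n v *~ eps).
  split=> [k x y|w]; first by rewrite (islin_addv (GG_lin _ _)) mulrzDl.
  by have [N hN] := (GG_field (- l)).2 w; exists N => k /hN ->; rewrite mul0rz.
have aG k : adj (G l k) (fun w => G (- l) (0 - k) w *~ eps).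
  by move=> x y; rewrite GG_adj l2 ipMzr subrr.
rewrite [in LHS]Y_hm1 Y_Ef.
rewrite (Dm_adj _ _ _ (hh_field i) (GG_field l) (hh_field i) fG (hh_adj0 i) aG).
rewrite opp_sgz1; congr (ip u _).
have -> : 0 - 0 - -1 = 1 :> int by [].
have -> : 0 - n - -1 = 1 - n by ring.
have -> : (fun n v => G (- l) n v *~ eps) = Y (E (- l) *~ eps).
  by apply/funext => k; apply/funext => w; rewrite (linMz (Y_linl _ _)) Y_E.
rewrite Dm_h1 (linMz (hh_lin i _)) addrA; congr (Y _ _ v + Y _ _ v).
by rewrite (linMz (hh_lin i _)) hh0E dotZNr mulrNz -mulNrz -mulrzA.
Qed.

End Form.

(** * Normal forms in V_L *)
Transparent heis lin_ext msetD msetB msetn mset0 seq_mset mkmalgU dotZ sgnL hcoef creation annihilation hmode Esh exp_mode cz bnorm.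

Opaque msetD msetB msetn mset0 seq_mset bnorm.

Notation "a +z b" := (Z.add a b) (at level 50, left associativity).
Notation "a -z b" := (Z.sub a b) (at level 50, left associativity).
Notation "a *z b" := (Z.mul a b) (at level 40, left associativity).
Notation iz := int_of_Z.
Arguments Z.mul : simpl never.
Arguments Z.add : simpl never.
Arguments Z.sub : simpl never.

Lemma izD a b : iz (a +z b) = iz a + iz b. Proof. lia. Qed.
Lemma izB a b : iz (a -z b) = iz a - iz b. Proof. lia. Qed.
Lemma izM a b : iz (a *z b) = iz a * iz b.
Proof. by rewrite -[Z.mul a b]/(a * b) rmorphM. Qed.
Lemma iz2 : iz (Zpos 2) = 2. Proof. by []. Qed.
Lemma izn n : iz (Z.of_nat n) = n. Proof. lia. Qed.
Lemma izN a : iz (Z.opp a) = - iz a. Proof. lia. Qed.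

(* n_1, ..., n_5, t stand for n_1 alpha^1 + ... + n_5 alpha^5 + t gamma *)
Definition L6 := (Z * Z * Z * Z * Z * Z)%type.
Definition L6add (c d : L6) : L6 := let: (a0, a1, a2, a3, a4, t) := c in
  let: (b0, b1, b2, b3, b4, s) := d in (a0 +z b0, a1 +z b1, a2 +z b2, a3 +z b3, a4 +z b4, t +z s).
Definition L6dot (c d : L6) : Z := let: (a0, a1, a2, a3, a4, t) := c in
  let: (b0, b1, b2, b3, b4, s) := d in
  Zpos 2 *z (a0 *z b0 +z a1 *z b1 +z a2 *z b2 +z a3 *z b3 +z a4 *z b4)
    +z s *z (a0 +z a1 +z a2 +z a3) +z t *z (b0 +z b1 +z b2 +z b3) +z Zpos 2 *z t *z s.
(** Modulo 2 the exponent (2 a0 + t)(b0 + b1 + b2 + b3 + 2 s) is t (b0 + b1 + b2 + b3). *)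
Definition L6sgn (c d : L6) : Z := let: (a0, a1, a2, a3, a4, t) := c in
  let: (b0, b1, b2, b3, b4, s) := d in
  if Z.even (t *z (b0 +z b1 +z b2 +z b3)) then Zpos 1 else Zneg 1.
(** Every index outside 1, ..., 4 is treated as 0, in agreement with the default value of
    [inord]. *)
Definition L6al (i : nat) (c : L6) : Z := let: (a0, a1, a2, a3, a4, t) := c in
  match i with 1%N => Zpos 2 *z a1 +z t | 2%N => Zpos 2 *z a2 +z t | 3%N => Zpos 2 *z a3 +z t
  | 4%N => Zpos 2 *z a4 | _ => Zpos 2 *z a0 +z t end.
(** The relation 2 gamma = alpha^1 + ... + alpha^4 reduces t to 0 or 1, which makes the coordinates
    unique. *)
Definition L6norm (c : L6) : L6 := let: (a0, a1, a2, a3, a4, t) := c in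
  let k := Z.div2 t in (a0 +z k, a1 +z k, a2 +z k, a3 +z k, a4, t -z Zpos 2 *z k).
Definition L6eqb (c d : L6) : bool := let: (a0, a1, a2, a3, a4, t) := c in
  let: (b0, b1, b2, b3, b4, s) := d in
  [&& Z.eqb a0 b0, Z.eqb a1 b1, Z.eqb a2 b2, Z.eqb a3 b3, Z.eqb a4 b4 & Z.eqb t s].

Lemma L6eqbP c d : L6eqb c d -> c = d.
Proof.
case: c => [[[[[a0 a1] a2] a3] a4] t]; case: d => [[[[[b0 b1] b2] b3] b4] s].
by move=> /and5P[/Z.eqb_eq-> /Z.eqb_eq-> /Z.eqb_eq-> /Z.eqb_eq-> /andP[/Z.eqb_eq-> /Z.eqb_eq->]].
Qed.

Definition L6lat (c : L6) : lat := let: (a0, a1, a2, a3, a4, t) := c in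
  alphaL 1 *~ iz a0 + alphaL 2 *~ iz a1 + alphaL 3 *~ iz a2 + alphaL 4 *~ iz a3 + alphaL 5 *~ iz a4 + gammaL *~ iz t.

Definition L6co (c : L6) : nat -> int := let: (a0, a1, a2, a3, a4, t) := c in
  nth 0 [:: iz a0; iz a1; iz a2; iz a3; iz a4].
Definition L6t (c : L6) : int := let: (a0, a1, a2, a3, a4, t) := c in iz t.

Lemma lat_rowD (x y : lat) : lat_row (x + y) = lat_row x + lat_row y. Proof. by []. Qed.
Lemma lat_row0 : lat_row 0 = 0. Proof. by []. Qed.
Lemma lat_rowN (x : lat) : lat_row (- x) = - lat_row x. Proof. by []. Qed.
Lemma lat_rowMz (x : lat) z : lat_row (x *~ z) = lat_row x *~ z.
Proof.
case: z => n.
  by elim: n => [|n IH]; rewrite ?mulr0z ?lat_row0// -(addn1 n) PoszD !mulrzDr lat_rowD IH.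
rewrite NegzE !mulrNz lat_rowN; congr (- _).
by elim: n.+1 => [|m IH]; rewrite ?mulr0z ?lat_row0// -(addn1 m) PoszD !mulrzDr lat_rowD IH.
Qed.

Lemma rowMz (x : 'rV[rat]_5) z i : (x *~ z) 0 i = x 0 i * z%:~R.
Proof. by rewrite -scaler_int mxE mulrC. Qed.

Lemma L6coords c : coords (L6lat c) (L6co c) (L6t c).
Proof.
case: c => [[[[[a0 a1] a2] a3] a4] t] i; rewrite /L6lat !lat_rowD !lat_rowMz !mxE.
rewrite !rowMz /= /alpha_row !mxE /=.
have e k : (k < 5)%N -> (i == inord k) = (val i == k).
  by move=> k5; apply/eqP/eqP => [->|e]; [rewrite /= inordK|apply: val_inj; rewrite /= inordK].
rewrite !e// /gcoord; case: i {e} => -[|[|[|[|[|//]]]]] hi /=; ring.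
Qed.

Lemma L6addE c d : L6lat (L6add c d) = L6lat c + L6lat d.
Proof.
case: c => [[[[[a0 a1] a2] a3] a4] t]; case: d => [[[[[b0 b1] b2] b3] b4] s].
by rewrite /L6lat /L6add !izD !mulrzDr; zmod.
Qed.
Lemma L6dotE c d : dotZ (L6lat c) (L6lat d) = iz (L6dot c d).
Proof.
rewrite (dotZ_coords (@L6coords c) (@L6coords d)).
case: c => [[[[[a0 a1] a2] a3] a4] t]; case: d => [[[[[b0 b1] b2] b3] b4] s].
by rewrite /L6dot ?(izD, izM, iz2) /=; ring.
Qed.
Lemma L6sgnE c d : sgz1 (sgnL (L6lat c) (L6lat d)) = iz (L6sgn c d).
Proof.
rewrite (sgnL_coords (@L6coords c) (@L6coords d)).
case: c => [[[[[a0 a1] a2] a3] a4] t]; case: d => [[[[[b0 b1] b2] b3] b4] s].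
rewrite /L6sgn /=; set B := b0 +z b1 +z b2 +z b3.
have -> : (2 * iz a0 + iz t) * (iz b0 + iz b1 + iz b2 + iz b3 + 2 * iz s)
   = 2 * (iz a0 * (iz B + 2 * iz s) + iz t * iz s) + iz (t *z B).
  by rewrite izM /B !izD; ring.
rewrite sgzM sgz_double mul1r; move: (t *z B) => z.
have [k [->|->]] : exists k, z = Zpos 2 *z k \/ z = Zpos 2 *z k +z Zpos 1.
  by exists (Z.div2 z); have := Z.div2_odd z; case: (Z.odd z) => /= e; [right|left]; lia.
  by rewrite Z.even_mul izM (sgz_double (iz k)).
rewrite Z.even_add Z.even_mul izD izM sgzM (sgz_double (iz k)) mul1r.
by [].
Qed.
Lemma L6alE i c : dotZ (alphaL (inord i : 'I_5).+1) (L6lat c) = iz (L6al i c).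
Proof.
apply: (@intr_inj rat); rewrite dotZ_alpha (@L6coords c) /gcoord.
case: c => [[[[[a0 a1] a2] a3] a4] t].
have [i5|i5] := ltnP i 5.
  rewrite inordK//; case: i i5 => [|[|[|[|[|//]]]]] _ /=; rewrite ?(izD, izM, iz2) ?(rmorphD, rmorphM) /=; by field.
have -> : val (inord i : 'I_5) = 0%N by rewrite /inord val_insubd ltnNge i5.
case: i i5 => [|[|[|[|[|i]]]]] //= _; rewrite ?(izD, izM, iz2) ?(rmorphD, rmorphM) /=; by field.
Qed.
Lemma L6normE c : L6lat (L6norm c) = L6lat c.
Proof.
case: c => [[[[[a0 a1] a2] a3] a4] t]; rewrite /L6norm; set k := Z.div2 t.
apply: val_inj; apply/rowP => i; rewrite -/(lat_row _) (@L6coords _ i) -/(lat_row _) (@L6coords _ i).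
rewrite /gcoord; case: i => -[|[|[|[|[|//]]]]] hi /=; rewrite ?(izD, izB, izM, iz2) ?(rmorphD, rmorphM, rmorphN) /=; by field.
Qed.

Section Qval.
Variable K : numFieldType.

Definition zv (z : Z) : K := (int_of_Z z)%:~R.
Definition qval (q : Q) : K := zv (Qnum q) / zv (Zpos (Qden q)).

Lemma zvD a b : zv (Z.add a b) = zv a + zv b.
Proof. by rewrite /zv -[Z.add a b]/(a + b) rmorphD rmorphD. Qed.
Lemma zvM a b : zv (Z.mul a b) = zv a * zv b.
Proof. by rewrite /zv -[Z.mul a b]/(a * b) rmorphM rmorphM. Qed.
Lemma zv_pos p : zv (Zpos p) != 0.
Proof. by rewrite /zv intr_eq0; apply/eqP; lia. Qed.

Lemma qvD a b : qval (Qplus a b) = qval a + qval b.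
Proof.
case: a => a p; case: b => b q; rewrite /qval /= zvD !zvM Pos2Z.inj_mul zvM.
by field; rewrite !zv_pos.
Qed.
Lemma qvM a b : qval (Qmult a b) = qval a * qval b.
Proof.
case: a => a p; case: b => b q; rewrite /qval /= zvM Pos2Z.inj_mul zvM.
by field; rewrite !zv_pos.
Qed.
Lemma qv_eq a b : Qeq a b -> qval a = qval b.
Proof.
case: a => a p; case: b => b q; rewrite /Qeq /qval /= => e.
apply/eqP; rewrite eqr_div ?zv_pos// -!zvM e; apply/eqP; congr zv; lia.
Qed.
Lemma qvD' a b : qval (Qred (Qplus a b)) = qval a + qval b.
Proof. by rewrite (qv_eq (Qred_correct _)) qvD. Qed.
Definition qint (n : Z) : Q := Qmake n 1.
Lemma qv_int n : qval (qint n) = (iz n)%:~R.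
Proof. by rewrite /qval /qint /= /zv divr1. Qed.
Lemma qv_0 q : Z.eqb (Qnum q) Z0 -> qval q = 0.
Proof. by move=> /Z.eqb_eq e; rewrite /qval e /zv /= mul0r. Qed.
End Qval.

(** * Computation of products on rational combinations of monomials *)

Notation letter := (nat * nat)%type.
Notation word := (seq (nat * nat)%type).
Notation key := (seq (nat * nat)%type * L6)%type.
Notation poly := (seq (Q * (seq (nat * nat)%type * L6))%type).

Definition pscale (q : Q) (p : poly) : poly := [seq (Qmult q t.1, t.2) | t <- p].
Definition pcons (x : letter) (p : poly) : poly := [seq (t.1, (x :: t.2.1, t.2.2)) | t <- p].
Definition pbind (f : key -> poly) (p : poly) : poly := flatten [seq pscale t.1 (f t.2) | t <- p].

Definition n5 (i : nat) : nat := match i with 1%N | 2%N | 3%N | 4%N => i | _ => 0%N end.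

(** A nonnegative Heisenberg mode acts as a derivation on the letters, with contraction 2 k, and
    reaches e^c only for k = 0. *)
Fixpoint hop (i k : nat) (w : word) (c : L6) : poly := match w with
  | [::] => if k is 0%N then [:: (qint (L6al i c), ([::], c))] else [::]
  | x :: w' => pcons x (hop i k w' c) ++
     (if eqn (n5 x.1) (n5 i) && eqn x.2.+1 k then [:: (qint (Z.of_nat (2 * k)), (w', c))] else [::])
  end.

(* The coefficients of exp (\sum_(k >= 1) be_(-k) z^k / k), in decreasing degrees. *)
Definition sstep (be : L6) (n : nat) (L : seq (seq (Q * word))) : seq (Q * word) :=
  flatten [seq flatten [seq [seq (Qmult (Qmake (L6al i be) (Pos.of_succ_nat n.*2.+1)) t.1,
     (i, k) :: t.2) | t <- nth [::] L k] | i <- iota 0 5] | k <- iota 0 n.+1].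
Fixpoint schurl (be : L6) (n : nat) : seq (seq (Q * word)) := match n with
  | 0%N => [:: [:: (qint (Zpos 1), [::])]]
  | n'.+1 => let L := schurl be n' in sstep be n' L :: L end.

Definition gbase (be : L6) (m : Z) (c : L6) : poly :=
  let p := Z.opp (m +z Zpos 1 +z L6dot be c) in
  if Z.ltb p Z0 then [::] else
    pscale (qint (L6sgn be c)) [seq (t.1, (t.2, L6add be c)) | t <- head [::] (schurl be (Z.to_nat p))].

Fixpoint gop (be : L6) (m : Z) (w : word) (c : L6) : poly := match w with
  | [::] => gbase be m c
  | x :: w' => pcons x (gop be m w' c) ++
     (let a := L6al x.1 be in if Z.eqb a Z0 then [::] else
      pscale (qint (Z.opp a)) (gop be (m -z Z.of_nat x.2.+1) w' c))
  end.

Definition wdeg (w : word) (c : L6) : Z := foldr (fun x d => Z.of_nat (2 * x.2.+1) +z d) (L6dot c c) w.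

(** The number of j >= 0 with z - 2 j >= 0; later terms of a sum have negative degree and vanish. *)
Definition hpos (z : Z) : nat := if Z.ltb z Z0 then 0%N else (Z.to_nat (Z.div2 z)).+1.

Definition zsgn (n : nat) : Z := if odd n then Zneg 1 else Zpos 1.
Definition zbin (n m : nat) : Z := Z.of_nat 'C(n, m).

(** The recursion of [word_mode] with both infinite sums cut off by degree. *)
Fixpoint wop (w : word) (be : L6) (m : Z) (w2 : word) (c : L6) : poly := match w with
  | [::] => gop be m w2 c
  | x :: w' =>
      flatten [seq pscale (qint (zbin (x.2 + j) x.2)) (pcons (x.1, (x.2 + j)%N) (wop w' be (m +z Z.of_nat j) w2 c))
        | j <- iota 0 (hpos (wdeg w' be +z wdeg w2 c -z Zpos 2 -z Zpos 2 *z m))] ++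
      pscale (qint (zsgn x.2)) (flatten [seq pscale (qint (zbin (x.2 + j) x.2))
          (pbind (fun t => wop w' be (m -z Z.of_nat x.2.+1 -z Z.of_nat j) t.1 t.2) (hop x.1 j w2 c))
        | j <- iota 0 (hpos (wdeg w2 c))])
  end.

Definition yop (p : poly) (n : Z) (q : poly) : poly :=
  pbind (fun t => pbind (fun t' => wop t.1 t.2 n t'.1 t'.2) q) p.

Definition lel (x y : letter) : bool := Nat.ltb x.1 y.1 || (eqn x.1 y.1 && Nat.leb x.2 y.2).
Fixpoint wins (x : letter) (w : word) : word := match w with
  | [::] => [:: x] | y :: w' => if lel x y then x :: w else y :: wins x w' end.
Definition nkey (t : key) : key := (foldr wins [::] t.1, L6norm t.2).
Fixpoint weqb (w w' : word) : bool := match w, w' with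
  | [::], [::] => true
  | x :: v, x' :: v' => [&& eqn x.1 x'.1, eqn x.2 x'.2 & weqb v v']
  | _, _ => false end.
Definition keqb (s t : key) : bool := weqb s.1 t.1 && L6eqb s.2 t.2.
Fixpoint pins (t : Q * key) (p : poly) : poly := match p with
  | [::] => [:: t]
  | s :: p' => if keqb s.2 t.2 then (Qred (Qplus s.1 t.1), s.2) :: p' else s :: pins t p'
  end.
Definition pnorm (p : poly) : poly :=
  [seq t <- foldr (fun t => pins (t.1, nkey t.2)) [::] p | ~~ Z.eqb (Qnum t.1) Z0].
Definition peq (p q : poly) : bool :=
  if pnorm (p ++ pscale (qint (Zneg 1)) q) is [::] then true else false.

Lemma weqbP w w' : weqb w w' -> w = w'.
Proof.
elim: w w' => [|[x1 x2] w IH] [|[y1 y2] w'] //= /and3P[/eqnP -> /eqnP ->] /IH ->.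
by [].
Qed.

Lemma keqbP s t : keqb s t -> s = t.
Proof. by case: s t => [w c] [w' c'] /andP[/weqbP /= -> /L6eqbP /= ->]. Qed.

Lemma perm_wins x w : perm_eq (wins x w) (x :: w).
Proof.
elim: w => //= y w IH; case: ifP => // _.
apply: (@perm_trans _ (y :: x :: w)); first by rewrite perm_cons.
by apply/permPl; exact: (perm_catCA [:: y] [:: x] w).
Qed.
Lemma perm_wsort w : perm_eq (foldr wins [::] w) w.
Proof. by elim: w => //= x w IH; rewrite (permPl (perm_wins _ _)) perm_cons. Qed.

Lemma wopS x w be m w2 c : wop (x :: w) be m w2 c =
  flatten [seq pscale (qint (zbin (x.2 + j) x.2)) (pcons (x.1, (x.2 + j)%N) (wop w be (m +z Z.of_nat j) w2 c))
        | j <- iota 0 (hpos (wdeg w be +z wdeg w2 c -z Zpos 2 -z Zpos 2 *z m))] ++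
  pscale (qint (zsgn x.2)) (flatten [seq pscale (qint (zbin (x.2 + j) x.2))
          (pbind (fun t => wop w be (m -z Z.of_nat x.2.+1 -z Z.of_nat j) t.1 t.2) (hop x.1 j w2 c))
        | j <- iota 0 (hpos (wdeg w2 c))]).
Proof. by []. Qed.

Lemma hposP z j : (hpos z <= j)%N -> iz z - 2 * j%:Z < 0.
Proof.
rewrite /hpos; case: Z.ltb_spec => h1; first by lia.
have := Z.div2_odd z; move: (Z.div2 z) => d e.
have d0 : Z.le Z0 d by case: (Z.odd z) e => /=; lia.
have := Z2Nat.id d d0; move: (Z.to_nat d) => n hn hj.
by case: (Z.odd z) e => /= e; lia.
Qed.

Arguments Qred _ : simpl never.
Arguments Qmult _ _ : simpl never.
Arguments Qplus _ _ : simpl never.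

Section Eval.
Context {K : numClosedFieldType} {F : fockData K}.
Implicit Types (u v : F) (p q : poly).

Local Notation h := (@hh K F).
Local Notation G := (@GG K F).
Local Notation E l := (@bb K F (mset0, l)).
Local Notation one := (@bb K F (mset0, 0)).
Local Notation qv := (@qval K).

Definition hL (i : nat) (n : int) : F -> F := h (inord i) n.
Definition wd (w : word) u : F := foldr (fun x u => hL x.1 (Negz x.2) u) u w.
Definition tmd (t : key) : F := wd t.1 (E (L6lat t.2)).
Definition den p : F := \sum_(t <- p) qv t.1 *: tmd t.2.

Lemma den_nil : den [::] = 0. Proof. by rewrite /den big_nil. Qed.
Lemma den_cons t p : den (t :: p) = qv t.1 *: tmd t.2 + den p. Proof. by rewrite /den big_cons. Qed.
Lemma den_cat p q : den (p ++ q) = den p + den q. Proof. by rewrite /den big_cat. Qed.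
Lemma den_scale a p : den (pscale a p) = qv a *: den p.
Proof.
rewrite /den big_map scaler_sumr; apply: eq_bigr => t _ /=.
by rewrite qvM scalerA.
Qed.
Lemma den_pcons x p : den (pcons x p) = hL x.1 (Negz x.2) (den p).
Proof.
rewrite /den big_map /hL (lin_sum (hh_lin _ _)); apply: eq_bigr => t _ /=.
by rewrite (linZ (hh_lin _ _)).
Qed.
Lemma den_flatten (ps : seq poly) : den (flatten ps) = \sum_(p <- ps) den p.
Proof. by elim: ps => [|p ps IH] /=; rewrite ?big_nil ?den_nil// big_cons den_cat IH. Qed.
Lemma den_bind f (g : F -> F) p : islin g -> (forall t, den (f t) = g (tmd t)) -> den (pbind f p) = g (den p).
Proof.
move=> lg fg; rewrite /pbind den_flatten big_map {2}/den (lin_sum lg); apply: eq_bigr => t _.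
by rewrite den_scale fg (linZ lg).
Qed.
Lemma qvi (n : Z) u : qv (qint n) *: u = u *~ iz n.
Proof. by rewrite qv_int scaler_int. Qed.

Lemma qvN1 u : qv (qint (Zneg 1)) *: u = - u.
Proof. by rewrite qvi -[iz _]/(-1 : int) mulrNz mulr1z. Qed.

Lemma n5E i : val (inord i : 'I_5) = n5 i.
Proof.
rewrite /inord val_insubd /=; case: (ltnP i 5) => i5; first by case: i i5 => [|[|[|[|[|//]]]]].
by case: i i5 => [|[|[|[|[|i]]]]].
Qed.

Lemma den_hop i k w c : den (hop i k w c) = hL i k%:Z (tmd (w, c)).
Proof.
elim: w => [|x w IH] /=.
  case: k => [|k]; last by rewrite den_nil /hL hhE.
  by rewrite den_cons den_nil addr0 qvi /tmd /= /hL hh0E L6alE.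
rewrite den_cat den_pcons IH /tmd /= -/(tmd (w, c)) /hL.
have := hh_comm (inord i) k%:Z (inord x.1) (Negz x.2) (tmd (w, c)) => /eqP.
rewrite subr_eq addrC => /eqP ->; congr (_ + _).
rewrite /hcoef -(inj_eq val_inj) !n5E eq_sym !eqnE.
have -> : (k%:Z + Negz x.2 == 0) = (x.2.+1 == k) by rewrite NegzE; apply/eqP/eqP; lia.
case: (_ && _); rewrite ?den_cons ?den_nil ?addr0 ?qvi ?mulr0z//.
by congr (_ *~ _); lia.
Qed.

(** The coefficient p steps below the leading one when e^be acts on e^l. *)
Definition W be l (p : nat) : F := G be (-1 - dotZ be l - p%:Z) (E l).

Lemma W_top be l (p : nat) l' : (0 < p)%N -> cf (W be l p) (mset0, l') = 0.
Proof.
move=> p0; rewrite /W GG_topZ (_ : (_ == _) = false) ?mulr0//; apply/eqP; lia.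
Qed.

Lemma W_h be l (p : nat) i (q : nat) : h i (Posz q.+1) (W be l p) =
  if (q < p)%N then W be l (p - q.+1) *~ dotZ (alphaL i.+1) be else 0.
Proof.
rewrite /W GG_hh hhE (lin0 (GG_lin _ _)) add0r; case: ifP => qp.
  by congr (G be _ _ *~ _); lia.
by rewrite GE_gt ?mul0rz//; lia.
Qed.

Lemma W_rec be l n : (2 * n.+1)%:R *: W be l n.+1 =
  \sum_(k < n.+1) \sum_(i < 5) (h i (Negz k) (W be l (n - k)) *~ dotZ (alphaL i.+1) be) :> F.
Proof.
elim/ltn_ind: n => n IH; apply/eqP; rewrite -subr_eq0; apply/eqP; apply: fker => [i q|l']; last first.
  rewrite cfB cfZ W_top// mulr0 sub0r cf_sum big1 ?oppr0// => k _.
  by rewrite cf_sum big1// => i _; rewrite cfMz hN_top mul0rz.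
rewrite (linB (hh_lin _ _)) (linZ (hh_lin _ _)) W_h (lin_sum (hh_lin _ _)).
set c := dotZ _ be.
have E1 (k : 'I_n.+1) : h i (Posz q.+1) (\sum_(j < 5) (h j (Negz k) (W be l (n - k)) *~ dotZ (alphaL j.+1) be))
  = (if (q < n - k)%N then \sum_(j < 5) h j (Negz k) (W be l (n - k - q.+1)) *~ dotZ (alphaL j.+1) be *~ c else 0)
    + (if k == q :> nat then W be l (n - q) *~ (2 * q.+1%:Z * c) else 0).
  rewrite (lin_sum (hh_lin _ _)).
  transitivity (\sum_(j < 5) ((if (q < n - k)%N then h j (Negz k) (W be l (n - k - q.+1)) *~ dotZ (alphaL j.+1) be *~ c else 0)
      + (if (j == i) && (k == q :> nat) then W be l (n - q) *~ (2 * q.+1%:Z * c) else 0))).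
    apply: eq_bigr => j _; rewrite (linMz (hh_lin _ _)).
    have := hh_comm i q.+1 j (Negz k) (W be l (n - k)) => /eqP.
    rewrite subr_eq addrC => /eqP ->; rewrite W_h mulrzDl; congr (_ + _).
      case: ifP => _; rewrite ?(lin0 (hh_lin _ _)) ?mul0rz// (linMz (hh_lin _ _)).
      by rewrite -!mulrzA mulrC.
    rewrite /hcoef eq_sym; have -> : (q.+1%:Z + Negz k == 0) = (k == q :> nat) by rewrite NegzE; apply/eqP/eqP; lia.
    case: eqP => [->|_] /=; last by rewrite mulr0z mul0rz.
    by case: eqP => [->|_]; rewrite ?mulr0z ?mul0rz// -mulrzA.
  rewrite big_split /=; congr (_ + _); first by case: ifP => // _; rewrite big1.
  rewrite (bigD1 i)//= eqxx /= big1 ?addr0// => j /negPf ->//.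
rewrite (eq_bigr _ (fun k _ => E1 k)) big_split /=.
have [qn|qn] := ltnP q n.+1; last first.
  rewrite scaler0 sub0r !big1 ?addr0 ?oppr0// => k _; rewrite ifF//; apply/negP; have := ltn_ord k; lia.
have -> : \sum_(k < n.+1) (if k == q :> nat then W be l (n - q) *~ (2 * q.+1%:Z * c) else 0) =
   W be l (n - q) *~ (2 * q.+1%:Z * c).
  rewrite (bigD1 (Ordinal qn))//= eqxx big1 ?addr0// => k kq; rewrite ifF//.
  by apply: contraNF kq => /eqP e; apply/eqP/val_inj.
rewrite subSS; pose X k := \sum_(j < 5) h j (Negz k) (W be l (n - k - q.+1)) *~ dotZ (alphaL j.+1) be *~ c.
have -> : \sum_(k < n.+1) (if (q < n - k)%N then X k else 0) = (2 * (n - q))%:R *: W be l (n - q) *~ c.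
  have -> : \sum_(k < n.+1) (if (q < n - k)%N then X k else 0) = \sum_(k < n - q) X k.
    rewrite -(big_mkord xpredT (fun k => if (q < n - k)%N then X k else 0)) -(big_mkord xpredT X).
    rewrite (@big_cat_nat _ _ _ (n - q)%N) //=; last lia.
    rewrite [X in _ + X]big_nat [X in _ + X]big1 ?addr0 => [|k hk]; last by rewrite ifF//; apply/negP; lia.
    by apply: eq_big_nat => k hk; rewrite ifT//; lia.
  have [e|nq] := posnP (n - q)%N; first by rewrite e big_ord0 muln0 scale0r mul0rz.
  have [m hm] : exists m, (n - q = m.+1)%N by exists (n - q).-1; rewrite prednK.
  rewrite hm IH; last lia.
  rewrite mulrz_suml; apply: eq_bigr => k _; rewrite /X mulrz_suml; apply: eq_bigr => j _.
  have -> : (n - k - q.+1 = m - k)%N by lia.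
  by [].
rewrite !scaler_nat !pmulrn -!mulrzA -mulrzDr -mulrzBr -[RHS](mulr0z (W be l (n - q))); congr (_ *~ _).
by rewrite !PoszM; have -> : (n - q)%N%:Z = n%:Z - q%:Z; lia.
Qed.

Definition sden (S : seq (Q * word)) u : F := \sum_(t <- S) qv t.1 *: wd t.2 u.

Lemma schurl_nth be n k : (k <= n)%N -> nth [::] (schurl be n) k = head [::] (schurl be (n - k)).
Proof.
elim: n k => [|n IH] [|k] //= kn; first by rewrite subSS -IH.
Qed.

Lemma schurE be c n : sden (head [::] (schurl be n)) (E (L6lat be + L6lat c)) *~ iz (L6sgn be c) =
  W (L6lat be) (L6lat c) n.
Proof.
set u := E _; set eps := iz _.
elim/ltn_ind: n => -[_|n IH].
  by rewrite /= /sden big_seq1 qvi mulr1z /W subr0 GE_eq L6sgnE.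
apply: (@scalerI _ _ (2 * n.+1)%:R); first by rewrite pnatr_eq0.
rewrite W_rec /= /sden /sstep.
rewrite big_flatten big_map -[iota 0 n.+1]/(index_iota 0 n.+1) big_mkord.
rewrite mulrz_suml scaler_sumr; apply: eq_bigr => k _.
rewrite big_flatten big_map mulrz_suml scaler_sumr.
rewrite -val_enum_ord big_map big_enum /=; apply: eq_bigr => i _.
have kn : (k <= n)%N by rewrite -ltnS.
rewrite big_map schurl_nth// -IH ?ltnS ?leq_subr// (linMz (hh_lin _ _)) /sden (lin_sum (hh_lin _ _)).
rewrite !mulrz_suml scaler_sumr; apply: eq_bigr => t _ /=.
rewrite qvM (linZ (hh_lin _ _)) /hL inord_val -!scaler_int !scalerA; congr (_ *: _).
have -> : (dotZ (alphaL i.+1) (L6lat be))%:~R = (iz (L6al i be))%:~R :> K.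
  by rewrite -L6alE inord_val.
rewrite [qv (Qmake _ _)]/qval /= /zv.
have -> : int_of_Z (Z.pos (Pos.succ (Pos.of_succ_nat n.*2))) = (2 * n.+1)%N%:Z by lia.
rewrite -pmulrn; have : (2 * n.+1)%:R != 0 :> K by rewrite pnatr_eq0.
by move: (_%:R) (iz (L6al i be))%:~R (qval K t.1) eps%:~R => x y z w x0; field.
Qed.

Lemma den_gop be m w c : den (gop be m w c) = G (L6lat be) (iz m) (tmd (w, c)).
Proof.
elim: w m => [|x w IH] m /=; last first.
  rewrite den_cat den_pcons IH.
  rewrite (_ : den (if _ then _ else _) = - G (L6lat be) (iz m + Negz x.2) (tmd (w, c)) *~ iz (L6al x.1 be)); last first.
    case: Z.eqb_spec => [->|_]; first by rewrite den_nil mulr0z.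
    rewrite den_scale IH qvi izN mulrNz mulNrz; congr (- (G _ _ _ *~ _)).
    by rewrite izB NegzE; lia.
  by rewrite /tmd /= /hL -/(tmd (w, c)) GG_hh L6alE mulNrz addrK.
rewrite /gbase /tmd /=.
case: Z.ltb_spec => hp; first by rewrite den_nil GE_gt// L6dotE; lia.
set n := Z.to_nat _; rewrite den_scale qvi /den big_map /=.
have -> : iz m = -1 - dotZ (L6lat be) (L6lat c) - n%:Z by rewrite L6dotE /n; lia.
rewrite -/(W (L6lat be) (L6lat c) n) -schurE; congr (_ *~ _); apply: eq_bigr => t _.
by rewrite /tmd /= L6addE.
Qed.

Lemma tmd_hmg w c : hmg (iz (wdeg w c)) (tmd (w, c)).
Proof.
elim: w => [|x w IH]; first by rewrite /wdeg /= -L6dotE; exact: hmgE.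
apply: (hmg_eq (hh_hmg (inord x.1) (Negz x.2) IH)).
by rewrite -[wdeg (x :: w) c]/(Z.of_nat (2 * x.2.+1) +z wdeg w c) izD izn NegzE; lia.
Qed.

Arguments tmd_hmg : clear implicits.

Lemma big_iota (V : zmodType) n (X : nat -> V) : \sum_(i <- iota 0 n) X i = \sum_(i < n) X i.
Proof. by rewrite -(big_mkord xpredT) /index_iota subn0. Qed.

Lemma den_wop w be m w2 c : den (wop w be m w2 c) = Y (tmd (w, be)) (iz m) (tmd (w2, c)).
Proof.
elim: w m w2 c => [|x w IH] m w2 c; first by rewrite /= den_gop /tmd /= Y_E.
rewrite wopS -[tmd (x :: w, be)]/(hL x.1 (Negz x.2) (tmd (w, be))) Y_hNeg.
set a := tmd (w, be); set b := tmd (w2, c).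
set B1 := hpos (_ -z _); set B2 := hpos _.
have b1 j : (B1 <= j)%N -> Y a (iz m + j%:Z) b = 0.
  move=> /hposP hj; apply: (@hmg_lt0 K F _ _ (@Y_hmg K F _ _ _ _ (iz m + j%:Z) (tmd_hmg w be) (tmd_hmg w2 c))).
  by move: hj; lia.
have b2 j : (B2 <= j)%N -> hL x.1 j b = 0.
  by move=> /hposP hj; apply: (@hmg_lt0 K F _ _ (hh_hmg (inord x.1) j (tmd_hmg w2 c))).
rewrite /Dm (@nsumE _ B1) => [|j /b1 ->]; last by rewrite (lin0 (hh_lin _ _)) mul0rz.
rewrite (@nsumE _ B2) => [|j /b2 e]; last by rewrite add0r -/(hL _ _ _) e (lin0 (Y_lin _ _)) mul0rz.
rewrite den_cat den_scale !den_flatten !big_map qvi !big_iota -mulrNz.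
have -> : iz (zsgn x.2) = - sgz1 (Negz x.2).
  rewrite /sgz1 /= [in RHS]exprS mulN1r opprK -signr_odd /zsgn.
  by case: (odd x.2).
have zb n k : iz (zbin n k) = 'C(n, k) by rewrite /zbin; lia.
congr (_ + _ *~ _); apply: eq_bigr => j _; rewrite den_scale qvi zb.
  rewrite den_pcons IH !add0r /cz /hL /=.
  have -> : iz (m +z Z.of_nat j) = iz m + j%:Z by lia.
  by congr (h _ _ _ *~ _); rewrite !NegzE; lia.
rewrite (@den_bind _ (Y a (iz m + Negz x.2 - j%:Z))); [|exact: Y_lin|].
  by rewrite den_hop -/b /cz !add0r.
by case=> w' c'; rewrite IH; congr (Y _ _ _); rewrite NegzE; lia.
Qed.

Lemma den_yop p n q : den (yop p n q) = Y (den p) (iz n) (den q).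
Proof.
apply: (den_bind (g := fun u => Y u (iz n) (den q))); first exact: Y_linl.
move=> [w be]; apply: (den_bind (g := Y (tmd (w, be)) (iz n))); first exact: Y_lin.
by case=> w2 c; exact: den_wop.
Qed.

Lemma wdE w l : wd w (E l) = bb F (seq_mset [seq (inord x.1 : 'I_5, x.2) | x <- w], l).
Proof.
elim: w => [|x w IH] /=.
  by congr (bb F (_, l)); apply/msetP => x; rewrite mset_seqE mset0E.
rewrite IH /hL -bbS; congr (bb F (_, l)); apply/msetP => y.
by rewrite mset1DE !mset_seqE /= eq_sym.
Qed.

Lemma tmd_nkey t : tmd (nkey t) = tmd t.
Proof.
case: t => w c; rewrite /tmd /nkey /= L6normE !wdE; congr (bb F (_, _)).
by apply/eq_seq_msetP; apply: perm_map; exact: perm_wsort.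
Qed.

Lemma den_pins t p : den (pins t p) = qv t.1 *: tmd t.2 + den p.
Proof.
elim: p => [|s p IH] /=; first by rewrite den_cons.
case: ifP => [/keqbP e|_]; rewrite !den_cons ?IH /=; last by rewrite addrCA.
by rewrite qvD' scalerDl e addrA [X in X + _]addrC.
Qed.

Lemma den_pnorm p : den (pnorm p) = den p.
Proof.
rewrite /pnorm {1}/den big_filter big_mkcond /=.
transitivity (den (foldr (fun t => pins (t.1, nkey t.2)) [::] p)).
  apply: eq_bigr => t _; case: ifP => // /negbFE /qv_0 ->; by rewrite scale0r.
elim: p => [|t p IH] /=; first by [].
by rewrite den_pins IH tmd_nkey den_cons.
Qed.

Lemma den_eq p q : peq p q -> den p = den q.
Proof.
rewrite /peq; case e: (pnorm _) => // _; have := den_pnorm (p ++ pscale (qint (Zneg 1)) q).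
rewrite e den_nil den_cat den_scale qvN1 => /esym/eqP.
by rewrite subr_eq0 => /eqP.
Qed.

End Eval.

(** * Structure constants *)

Definition qf (n : Z) (d : nat) : Q := Qmake n (Pos.of_succ_nat d.-1).

Definition L6c (i : nat) (z : Z) : L6 := match i with
  | 0%N => (z, Z0, Z0, Z0, Z0, Z0) | 1%N => (Z0, z, Z0, Z0, Z0, Z0) | 2%N => (Z0, Z0, z, Z0, Z0, Z0)
  | 3%N => (Z0, Z0, Z0, z, Z0, Z0) | 4%N => (Z0, Z0, Z0, Z0, z, Z0) | _ => (Z0, Z0, Z0, Z0, Z0, z) end.
Definition L60 : L6 := (Z0, Z0, Z0, Z0, Z0, Z0).
Notation z1 := (Zpos 1).
Notation zm1 := (Zneg 1).

Definition PH (j : nat) : poly := [seq (qint z1, ([:: (i, 0%N)], L60)) | i <- iota 0 j].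
Definition PE (j : nat) : poly := [seq (qint z1, ([::], L6c i z1)) | i <- iota 0 j].
Definition PF (j : nat) : poly := [seq (qint z1, ([::], L6c i zm1)) | i <- iota 0 j].
Definition POm (j : nat) : poly := pnorm (pscale (qf z1 (2 * (j + 2)))
  (pscale (qf z1 2) (yop (PH j) zm1 (PH j)) ++ yop (PE j) zm1 (PF j) ++ yop (PF j) zm1 (PE j))).
Definition Pom (i : nat) : poly := pnorm (POm i ++ pscale (qf z1 4) [:: (qint z1, ([:: (i, 0%N); (i, 0%N)], L60))]
  ++ pscale (qint zm1) (POm i.+1)).
Definition Pe : poly := pscale (qf z1 16) [:: (qint z1, ([:: (3, 0); (3, 0)]%N, L60)); (qint (Zneg 2), ([:: (3, 0); (4, 0)]%N, L60));
    (qint z1, ([:: (4, 0); (4, 0)]%N, L60))] ++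
  pscale (qf zm1 4) [:: (qint z1, ([::], (Z0, Z0, Z0, z1, zm1, Z0))); (qint z1, ([::], (Z0, Z0, Z0, zm1, z1, Z0)))].
Definition Pw : poly :=
  pnorm (yop (pscale (qint (Zpos 4)) (PF 3) ++ pscale (qint (Zneg 3)) (PF 4)) Z0 [:: (qint z1, ([::], L6c 5 z1))]).
Definition Pw1 : poly := pnorm (yop (PF 4) Z0 Pw).
Definition Pw2 : poly := pnorm (yop (PF 4) Z0 Pw1).
Definition Pv1 : poly :=
  pnorm (yop (pscale (qint (Zpos 9)) (PF 4) ++ pscale (qint (Zneg 8)) (PF 5)) zm1 Pw ++
   pscale (qf zm1 2) (yop (pscale (qint (Zpos 9)) (PH 4) ++ pscale (qint (Zneg 8)) (PH 5)) zm1 Pw1) ++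
   pscale (qf zm1 2) (yop (pscale (qint (Zpos 9)) (PE 4) ++ pscale (qint (Zneg 8)) (PE 5)) zm1 Pw2)).
Definition PW1 := Eval vm_compute in Pom 1.
Definition PW2 := Eval vm_compute in Pom 2.
Definition PW3 := Eval vm_compute in Pom 3.
Definition PW4 := Eval vm_compute in Pom 4.
Definition PO5 := Eval vm_compute in POm 5.
(** With the scale 1/64 the vector c is [kap] times this one with kap = 64 k and kap^2 = -3/16. *)
Definition PV := Eval vm_compute in pscale (qf 1 64) Pv1.

Lemma PW1E : PW1 = Pom 1. Proof. by vm_compute. Qed.
Lemma PW2E : PW2 = Pom 2. Proof. by vm_compute. Qed.
Lemma PW3E : PW3 = Pom 3. Proof. by vm_compute. Qed.
Lemma PW4E : PW4 = Pom 4. Proof. by vm_compute. Qed.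
Lemma PO5E : PO5 = POm 5. Proof. by vm_compute. Qed.
Lemma PVE : PV = pscale (qf 1 64) Pv1. Proof. by vm_compute. Qed.

Definition L6opp (c : L6) : L6 := let: (a0, a1, a2, a3, a4, t) := c in
  (Z.opp a0, Z.opp a1, Z.opp a2, Z.opp a3, Z.opp a4, Z.opp t).

(* Adjoints of the terms of weight 2: the state s and the correction r of [adj2]. *)
Definition tstar (t : Q * key) : option (poly * poly) :=
  let: (q, (w, c)) := t in let e := qint (L6sgn c c) in
  match w with
  | [:: (i, 0%N); (j, 0%N)] => if L6eqb (L6norm c) L60 then Some ([:: t], [::]) else None
  | [:: (i, 0%N)] => if Z.eqb (L6dot c c) (Zpos 2) then
      Some (pscale q (pscale e [:: (qint z1, (w, L6opp c))]),
            pscale q (pscale (qint (Z.opp (L6al i c))) (pscale e [:: (qint z1, ([::], L6opp c))]))) else None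
  | [::] => if Z.eqb (L6dot c c) (Zpos 4) then Some (pscale q (pscale e [:: (qint z1, ([::], L6opp c))]), [::]) else None
  | _ => None
  end.
Fixpoint pstar (p : poly) : option (poly * poly) := match p with
  | [::] => Some ([::], [::])
  | t :: p' => if tstar t is Some (a, b) then if pstar p' is Some (a', b') then Some (a ++ a', b ++ b') else None else None
  end.
Definition adjq (p q : poly) : bool := if pstar p is Some (a, b) then peq a q && peq b [::] else false.

(** The sum of the three operators whose common kernel is U. Being self-adjoint, it has image
    orthogonal to U. *)
Definition PK (p : poly) := pnorm (yop PW1 z1 p ++ yop PW2 z1 p ++ yop PO5 z1 p).
(* An inverse of PK in weight one, from its characteristic polynomial. *)
Definition PKinv (p : poly) :=
  let p1 := PK p in let p2 := PK p1 in let p3 := PK p2 in let p4 := PK p3 in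
  pnorm (pscale (Qmake (Zpos 787) 93) p ++ pscale (Qmake (Zneg 29545) 1116) p1 ++ pscale (Qmake (Zpos 43757) 1116) p2
    ++ pscale (Qmake (Zneg 31115) 1116) p3 ++ pscale (Qmake (Zpos 8575) 1116) p4).
Arguments pscale : simpl never.
Arguments L6lat _ : simpl never.
Arguments L60 : simpl never.
Arguments L6c _ _ : simpl never.

(** * The vectors of the statement as computable combinations *)

Section Facts.
Context {K : numClosedFieldType} {F : fockData K}.
Implicit Types (u v : F).

Local Notation h := (@hh K F).
Local Notation E l := (@bb K F (mset0, l)).
Local Notation one := (@bb K F (mset0, 0)).
Local Notation den := (@den K F).

(** This and the following definitions copy those of the statement over an arbitrary [fockData]; on
    V_L the copies are convertible to the originals once products are rewritten by [Y]. *)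
Definition hm (be : lat) (n : int) u : F := \sum_(i < 5) ratr (lat_row be 0 i) *: h i n u.
Definition avf (i : nat) : F := hm (alphaL i) (-1) one.
Definition Hf (j : nat) : F := \sum_(1 <= i < j.+1) avf i.
Definition Ef (j : nat) : F := \sum_(1 <= i < j.+1) E (alphaL i).
Definition Ff (j : nat) : F := \sum_(1 <= i < j.+1) E (- alphaL i).
Definition Omf (j : nat) : F :=
  (1 / (2 * (j%:R + 2))) *:
    ((1 / 2) *: Y (Hf j) (-1) (Hf j) + Y (Ef j) (-1) (Ff j) + Y (Ff j) (-1) (Ef j)).
Definition omf (i : nat) : F :=
  Omf i + (1 / 4) *: hm (alphaL i.+1) (-1) (hm (alphaL i.+1) (-1) one) - Omf i.+1.
Definition ef : F :=
  (1 / 16) *: hm (alphaL 4 - alphaL 5) (-1) (hm (alphaL 4 - alphaL 5) (-1) one)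
  - (1 / 4) *: (E (alphaL 4 - alphaL 5) + E (- alphaL 4 + alphaL 5)).
Definition v1f : F :=
  let w := Y (4 *: Ff 3 - 3 *: Ff 4) 0 (E gammaL) in
  Y (9 *: Ff 4 - 8 *: Ff 5) (-1) w
  - (1 / 2) *: Y (9 *: Hf 4 - 8 *: Hf 5) (-1) (Y (Ff 4) 0 w)
  - (1 / 2) *: Y (9 *: Ef 4 - 8 *: Ef 5) (-1) (Y (Ff 4) 0 (Y (Ff 4) 0 w)).

Lemma qval_f n d : (0 < d)%N -> qval K (qf n d) = (iz n)%:~R / d%:R.
Proof.
case: d => // d _; rewrite /qval /qf /= /zv.
by have -> : int_of_Z (Z.pos (Pos.of_succ_nat d)) = d.+1 by lia.
Qed.

Lemma den1 k : den [:: (qint z1, k)] = tmd k.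
Proof. by rewrite den_cons den_nil addr0 qvi. Qed.

Lemma L6lat0 : L6lat L60 = 0.
Proof. by rewrite /L6lat /L60 -[iz Z0]/(0 : int) !mulr0z !addr0. Qed.

Lemma hm_alpha i n u : hm (alphaL i.+1) n u = hL i n u.
Proof.
rewrite /hm /hL (bigD1 (inord i))//= mxE !eqxx rmorph1 scale1r big1 ?addr0// => j ji.
by rewrite mxE (negPf ji) andbF rmorph0 scale0r.
Qed.

Lemma L6c_al i : (i < 5)%N -> L6lat (L6c i z1) = alphaL i.+1 /\ L6lat (L6c i zm1) = - alphaL i.+1.
Proof.
have m1 : iz zm1 = -1 by [].
have p1 : iz z1 = 1 by [].
have e0 : iz Z0 = 0 by [].
by case: i => [|[|[|[|[|//]]]]] _; rewrite /L6lat /L6c ?m1 ?p1 !e0 !mulr0z ?mulrNz !mulr1z ?addr0 ?add0r.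
Qed.

Lemma sum_iota (V : zmodType) j (X : nat -> V) :
  \sum_(1 <= i < j.+1) X i = \sum_(i <- iota 0 j) X i.+1.
Proof. by rewrite big_add1 /= /index_iota subn0. Qed.

Lemma den_PH j : den (PH j) = Hf j.
Proof.
rewrite /Hf sum_iota /den /PH big_map.
apply: eq_bigr => i _.
by rewrite qvi mulr1z /tmd /= L6lat0 /avf hm_alpha.
Qed.
Lemma den_PE j : (j <= 5)%N -> den (PE j) = Ef j.
Proof.
move=> j5; rewrite /Ef sum_iota /den /PE big_map.
apply: eq_big_seq => i; rewrite mem_iota => hi.
by rewrite qvi mulr1z /tmd /= (L6c_al _).1//; lia.
Qed.
Lemma den_PF j : (j <= 5)%N -> den (PF j) = Ff j.
Proof.
move=> j5; rewrite /Ff sum_iota /den /PF big_map.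
apply: eq_big_seq => i; rewrite mem_iota => hi.
by rewrite qvi mulr1z /tmd /= (L6c_al _).2//; lia.
Qed.

Lemma den_POm j : (j <= 5)%N -> den (POm j) = Omf j.
Proof.
move=> j5; rewrite /POm den_pnorm den_scale !den_cat den_scale !den_yop den_PH den_PE// den_PF//.
rewrite !qval_f ?muln_gt0 ?addn_gt0 ?orbT// natrM natrD mulr1z.
by rewrite /Omf -[in RHS]addrA.
Qed.

Lemma den_Pom i : (i < 5)%N -> den (Pom i) = omf i.
Proof.
move=> i5; rewrite /Pom den_pnorm !den_cat !den_scale den1 !den_POm ?(ltnW i5)//.
rewrite /omf !hm_alpha qval_f// qvN1 addrA /tmd /= L6lat0.
by [].
Qed.

Lemma hm_lin be n : islin (hm be n).
Proof. by apply: islin_sum => i _; apply: islin_scale; exact: hh_lin. Qed.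

Lemma hmB be be' n u : hm (be - be') n u = hm be n u - hm be' n u.
Proof.
rewrite /hm -sumrB; apply: eq_bigr => i _.
by rewrite [lat_row _]/= mxE [_ 0 i in X in ratr (_ + X)]mxE rmorphB scalerBl.
Qed.

Lemma den_Pe : den Pe = ef.
Proof.
rewrite /Pe den_cat !den_scale !den_cons !den_nil !addr0 !qvi !qval_f// /tmd /= !L6lat0.
rewrite /ef !hmB !(linB (hm_lin _ _)) !hm_alpha.
have -> : L6lat (Z0, Z0, Z0, z1, zm1, Z0) = alphaL 4 - alphaL 5.
  by rewrite /L6lat -[iz zm1]/(-1 : int) -[iz z1]/(1 : int) -[iz Z0]/(0 : int) !mulr0z ?mulrNz !mulr1z ?addr0 ?add0r.
have -> : L6lat (Z0, Z0, Z0, zm1, z1, Z0) = - alphaL 4 + alphaL 5.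
  by rewrite /L6lat -[iz zm1]/(-1 : int) -[iz z1]/(1 : int) -[iz Z0]/(0 : int) !mulr0z ?mulrNz !mulr1z ?addr0 ?add0r.
have -> : hL 4 (-1) (hL 3 (-1) one) = hL 3 (-1) (hL 4 (-1) one).
  apply/eqP; rewrite -subr_eq0; apply/eqP; rewrite (hh_comm _ _ _ _ one) hcoef_eq0 ?mulr0z//.
rewrite -[Negz 0]/(-1 : int) !mulr1z; congr (_ *: _ + _); first by zmod.
by rewrite mulNr scaleNr.
Qed.

Lemma den_lcF (a b : Z) i j : (i <= 5)%N -> (j <= 5)%N ->
  den (pscale (qint a) (PF i) ++ pscale (qint b) (PF j)) = Ff i *~ iz a + Ff j *~ iz b.
Proof. by move=> i5 j5; rewrite den_cat !den_scale !den_PF// !qvi. Qed.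
Lemma den_lcE (a b : Z) i j : (i <= 5)%N -> (j <= 5)%N ->
  den (pscale (qint a) (PE i) ++ pscale (qint b) (PE j)) = Ef i *~ iz a + Ef j *~ iz b.
Proof. by move=> i5 j5; rewrite den_cat !den_scale !den_PE// !qvi. Qed.
Lemma den_lcH (a b : Z) i j :
  den (pscale (qint a) (PH i) ++ pscale (qint b) (PH j)) = Hf i *~ iz a + Hf j *~ iz b.
Proof. by rewrite den_cat !den_scale !den_PH !qvi. Qed.
Lemma lc_scale (x y : F) (m n : nat) : x *~ m + y *~ (- n%:Z) = m%:R *: x - n%:R *: y.
Proof. by rewrite mulrNz -!pmulrn !scaler_nat. Qed.

Definition wf : F := Y (4 *: Ff 3 - 3 *: Ff 4) 0 (E gammaL).

Lemma den_Pw : den Pw = wf.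
Proof.
rewrite /Pw den_pnorm den_yop den_lcF// den1 /tmd /=.
have -> : L6lat (L6c 5 z1) = gammaL.
  by rewrite /L6lat /L6c -[iz z1]/(1 : int) -[iz Z0]/(0 : int) !mulr0z !mulr1z !add0r.
by rewrite /wf (lc_scale _ _ 4 3).
Qed.
Lemma den_Pw1 : den Pw1 = Y (Ff 4) 0 wf.
Proof. by rewrite /Pw1 den_pnorm den_yop den_PF// den_Pw. Qed.
Lemma den_Pw2 : den Pw2 = Y (Ff 4) 0 (Y (Ff 4) 0 wf).
Proof. by rewrite /Pw2 den_pnorm den_yop den_PF// den_Pw1. Qed.

Lemma den3 p1 p2 p3 n q2 q3 r1 r2 r3 : den (pnorm (yop p1 n r1 ++ pscale q2 (yop p2 n r2) ++ pscale q3 (yop p3 n r3))) =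
  Y (den p1) (iz n) (den r1) + (qval K q2 *: Y (den p2) (iz n) (den r2) + qval K q3 *: Y (den p3) (iz n) (den r3)).
Proof.
rewrite den_pnorm -!den_yop; move: (yop p1 n r1) (yop p2 n r2) (yop p3 n r3) => x y z.
by rewrite !den_cat !den_scale.
Qed.

Lemma den_Pv1 : den Pv1 = v1f.
Proof.
apply: etrans (den3 _ _ _ _ _ _ _ _ _) _.
rewrite den_Pw den_Pw1 den_Pw2 den_lcF// den_lcE// den_lcH !qval_f//.
rewrite (lc_scale (Ff 4) _ 9 8) (lc_scale (Hf 4) _ 9 8) (lc_scale (Ef 4) _ 9 8).
have -> : (iz zm1)%:~R / 2%:R = - (1 / 2) :> K by rewrite -[iz zm1]/(-1 : int) mulrNz mulr1z mulNr.
by rewrite !scaleNr addrA.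
Qed.

Lemma adj2_den p a b : pstar p = Some (a, b) -> adj2 (den p) (den a) (den b).
Proof.
have negl c : L6lat (L6opp c) = - L6lat c.
  by case: c => [[[[[a0 a1] a2] a3] a4] t]; rewrite /L6lat /L6opp !izN !mulrNz; zmod.
have qc q : (qval K q)^* = qval K q by rewrite /qval /zv rmorphM fmorphV !rmorph_int.
have dN : den [::] = 0 by exact: den_nil.
elim: p a b => [|[q [w c]] p IH] a b /=; first by case=> <- <-; rewrite dN; exact: adj2_0.
have step s r a' b' : adj2 (tmd (w, c)) s r -> adj2 (den p) (den a') (den b') -> forall A B,
    den A = qval K q *: s -> den B = qval K q *: r ->
    adj2 (den ((q, (w, c)) :: p)) (den (A ++ a')) (den (B ++ b')).
  move=> h1 h2 A B hA hB; rewrite den_cons !den_cat hA hB -(qc q).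
  by have := adj2_lin (qval K q) h1 h2; rewrite qc.
case: w step => [|[i [|?]] [|[j [|?]] [|? ?]]] step //=.
- case: Z.eqb_spec => // h4; case e: (pstar p) => [[a' b']|//] [<- <-].
  have l4 : dotZ (L6lat c) (L6lat c) = 4 by rewrite L6dotE ?h4 ?h2.
  have := step _ _ _ _ (adj2_E l4) (IH _ _ e) (pscale q (pscale (qint (L6sgn c c)) [:: (qint z1, ([::], L6opp c))])) [::].
  apply; last by rewrite dN scaler0.
  by rewrite !den_scale den1 qvi /tmd /= negl L6sgnE.
- case: Z.eqb_spec => // h2; case e: (pstar p) => [[a' b']|//] [<- <-].
  have l2 : dotZ (L6lat c) (L6lat c) = 2 by rewrite L6dotE ?h4 ?h2.
  have := step _ _ _ _ (adj2_hE (inord i) l2) (IH _ _ e); rewrite L6sgnE.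
  move=> /(_ (pscale q (pscale (qint (L6sgn c c)) [:: (qint z1, ([:: (i, 0%N)], L6opp c))]))
    (pscale q (pscale (qint (Z.opp (L6al i c))) (pscale (qint (L6sgn c c)) [:: (qint z1, ([::], L6opp c))])))); apply.
    by rewrite !den_scale den1 qvi /tmd /= negl.
  rewrite !den_scale den1 !qvi /tmd /= negl L6alE izN mulrNz mulNrz -!mulrzA.
  by rewrite [iz (L6al i c) * _]mulrC.
- case h0: (L6eqb _ _) => //; move/L6eqbP: h0 => h0; case e: (pstar p) => [[a' b']|//] [<- <-].
  have c0 : L6lat c = 0 by rewrite -L6normE h0 L6lat0.
  have et : tmd ([:: (i, 0%N); (j, 0%N)], c) = h (inord i) (-1) (h (inord j) (-1) one).
    by rewrite /tmd /= c0.
  have := step (h (inord i) (-1) (h (inord j) (-1) one)) 0 a' b'; rewrite et => step'.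
  have := step' (adj2_hh _ _) (IH _ _ e) [:: (q, ([:: (i, 0%N); (j, 0%N)], c))] [::]; apply.
    by rewrite den_cons dN addr0 et.
  by rewrite dN scaler0.
Qed.

Lemma adjqP p q : adjq p q -> adj2 (den p) (den q) 0.
Proof.
rewrite /adjq; case e: (pstar p) => [[a b]|//] /andP[/(@den_eq K F) h1 /(@den_eq K F) h2].
by rewrite -h1 -(den_nil (F := F)) -h2; exact: adj2_den.
Qed.

Definition w1 : F := den PW1.
Definition w2 : F := den PW2.
Definition w3 : F := den PW3.
Definition w4 : F := den PW4.
Definition o5 : F := den PO5.
Definition ee : F := den Pe.
Definition vv : F := den PV.

Lemma w1E : w1 = omf 1. Proof. by rewrite /w1 PW1E den_Pom. Qed.
Lemma w2E : w2 = omf 2. Proof. by rewrite /w2 PW2E den_Pom. Qed.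
Lemma w3E : w3 = omf 3. Proof. by rewrite /w3 PW3E den_Pom. Qed.
Lemma w4E : w4 = omf 4. Proof. by rewrite /w4 PW4E den_Pom. Qed.
Lemma o5E : o5 = Omf 5. Proof. by rewrite /o5 PO5E den_POm. Qed.
Lemma eeE : ee = ef. Proof. exact: den_Pe. Qed.
Lemma vvE : vv = (1 / 64) *: v1f. Proof. by rewrite /vv PVE den_scale den_Pv1 qval_f. Qed.

Lemma adj_w1 : adj2 w1 w1 0. Proof. by apply: adjqP; vm_compute. Qed.
Lemma adj_w2 : adj2 w2 w2 0. Proof. by apply: adjqP; vm_compute. Qed.
Lemma adj_w3 : adj2 w3 w3 0. Proof. by apply: adjqP; vm_compute. Qed.
Lemma adj_w4 : adj2 w4 w4 0. Proof. by apply: adjqP; vm_compute. Qed.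
Lemma adj_o5 : adj2 o5 o5 0. Proof. by apply: adjqP; vm_compute. Qed.
Lemma adj_ee : adj2 ee ee 0. Proof. by apply: adjqP; vm_compute. Qed.
(** The wrong sign is compensated in c = kap v: the normalization of c makes the scalar purely
    imaginary. *)
Lemma adj_vv : adj2 vv (- vv) 0.
Proof.
have -> : - vv = den (pscale (qint zm1) PV) by rewrite den_scale qvN1.
by apply: adjqP; vm_compute.
Qed.

Definition P1v : poly := [:: (qint z1, ([::], L60))].
Lemma den_1 : den P1v = one. Proof. by rewrite den1 /tmd /= L6lat0. Qed.

Lemma evalq p n q r : peq (yop p n q) r -> Y (den p) (iz n) (den q) = den r.
Proof. by move=> /(@den_eq K F) <-; rewrite den_yop. Qed.

Lemma evals p n q (c : Z) d r : (0 < d)%N -> peq (yop p n q) (pscale (qf c d) r) ->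
  Y (den p) (iz n) (den q) = ((iz c)%:~R / d%:R) *: den r.
Proof. by move=> d0 /evalq ->; rewrite den_scale qval_f. Qed.

Lemma eval0 p n q : peq (yop p n q) [::] -> Y (den p) (iz n) (den q) = 0.
Proof. by move=> /evalq ->; rewrite den_nil. Qed.

Lemma eval3 p n q (a b c : Z) d r1 r2 r3 : (0 < d)%N ->
  peq (yop p n q) (pscale (qf a d) r1 ++ pscale (qf b d) r2 ++ pscale (qf c d) r3) ->
  Y (den p) (iz n) (den q) = ((iz a)%:~R / d%:R) *: den r1 + ((iz b)%:~R / d%:R) *: den r2 + ((iz c)%:~R / d%:R) *: den r3.
Proof. by move=> d0 /evalq ->; rewrite !den_cat !den_scale !qval_f// addrA. Qed.

(** * Products and pairings of the omega^i, e and v_1 / 64 *)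

Lemma w1w1 : Y w1 1 w1 = (2%:~R / 1%:R) *: w1.
Proof. by apply: (@evals PW1 (Zpos 1) PW1 (Zpos 2) 1 PW1); [|vm_compute]. Qed.
Lemma w2w2 : Y w2 1 w2 = (2%:~R / 1%:R) *: w2.
Proof. by apply: (@evals PW2 (Zpos 1) PW2 (Zpos 2) 1 PW2); [|vm_compute]. Qed.
Lemma w3w3 : Y w3 1 w3 = (2%:~R / 1%:R) *: w3.
Proof. by apply: (@evals PW3 (Zpos 1) PW3 (Zpos 2) 1 PW3); [|vm_compute]. Qed.
Lemma w4w4 : Y w4 1 w4 = (2%:~R / 1%:R) *: w4.
Proof. by apply: (@evals PW4 (Zpos 1) PW4 (Zpos 2) 1 PW4); [|vm_compute]. Qed.
Lemma o5o5 : Y o5 1 o5 = (2%:~R / 1%:R) *: o5.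
Proof. by apply: (@evals PO5 (Zpos 1) PO5 (Zpos 2) 1 PO5); [|vm_compute]. Qed.
Lemma eeee : Y ee 1 ee = (2%:~R / 1%:R) *: ee.
Proof. by apply: (@evals Pe (Zpos 1) Pe (Zpos 2) 1 Pe); [|vm_compute]. Qed.
Lemma w3w4 : Y w3 1 w4 = 0. Proof. by apply: (@eval0 PW3 (Zpos 1) PW4); vm_compute. Qed.
Lemma w3ee : Y w3 1 ee = (5%:~R / 24%:R) *: w3 + ((-7)%:~R / 24%:R) *: w4 + (16%:~R / 24%:R) *: ee.
Proof. by apply: (@eval3 PW3 (Zpos 1) Pe (Zpos 5) (Zneg 7) (Zpos 16) 24 PW3 PW4 Pe); [|vm_compute]. Qed.
Lemma w4ee : Y w4 1 ee = ((-5)%:~R / 24%:R) *: w3 + (7%:~R / 24%:R) *: w4 + (32%:~R / 24%:R) *: ee.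
Proof. by apply: (@eval3 PW4 (Zpos 1) Pe (Zneg 5) (Zpos 7) (Zpos 32) 24 PW3 PW4 Pe); [|vm_compute]. Qed.
Lemma w3vv : Y w3 1 vv = (2%:~R / 3%:R) *: vv.
Proof. by apply: (@evals PW3 (Zpos 1) PV (Zpos 2) 3 PV); [|vm_compute]. Qed.
Lemma w4vv : Y w4 1 vv = (4%:~R / 3%:R) *: vv.
Proof. by apply: (@evals PW4 (Zpos 1) PV (Zpos 4) 3 PV); [|vm_compute]. Qed.
Lemma eevv : Y ee 1 vv = (1%:~R / 16%:R) *: vv.
Proof. by apply: (@evals Pe (Zpos 1) PV (Zpos 1) 16 PV); [|vm_compute]. Qed.
Lemma vvvv : Y vv 1 vv = ((-185)%:~R / 128%:R) *: w3 + ((-392)%:~R / 128%:R) *: w4 + (320%:~R / 128%:R) *: ee.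
Proof. by apply: (@eval3 PV (Zpos 1) PV (Zneg 185) (Zneg 392) (Zpos 320) 128 PW3 PW4 Pe); [|vm_compute]. Qed.

Lemma evalf p n q (c : Z) d : (0 < d)%N -> peq (yop p n q) (pscale (qf c d) P1v) ->
  Y (den p) (iz n) (den q) = ((iz c)%:~R / d%:R) *: one.
Proof. by move=> d0 /(evals d0) ->; rewrite den_1. Qed.

Lemma w3_3 : Y w3 3 w3 = (2%:~R / 5%:R) *: one.
Proof. by apply: (@evalf PW3 (Zpos 3) PW3 (Zpos 2) 5); [|vm_compute]. Qed.
Lemma w4_3 : Y w4 3 w4 = (3%:~R / 7%:R) *: one.
Proof. by apply: (@evalf PW4 (Zpos 3) PW4 (Zpos 3) 7); [|vm_compute]. Qed.
Lemma ee_3 : Y ee 3 ee = (1%:~R / 4%:R) *: one.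
Proof. by apply: (@evalf Pe (Zpos 3) Pe (Zpos 1) 4); [|vm_compute]. Qed.
Lemma vv_3 : Y vv 3 vv = ((-81)%:~R / 128%:R) *: one.
Proof. by apply: (@evalf PV (Zpos 3) PV (Zneg 81) 128); [|vm_compute]. Qed.
Lemma w3e_3 : Y w3 3 ee = (1%:~R / 16%:R) *: one.
Proof. by apply: (@evalf PW3 (Zpos 3) Pe (Zpos 1) 16); [|vm_compute]. Qed.
Lemma w4e_3 : Y w4 3 ee = (3%:~R / 16%:R) *: one.
Proof. by apply: (@evalf PW4 (Zpos 3) Pe (Zpos 3) 16); [|vm_compute]. Qed.
Lemma w34_3 : Y w3 3 w4 = 0. Proof. by apply: (@eval0 PW3 (Zpos 3) PW4); vm_compute. Qed.
Lemma w3v_3 : Y w3 3 vv = 0. Proof. by apply: (@eval0 PW3 (Zpos 3) PV); vm_compute. Qed.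
Lemma w4v_3 : Y w4 3 vv = 0. Proof. by apply: (@eval0 PW4 (Zpos 3) PV); vm_compute. Qed.
Lemma ev_3 : Y ee 3 vv = 0. Proof. by apply: (@eval0 Pe (Zpos 3) PV); vm_compute. Qed.

(* Membership in U. *)
Definition kill u := [/\ Y w1 1 u = 0, Y w2 1 u = 0 & Y o5 1 u = 0].
Lemma kill_den p : [&& peq (yop PW1 z1 p) [::], peq (yop PW2 z1 p) [::] & peq (yop PO5 z1 p) [::]] -> kill (den p).
Proof. by move=> /and3P[a b c]; split; exact: (@eval0 _ z1). Qed.
Lemma kill_w3 : kill w3. Proof. by apply: kill_den; vm_compute. Qed.
Lemma kill_w4 : kill w4. Proof. by apply: kill_den; vm_compute. Qed.
Lemma kill_ee : kill ee. Proof. by apply: kill_den; vm_compute. Qed.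
Lemma kill_vv : kill vv. Proof. by apply: kill_den; vm_compute. Qed.

End Facts.

(** * Conformal vectors *)

Lemma binz_m1 j : binz (-1) j = (-1) ^+ j.
Proof. by rewrite /binz /= bin0 mulr1. Qed.
Lemma binz_1S j : binz 1 j.+2 = 0.
Proof. by rewrite /binz -[1 : int]/(Posz 1) cz_pos bin_small ?mulr0. Qed.

Lemma mset_case (s : fmset) : s = mset0 \/ exists x t, s = ([mset x] `+` t)%mset.
Proof.
have [->|] := eqVneq s mset0; first by left.
move=> /eqP ns; right; have [x xs] : exists x, x \in enum_mset s.
  apply: contrapT => nx; apply: ns; apply/msetP => x.
  by rewrite mset0E; apply/eqP; rewrite mset_eq0; apply/negP => xs; apply: nx; exists x.
by exists x, (msetB s [mset x]%mset); rewrite msetB1K.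
Qed.

Lemma dotZ_ge0 l : 0 <= dotZ l l.
Proof. by have := deg2_ge0 (mset0, l); rewrite /deg2 /= fdeg0 add0r. Qed.

Lemma dotZ_eq0 l : dotZ l l = 0 -> l = 0.
Proof.
move=> /(congr1 (fun z : int => z%:~R : rat)); rewrite dotZE /dotL => /eqP.
rewrite psumr_eq0 => [/allP h|i _]; last by rewrite -mulrA mulr_ge0// -expr2 sqr_ge0.
apply: val_inj; apply/rowP => i; rewrite -/(lat_row _) -/(lat_row _) [in RHS]mxE.
have := h i (mem_index_enum i); rewrite /= -mulrA !mulf_eq0 pnatr_eq0 /= orbb.
by move/eqP.
Qed.

Lemma deg2_eq0 b : deg2 b = 0 -> b = (mset0, 0).
Proof.
case: b => s l; rewrite /deg2 /= => e; have l0 := dotZ_ge0 l.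
have [->|[x [t es]]] := mset_case s; first by rewrite (@dotZ_eq0 l)//; lia.
by move: e; rewrite es fdegD fdeg1; lia.
Qed.

Lemma deg2_even b : exists n : int, deg2 b = 2 * n.
Proof.
case: b => s l; rewrite /deg2 /=; have [n [t hx]] := lat_coords l.
rewrite (dotZ_coords hx hx).
set A := _ + n 4%N * n 4%N; set B := n 0%N + _ + _ + _.
by exists ((fdeg s)%:Z + A + t * B + t * t); rewrite PoszM; ring.
Qed.

Opaque dotZ sgnL msetD msetB msetn mset0 seq_mset cz bnorm Y ip Tf.

Arguments Y_hmg {K F d d' u v} n _ _ b _ : rename.
Arguments hmg_eq {K F d d' u} _ _ b _ : rename.

Section Conformal.
Context {K : numClosedFieldType} {F : fockData K}.
Implicit Types (u v w : F).

Local Notation one := (@bb K F (mset0, 0)).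
Local Notation T := (@Tf K F).

Lemma hmgP d u b : hmg d u -> cf u b != 0 -> deg2 b = d.
Proof. by move=> h /h. Qed.

(** The commutator of a_(-1) and b_(n) applied to the vacuum, which b_(n) kills. *)
Lemma skew a b n : 0 <= n ->
  Y b n a = - nsum (fun j => Y (Y a j%:Z b) (n - 1 - j%:Z) one *~ (-1) ^+ j) :> F.
Proof.
move=> n0; have := Y_comm a b (-1) n one.
rewrite Y_creative// (lin0 (Y_lin _ _)) sub0r Y_vac => /(congr1 -%R); rewrite opprK => ->.
congr (- _); apply: eq_nsum => j; rewrite binz_m1.
by have -> : -1 + n - j%:Z = n - 1 - j%:Z by ring.
Qed.

Lemma hmg0_one u : hmg 0 u -> exists c : K, u = c *: one.
Proof.
move=> hu; exists (cf u (mset0, 0)); apply: cf_eq => b; rewrite cfZ cfb.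
have [<-|ne] := eqVneq (mset0, 0) b; first by rewrite mulr1.
rewrite mulr0; apply/eqP/negPn/negP => /(hmgP hu) /deg2_eq0 e.
by move: ne; rewrite e eqxx.
Qed.

Lemma Yone_pos (c : K) n u : n != -1 -> Y (c *: one) n u = 0.
Proof. by move=> n1; rewrite (linZ (Y_linl n u)) Y_one (negPf n1) scaler0. Qed.

Section Weight2.
Variables a b : F.
Hypothesis ha : hmg 4 a.
Hypothesis hb : hmg 4 b.

Let hab (n : int) : hmg (6 - 2 * n) (Y a n b).
Proof. by apply: (hmg_eq (Y_hmg n ha hb)); ring. Qed.
Arguments hab : clear implicits.

Lemma w2_ge4 (n : int) : 4 <= n -> Y a n b = 0.
Proof. by move=> hn; apply: (@hmg_lt0 K F _ _ (hab n)); lia. Qed.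

Lemma wt2_3 : exists c : K, Y a 3 b = c *: one.
Proof. by apply: hmg0_one; exact: (hmg_eq (hab 3)). Qed.

Let term (n : int) (j : nat) : F := Y (Y a (Posz j) b) (n - 1 - (Posz j)) one *~ (-1) ^+ j.

Let term3 (n : int) : term n 3 = 0 \/ n = 3.
Proof.
have [->|n3] := eqVneq n 3; first by right.
left; rewrite /term; have [c ->] := wt2_3; rewrite Yone_pos ?mul0rz//.
by apply/eqP; move/eqP: n3; lia.
Qed.

Lemma w2_skew (n : int) : 0 <= n -> Y b n a = - (\sum_(j < 4) term n j).
Proof.
move=> n0; rewrite (skew a b n0); congr (- _); apply: nsumE => j j4.
by rewrite w2_ge4 ?(lin0 (Y_linl _ _)) ?mul0rz//; lia.
Qed.

Let cre (n : int) (j : nat) : 0 <= n - 1 - (Posz j) -> term n j = 0.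
Proof. by move=> h; rewrite /term Y_creative// mul0rz. Qed.

Lemma skew3 : Y b 3 a = Y a 3 b.
Proof.
rewrite w2_skew// !big_ord_recr big_ord0 /= (cre (j := 0))// (cre (j := 1))// (cre (j := 2))// !add0r /term.
have -> : 3 - 1 - 3%N%:Z = -1 by [].
by rewrite Y_vac exprS mulN1r mulrNz opprK sqrrN expr1n mulr1z.
Qed.

Lemma skew2 : Y b 2 a = - Y a 2 b.
Proof.
rewrite w2_skew// !big_ord_recr big_ord0 /= cre// cre// !add0r.
have -> : term 2 3 = 0 by case: (term3 2).
by rewrite addr0 /term; have -> : 2 - 1 - 2%N%:Z = -1 by []; rewrite Y_vac sqrrN expr1n mulr1z.
Qed.

Lemma skew1 : Y b 1 a = Y a 1 b - T (Y a 2 b).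
Proof.
rewrite w2_skew// !big_ord_recr big_ord0 /= cre// !add0r.
have -> : term 1 3 = 0 by case: (term3 1).
rewrite addr0 /term; have -> : 1 - 1 - 2%N%:Z = -2 by [].
have -> : 1 - 1 - 1%N%:Z = -1 by [].
by rewrite -T_Y Y_vac sqrrN expr1n expr1 mulrNz !mulr1z opprD opprK.
Qed.

Lemma skew0 : Y b 0 a = - Y a 0 b + T (Y a 1 b) - Y (Y a 2 b) (-3) one.
Proof.
rewrite w2_skew// !big_ord_recr big_ord0 /= !add0r.
have -> : term 0 3 = 0 by case: (term3 0).
rewrite addr0 /term; have -> : 0 - 1 - 2%N%:Z = -3 by [].
have -> : 0 - 1 - 1%N%:Z = -2 by []. have -> : 0 - 1 - 0%N%:Z = -1 by [].
by rewrite -T_Y Y_vac sqrrN expr1n expr1 expr0 mulrNz !mulr1z !opprD opprK.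
Qed.

End Weight2.

(* Conformal vectors with x_(n)^+ = x_(2-n). *)
Record conf (c : K) (x : F) : Prop := Conf {
  conf_hmg : hmg 4 x;
  conf_adj : adj2 x x 0;
  conf_1 : Y x 1 x = 2%:R *: x;
  conf_3 : Y x 3 x = (c / 2%:R) *: one }.

Lemma qconf x : hmg 4 x -> adj2 x x 0 -> Y x 1 x = 2%:R *: x -> exists c, conf c x.
Proof.
move=> hx ax x1; have [c hc] := wt2_3 hx hx; exists (c * 2%:R); split=> //.
by rewrite mulfK ?pnatr_eq0.
Qed.

Lemma double0 (u : F) : u = - u -> u = 0.
Proof.
move=> h; apply: (@F_tf K F u 1); rewrite mulr2n {1}h addNr//.
Qed.

Section Vir.
Variables (c : K) (x : F).
Hypothesis hx : conf c x.
Let h4 := conf_hmg hx.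

Lemma conf_2 : Y x 2 x = 0. Proof. exact: double0 (skew2 h4 h4). Qed.

Lemma conf_0 : Y x 0 x = T x.
Proof.
apply: (@scalerI _ _ 2%:R); first by rewrite pnatr_eq0.
have := skew0 h4 h4; rewrite conf_2 (lin0 (Y_linl _ _)) subr0 (conf_1 hx) (linZ (@Tf_lin K F)).
by rewrite -addrC => /eqP; rewrite -subr_eq opprK => /eqP <-; rewrite scaler_nat mulr2n.
Qed.

Lemma conf_adjE n : adj (Y x n) (Y x (2 - n)).
Proof.
move=> u v; rewrite (conf_adj hx); congr (ip u _).
by rewrite (lin0 (Y_linl _ _)) addr0.
Qed.

Lemma conf_comm (m n : int) u : Y x m (Y x n u) - Y x n (Y x m u) =
  Y x (m + n - 1) u *~ (m - n) + (if m + n == 2 then (c / 2%:R) *: u *~ binz m 3 else 0).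
Proof.
rewrite Y_comm (@nsumE _ 4) => [|j j4]; last first.
  by rewrite (w2_ge4 h4 h4) ?(lin0 (Y_linl _ _)) ?mul0rz.
rewrite !big_ord_recr big_ord0 /= add0r conf_0 (conf_1 hx) conf_2 (conf_3 hx) binz0 binz1.
rewrite (lin0 (Y_linl _ _)) mul0rz addr0 Y_T mulr1z subr0 (linZ (Y_linl _ _)) scaler_nat.
rewrite (linZ (Y_linl _ _)) Y_one.
have -> : (m + n - 3%N%:Z == -1) = (m + n == 2) by apply/eqP/eqP; lia.
congr (_ + _); last by case: ifP => // _; rewrite ?scaler0 ?mul0rz.
by rewrite pmulrn; zmod.
Qed.

Lemma L1Lm1 u : Y x 2 (Y x 0 u) = Y x 0 (Y x 2 u) + Y x 1 u *~ 2.
Proof.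
have := conf_comm 2 0 u; have -> : binz 2 3 = 0.
  by rewrite /binz -[2 : int]/(Posz 2) cz_pos bin_small ?mulr0.
rewrite subr0 => e; rewrite -[LHS](subrK (Y x 0 (Y x 2 u))) e addrC.
by case: (2 + 0 == 2); rewrite ?mulr0z addr0.
Qed.

Lemma L1L0 u : Y x 2 (Y x 1 u) = Y x 1 (Y x 2 u) + Y x 2 u.
Proof.
have := conf_comm 2 1 u => /eqP; rewrite subr_eq => /eqP ->.
by rewrite addr0 mulr1z addrC.
Qed.

Definition low (d : int) u := forall b, cf u b != 0 -> deg2 b <= d.

Lemma low_ex u : exists d : nat, low d u.
Proof.
elim/(@b_ind K F): u => [a u v [d hu] [d' hv]|b].
  exists (maxn d d') => b; rewrite cf_lin => nz.
  have [e|/hu] := eqVneq (cf u b) 0; last by lia.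
  by have := hv b; move: nz; rewrite e mulr0 add0r => nz /(_ nz); lia.
exists `|deg2 b|%N => b'; rewrite cfb; have [<-|] := eqVneq b b'; last by rewrite eqxx.
lia.
Qed.

Lemma low_lt0 d u : low d u -> d < 0 -> u = 0.
Proof.
move=> hu d0; apply: cf_eq => b; rewrite cf0; apply/eqP/negPn/negP => /hu.
by have := deg2_ge0 b; lia.
Qed.

Lemma low_sum d I (r : seq I) (P : pred I) (X : I -> F) : (forall i, P i -> low d (X i)) ->
  low d (\sum_(i <- r | P i) X i).
Proof.
move=> hX; elim/big_ind: _ => // [b|u v hu hv b]; first by rewrite cf0 eqxx.
rewrite cfD => nz; have [e|/hu//] := eqVneq (cf u b) 0.
by apply: hv; move: nz; rewrite e add0r.
Qed.

Lemma Y_low (n : int) d u : low d u -> low (d + 2 - 2 * n) (Y x n u).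
Proof.
move=> hu; rewrite [u]fexp (lin_sum (Y_lin x n)); apply: low_sum => b _; rewrite (linZ (Y_lin x n)).
have [->|/hu hb] := eqVneq (cf u b) 0; first by rewrite scale0r => b'; rewrite cf0 eqxx.
move=> b'; rewrite cfZ mulf_eq0 negb_or => /andP[_ nz].
by have := Y_hmg n h4 (hmgb b) b' nz; lia.
Qed.

Lemma L1_nil u : exists N, iter N (Y x 2) u = 0.
Proof.
have [d hd] := low_ex u; exists d.+1.
have E N : low (d%:Z - 2 * N%:Z) (iter N (Y x 2) u).
  elim: N => [|N IH]; first by move: hd; congr low; lia.
  by have := Y_low (n := 2) IH; rewrite -iterS; congr low; lia.
by apply: (low_lt0 (E _)); lia.
Qed.

(** L_1 u has eigenvalue t - 1, so by induction on the nilpotency of L_1 it vanishes. Then |L_(-1)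
    u|^2 = 2 t |u|^2 is nonnegative only if u = 0. *)
Lemma L0_ge u (t : K) : Y x 1 u = t *: u -> t < 0 -> u = 0.
Proof.
have [N hN] := L1_nil u; elim: N u t hN => // N IH u t; rewrite iterSr => hN ht t0.
have h2 : Y x 2 u = 0.
  apply: (IH _ (t - 1)) => //; last by apply: lt_trans t0; rewrite gtrBl.
  have := L1L0 u; rewrite ht (linZ (Y_lin x 2)) => /eqP; rewrite -subr_eq => /eqP <-.
  by rewrite scalerBl scale1r.
apply/eqP; rewrite -ip_eq0; have := ip_ge0 (Y x 0 u).
rewrite (conf_adjE 0) subr0.
rewrite L1Lm1 h2 (lin0 (Y_lin x 0)) add0r ht ipMzr ipZr conj_Creal; last by rewrite realE (ltW t0) orbT.
rewrite -mulrzr mulrAC -mulrA; move=> h; have [_|nz] := eqVneq (ip u u) 0; first by [].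
have pos : 0 < ip u u by rewrite lt_def nz ip_ge0.
have : t * (2%:~R * ip u u) < 0 by rewrite nmulr_rlt0// mulr_gt0// ltr0z.
by move=> lt0; have := le_lt_trans h lt0; rewrite ltxx.
Qed.

(** L_1 u would have L_0-eigenvalue -1 and so vanishes; then |L_(-1) u|^2 = 2 <u, L_0 u> = 0. *)
Lemma L0_kill u : Y x 1 u = 0 -> Y x 0 u = 0.
Proof.
move=> h1; have h2 : Y x 2 u = 0.
  apply: (@L0_ge _ (-1)); last by rewrite ltrN10.
  have := L1L0 u; rewrite h1 (lin0 (Y_lin x 2)) => /esym/eqP; rewrite addr_eq0 => /eqP ->.
  by rewrite scaleN1r.
apply/eqP; rewrite -ip_eq0 (conf_adjE 0) subr0.
by rewrite L1Lm1 h2 (lin0 (Y_lin x 0)) add0r h1 mul0rz ip0r.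
Qed.

(** The commutator of x_(1) with u_(n) involves only x_(0) u and x_(1) u, both zero. This is why U
    is closed under all products. *)
Lemma kill_prod u v n : Y x 1 u = 0 -> Y x 1 v = 0 -> Y x 1 (Y u n v) = 0.
Proof.
move=> hu hv; have := Y_comm x u 1 n v; rewrite hv (lin0 (Y_lin u n)) subr0 => ->.
rewrite (@nsumE _ 2) => [|j j2]; last by case: j j2 => [|[|j]] // _; rewrite binz_1S mulr0z.
by rewrite !big_ord_recr big_ord0 /= (L0_kill hu) hu !(lin0 (Y_linl _ _)) !mul0rz !addr0.
Qed.

End Vir.
End Conformal.

(** * The grading of U *)

Lemma lat_coords01 (x : lat) : exists n t, [/\ coords x n t, 0 <= t & t <= 1].
Proof.
case: x => x /= xP; have := xP; rewrite unfold_in => /orP[/forallP h|/forallP h].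
  exists (fun i => Num.floor (x 0 (inord i))), 0; split=> // i; rewrite mul0r addr0 inord_val.
  by apply/esym/floorK/h.
exists (fun i => Num.floor (x 0 (inord i) - gcoord i)), 1; split=> // i; rewrite mul1r inord_val.
have -> : (Num.floor (x 0 i - gcoord i))%:~R = x 0 i - gcoord i :> rat.
  by apply: floorK; have := h i; rewrite !mxE.
by rewrite subrK.
Qed.

Lemma coords_ext x y n t m s : coords x n t -> coords y m s ->
  (forall i, (i < 5)%N -> n i = m i) -> t = s -> x = y.
Proof.
move=> hx hy nm ts; apply: val_inj; apply/rowP => i.
by rewrite -/(lat_row _) -/(lat_row _) hx hy nm// ts.
Qed.

Definition chkE (c : L6) := peq (PK (PKinv [:: (qint 1, ([::], c))])) [:: (qint 1, ([::], c))].

Lemma int_sq1 (a : int) : a * a <= 1 -> [\/ a = -1, a = 0 | a = 1].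
Proof.
move=> h; have [h1 h2] : -1 <= a /\ a <= 1 by nia.
have : (a == -1) || (a == 0) || (a == 1) by lia.
by case/orP => [/orP[]|] /eqP ->; [constructor 1|constructor 2|constructor 3].
Qed.

Definition isgn (a : int) : Z := if a == 0 then Z0 else if a == 1 then Zpos 1 else Zneg 1.
Lemma isgnE a : a * a <= 1 -> iz (isgn a) = a.
Proof. by case/int_sq1 => ->. Qed.

(** Norm 2 bounds all coordinates by 1 in absolute value; the remaining roots are listed and the
    check is evaluated on each. *)
Lemma norm2_cases l : dotZ l l = 2 -> exists2 c, l = L6lat c & chkE c.
Proof.
have [n [t [hx t0 t1]]] := lat_coords01 l; rewrite (dotZ_coords hx hx).
move e0: (n 0%N) => n0; move e1: (n 1%N) => n1; move e2: (n 2%N) => n2; move e3: (n 3%N) => n3; move e4: (n 4%N) => n4.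
move=> e; have sq (a : int) : 0 <= a * a by nia.
have sq' (a : int) : 0 <= a * (a + 1) by nia.
have s0 := sq n0; have s1 := sq n1; have s2 := sq n2; have s3 := sq n3; have s4 := sq n4.
have r0 := sq' n0; have r1 := sq' n1; have r2 := sq' n2; have r3 := sq' n3.
have tt : t = 0 \/ t = 1 by lia.
have [b0 b1 b2 b3 b4] : [/\ n0 * n0 <= 1, n1 * n1 <= 1, n2 * n2 <= 1, n3 * n3 <= 1 & n4 * n4 <= 1].
  by case: tt => E; rewrite E in e; split; nia.
exists (isgn n0, isgn n1, isgn n2, isgn n3, isgn n4, isgn t).
  apply: (coords_ext hx (@L6coords _)) => [|/=]; last by rewrite isgnE//; nia.
  by case=> [|[|[|[|[|//]]]]] _ /=; rewrite isgnE.
have [E|E] := tt.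
  rewrite E in e *.
  have {}e : n0 * n0 + n1 * n1 + n2 * n2 + n3 * n3 + n4 * n4 = 1 by lia.
  have [h0|h0|h0] := @int_sq1 n0 ltac:(lia); rewrite h0 /= in e;
  have [h1|h1|h1] := @int_sq1 n1 ltac:(lia); rewrite h1 /= in e; try (by move: e; lia);
  have [h2|h2|h2] := @int_sq1 n2 ltac:(lia); rewrite h2 /= in e; try (by move: e; lia);
  have [h3|h3|h3] := @int_sq1 n3 ltac:(lia); rewrite h3 /= in e; try (by move: e; lia);
  have [h4|h4|h4] := @int_sq1 n4 ltac:(lia); rewrite h4 /= in e; try (by move: e; lia); by rewrite h0 h1 h2 h3 h4; vm_compute.
rewrite E in e *.
have h4 : n4 = 0 by nia.
have half (a : int) : a * (a + 1) = 0 -> a = 0 \/ a = -1.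
  by move/eqP; rewrite mulf_eq0 => /orP[/eqP|/eqP h]; [left|right; lia].
have [h0|h0] := half n0 ltac:(nia); have [h1|h1] := half n1 ltac:(nia);
have [h2|h2] := half n2 ltac:(nia); have [h3|h3] := half n3 ltac:(nia); by rewrite h0 h1 h2 h3 h4; vm_compute.
Qed.

Lemma deg2_2 b : deg2 b = 2 -> (exists i, b = ([mset (i, 0%N)]%mset, 0)) \/
  (exists l, b = (mset0, l) /\ dotZ l l = 2).
Proof.
case: b => s l; rewrite /deg2 /= => e; have l0 := dotZ_ge0 l.
have [s0|[[i p] [t es]]] := mset_case s; first by right; exists l; rewrite s0; split=> //; move: e; rewrite s0 fdeg0; lia.
left; exists i; move: e; rewrite es fdegD fdeg1 /= => e.
have -> : p = 0%N by lia.
have -> : l = 0 by apply: dotZ_eq0; lia.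
have [->|[x [t' et]]] := mset_case t; last by move: e; rewrite et fdegD fdeg1; lia.
by congr (_, _); apply/msetP => x; rewrite mset1DE mset0E addn0 msetnE; case: eqP => //=; rewrite eq_sym.
Qed.

Definition mset_upto (N : nat) : nat -> seq fmset := fix f k := if k is k'.+1 then
  mset0 :: [seq ([mset x] `+` t)%mset | x <- [seq (i, p) | i <- enum 'I_5, p <- iota 0 N], t <- f k'] else [:: mset0].

Lemma mset_uptoP N k s : (fdeg s <= k)%N -> (fdeg s <= N)%N -> s \in mset_upto N k.
Proof.
elim: k s => [|k IH] s hk hN; have [e|[[i p] [t e]]] := mset_case s; try by rewrite e ?inE ?eqxx.
  by move: hk; rewrite e fdegD fdeg1.
rewrite /= inE; apply/orP; right; move: hk hN; rewrite e fdegD fdeg1 /= => hk hN.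
apply: allpairs_f; last by apply: IH; lia.
by apply: allpairs_f; rewrite ?mem_enum// mem_iota; lia.
Qed.

Lemma lat_fin d : exists B : seq lat, forall l, dotZ l l <= d -> l \in B.
Proof.
have [m hm] : exists m : nat, d <= m%:Z by exists `|d|%N; lia.
pose R := [seq i%:Z - (m.+1)%:Z | i <- iota 0 (2 * m + 3)].
have RP (a : int) : a * a <= 2 * m + 1 -> a \in R.
  move=> ha; have ha' : - m%:Z - 1 <= a <= m%:Z + 1 by nia.
  apply/mapP; exists `|(a + m.+1%:Z)%R|%N; last by lia.
  by rewrite mem_iota; lia.
pose mk (n : seq int) (t : int) : lat :=
  alphaL 1 *~ n`_0 + alphaL 2 *~ n`_1 + alphaL 3 *~ n`_2 + alphaL 4 *~ n`_3 + alphaL 5 *~ n`_4 + gammaL *~ t.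
have mkP n t : coords (mk n t) (nth 0 n) t.
  move=> i; rewrite /mk !lat_rowD !lat_rowMz !mxE !rowMz /= /alpha_row !mxE /=.
  have e k : (k < 5)%N -> (i == inord k) = (val i == k).
    by move=> k5; apply/eqP/eqP => [->|e]; [rewrite /= inordK|apply: val_inj; rewrite /= inordK].
  by rewrite !e// /gcoord; case: i {e} => -[|[|[|[|[|//]]]]] hi /=; ring.
exists [seq mk [:: q.1.1.1.1; q.1.1.1.2; q.1.1.2; q.1.2; q.2] t |
    q <- [seq (q, e) | q <- [seq (q, e) | q <- [seq (q, e) | q <- [seq (q, e) | q <- R, e <- R], e <- R], e <- R], e <- R],
    t <- [:: 0; 1]] => l.
have [n [t [hx t0 t1]]] := lat_coords01 l; rewrite (dotZ_coords hx hx) => hd.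
have -> : l = mk [:: n 0%N; n 1%N; n 2%N; n 3%N; n 4%N] t.
  by apply: (coords_ext hx (mkP _ _)) => // -[|[|[|[|[|//]]]]].
move: (n 0%N) (n 1%N) (n 2%N) (n 3%N) (n 4%N) hd => n0 n1 n2 n3 n4 hd.
have sq (a : int) : 0 <= a * a by nia.
have sq' (a : int) : 0 <= a * (a + 1) by nia.
have s0 := sq n0; have s1 := sq n1; have s2 := sq n2; have s3 := sq n3; have s4 := sq n4.
have r0 := sq' n0; have r1 := sq' n1; have r2 := sq' n2; have r3 := sq' n3.
have half (a : int) : a * (a + 1) <= m -> a * a <= 2 * m + 1 by move=> ?; nia.
have [b0 b1 b2 b3 b4] : [/\ n0 \in R, n1 \in R, n2 \in R, n3 \in R & n4 \in R].
  have [E|E] : t = 0 \/ t = 1 by lia.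
    by rewrite E in hd; split; apply: RP; lia.
  by rewrite E in hd; split; apply: RP; [apply: half; lia|apply: half; lia|apply: half; lia|apply: half; lia|lia].
apply: (allpairs_f (fun q t => mk [:: q.1.1.1.1; q.1.1.1.2; q.1.1.2; q.1.2; q.2] t) (x := (n0, n1, n2, n3, n4)));
  last by rewrite !inE; have [->|->] : t = 0 \/ t = 1 by lia.
by do 4 (apply: allpairs_f => //).
Qed.

(** Weight spaces are finite dimensional, as the projections of [orth_proj] require. *)
Lemma deg2_fin d : exists B : seq fock_basis, forall b, deg2 b = d -> b \in B.
Proof.
have [B hB] := lat_fin d; have [m hm] : exists m : nat, d <= m%:Z by exists `|d|%N; lia.
exists [seq (s, l) | s <- mset_upto m m, l <- B] => -[s l]; rewrite /deg2 /= => e.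
have l0 := dotZ_ge0 l; apply: allpairs_f; last by apply: hB; lia.
by apply: mset_uptoP; lia.
Qed.

Section Grading.
Context {K : numClosedFieldType} {F : fockData K}.
Implicit Types (u v w : F).
Local Notation h := (@hh K F).
Local Notation E l := (@bb K F (mset0, l)).
Local Notation one := (@bb K F (mset0, 0)).

Lemma den_K (p : poly) : @den K F (PK p) = Y (w1 : F) 1 (@den K F p) + Y (w2 : F) 1 (@den K F p) + Y (o5 : F) 1 (@den K F p).
Proof. have g x y z : @den K F (pnorm (x ++ y ++ z)) = den x + den y + den z by rewrite den_pnorm !den_cat addrA.
by rewrite /PK g !den_yop.
Qed.

Lemma den_hmg p d : all (fun t => Z.eqb (wdeg t.2.1 t.2.2) d) p -> hmg (iz d) (@den K F p).
Proof.
elim: p => [|[q [w c]] p IH] /=; first by rewrite den_nil => _; exact: hmg0.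
move=> /andP[/Z.eqb_spec e hp]; rewrite den_cons; apply: hmgD; last exact: IH.
by rewrite -e; apply: hmgZ; exact: tmd_hmg.
Qed.
Lemma w1_hmg : hmg 4 (w1 : F). Proof. by apply: (@den_hmg _ (Zpos 4)); vm_compute. Qed.
Lemma w2_hmg : hmg 4 (w2 : F). Proof. by apply: (@den_hmg _ (Zpos 4)); vm_compute. Qed.
Lemma w3_hmg : hmg 4 (w3 : F). Proof. by apply: (@den_hmg _ (Zpos 4)); vm_compute. Qed.
Lemma w4_hmg : hmg 4 (w4 : F). Proof. by apply: (@den_hmg _ (Zpos 4)); vm_compute. Qed.
Lemma o5_hmg : hmg 4 (o5 : F). Proof. by apply: (@den_hmg _ (Zpos 4)); vm_compute. Qed.
Lemma ee_hmg : hmg 4 (ee : F). Proof. by apply: (@den_hmg _ (Zpos 4)); vm_compute. Qed.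
Lemma vv_hmg : hmg 4 (vv : F). Proof. by apply: (@den_hmg _ (Zpos 4)); vm_compute. Qed.

Lemma two1 : 2%:~R / 1%:R = 2%:R :> K. Proof. by rewrite divr1. Qed.
Lemma conf_w1 : exists c, conf c (w1 : F).
Proof. by apply: qconf; [exact: w1_hmg|exact: adj_w1|rewrite w1w1 two1]. Qed.
Lemma conf_w2 : exists c, conf c (w2 : F).
Proof. by apply: qconf; [exact: w2_hmg|exact: adj_w2|rewrite w2w2 two1]. Qed.
Lemma conf_w4 : exists c, conf c (w4 : F).
Proof. by apply: qconf; [exact: w4_hmg|exact: adj_w4|rewrite w4w4 two1]. Qed.
Lemma conf_o5 : exists c, conf c (o5 : F).
Proof. by apply: qconf; [exact: o5_hmg|exact: adj_o5|rewrite o5o5 two1]. Qed.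

Lemma ip_K u p : kill u -> ip u (@den K F (PK p)) = 0.
Proof.
move=> [k1 k2 k5]; have [c1 h1] := conf_w1; have [c2 h2] := conf_w2; have [c5 h5] := conf_o5.
by rewrite den_K !ipDr -(conf_adjE h1 1) -(conf_adjE h2 1) -(conf_adjE h5 1) k1 k2 k5 !ip0l !addr0.
Qed.

(** By [PKinv] every basis vector of weight one is in the image of the self-adjoint operator [PK],
    and u is orthogonal to that image. *)
Lemma kill_hmg2 u : kill u -> hmg 2 u -> u = 0.
Proof.
move=> ku hu; apply: cf_eq => b; rewrite cf0.
have [e|] := eqVneq (cf u b) 0; first by [].
move=> /hu e2; suff : ip u (bb F b) = 0.
  by rewrite ip_br => /eqP; rewrite mulf_eq0 pnatr_eq0 -[_ == 0%N]negbK -lt0n bnorm_gt0 orbF => /eqP.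
have chk k : peq (PK (PKinv [:: (qint 1, k)])) [:: (qint 1, k)] -> ip u (@tmd K F k) = 0.
  by move=> /(@den_eq K F) e; rewrite -den1 -e ip_K.
have [[i ->]|[l [-> /norm2_cases[c -> hc]]]] := deg2_2 e2; last exact: (chk ([::], c)).
have -> : bb F ([mset (i, 0%N)]%mset, 0) = tmd ([:: (val i, 0%N)], L60).
  transitivity (h (inord i) (Negz 0) (E (L6lat L60))) => //.
  by rewrite L6lat0 inord_val -bbS; congr (bb F (_, _)); apply/msetP => x; rewrite mset1DE mset0E addn0 msetnE eq_sym; case: eqP.
apply: chk; case: i => -[|[|[|[|[|//]]]]] ? /=; vm_compute; reflexivity.
Qed.

Lemma kill_lin (a : K) u v : kill u -> kill v -> kill (a *: u + v).
Proof.
by move=> [u1 u2 u5] [v1 v2 v5]; split; rewrite Y_lin ?u1 ?u2 ?u5 ?v1 ?v2 ?v5 scaler0 addr0.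
Qed.
Lemma kill_one : kill one.
Proof. by split; rewrite Y_creative. Qed.
Lemma kill_Y u v n : kill u -> kill v -> kill (Y u n v).
Proof.
move=> [u1 u2 u5] [v1 v2 v5]; have [c1 h1] := conf_w1; have [c2 h2] := conf_w2; have [c5 h5] := conf_o5.
by split; [exact: (kill_prod h1)|exact: (kill_prod h2)|exact: (kill_prod h5)].
Qed.
Lemma kill0 : kill (0 : F). Proof. by split; rewrite (lin0 (Y_lin _ _)). Qed.

Definition pr (d : int) u : F := \sum_(b <- fs u) cf u b *: (if deg2 b == d then bb F b else 0).
Lemma pr_lin d : islin (pr d). Proof. exact: le_lin. Qed.
Lemma pr_b d b : pr d (bb F b) = if deg2 b == d then bb F b else 0.
Proof. exact: (le_b (fun b => if deg2 b == d then bb F b else 0)). Qed.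
Lemma cf_pr d u b : cf (pr d u) b = if deg2 b == d then cf u b else 0.
Proof.
elim/(@b_ind K F): u => [a u v hu hv|b']; first by rewrite pr_lin cf_lin hu hv cf_lin; case: ifP; rewrite ?mulr0 ?addr0.
rewrite pr_b (fun_if (fun x => cf x b)) cf0 cfb.
by have [->|ne] := eqVneq b' b; rewrite // mulr0n !if_same.
Qed.
Lemma pr_hmg d u : hmg d (pr d u).
Proof. by move=> b; rewrite cf_pr; case: ifP => [/eqP//|_]; rewrite eqxx. Qed.
Lemma pr_id d u : hmg d u -> pr d u = u.
Proof.
move=> hu; apply: cf_eq => b; rewrite cf_pr; case: eqP => // ne.
by apply/esym/eqP/negPn/negP => /hu.
Qed.
Lemma pr_ne d d' u : hmg d u -> d != d' -> pr d' u = 0.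
Proof.
move=> hu ne; apply: cf_eq => b; rewrite cf_pr cf0; case: eqP => // e.
by apply/eqP/negPn/negP => /hu e'; move: ne; rewrite -e -e' eqxx.
Qed.
Lemma pr_comm (f : F -> F) d u : islin f -> (forall e v, hmg e v -> hmg e (f v)) -> pr d (f u) = f (pr d u).
Proof.
move=> hf gf; elim/(@b_ind K F): u => [a u v hu hv|b]; first by rewrite hf !pr_lin hu hv hf.
have hb := gf _ _ (@hmgb K F b); rewrite pr_b; case: eqP => [<-|ne]; first exact: pr_id.
by rewrite (lin0 hf); apply: (pr_ne hb); apply/eqP.
Qed.
Lemma pr_sum u : exists r : seq int, uniq r /\ u = \sum_(d <- r) pr d u.
Proof.
exists (undup [seq deg2 b | b <- fs u]); split; first exact: undup_uniq.
apply: cf_eq => b; rewrite cf_sum; under eq_bigr => d _ do rewrite cf_pr.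
have [e|nz] := eqVneq (cf u b) 0; first by rewrite big1 // => d _; case: ifP.
have bs : deg2 b \in undup [seq deg2 b | b <- fs u].
  rewrite mem_undup; apply: map_f; apply: contraNT nz => bs; rewrite [u in cf u b]fexp cf_sum.
  apply/eqP; apply: big1_seq => b' /andP[_ b's]; rewrite cfZ cfb.
  by have [e|] := eqVneq b' b; [move: bs; rewrite -e b's|rewrite mulr0].
rewrite (bigD1_seq (deg2 b)) ?undup_uniq//= eqxx big1 ?addr0// => d.
by rewrite eq_sym; case: eqP.
Qed.

Lemma kill_pr d u : kill u -> kill (pr d u).
Proof.
have g x : hmg 4 (x : F) -> Y x 1 u = 0 -> Y x 1 (pr d u) = 0.
  move=> hx e; rewrite -pr_comm ?e ?(lin0 (@pr_lin _))//; first exact: Y_lin.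
  by move=> e' v hv; apply: (hmg_eq (Y_hmg 1 hx hv)); ring.
by move=> [u1 u2 u5]; split; apply: g => //; [exact: w1_hmg|exact: w2_hmg|exact: o5_hmg].
Qed.

Definition subsp (P : F -> Prop) := P 0 /\ forall (a : K) u v, P u -> P v -> P (a *: u + v).
Lemma subspZ P (a : K) u : subsp P -> P u -> P (a *: u).
Proof. by move=> [h0 hl] hu; rewrite -[_ *: _]addr0; apply: hl. Qed.
Lemma subspD P u v : subsp P -> P u -> P v -> P (u + v).
Proof. by move=> [h0 hl] hu; rewrite -[u in u + v]scale1r; apply: hl. Qed.
Lemma subspN P u : subsp P -> P u -> P (- u).
Proof. by move=> hP hu; rewrite -scaleN1r; apply: subspZ. Qed.
Lemma subspB P u v : subsp P -> P u -> P v -> P (u - v).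
Proof. by move=> hP hu hv; apply: subspD => //; apply: subspN. Qed.
Lemma subspMz P u z : subsp P -> P u -> P (u *~ z).
Proof. by move=> hP hu; rewrite -scaler_int; apply: subspZ. Qed.
Lemma subsp_sum P I (r : seq I) (Q : pred I) (X : I -> F) : subsp P ->
  (forall i, Q i -> P (X i)) -> P (\sum_(i <- r | Q i) X i).
Proof. by move=> hP hX; elim/big_ind: _ => //; [exact: hP.1|move=> x y; exact: subspD]. Qed.
Lemma subsp_nsum P (X : nat -> F) : subsp P -> fins X -> (forall j, P (X j)) -> P (nsum X).
Proof. by move=> hP [N hN] hX; rewrite (@nsumE _ N)//; apply: subsp_sum. Qed.

(** Gram-Schmidt by induction on B: the vectors of W without b0 component form a subspace of smaller
    support, whose complement in W is at most a line spanned by some [w1] orthogonal to it. *)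
Lemma orth_proj (B : seq fock_basis) (W : F -> Prop) : subsp W ->
  (forall w b, W w -> cf w b != 0 -> b \in B) ->
  forall u, exists2 w, W w & forall w', W w' -> ip (u - w) w' = 0.
Proof.
elim: B W => [|b0 B IH] W hW hB u.
  exists 0; first exact: hW.1; move=> w' /hB hw'; have -> : w' = 0; last exact: ip0r.
  by apply: cf_eq => b; rewrite cf0; apply/eqP/negPn/negP => /hw'.
pose W0 w := W w /\ cf w b0 = 0.
have hW0 : subsp W0.
  split; first by split; [exact: hW.1|exact: cf0].
  by move=> a x y [x1 x2] [y1 y2]; split; [exact: hW.2|rewrite cf_lin x2 y2 mulr0 addr0].
have hB0 w b : W0 w -> cf w b != 0 -> b \in B.
  move=> [h1 h2] nz; have := hB _ _ h1 nz; rewrite inE => /orP[/eqP e|//].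
  by move: nz; rewrite e h2 eqxx.
have [[w0 [hw0 nz]]|no] := EM (exists w0, W w0 /\ cf w0 b0 != 0); last first.
  have [w hw h'] := IH W0 hW0 hB0 u; exists w; first exact: hw.1.
  move=> w' hw'; apply: h'; split=> //; apply/eqP/negPn/negP => nz; apply: no; by exists w'.
have [p hp hp'] := IH W0 hW0 hB0 w0; pose w1 := w0 - p.
have W1 : W w1 by apply: subspB => //; exact: hp.1.
have c1 : cf w1 b0 != 0 by rewrite cfB hp.2 subr0.
have n1 : ip w1 w1 != 0 by rewrite ip_eq0; apply: contraNneq c1 => ->; rewrite cf0.
have [w hw h'] := IH W0 hW0 hB0 u.
exists (w + (ip u w1 / ip w1 w1) *: w1); first by apply: subspD; [|exact: hw.1|exact: subspZ].
move=> w' hw'; pose a := cf w' b0 / cf w1 b0.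
have h0 : W0 (w' - a *: w1).
  split; first by apply: subspB => //; apply: subspZ.
  by rewrite cfB cfZ mulfVK// subrr.
have -> : w' = a *: w1 + (w' - a *: w1) by rewrite addrC subrK.
rewrite opprD addrA ipBl ipZl !ip_linr (h' _ h0) (hp' _ h0) !addr0.
have e : ip w w1 = 0 by rewrite ip_sym (hp' _ hw) rmorph0.
by rewrite ipBl e subr0 mulrCA mulfVK// subrr.
Qed.

(** Subtracting an orthogonal projection replaces a homogeneous vector by one orthogonal to
    everything of its degree that already satisfies P. It serves both the decomposition of U under
    Vir(x) and the generation of U. *)
Lemma graded_ind (P : F -> Prop) : subsp P ->
  (forall d, (forall d' v, d' < d -> kill v -> hmg d' v -> P v) ->
     forall r, kill r -> hmg d r -> (forall v, kill v -> hmg d v -> P v -> ip r v = 0) -> P r) ->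
  forall u, kill u -> P u.
Proof.
move=> hP step; have hg d u : kill u -> hmg d u -> P u.
  have [n hn] : exists n : nat, d < n%:Z by exists `|d|.+1%N; lia.
  elim: n d hn u => [|n IH] d hn u ku hu; first by rewrite (hmg_lt0 hu)//; exact: hP.1.
  have [B hB] := deg2_fin d.
  pose W w := [/\ kill w, hmg d w & P w].
  have hW : subsp W.
    split; first by split; [exact: kill0|exact: hmg0|exact: hP.1].
    move=> a x y [x1 x2 x3] [y1 y2 y3]; split; [exact: kill_lin| |exact: hP.2].
    by apply: hmgD => //; exact: hmgZ.
  have [w [w1 w2 w3] hw'] := @orth_proj B W hW (fun w b hw nz => hB b (let: And3 _ hw2 _ := hw in hw2 b nz)) u.
  rewrite -[u](subrK w); apply: subspD => //; apply: (step d).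
  - by move=> d' v dd; apply: IH; lia.
  - by rewrite addrC -scaleN1r; exact: kill_lin.
  - exact: hmgB.
  - by move=> v v1 v2 v3; exact: hw'.
move=> u ku; have [r [_ ->]] := pr_sum u; apply: subsp_sum => // d _.
by apply: (hg d); [exact: kill_pr|exact: pr_hmg].
Qed.

Definition PomV : poly := [seq (qf (Zpos 1) 4, ([:: (i, 0%N); (i, 0%N)], L60)) | i <- iota 0 5].
Definition omV : F := den PomV.
Definition om : F := w3 + w4.

(** The conformal vector of V_L is a sum of coset Virasoro vectors; on U only omega^3 + omega^4 acts
    by a nonzero operator under the mode (1), so omega measures the weight there. *)
Lemma omV_sum : omV = w1 + w2 + (w3 + (w4 + o5)).
Proof.
have -> : omV = @den K F (PW1 ++ PW2 ++ PW3 ++ PW4 ++ PO5) by apply: den_eq; vm_compute.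
by rewrite !den_cat addrA.
Qed.

Lemma omVE : omV = (1 / 4%:R) *: \sum_(i < 5) h i (-1) (h i (-1) one).
Proof.
rewrite /omV /PomV /den big_map -[iota 0 5]/(index_iota 0 5) big_mkord scaler_sumr.
by apply: eq_bigr => i _; rewrite qval_f// [tmd _]/(h (inord i) (Negz 0) (h (inord i) (Negz 0) (E (L6lat L60)))) L6lat0 inord_val mulr1z.
Qed.

Lemma h_omV i (j : nat) : h i j omV = if j == 1%N then h i (-1) one else 0.
Proof.
have c k : h i j (h k (-1) (h k (-1) one)) = h k (-1) one *~ (2 * hcoef i k j (-1)).
  have e1 := hh_comm i (j : int) k (-1) one.
  have e2 := hh_comm i (j : int) k (-1) (h k (-1) one).
  have e0 : h i j one = 0 by case: (j) => [|p]; [rewrite hh0E dotZ0r mulr0z|rewrite hhE].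
  move: e1; rewrite e0 (lin0 (hh_lin _ _)) subr0 => e1.
  by move: e2; rewrite e1 (linMz (hh_lin _ _)) => /eqP; rewrite subr_eq => /eqP ->; zmod.
rewrite omVE (linZ (hh_lin _ _)) (lin_sum (hh_lin _ _)); under eq_bigr => k _ do rewrite c.
rewrite (bigD1 i)//= big1 => [|k ki]; last by rewrite hcoef_neq ?mulr0 ?mulr0z// eq_sym.
rewrite addr0; have [->|j1] := eqVneq j 1%N; last by rewrite hcoef_eq0 ?mulr0 ?mulr0z ?scaler0//; lia.
rewrite hcoef_eq// -[2 * _]/(4%:Z) -scaler_int scalerA mulrC mulrA mulr1 divff ?scale1r//.
by rewrite -[4%:~R]/(4%:R) pnatr_eq0.
Qed.

Lemma omV_h i m u : Y omV 1 (h i m u) = h i m (Y omV 1 u) - h i m u *~ m.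
Proof.
have := Y_comm (h i (-1) one) omV m 1 u.
rewrite (@nsum1 _ 1%N) => [|j j1]; last by rewrite !Y_h1 h_omV (negPf j1) (lin0 (Y_linl _ _)) mul0rz.
rewrite !Y_h1 h_omV eqxx Y_h1 binz1; have -> : m + 1 - 1%N%:Z = m by lia.
by move/eqP; rewrite subr_eq addrC -subr_eq => /eqP <-.
Qed.

Lemma omV_E l : Y omV 1 (E l) = ((dotZ l l)%:~R / 2%:R) *: E l.
Proof.
have e i : Y (h i (-1) (h i (-1) one)) 1 (E l) = E l *~ (dotZ (alphaL i.+1) l * dotZ (alphaL i.+1) l).
  rewrite Y_hm1 Y_h1f /Dm (@nsumE _ 0%N) => [|j _]; last first.
    by rewrite -PoszD add1n hhE (lin0 (hh_lin _ _)) mul0rz.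
  rewrite big_ord0 sub0r (@nsum1 _ 0%N) => [|[//|j] _]; last first.
    by rewrite add0r hhE (lin0 (hh_lin _ _)) mul0rz.
  have e1 x : h i (1 - 1 - Posz 0) x = h i 0 x by [].
  have e2 x : h i (0 + Posz 0) x = h i 0 x by [].
  rewrite e1 e2 hh0E (linMz (hh_lin _ _)) hh0E cz0 mulr1z.
  by rewrite -mulNrz opp_sgz1 -mulrzA.
rewrite omVE (linZ (Y_linl _ _)) (lin_sum (Y_linl _ _)); under eq_bigr => i _ do rewrite e.
rewrite -mulrz_sumr dotZ_sum -scaler_int scalerA rmorphM /=; congr (_ *: _).
by rewrite -[2%:~R]/(2%:R); field.
Qed.

Lemma omV_b b : Y omV 1 (bb F b) = ((deg2 b)%:~R / 2%:R) *: bb F b.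
Proof.
case: b => s l; rewrite -[s]seq_mset_id; elim: (enum_mset s) => [|[i p] t IH].
  have -> : seq_mset [::] = mset0 :> {mset ('I_5 * nat)%type}%mset.
    by apply/msetP => x; rewrite mset_seqE mset0E.
  by rewrite omV_E /deg2 /= fdeg0 add0r.
have -> : seq_mset ((i, p) :: t) = ([mset (i, p)] `+` seq_mset t)%mset :> {mset ('I_5 * nat)%type}%mset.
  by apply/msetP => x; rewrite mset1DE !mset_seqE /= eq_sym.
rewrite bbS omV_h IH (linZ (hh_lin _ _)) /deg2 /= fdegD fdeg1 -scaler_int -scalerBl; congr (_ *: _).
move: (fdeg _) (dotZ l l) => N m; have -> : (2 * (p.+1 + N))%N%:Z = 2 * p.+1%:Z + 2 * N%:Z :> int by lia.
have -> : (2 * N)%N%:Z = 2 * N%:Z :> int by lia.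
by rewrite NegzE !(rmorphD, rmorphN, rmorphM) /=; field.
Qed.

Lemma omV_hmg d u : hmg d u -> Y omV 1 u = (d%:~R / 2%:R) *: u.
Proof.
move=> hu; rewrite [u in LHS]fexp [u in RHS]fexp (lin_sum (Y_lin _ _)) scaler_sumr.
apply: eq_bigr => b _; rewrite (linZ (Y_lin _ _)) omV_b.
have [->|/hu ->] := eqVneq (cf u b) 0; first by rewrite !scale0r scaler0.
by rewrite !scalerA mulrC.
Qed.

Lemma om_hmg d u : kill u -> hmg d u -> Y om 1 u = (d%:~R / 2%:R) *: u.
Proof.
move=> [k1 k2 k5] /omV_hmg <-; by rewrite omV_sum !(linD (Y_linl _ _)) k1 k2 k5 !add0r addr0.
Qed.

Lemma hmg_odd d u : hmg d u -> u != 0 -> exists2 n : nat, d = 2 * n%:Z & 0 <= d.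
Proof.
move=> hu u0; have [b nz] : exists b, cf u b != 0.
  apply: contrapT => no; move/eqP: u0; apply; apply: cf_eq => b; rewrite cf0.
  by apply/eqP/negPn/negP => nz; apply: no; exists b.
have e := hu _ nz; have d0 := deg2_ge0 b; have [n hn] := deg2_even b.
by exists `|n|%N; lia.
Qed.

End Grading.

(** * Virasoro modules with c = 1/2 *)

Opaque dotZ sgnL msetD msetB msetn mset0 seq_mset cz bnorm Y ip Tf.

Arguments Y_hmg {K F d d' u v} n _ _ b _ : rename.
Arguments hmg_eq {K F d d' u} _ _ b _ : rename.

Section Ising.
Context {K : numClosedFieldType} {F : fockData K}.
Variables (x : F).
Hypothesis hx : conf (2%:R^-1) x.
Implicit Types (u v w y a : F).

Local Notation one := (@bb K F (mset0, 0)).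
Local Notation X n := (Y x n).

Lemma X_lin n : islin (Y x n). Proof. exact: Y_lin. Qed.

Lemma XX (m n k z : int) u : m + n != 2 -> m + n - 1 = k -> m - n = z ->
  X m (X n u) = X n (X m u) + X k u *~ z.
Proof.
move=> /negPf mn <- <-; have := conf_comm hx m n u; rewrite mn addr0 => <-.
by rewrite addrC subrK.
Qed.
Lemma X3Xm1 u : X 3 (X (-1) u) = X (-1) (X 3 u) + X 1 u *~ 4 + (4%:R^-1) *: u.
Proof.
have := conf_comm hx 3 (-1) u; have -> : binz 3 3 = 1 by rewrite /binz -[3 : int]/(Posz 3) cz_pos binn; lia.
rewrite /= mulr1z => /eqP; rewrite subr_eq => /eqP ->.
have -> : 2%:R^-1 / 2%:R = 4%:R^-1 :> K by rewrite -[4%N]/(2 * 2)%N natrM invfM.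
by rewrite addrC addrA.
Qed.
Lemma X1X (n : int) u : X 1 (X n u) = X n (X 1 u) + X n u *~ (1 - n).
Proof.
have [->|n1] := eqVneq n 1; first by rewrite subrr mulr0z addr0.
by apply: XX => //; [lia|ring].
Qed.

Lemma X_adj n u v : ip (X n u) v = ip u (X (2 - n) v).
Proof. exact: (conf_adjE hx). Qed.

Lemma X_one (n : int) : 0 <= n -> X n one = 0. Proof. exact: Y_creative. Qed.

(* The singular vector of weight 6 of the Verma module with c = 1/2 and h = 0. *)
Definition nullv : F :=
  64%:R *: X (-1) (X (-1) (X (-1) one)) + 93%:R *: X (-2) (X (-2) one)
  - 264%:R *: X (-3) (X (-1) one) - 108%:R *: X (-5) one.

Let r2m1 u : X 2 (X (-1) u) = X (-1) (X 2 u) + X 0 u *~ 3. Proof. exact: XX. Qed.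
Let r2m2 u : X 2 (X (-2) u) = X (-2) (X 2 u) + X (-1) u *~ 4. Proof. exact: XX. Qed.
Let r2m3 u : X 2 (X (-3) u) = X (-3) (X 2 u) + X (-2) u *~ 5. Proof. exact: XX. Qed.
Let r2m5 u : X 2 (X (-5) u) = X (-5) (X 2 u) + X (-4) u *~ 7. Proof. exact: XX. Qed.
Let r0m1 u : X 0 (X (-1) u) = X (-1) (X 0 u) + X (-2) u *~ 1. Proof. exact: XX. Qed.
Let r0m2 u : X 0 (X (-2) u) = X (-2) (X 0 u) + X (-3) u *~ 2. Proof. exact: XX. Qed.
Let r0m3 u : X 0 (X (-3) u) = X (-3) (X 0 u) + X (-4) u *~ 3. Proof. exact: XX. Qed.
Let rm1m2 u : X (-1) (X (-2) u) = X (-2) (X (-1) u) + X (-4) u *~ 1. Proof. exact: XX. Qed.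
Let rm1m3 u : X (-1) (X (-3) u) = X (-3) (X (-1) u) + X (-5) u *~ 2. Proof. exact: XX. Qed.
Let r3m2 u : X 3 (X (-2) u) = X (-2) (X 3 u) + X 0 u *~ 5. Proof. exact: XX. Qed.
Let r3m3 u : X 3 (X (-3) u) = X (-3) (X 3 u) + X (-1) u *~ 6. Proof. exact: XX. Qed.
Let r3m5 u : X 3 (X (-5) u) = X (-5) (X 3 u) + X (-3) u *~ 8. Proof. exact: XX. Qed.
Let r1 n u := X1X n u.
Let rules := (r2m1, r2m2, r2m3, r2m5, r0m1, r0m2, r0m3, rm1m2, rm1m3, r3m2, r3m3, r3m5, X3Xm1, r1).
Let lD n u v := linD (X_lin n) u v.
Let lN n u := linN (X_lin n) u.
Let lMz n u z := linMz (X_lin n) u z.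
Let lZ n (c : K) u := linZ (X_lin n) c u.
Let l0 n := lin0 (X_lin n).
Let lins := (lD, lN, lMz, lZ, l0).

Lemma nullv_2 : X 2 nullv = 0.
Proof.
have z0 := X_one (n := 0) isT; have z1 := X_one (n := 1) isT; have z2 := X_one (n := 2) isT.
rewrite /nullv; do 20 rewrite ?lins ?rules ?z0 ?z1 ?z2.
lmod.
Qed.

Lemma nullv_3 : X 3 nullv = 0.
Proof.
have z0 := X_one (n := 0) isT; have z1 := X_one (n := 1) isT; have z2 := X_one (n := 2) isT; have z3 := X_one (n := 3) isT.
rewrite /nullv; do 20 rewrite ?lins ?rules ?z0 ?z1 ?z2 ?z3.
have e : 4%:R * 4%:R^-1 = 1 :> K by rewrite mulfV ?pnatr_eq0.
transitivity ((4%:R * 4%:R^-1 - 1) *: (48%:R *: X (-1) (X (-1) one) - 66%:R *: X (-3) one)); last by rewrite e subrr scale0r.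
lmod.
Qed.

(** L_1 and L_2, here [X 2] and [X 3], generate all L_n with n > 0. *)
Lemma nullv_pos n : (2 <= n)%N -> X n%:Z nullv = 0.
Proof.
elim: n => // -[//|[_ _|[_ _|n IH _]]]; [exact: nullv_2|exact: nullv_3|].
have h := IH isT; have := @XX (n.+3%:Z) 2 (n.+4%:Z) (n.+1%:Z) nullv.
rewrite h nullv_2 !(lin0 (X_lin _)) add0r => /(_ ltac:(lia) ltac:(lia) ltac:(lia)) /esym/eqP.
by rewrite -scaler_int scaler_eq0 intr_eq0 /= => /eqP.
Qed.

(** Each of its terms begins with a creating mode, whose adjoint is a positive mode and kills the
    vector; so its norm is zero. *)
Lemma nullv0 : nullv = 0.
Proof.
apply/eqP; rewrite -ip_eq0 {1}/nullv !(ipDl, ipNl, ipZl) !X_adj.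
have p n : (2 <= n)%N -> X n%:Z nullv = 0 := @nullv_pos n.
by rewrite (p 3%N)// (p 4%N)// (p 5%N)// (p 7%N)// !(lin0 (X_lin _)) !ip0r !mulr0 !(addr0, oppr0).
Qed.

Definition sing w := forall n : int, 2 <= n -> X n w = 0.

Lemma sing_lin (b : K) u v : sing u -> sing v -> sing (b *: u + v).
Proof. by move=> hu hv n n2; rewrite X_lin hu// hv// scaler0 addr0. Qed.
Lemma sing0 : sing 0. Proof. by move=> n _; rewrite (lin0 (X_lin n)). Qed.
Lemma sing_subsp : subsp sing. Proof. by split; [exact: sing0|exact: sing_lin]. Qed.
Lemma sing_X1 w : sing w -> sing (X 1 w).
Proof.
move=> hw n n2; have := X1X n w; rewrite hw// (lin0 (X_lin _)) mul0rz addr0.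
by move=> <-.
Qed.

(* On singular vectors, the zero mode (k) of v acts as P up to descendants. *)
Definition zmode v (k : int) (P : F -> F) :=
  [/\ islin P, forall w, P (X 1 w) = X 1 (P w) &
      forall w y, sing w -> sing y -> ip (Y v k w) y = ip (P w) y].

Lemma Y_x0 v (m : int) w : Y (X 0 v) m w = X 1 (Y v (m - 1) w) - Y v (m - 1) (X 1 w) - Y (X 1 v) (m - 1) w.
Proof.
rewrite Y_comm (@nsumE _ 2) => [|j j2]; last by case: j j2 => [|[|j]] // _; rewrite binz_1S mulr0z.
rewrite !big_ord_recr big_ord0 /= add0r binz0 binz1 !mulr1z.
have -> : 1 + (m - 1) - 0%N%:Z = m by lia.
have -> : 1 + (m - 1) - 1%N%:Z = m - 1 by lia.
by rewrite addrK.
Qed.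

Lemma X0_comm v (m : int) w : Y v m (X 0 w) = X 0 (Y v m w) - Y (X 0 v) m w.
Proof.
have := Y_comm x v 0 m w; rewrite (@nsumE _ 1) => [|j j1]; last first.
  by case: j j1 => // j _; rewrite /binz -[0 : int]/(Posz 0) cz_pos bin_small ?mulr0 ?mulr0z.
rewrite big_ord_recr big_ord0 /= add0r binz0 mulr1z; have -> : 0 + m - 0%N%:Z = m by lia.
by move=> <-; rewrite opprB addrC subrK.
Qed.

Lemma ip_Yx (l : int) v (k : int) w y : ip (Y (X l v) k w) y =
  nsum (fun j => ip (Y v (k + j%:Z) w) (X (2 - l + j%:Z) y) *~ cz l j)
  - nsum (fun j => ip (Y v (k + l - j%:Z) (X j%:Z w)) y *~ cz l j) *~ sgz1 l.
Proof.
rewrite Y_iter /Dm ipBl ipMzl !ip_nsuml; first last.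
- by apply: finsMz; apply: (fins_comp (fun j => 0 + l - j%:Z) k w (good_field (good_Y x)).1); exact: Y_field.
- apply: finsMz; have := fins_comp (fun j => k + l - j%:Z) 0 w (Y_field v).1 (Y_field x).
  by case=> N hN; exists N => j /hN; rewrite add0r.
congr (_ - _ *~ _); apply: eq_nsum => j; rewrite ipMzl; last by rewrite add0r.
rewrite X_adj; congr (ip _ (Y x _ y) *~ _); lia.
Qed.

Lemma nsum0' (V : zmodType) (f : nat -> V) : (forall j, f j = 0) -> nsum f = 0.
Proof. by move=> f0; rewrite (@nsumE _ 0) ?big_ord0. Qed.

Lemma cz_1 (l : int) : cz l 1 = - l.
Proof. by have := cz_rec l 0; rewrite cz0 mulr1 mul1r sub0r. Qed.

(* L_(-n) v acts as (-1)^n ((n - 1) L_0 + h) P if v of weight h acts as P. *)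
Lemma zmode_step v (k : int) P n : (2 <= n)%N -> X 1 v = v *~ (k + 1) -> zmode v k P ->
  zmode (X (1 - n%:Z) v) (k + n%:Z) (fun w => (X 1 (P w) *~ (n%:Z - 1) + P w *~ (k + 1)) *~ (- sgz1 (1 - n%:Z))).
Proof.
move=> n2 hv [Pl Pc hP]; split.
- apply: islinMz; apply: islinD; apply: islinMz => //.
  by apply: (islin_comp (f := Y x 1)) => //; exact: X_lin.
- by move=> w; rewrite !Pc !(linMz (X_lin _)) !(linD (X_lin _)) !(linMz (X_lin _)).
move=> w y hw hy; rewrite ip_Yx nsum0' => [|j]; last by rewrite hy ?ip0r ?mul0rz//; lia.
rewrite sub0r (@nsumE _ 2) => [|j j2]; last by rewrite hw ?(lin0 (Y_lin _ _)) ?ip0l ?mul0rz//; lia.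
rewrite !big_ord_recr big_ord0 /= add0r cz0 cz_1 mulr1z.
have -> : k + n%:Z + (1 - n%:Z) - 0%N%:Z = k + 1 by lia.
have -> : k + n%:Z + (1 - n%:Z) - 1%N%:Z = k by lia.
rewrite X0_comm ipBl X_adj hy ?ip0r ?sub0r; last by lia.
rewrite Y_x0 addrK hv (linMz (Y_linl _ _)) !ipBl ipMzl X_adj.
have h1 := sing_X1 hw; have h2 := sing_X1 hy.
have -> : 2 - 1 = 1 :> int by [].
rewrite !hP// Pc -[ip _ (X 1 y)]/(ip _ (X (2 - 1) y)) -X_adj !ipMzl ipDl !ipMzl hP//.
by zmod.
Qed.

Lemma zmode_one : zmode one (-1) id.
Proof. by split=> // w y hw hy; rewrite Y_one eqxx. Qed.

Lemma zmode_lin (b : K) u v k P Q : zmode u k P -> zmode v k Q ->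
  zmode (b *: u + v) k (fun w => b *: P w + Q w).
Proof.
move=> [P1 P2 P3] [Q1 Q2 Q3]; split; first by apply: islinD => //; exact: islin_scale.
  by move=> w; rewrite X_lin P2 Q2.
by move=> w y hw hy; rewrite Y_linl !ip_lin P3 ?Q3.
Qed.

(** The zero mode of the vanishing vector [nullv] acts on singular vectors as 2 h (2 h - 1)(16 h -
    1) with h = L_0, whose roots are 0, 1/2 and 1/16. *)
Lemma sing_spec w : sing w ->
  64%:R *: X 1 (X 1 (X 1 w)) - 36%:R *: X 1 (X 1 w) + 2%:R *: X 1 w = 0.
Proof.
have o1 : X 1 one = one *~ (-1 + 1) by rewrite X_one// mulr0z.
have a1 := @zmode_step one (-1) id 2 isT o1 zmode_one.
have e1 : X 1 (X (-1) one) = X (-1) one *~ (1 + 1) by rewrite X1X X_one// (lin0 (X_lin _)) add0r.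
have a2 := @zmode_step _ _ _ 2 isT e1 a1.
have e2 : X 1 (X (-1) (X (-1) one)) = X (-1) (X (-1) one) *~ (3 + 1).
  by rewrite X1X e1 (linMz (X_lin _)); zmod.
have a3 := @zmode_step _ _ _ 2 isT e2 a2.
have b1 := @zmode_step one (-1) id 3 isT o1 zmode_one.
have f1 : X 1 (X (-2) one) = X (-2) one *~ (2 + 1) by rewrite X1X X_one// (lin0 (X_lin _)) add0r.
have b2 := @zmode_step _ _ _ 3 isT f1 b1.
have c2 := @zmode_step _ _ _ 4 isT e1 a1.
have d1 := @zmode_step one (-1) id 6 isT o1 zmode_one.
(* The last summand, -1 times [d1] plus [d1], is zero and only terminates the combination. *)
have [Rl Rc hR] := zmode_lin 64%:R a3 (zmode_lin 93%:R b2 (zmode_lin (- 264%:R) c2 (zmode_lin (- 108%:R) d1 (zmode_lin (-1) d1 d1)))).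
move: Rl Rc hR; set R := fun w => _ : F => Rl Rc hR hw.
(* The squared norm of R w is a matrix coefficient of a mode of [nullv], as soon as R w may be used
   as a singular test vector. *)
have hRw : sing (R w) -> R w = 0.
  move=> hs; apply/eqP; rewrite -ip_eq0 -hR//; apply/eqP.
  rewrite [Z in Y Z _ _](_ : _ = nullv); first by rewrite nullv0 (lin0 (Y_linl _ _)) ip0l.
  by rewrite /nullv; lmod.
have e : R w = 64%:R *: X 1 (X 1 (X 1 w)) - 36%:R *: X 1 (X 1 w) + 2%:R *: X 1 w.
  rewrite /R /= !(linMz (X_lin _), linD (X_lin _)).
  have -> : sgz1 (1 - 2%:Z) = -1 by []. have -> : sgz1 (1 - 3%:Z) = 1 by [].
  have -> : sgz1 (1 - 4%:Z) = -1 by []. have -> : sgz1 (1 - 6%:Z) = -1 by [].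
  by lmod.
rewrite -e; apply: hRw; rewrite e.
have s1 := sing_X1 hw; have s2 := sing_X1 s1; have s3 := sing_X1 s2; have hs := sing_subsp.
by do !apply: (subspD hs); try apply: (subspN hs); apply: (subspZ _ hs).
Qed.

Definition prim (t : K) w := X 1 w = t *: w /\ sing w.

Lemma sing_split w : sing w -> exists w0 w1 w2,
  [/\ prim 0 w0, prim (2%:R^-1) w1, prim (16%:R^-1) w2, w = w0 + w1 + w2 &
    forall S : F -> Prop, subsp S -> (forall u, S u -> S (X 1 u)) -> S w -> [/\ S w0, S w1 & S w2]].
Proof.
move=> hw; have e := sing_spec hw; have s1 := sing_X1 hw; have s2 := sing_X1 s1.
pose L := X 1 w; pose M := X 1 L; have hs := sing_subsp.
have e3 : X 1 M = (64%:R^-1 * 36%:R) *: M - (64%:R^-1 * 2%:R) *: L.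
  have := congr1 (fun v => 64%:R^-1 *: v) e; rewrite scaler0 scalerDr scalerBr !scalerA mulVf ?pnatr_eq0// scale1r.
  by rewrite -addrA => /eqP; rewrite addr_eq0 => /eqP ->; rewrite opprD !opprK.
have two (c1 c2 : K) (A B : F) : c1 = 0 -> c2 = 0 -> A - B = c1 *: M + c2 *: L -> A = B.
  by move=> -> -> /eqP; rewrite !scale0r addr0 subr_eq0 => /eqP.
(* Lagrange interpolation at the roots 0, 1/2, 1/16: the coefficients are those of (2h-1)(16h-1),
   2h(16h-1)/7 and -128h(2h-1)/7. *)
exists (32%:R *: M - 18%:R *: L + w), ((32%:R / 7%:R) *: M - (2%:R / 7%:R) *: L),
  (- (256%:R / 7%:R) *: M + (128%:R / 7%:R) *: L).
have nz n : n.+1%:R != 0 :> K by rewrite pnatr_eq0.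
split.
- split; last by apply: (subspD hs) => //; apply: (subspB hs); apply: (subspZ _ hs).
  rewrite !(linD (X_lin _), linN (X_lin _), linZ (X_lin _)) -/L -/M e3.
  by apply: (two (32%:R * (64%:R^-1 * 36%:R) - 18%:R) (1 - 32%:R * (64%:R^-1 * 2%:R))); [field|field|lmod].
- split; last by apply: (subspB hs); apply: (subspZ _ hs).
  rewrite !(linD (X_lin _), linN (X_lin _), linZ (X_lin _)) -/L -/M e3.
  by apply: (two (32%:R / 7%:R * (64%:R^-1 * 36%:R) - 2%:R / 7%:R - 2%:R^-1 * (32%:R / 7%:R)) (2%:R^-1 * (2%:R / 7%:R) - 32%:R / 7%:R * (64%:R^-1 * 2%:R))); [field|field|lmod].
- split; last by apply: (subspD hs); apply: (subspZ _ hs).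
  rewrite !(linD (X_lin _), linN (X_lin _), linZ (X_lin _)) -/L -/M e3.
  by apply: (two (- (256%:R / 7%:R) * (64%:R^-1 * 36%:R) + 128%:R / 7%:R + 16%:R^-1 * (256%:R / 7%:R)) ((256%:R / 7%:R) * (64%:R^-1 * 2%:R) - 16%:R^-1 * (128%:R / 7%:R))); [field|field|lmod].
- by apply: (two (256%:R / 7%:R - 32%:R - 32%:R / 7%:R) (18%:R + 2%:R / 7%:R - 128%:R / 7%:R)); [field|field|lmod].
move=> S hS SX Sw; have SL := SX _ Sw; have SM := SX _ SL; rewrite -/L -/M in SL SM.
split; last by apply: (subspD hS); apply: (subspZ _ hS).
  by apply: (subspD hS) => //; apply: (subspB hS); apply: (subspZ _ hS).
by apply: (subspB hS); apply: (subspZ _ hS).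
Qed.

(* parity of the L(1/2, h): true for h = 1/16, false for h = 0, 1/2 *)
Definition pv (p : bool) (t : K) : Prop := if p then t = 16%:R^-1 else t = 0 \/ t = 2%:R^-1.

Lemma pv_real p t : pv p t -> t^* = t.
Proof. by case: p => /= [->|[->|->]]; rewrite ?rmorph0// fmorphV /= rmorph_nat. Qed.

Let r20 u : X 2 (X 0 u) = X 0 (X 2 u) + X 1 u *~ 2. Proof. exact: L1Lm1 hx u. Qed.
Let r30 u : X 3 (X 0 u) = X 0 (X 3 u) + X 2 u *~ 3. Proof. exact: XX. Qed.

Lemma X2X00 t w : prim t w -> X 2 (X 0 (X 0 w)) = (4%:R * t + 2%:R) *: X 0 w.
Proof.
move=> [e hw]; rewrite !r20 (hw 2 isT) X1X e.
by rewrite !(linD (X_lin _), lin0 (X_lin _), linMz (X_lin _), linZ (X_lin _)); lmod.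
Qed.
Lemma X3X00 t w : prim t w -> X 3 (X 0 (X 0 w)) = (6%:R * t) *: w.
Proof.
move=> [e hw]; rewrite !r30 r20 (hw 2 isT) (hw 3 isT) e.
by rewrite !(linD (X_lin _), lin0 (X_lin _), linMz (X_lin _), linZ (X_lin _)); lmod.
Qed.

(* L_(-1)^2 w = kap h L_(-2) w on a primary w of weight h = 1/2 or 1/16. *)
Definition kap (t : K) := (4%:R * t + 2%:R) / 3%:R.

(** The difference of the two sides is killed by L_1 for every h, through the choice of [kap], and
    by L_2 for these two h; it is then orthogonal to itself. *)
Lemma null2 t w : t = 2%:R^-1 \/ t = 16%:R^-1 -> prim t w -> X 0 (X 0 w) = kap t *: X (-1) w.
Proof.
move=> ht pw; have [e hw] := pw; pose v := X 0 (X 0 w) - kap t *: X (-1) w.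
have v2 : X 2 v = 0.
  rewrite (linB (X_lin _)) (linZ (X_lin _)) (X2X00 pw) r2m1 (hw 2 isT) (lin0 (X_lin _)) add0r.
  by rewrite -scaler_int scalerA -scalerBl /kap -[3%:~R]/(3%:R) mulfVK ?pnatr_eq0// subrr scale0r.
have v3 : X 3 v = 0.
  rewrite (linB (X_lin _)) (linZ (X_lin _)) (X3X00 pw) X3Xm1 (hw 3 isT) (lin0 (X_lin _)) add0r e.
  transitivity ((6%:R * t - kap t * (4%:R * t + 4%:R^-1)) *: w); first by lmod.
  (* The condition 6 h = kap (4 h + c/2) with c = 1/2 reads 16 h^2 - 9 h + 1/2 = 0, whose roots are
     exactly 1/2 and 1/16. *)
  have -> : 6%:R * t - kap t * (4%:R * t + 4%:R^-1) = 0; last by rewrite scale0r.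
  have n2 : 2%:R != 0 :> K by rewrite pnatr_eq0.
  by rewrite /kap; case: ht => ->; field.
apply/eqP; rewrite -subr_eq0 -ip_eq0 -/v {1}/v ipBl ipZl !X_adj.
by rewrite subr0 v2 -[2 - -1]/(3 : int) v3 !(lin0 (X_lin _)) !ip0r mulr0 subrr.
Qed.

(** * Fusion rules for primary vectors *)

Section Fusion.
Variables (t1 t2 t3 : K) (a w y : F).
Hypotheses (ha : prim t2 a) (hw : prim t1 w) (hy : prim t3 y) (r3 : t3^* = t3).
Let dl := t3 - t1 - t2.

(** The pairing is a three-point coefficient with exponent [dl]; L_(-1) a is a derivative, so it
    multiplies by the exponent. *)
Lemma fus1 (k : int) : ip (Y (X 0 a) k w) y = dl * ip (Y a (k - 1) w) y.
Proof.
rewrite Y_x0 !ipBl X_adj -[2 - 1]/(1 : int) hy.1 hw.1 ha.1 (linZ (Y_linl _ _)) (linZ (Y_lin _ _)).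
by rewrite !ipZl ipZr r3 /dl; ring.
Qed.

Lemma fus2 (k : int) : ip (Y (X 0 (X 0 a)) k w) y = dl * (dl - 1) * ip (Y a (k - 2) w) y.
Proof.
rewrite Y_x0 !ipBl X_adj -[2 - 1]/(1 : int) hy.1 hw.1 X1X ha.1 subr0 mulr1z (linD (Y_linl _ _)).
rewrite (linZ (X_lin _)) (linZ (Y_linl _ _)) (linZ (Y_lin _ _)) ipDl !ipZl ipZr r3 fus1.
by have -> : k - 1 - 1 = k - 2 by [lia]; rewrite /dl; ring.
Qed.

Lemma fus3 (k : int) : ip (Y (X (-1) a) k w) y = (t1 - dl) * ip (Y a (k - 2) w) y.
Proof.
rewrite ip_Yx nsum0' => [|j]; last by rewrite hy.2 ?ip0r ?mul0rz//; lia.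
rewrite sub0r (@nsumE _ 2) => [|j j2]; last by rewrite hw.2 ?(lin0 (Y_lin _ _)) ?ip0l ?mul0rz//; lia.
rewrite !big_ord_recr big_ord0 /= add0r cz0 cz_1 opprK !mulr1z.
have -> : k + -1 - 0%N%:Z = k - 1 by lia.
have -> : k + -1 - 1%N%:Z = k - 2 by lia.
rewrite X0_comm ipBl X_adj hy.2 ?ip0r ?sub0r// hw.1 (linZ (Y_lin _ _)) ipZl fus1.
have -> : k - 1 - 1 = k - 2 by lia.
by ring.
Qed.

Lemma fus0 (k : int) : t2 = 0 -> dl != 0 -> ip (Y a k w) y = 0.
Proof.
move=> e nz; have := fus1 (k + 1); rewrite (L0_kill hx) ?ha.1 ?e ?scale0r//.
by rewrite (lin0 (Y_linl _ _)) ip0l addrK => /esym/eqP; rewrite mulf_eq0 (negPf nz) => /eqP.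
Qed.

(** Inserting the level two relation of a into the pairing gives a polynomial in the exponent times
    the pairing itself, so one of the two factors is zero. *)
Lemma fusN (k : int) : t2 = 2%:R^-1 \/ t2 = 16%:R^-1 ->
  dl * (dl - 1) - kap t2 * (t1 - dl) != 0 -> ip (Y a k w) y = 0.
Proof.
move=> e nz; have := fus2 (k + 2); rewrite (null2 e ha) (linZ (Y_linl _ _)) ipZl fus3 addrK => /eqP.
by rewrite mulrA eq_sym -subr_eq0 -mulrBl mulf_eq0 (negPf nz) => /eqP.
Qed.
End Fusion.

Lemma fusion p1 p2 p3 t1 t2 t3 a w y k : pv p1 t1 -> pv p2 t2 -> pv p3 t3 ->
  prim t2 a -> prim t1 w -> prim t3 y -> p3 != p1 (+) p2 -> ip (Y a k w) y = 0.
Proof.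
move=> h1 h2 h3 pa pw py; have r3 := pv_real h3.
have n2 : 2%:R != 0 :> K by rewrite pnatr_eq0.
(* 768 = 3 * 16^2 clears the denominators of the weights, of their squares and of [kap]. *)
have nz (q : K) (z : int) : q * 768%:R = z%:~R -> z != 0 -> q != 0.
  by move=> e; apply: contraNneq => q0; move: e; rewrite q0 mul0r => /esym/eqP; rewrite intr_eq0.
have two2 (p : K -> Prop) t : t = 0 \/ t = 2%:R^-1 -> p 0 -> p (2%:R^-1) -> p t by move=> [->|->].
case: p1 p2 p3 h1 h2 h3 => -[] [] //= h1 h2 h3 _.
- rewrite h1 h2 h3 in pa pw py r3; apply: (fusN pa pw py r3); first by right.
  by apply: (nz _ (-21)) => //; rewrite /kap; field.
- have [e|e] := h2; rewrite h1 e in pa pw.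
    apply: (fus0 pa pw py r3) => //.
    by case: h3 => ->; [apply: (nz _ (-48))|apply: (nz _ 336)] => //; field.
  apply: (fusN pa pw py r3); first by left.
  by case: h3 => ->; [apply: (nz _ 35)|apply: (nz _ (-77))] => //; rewrite /kap; field.
- rewrite h2 in pa; apply: (fusN pa pw py r3); first by right.
  by case: h1 => ->; case: h3 => ->; [apply: (nz _ 15)|apply: (nz _ 63)|apply: (nz _ 63)|apply: (nz _ (-273))] => //; rewrite /kap; field.
- have [e|e] := h2; rewrite h3 e in pa py r3.
    apply: (fus0 pa pw py r3) => //.
    by case: h1 => ->; [apply: (nz _ 48)|apply: (nz _ (-336))] => //; field.
  apply: (fusN pa pw py r3); first by left.
  by case: h1 => ->; [apply: (nz _ 35)|apply: (nz _ (-77))] => //; rewrite /kap; field.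
Qed.

(** Finer than parity: weight 1/2 exchanges 0 and 1/2, so a component of weight 1/2 has mean zero on
    an eigenvector of weight 0 or 1/2. *)
Lemma fusion_half t a w y k : pv false t -> prim (2%:R^-1) a -> prim t w -> prim t y -> ip (Y a k w) y = 0.
Proof.
move=> ht pa pw py; have r3 := pv_real ht; apply: (fusN pa pw py r3); first by left.
have n2 : 2%:R != 0 :> K by rewrite pnatr_eq0.
have nz (q : K) (z : int) : q * 768%:R = z%:~R -> z != 0 -> q != 0.
  by move=> e; apply: contraNneq => q0; move: e; rewrite q0 mul0r => /esym/eqP; rewrite intr_eq0.
by case: ht => ->; [apply: (nz _ 64)|apply: (nz _ (-448))] => //; rewrite /kap; field.
Qed.

(** * Descendants of a primary vector and irreducibility *)

Inductive mono (t0 : K) (w : F) : K -> F -> Prop :=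
| mono0 : mono t0 w t0 w
| monoS t u (n : int) : n <= 0 -> mono t0 w t u -> mono t0 w (t + (1 - n)%:~R) (X n u).

Inductive desc (t0 : K) (w : F) : F -> Prop :=
| desc0 : desc t0 w 0
| descS (c t : K) u v : mono t0 w t u -> desc t0 w v -> desc t0 w (c *: u + v).

Lemma desc_ind2 (S : F -> Prop) t0 w : subsp S -> (forall t u, mono t0 w t u -> S u) ->
  forall u, desc t0 w u -> S u.
Proof. by move=> hS hm u; elim=> [|c t u' v /hm h1 _ h2]; [exact: hS.1|exact: hS.2]. Qed.

Lemma desc_subsp t0 w : subsp (desc t0 w).
Proof.
have D u v : desc t0 w u -> desc t0 w v -> desc t0 w (u + v).
  by move=> hu hv; elim: hu => [|c t u' v' h1 _ h2]; rewrite ?add0r// -addrA; exact: (descS c h1).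
split=> [|a u v hu hv]; first exact: desc0.
apply: D => //; elim: hu => [|c t u' v' h1 _ h2]; first by rewrite scaler0; exact: desc0.
by rewrite scalerDr scalerA; exact: (descS (a * c) h1).
Qed.

Lemma mono_desc t0 w t u : mono t0 w t u -> desc t0 w u.
Proof. by move=> h; have := descS 1 h (desc0 t0 w); rewrite scale1r addr0. Qed.

Section Desc.
Variables (t0 : K) (w : F).
Hypothesis hw : prim t0 w.

Lemma mono_eig t u : mono t0 w t u -> X 1 u = t *: u.
Proof.
elim=> [|t' v n n0 _ e]; first exact: hw.1.
by rewrite X1X e (linZ (X_lin n)) scalerDl -scaler_int.
Qed.

Lemma mono_nat t u : mono t0 w t u -> u = w \/ exists n : nat, t = t0 + n.+1%:R.
Proof.
have H : mono t0 w t u -> (t = t0 /\ u = w) \/ exists n : nat, t = t0 + n.+1%:R.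
  elim=> [|t' v n n0 _ IH]; [by left|right].
  have e : (1 - n)%:~R = (`|n|%N.+1)%:R :> K by rewrite -[RHS]/((`|n|%N.+1)%:Z%:~R); congr (_%:~R); lia.
  case: IH => [[-> _]|[m ->]]; first by exists `|n|%N; rewrite e.
  by exists (m.+1 + `|n|)%N; rewrite e -addrA -natrD; congr (_ + _%:R); lia.
by case/H => [[_ ->]|h]; [left|right].
Qed.

Lemma mono_X t u (n : int) : mono t0 w t u -> desc t0 w (X n u).
Proof.
have hD := desc_subsp t0 w; move=> hm; elim: hm n => [|t' v j j0 hm IH] n.
  have [n0|n0] := leP n 0; first exact: mono_desc (monoS n0 (mono0 _ _)).
  have [->|n1] := eqVneq n 1; first by rewrite hw.1; apply: (subspZ _ hD); exact: mono_desc (mono0 _ _).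
  by rewrite hw.2; [exact: desc0|lia].
have hv := monoS j0 hm.
have [n0|n0] := leP n 0; first exact: mono_desc (monoS n0 hv).
have [->|n1] := eqVneq n 1; first by rewrite (mono_eig hv); apply: (subspZ _ hD); exact: mono_desc hv.
have := conf_comm hx n j v => /eqP; rewrite subr_eq => /eqP ->.
have c : desc t0 w (X (n + j - 1) v *~ (n - j)) by apply: (subspMz _ hD); exact: IH.
apply: (subspD hD); first apply: (subspD hD) => //.
  by case: ifP => _; [apply: (subspMz _ hD); apply: (subspZ _ hD); exact: mono_desc hm|exact: desc0].
move: (IH n); apply: (desc_ind2 (S := fun z => desc t0 w (X j z))).
  by split; [rewrite (lin0 (X_lin j)); exact: desc0|move=> b z z' h1 h2; rewrite X_lin; exact: hD.2].
by move=> t'' z hz; exact: mono_desc (monoS j0 hz).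
Qed.

Lemma desc_X u (n : int) : desc t0 w u -> desc t0 w (X n u).
Proof.
have hD := desc_subsp t0 w; move: u; apply: desc_ind2; last by move=> t u; exact: mono_X.
by split; [rewrite (lin0 (X_lin n)); exact: desc0|move=> b z z' h1 h2; rewrite X_lin; exact: hD.2].
Qed.

Lemma desc_w : desc t0 w w. Proof. exact: mono_desc (mono0 _ _). Qed.

Lemma desc_min (S : F -> Prop) : subsp S -> (forall n u, S u -> S (X n u)) -> S w ->
  forall u, desc t0 w u -> S u.
Proof. by move=> hS SX Sw; apply: desc_ind2 => // t u; elim=> // t' v n _ _; exact: SX. Qed.

Definition filt (r : seq K) u : F := foldr (fun t z => X 1 z - t *: z) u r.
Lemma filt_lin r : islin (filt r).
Proof. elim: r => [|t r IH] a z z' //=; rewrite IH X_lin; lmod. Qed.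
Lemma filt_step r t u : filt r (X 1 u - t *: u) = X 1 (filt r u) - t *: filt r u.
Proof. elim: r => //= t' r ->; rewrite !(linB (X_lin 1)) !(linZ (X_lin 1)); lmod. Qed.
Lemma filt_w r : filt r w = (\prod_(t <- r) (t0 - t)) *: w.
Proof.
elim: r => [|t r IH] /=; first by rewrite big_nil scale1r.
by rewrite IH big_cons (linZ (X_lin 1)) hw.1; lmod.
Qed.
Lemma filt_ip r u : t0^* = t0 -> ip (filt r u) w = (\prod_(t <- r) (t0 - t)) * ip u w.
Proof.
move=> r0; elim: r => [|t r IH] /=; first by rewrite big_nil mul1r.
rewrite big_cons ipBl ipZl X_adj -[2 - 1]/(1 : int) hw.1 ipZr r0 -!/(filt r u) IH; ring.
Qed.
Lemma filt_sub (S : F -> Prop) r u : subsp S -> (forall u, S u -> S (X 1 u)) -> S u -> S (filt r u).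
Proof.
move=> hS SX Su; elim: r => //= t r IH.
by apply: (subspB hS); [exact: SX|exact: subspZ].
Qed.

Lemma desc_dec u : desc t0 w u -> exists (c : K) (r : seq K) (d : F),
  [/\ u = c *: w + d, forall t, t \in r -> t != t0 & filt r d = 0].
Proof.
elim=> [|c t u' v hm _ [c' [r [d [-> hr hd]]]]].
  by exists 0, [::], 0; rewrite scale0r addr0.
have [->|[n e]] := mono_nat hm.
  by exists (c + c'), r, d; split=> //; rewrite scalerDl addrA.
exists c', (t :: r), (c *: u' + d); split; first by rewrite addrCA.
  move=> t'; rewrite inE => /orP[/eqP ->|/hr //].
  by rewrite e -subr_eq0 addrAC subrr add0r pnatr_eq0.
rewrite /= -/(filt r _) -filt_step X_lin (mono_eig hm).
have -> : c *: (t *: u') + X 1 d - t *: (c *: u' + d) = X 1 d - t *: d by lmod.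
by rewrite filt_step hd (lin0 (X_lin 1)) scaler0 subr0.
Qed.

(* A submodule not orthogonal to w contains w, because a polynomial in L_0 kills
   the lower part of a vector; otherwise it is orthogonal to all of desc w. *)
Lemma desc_irr (S : F -> Prop) : t0^* = t0 -> subsp S -> (forall n u, S u -> S (X n u)) ->
  (forall u, S u -> desc t0 w u) -> (forall u, S u -> u = 0) \/ (forall u, desc t0 w u -> S u).
Proof.
move=> r0 hS SX Sd; have [[u [Su nz]]|no] := EM (exists u, S u /\ ip u w != 0); last first.
  left=> u Su; have orth : forall v, desc t0 w v -> forall u, S u -> ip u v = 0.
    apply: desc_ind2 => [|t v].
      split; first by move=> z _; rewrite ip0r.
      by move=> a z z' h1 h2 z'' h; rewrite ip_linr h1// h2// mulr0 addr0.
    elim=> [z Sz|t' z n n0 _ IH z' Sz']; first by apply/eqP/negPn/negP => nz; apply: no; exists z.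
    have := @X_adj (2 - n) z' z; have -> : 2 - (2 - n) = n by lia.
    by move=> <-; apply: IH; exact: SX.
  by apply/eqP; rewrite -ip_eq0; apply/eqP; apply: orth => //; exact: Sd.
right; apply: desc_min => //.
have [c [r [d [e hr hd]]]] := desc_dec (Sd _ Su).
have p0 : \prod_(t <- r) (t0 - t) != 0.
  rewrite prodf_seq_neq0; apply/allP => t /hr /=; rewrite subr_eq0 eq_sym//.
have d0 : ip d w = 0.
  by have := filt_ip r d r0; rewrite hd ip0l => /esym/eqP; rewrite mulf_eq0 (negPf p0) => /eqP.
have c0 : c != 0 by apply: contraNneq nz => c0; rewrite e c0 scale0r add0r d0.
have := filt_sub r hS (SX 1) Su; rewrite e (filt_lin r) hd addr0 filt_w scalerA => h.
have nz' : c * \prod_(t <- r) (t0 - t) != 0 by rewrite mulf_neq0.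
by have := subspZ (c * \prod_(t <- r) (t0 - t))^-1 hS h; rewrite scalerA mulVf// scale1r.
Qed.

End Desc.

(** * The parity decomposition of U under Vir(x) and the resulting involution *)

Hypothesis kx : kill x.

Inductive ps (p : bool) : F -> Prop :=
| ps0 : ps p 0
| psS t0 w u v : pv p t0 -> prim t0 w -> kill w -> desc t0 w u -> ps p v -> ps p (u + v).

Lemma ps_ind2 (S : F -> Prop) p : subsp S ->
  (forall t0 w t u, pv p t0 -> prim t0 w -> kill w -> mono t0 w t u -> S u) -> forall u, ps p u -> S u.
Proof.
move=> hS hm u; elim=> [|t0 w u' v h1 h2 h3 hd _ Sv]; first exact: hS.1.
apply: (subspD hS) => //; move: hd; apply: desc_ind2 => // t z; exact: hm.
Qed.

Lemma ps_subsp p : subsp (ps p).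
Proof.
have D u v : ps p u -> ps p v -> ps p (u + v).
  by move=> hu hv; elim: hu => [|t0 w u' v' h1 h2 h3 h4 _ h5]; rewrite ?add0r// -addrA; exact: (psS h1 h2 h3 h4).
split=> [|a u v hu hv]; first exact: ps0.
apply: D => //; elim: hu => [|t0 w u' v' h1 h2 h3 h4 _ h5]; first by rewrite scaler0; exact: ps0.
by rewrite scalerDr; apply: (psS h1 h2 h3) => //; apply: (subspZ _ (desc_subsp _ _)).
Qed.

Lemma ps_desc p t0 w u : pv p t0 -> prim t0 w -> kill w -> desc t0 w u -> ps p u.
Proof. by move=> h1 h2 h3 h4; rewrite -[u]addr0; apply: (psS h1 h2 h3 h4); exact: ps0. Qed.

Lemma ps_X p u (n : int) : ps p u -> ps p (X n u).
Proof.
elim=> [|t0 w u' v' h1 h2 h3 h4 _ h5]; first by rewrite (lin0 (X_lin n)); exact: ps0.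
by rewrite (linD (X_lin n)); apply: (psS h1 h2 h3) => //; exact: desc_X.
Qed.

Lemma kill_subsp : subsp (@kill K F). Proof. by split; [exact: kill0|exact: kill_lin]. Qed.

Lemma ps_kill p u : ps p u -> kill u.
Proof.
apply: ps_ind2; first exact: kill_subsp.
by move=> t0 w t v _ _ hw; elim=> // t' z n _ _; exact: kill_Y.
Qed.

(** The weights of odd parity lie in 1/16 + Z, those of even parity in Z/2. *)
Lemma pv_neq p t s (m n : nat) : pv p t -> pv (~~ p) s -> t + m%:R != s + n%:R.
Proof.
have H t' s' (m' n' : nat) : pv true t' -> pv false s' -> t' + m'%:R != s' + n'%:R.
  move=> /= -> hs; apply/eqP => /(congr1 (fun z => z * 16%:R)); rewrite !mulrDl mulVf ?pnatr_eq0//.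
  case: hs => ->; rewrite ?mul0r.
    by rewrite add0r -!natrM -[1]/(1%:R) -natrD => /eqP; rewrite eqr_nat; lia.
  have -> : 2%:R^-1 * 16%:R = 8%:R :> K by rewrite -[16%N]/(2 * 8)%N natrM mulrA mulVf ?mul1r// pnatr_eq0.
  by rewrite -!natrM -[1]/(1%:R) -!natrD => /eqP; rewrite eqr_nat; lia.
case: p => /= h1 h2; first exact: H.
by rewrite eq_sym; apply: H.
Qed.

Lemma eig_orth t s u v : X 1 u = t *: u -> X 1 v = s *: v -> s^* = s -> t != s -> ip u v = 0.
Proof.
move=> hu hv rs ts; have := X_adj 1 u v; rewrite -[2 - 1]/(1 : int) hu hv ipZl ipZr rs => /eqP.
by rewrite -subr_eq0 -mulrBl mulf_eq0 subr_eq0 (negPf ts) => /eqP.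
Qed.

Lemma mono_nat' t0 w t u : mono t0 w t u -> exists n : nat, t = t0 + n%:R.
Proof.
elim=> [|t' v n n0 _ [m ->]]; first by exists 0%N; rewrite addr0.
exists (m + `|(1 - n)%R|)%N; rewrite natrD -addrA; congr (_ + (_ + _)).
by rewrite -[RHS]/((`|(1 - n)%R|%N)%:Z%:~R); congr (_%:~R); lia.
Qed.

Lemma ps_orth p u v : ps p u -> ps (~~ p) v -> ip u v = 0.
Proof.
move=> hu; move: v; apply: ps_ind2.
  by split; [exact: ip0r|move=> a z z' h1 h2; rewrite ip_linr h1 h2 mulr0 addr0].
move=> s0 w' s v hs pw' _ hv; move: u hu; apply: ps_ind2.
  by split; [exact: ip0l|move=> a z z' h1 h2; rewrite ip_lin h1 h2 mulr0 addr0].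
move=> t0 w t u ht pw _ hu.
apply: (eig_orth (mono_eig pw hu) (mono_eig pw' hv)).
  by have [n ->] := mono_nat' hv; rewrite rmorphD /= rmorph_nat (pv_real hs).
by have [n ->] := mono_nat' hv; have [m ->] := mono_nat' hu; apply: pv_neq ht hs.
Qed.

Lemma ps_disj p u : ps p u -> ps (~~ p) u -> u = 0.
Proof. by move=> h1 h2; apply/eqP; rewrite -ip_eq0 (ps_orth h1 h2). Qed.

Definition psum u := exists v w, [/\ ps false v, ps true w & u = v + w].
Lemma psum_subsp : subsp psum.
Proof.
have hs p := ps_subsp p; split; first by exists 0, 0; split; [exact: ps0|exact: ps0|rewrite addr0].
move=> a _ _ [v [w [h1 h2 ->]]] [v' [w' [h1' h2' ->]]].
by exists (a *: v + v'), (a *: w + w'); split; [exact: (hs _).2|exact: (hs _).2|rewrite scalerDr addrACA].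
Qed.
Lemma psum_X u (n : int) : psum u -> psum (X n u).
Proof.
move=> [v [w [h1 h2 ->]]]; exists (X n v), (X n w).
by split; [exact: ps_X|exact: ps_X|rewrite (linD (X_lin n))].
Qed.
Lemma ps_psum p u : ps p u -> psum u.
Proof.
by case: p => h; [exists 0, u; rewrite add0r|exists u, 0; rewrite addr0]; split=> //; exact: ps0.
Qed.

(** |x_(n) r|^2 = <r, x_(2-n) x_(n) r>. For n >= 2 the vector x_(n) r has lower degree, hence lies
    in P, and so does x_(2-n) x_(n) r, to which r is orthogonal. *)
Lemma low_sing (P : F -> Prop) d r : (forall n u, P u -> P (X n u)) ->
  (forall d' v, d' < d -> kill v -> hmg d' v -> P v) ->
  kill r -> hmg d r -> (forall v, kill v -> hmg d v -> P v -> ip r v = 0) -> sing r.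
Proof.
move=> PX hlow kr hr ho n n2; apply/eqP; rewrite -ip_eq0 X_adj; apply/eqP.
have h1 : hmg (d + 2 - 2 * n) (X n r) by apply: (hmg_eq (Y_hmg n (conf_hmg hx) hr)); ring.
apply: ho; first by do 2 apply: kill_Y => //.
  by apply: (hmg_eq (Y_hmg (2 - n) (conf_hmg hx) h1)); ring.
by apply: PX; apply: (hlow (d + 2 - 2 * n)) => //; [lia|exact: kill_Y].
Qed.

Lemma psumP u : kill u -> psum u.
Proof.
apply: (graded_ind psum_subsp) => d hlow r kr hr ho.
have sr := low_sing (fun n u => @psum_X u n) hlow kr hr ho.
have [w0 [w1 [w2 [p0 p1 p2 e hS]]]] := sing_split sr.
have [k0 k1 k2] := hS _ kill_subsp (fun u ku => kill_Y 1 kx ku) kr; rewrite e.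
have Q p t w : pv p t -> prim t w -> kill w -> psum w.
  by move=> h1 h2 h3; apply: (@ps_psum p); apply: (ps_desc h1 h2 h3); exact: desc_w.
apply: (subspD psum_subsp); first apply: (subspD psum_subsp).
- by apply: (Q false 0) => //; left.
- by apply: (Q false (2%:R^-1)) => //; right.
by apply: (Q true (16%:R^-1)).
Qed.

(** * Fusion rules for descendants *)

Section Triple.
Variables (p1 p2 p3 : bool) (t1 t2 t3 : K) (w a y : F).
Hypotheses (h1 : pv p1 t1) (h2 : pv p2 t2) (h3 : pv p3 t3) (pw : prim t1 w) (pa : prim t2 a) (py : prim t3 y).
Hypothesis hp : p3 != p1 (+) p2.

(** For primary a the commutator stays within modes of a and L_(-1) a, and the latter is rewritten
    by commutators with L_0. So descendants can be stripped from the third, the first and the middle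
    argument in turn. *)
Lemma X_comm_prim (n k : int) v : X n (Y a k v) - Y a k (X n v) =
  Y (X 0 a) (n + k) v + (t2 *~ n) *: Y a (n + k - 1) v.
Proof.
rewrite Y_comm (@nsumE _ 2) => [|j j2]; last by rewrite pa.2 ?(lin0 (Y_linl _ _)) ?mul0rz//; lia.
rewrite !big_ord_recr big_ord0 /= add0r binz0 binz1 pa.1 (linZ (Y_linl _ _)) mulr1z.
have -> : n + k - 0%N%:Z = n + k by lia.
by rewrite scalerMzl.
Qed.

Let dw := desc_X pw. Let dy := desc_X py.

Lemma triple1 k z t : mono t3 y t z -> ip (Y a k w) z = 0.
Proof.
move=> hm; elim: hm k => [|t' v n n0 hm IH] k; first exact: (fusion _ h1 h2 h3).
have := @X_adj (2 - n) (Y a k w) v; have -> : 2 - (2 - n) = n by lia.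
move=> <-; have := X_comm_prim (2 - n) k w; rewrite pw.2; last by lia.
rewrite (lin0 (Y_lin _ _)) subr0 => ->; rewrite ipDl ipZl IH mulr0 addr0 Y_x0.
by rewrite pw.1 pa.1 (linZ (Y_lin _ _)) (linZ (Y_linl _ _)) !ipBl !ipZl X_adj -[2 - 1]/(1 : int) (mono_eig py hm) ipZr !IH !mulr0 !subrr.
Qed.

Lemma triple2 k v t z : mono t1 w t v -> desc t3 y z -> ip (Y a k v) z = 0.
Proof.
move=> hm; elim: hm k z => [|t' v' n n0 hm IH] k z hz.
  move: z hz; apply: desc_ind2 => [|s z]; last exact: triple1.
  by split; [exact: ip0r|move=> b u u' e1 e2; rewrite ip_linr e1 e2 mulr0 addr0].
have := X_comm_prim n k v' => /eqP; rewrite subr_eq addrC -subr_eq => /eqP <-.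
rewrite ipBl X_adj IH; last exact: dy.
rewrite ipDl ipZl IH// mulr0 addr0 Y_x0 pa.1 (mono_eig pw hm) (linZ (Y_lin _ _)) (linZ (Y_linl _ _)) !ipBl !ipZl.
by rewrite X_adj !IH ?mulr0 ?subrr//; exact: dy.
Qed.

Lemma triple3 k v z : desc t1 w v -> desc t3 y z -> ip (Y a k v) z = 0.
Proof.
move=> hv hz; move: v hv; apply: desc_ind2 => [|s v hv]; last exact: triple2 hv hz.
by split; [rewrite (lin0 (Y_lin _ _)) ip0l|move=> b u u' e1 e2; rewrite Y_lin ip_lin e1 e2 mulr0 addr0].
Qed.

Lemma triple4 u t : mono t2 a t u -> forall k v z, desc t1 w v -> desc t3 y z -> ip (Y u k v) z = 0.
Proof.
elim=> [k v z|t' u' n n0 _ IH k v z hv hz]; first exact: triple3.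
rewrite ip_Yx !nsum0' ?mul0rz ?subrr// => j; first by rewrite IH ?mul0rz//; exact: dw.
by rewrite IH ?mul0rz//; exact: dy.
Qed.
End Triple.

Lemma ps_Y_orth p1 p2 p3 u v z k : ps p2 u -> ps p1 v -> ps p3 z -> p3 != p1 (+) p2 ->
  ip (Y u k v) z = 0.
Proof.
move=> hu hv hz hp; move: u hu; apply: ps_ind2.
  by split; [rewrite (lin0 (Y_linl _ _)) ip0l|move=> b u u' e1 e2; rewrite Y_linl ip_lin e1 e2 mulr0 addr0].
move=> t2 a t u h2 pa _ hu; elim: hv => [|t1 w v' v'' h1 pw _ hv' _ IH]; first by rewrite (lin0 (Y_lin _ _)) ip0l.
rewrite (linD (Y_lin _ _)) ipDl IH addr0; elim: hz => [|t3 y z' z'' h3 py _ hz' _ IHz]; first exact: ip0r.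
by rewrite ipDr IHz addr0; apply: (triple4 h1 h2 h3 pw pa py hp hu).
Qed.

Lemma ps_Y p1 p2 u v k : ps p2 u -> ps p1 v -> ps (p1 (+) p2) (Y u k v).
Proof.
move=> hu hv; have hk := kill_Y k (ps_kill hu) (ps_kill hv).
have [a [b [ha hb e]]] := psumP hk.
have [c [d [hc hd e']]] : exists c d, [/\ ps (p1 (+) p2) c, ps (~~ (p1 (+) p2)) d & Y u k v = c + d].
  by case: (p1 (+) p2); [exists b, a|exists a, b]; split=> //; rewrite e addrC.
have d0 : ip (Y u k v) d = 0 by apply: (ps_Y_orth _ hu hv hd); case: (p1 (+) p2).
suff -> : Y u k v = c by [].
rewrite e'; have -> : d = 0; last by rewrite addr0.
by apply/eqP; rewrite -ip_eq0; have := d0; rewrite e' ipDl (ps_orth hc hd) add0r => ->.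
Qed.

Lemma ps_eig p t u : kill u -> prim t u -> pv p t -> ps p u.
Proof. by move=> ku pu ht; apply: (ps_desc ht pu ku); exact: desc_w. Qed.

Definition tauf u : F := xget 0 [set z | exists v w, [/\ ps false v, ps true w, u = v + w & z = v - w]].
Lemma tauf_eq v w : ps false v -> ps true w -> tauf (v + w) = v - w.
Proof.
move=> hv hw; rewrite /tauf; case: xgetP => [z _ /= [v' [w' [hv' hw' e ->]]]|no].
  have e1 : v - v' = w' - w.
    (have -> : v = v' + w' - w by rewrite -e addrK); zmod.
  have h0 : v - v' = 0.
    apply: (@ps_disj false); first exact: (subspB (ps_subsp _)).
    by rewrite e1; exact: (subspB (ps_subsp _)).
  move: e1; rewrite h0 => /esym/eqP; rewrite subr_eq0 => /eqP ->.
  by move/eqP: h0; rewrite subr_eq0 => /eqP ->.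
by case: (no (v - w)); exists v, w.
Qed.

Lemma tauf_ps (p : bool) u : ps p u -> tauf u = if p then - u else u.
Proof.
case: p => hu; [rewrite -{1}[u]add0r tauf_eq ?sub0r//; exact: ps0|].
by rewrite -{1}[u]addr0 tauf_eq ?subr0//; exact: ps0.
Qed.

Lemma tauf_lin (c : K) u v : kill u -> kill v -> tauf (c *: u + v) = c *: tauf u + tauf v.
Proof.
move=> /psumP[u1 [u2 [h1 h2 ->]]] /psumP[v1 [v2 [h3 h4 ->]]].
have hs p := ps_subsp p.
have -> : c *: (u1 + u2) + (v1 + v2) = (c *: u1 + v1) + (c *: u2 + v2) by rewrite scalerDr addrACA.
rewrite !tauf_eq//; [lmod|exact: (hs _).2|exact: (hs _).2].
Qed.

Lemma tauf_kill u : kill u -> kill (tauf u).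
Proof.
move=> /psumP[u1 [u2 [h1 h2 ->]]]; rewrite tauf_eq//.
by apply: (subspB kill_subsp); [exact: ps_kill h1|exact: ps_kill h2].
Qed.

Lemma tauf_inv u : kill u -> tauf (tauf u) = u.
Proof.
move=> /psumP[u1 [u2 [h1 h2 ->]]]; rewrite tauf_eq// tauf_eq ?opprK//.
exact: (subspN (ps_subsp _)).
Qed.

Lemma tauf_Y u v k : kill u -> kill v -> tauf (Y u k v) = Y (tauf u) k (tauf v).
Proof.
move=> /psumP[u1 [u2 [h1 h2 ->]]] /psumP[v1 [v2 [h3 h4 ->]]].
have hs p := ps_subsp p.
rewrite !tauf_eq// !(linD (Y_linl _ _), linD (Y_lin _ _), linN (Y_linl _ _), linN (Y_lin _ _)).
have p11 := ps_Y k h1 h3; have p12 := ps_Y k h1 h4; have p21 := ps_Y k h2 h3; have p22 := ps_Y k h2 h4.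
have -> : Y u1 k v1 + Y u1 k v2 + (Y u2 k v1 + Y u2 k v2) = (Y u1 k v1 + Y u2 k v2) + (Y u2 k v1 + Y u1 k v2).
  by zmod.
rewrite tauf_eq; [zmod|exact: subspD|exact: subspD].
Qed.

End Ising.

(** * The algebra U_2 *)

Opaque dotZ sgnL msetD msetB msetn mset0 seq_mset cz bnorm Y ip Tf w1 w2 w3 w4 o5 ee vv.

Arguments Y_hmg {K F d d' u v} n _ _ b _ : rename.
Arguments hmg_eq {K F d d' u} _ _ b _ : rename.

Section Griess.
Context {K : numClosedFieldType} {F : fockData K}.
Variable kap : K.
(** kap is 64 k, where c = k v_1; the value of its square is the condition <c,c> = 3^5/2^11, as
    <v_1,v_1> / 64^2 = -81/128. *)
Hypothesis kap2 : kap ^+ 2 = - (3%:R / 16%:R).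
Implicit Types (u v w x y : F).

Local Notation one := (@bb K F (mset0, 0)).
Local Notation w3 := (@w3 K F).
Local Notation w4 := (@w4 K F).
Local Notation ee := (@ee K F).
Local Notation vv := (@vv K F).
Local Notation om := (@om K F).

Lemma nz n : n.+1%:R != 0 :> K. Proof. by rewrite pnatr_eq0. Qed.

Definition cc : F := kap *: vv.

(** A real number has no negative square; the resulting sign cancels that of [adj_vv]. *)
Lemma kapC : kap^* = - kap.
Proof.
have : (kap^* - kap) * (kap^* + kap) = 0.
  have -> : (kap^* - kap) * (kap^* + kap) = kap^* ^+ 2 - kap ^+ 2 by ring.
  by rewrite -rmorphXn /= kap2 rmorphN fmorph_div /= !rmorph_nat subrr.
move/eqP; rewrite mulf_eq0 subr_eq0 addr_eq0 => /orP[/eqP e|/eqP //].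
have := mul_conjC_ge0 kap; rewrite e -expr2 kap2 oppr_ge0 => h.
by have := le_lt_trans h (divr_gt0 (ltr0Sn K 2) (ltr0Sn K 15)); rewrite ltxx.
Qed.

Definition V4 (a b s t : K) : F := a *: w3 + b *: w4 + s *: ee + t *: cc.

Lemma cc_hmg : hmg 4 cc. Proof. by apply: hmgZ; exact: vv_hmg. Qed.
Lemma cc_kill : kill cc. Proof. by apply: (subspZ _ kill_subsp); exact: kill_vv. Qed.

Lemma V4_hmg a b s t : hmg 4 (V4 a b s t).
Proof.
do 3 (apply: hmgD; last by apply: hmgZ; first [exact: cc_hmg|exact: ee_hmg|exact: w4_hmg]).
by apply: hmgZ; exact: w3_hmg.
Qed.
Arguments V4_hmg : clear implicits.
Lemma V4_kill a b s t : kill (V4 a b s t).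
Proof.
have hs := @kill_subsp K F.
do 3 (apply: (subspD hs); last by apply: (subspZ _ hs); first [exact: cc_kill|exact: kill_ee|exact: kill_w4]).
by apply: (subspZ _ hs); exact: kill_w3.
Qed.

Lemma cc_adj : adj2 cc cc 0.
Proof.
have := adj2_lin kap (@adj_vv K F) (@adj2_0 K F).
by rewrite !scaler0 !addr0 /cc kapC scaleNr scalerN opprK.
Qed.

Lemma V4_adj a b s t : a^* = a -> b^* = b -> s^* = s -> t^* = t -> adj2 (V4 a b s t) (V4 a b s t) 0.
Proof.
move=> ha hb hs ht; have z (q : K) : q *: (0 : F) + 0 = 0 by rewrite scaler0 addr0.
have e : V4 a b s t = t *: cc + (s *: ee + (b *: w4 + (a *: w3 + 0))) by rewrite /V4; lmod.
have := adj2_lin t cc_adj (adj2_lin s (@adj_ee K F) (adj2_lin b (@adj_w4 K F) (adj2_lin a (@adj_w3 K F) (@adj2_0 K F)))).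
by rewrite !z ha hb hs ht -e.
Qed.

Section Comm.
Variables a b : F.
Hypotheses (ka : kill a) (kb : kill b) (ha : hmg 4 a) (hb : hmg 4 b).
(** a_(2) b lies in U_1 = 0. This removes the correction in skew-symmetry and makes U_2 a
    commutative algebra under the product (1). *)
Lemma U2_2 : Y a 2 b = 0.
Proof. by apply: kill_hmg2; [exact: kill_Y|apply: (hmg_eq (Y_hmg 2 ha hb))]. Qed.
Lemma U2_C : Y b 1 a = Y a 1 b.
Proof. by rewrite (skew1 ha hb) U2_2 (lin0 (@Tf_lin K F)) subr0. Qed.
End Comm.

(* mul3, mul4, mule, mulc are the coordinates of x_(1) y in the basis w3, w4, e, c
   of U_2, and frm is the invariant form. *)
Definition mul3 (a b s t a' b' s' t' : K) : K :=
  2%:R * a * a' + (a * s' + s * a') * (5%:R / 24%:R) - (b * s' + s * b') * (5%:R / 24%:R) + t * t' * (555%:R / 2048%:R).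
Definition mul4 (a b s t a' b' s' t' : K) : K :=
  2%:R * b * b' - (a * s' + s * a') * (7%:R / 24%:R) + (b * s' + s * b') * (7%:R / 24%:R) + t * t' * (147%:R / 256%:R).
Definition mule (a b s t a' b' s' t' : K) : K :=
  2%:R * s * s' + (a * s' + s * a') * (16%:R / 24%:R) + (b * s' + s * b') * (32%:R / 24%:R) - t * t' * (15%:R / 32%:R).
Definition mulc (a b s t a' b' s' t' : K) : K :=
  (a * t' + t * a') * (2%:R / 3%:R) + (b * t' + t * b') * (4%:R / 3%:R) + (s * t' + t * s') / 16%:R.
Definition frm (a b s t a' b' s' t' : K) : K :=
  a * a' * (2%:R / 5%:R) + b * b' * (3%:R / 7%:R) + s * s' / 4%:R + t * t' * (243%:R / 2048%:R)
  + (a * s' + s * a') / 16%:R + (b * s' + s * b') * (3%:R / 16%:R).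

Lemma V4_lin (k a b s t a' b' s' t' : K) : k *: V4 a b s t + V4 a' b' s' t' = V4 (k * a + a') (k * b + b') (k * s + s') (k * t + t').
Proof. rewrite /V4; lmod. Qed.

Lemma Y_bil4 (n : int) (p q r z : F) a b s t a' b' s' t' :
  Y (a *: p + b *: q + s *: r + t *: z) n (a' *: p + b' *: q + s' *: r + t' *: z) =
  a *: (a' *: Y p n p + b' *: Y p n q + s' *: Y p n r + t' *: Y p n z) +
  b *: (a' *: Y q n p + b' *: Y q n q + s' *: Y q n r + t' *: Y q n z) +
  s *: (a' *: Y r n p + b' *: Y r n q + s' *: Y r n r + t' *: Y r n z) +
  t *: (a' *: Y z n p + b' *: Y z n q + s' *: Y z n r + t' *: Y z n z).
Proof.
by rewrite !(linD (Y_linl _ _), linZ (Y_linl _ _)) !(linD (Y_lin _ _)) !(linZ (Y_lin _ _)).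
Qed.

Let C a b ka kb ha hb := @U2_C a b ka kb ha hb.

Lemma cccc : Y cc 1 cc = (555%:R / 2048%:R) *: w3 + (147%:R / 256%:R) *: w4 - (15%:R / 32%:R) *: ee.
Proof.
rewrite (linZ (Y_linl _ _)) (linZ (Y_lin _ _)) vvvv scalerA -expr2 kap2 !scalerDr !scalerA -scaleNr.
congr (_ *: _ + _ *: _ + _ *: _).
- by rewrite -[(-185)%:~R]/(- 185%:R : K); field.
- by rewrite -[(-392)%:~R]/(- 392%:R : K); field.
by rewrite -[320%:~R]/(320%:R : K); field.
Qed.

Lemma V4_mul a b s t a' b' s' t' : Y (V4 a b s t) 1 (V4 a' b' s' t') =
  V4 (mul3 a b s t a' b' s' t') (mul4 a b s t a' b' s' t') (mule a b s t a' b' s' t') (mulc a b s t a' b' s' t').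
Proof.
have k3 := @kill_w3 K F; have k4 := @kill_w4 K F; have ke := @kill_ee K F; have kc := cc_kill.
have h3 := @w3_hmg K F; have h4 := @w4_hmg K F; have he := @ee_hmg K F; have hc := cc_hmg.
have e33 : Y w3 1 w3 = 2%:R *: w3 by rewrite w3w3 two1.
have e44 : Y w4 1 w4 = 2%:R *: w4 by rewrite w4w4 two1.
have eEE : Y ee 1 ee = 2%:R *: ee by rewrite eeee two1.
have e34 : Y w3 1 w4 = 0 := @w3w4 K F.
have e43 : Y w4 1 w3 = 0 by rewrite C.
have n7 : (-7)%:~R = - 7%:R :> K by []. have n5 : (-5)%:~R = - 5%:R :> K by [].
have p5 : 5%:~R = 5%:R :> K by []. have p7 : 7%:~R = 7%:R :> K by [].
have p16 : 16%:~R = 16%:R :> K by []. have p32 : 32%:~R = 32%:R :> K by [].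
have e3e := @w3ee K F; rewrite p5 n7 p16 in e3e; have ee3 : Y ee 1 w3 = _ := etrans (C k3 ke h3 he) e3e.
have e4e := @w4ee K F; rewrite n5 p7 p32 in e4e; have ee4 : Y ee 1 w4 = _ := etrans (C k4 ke h4 he) e4e.
have e3c : Y w3 1 cc = (2%:R / 3%:R) *: cc by rewrite (linZ (Y_lin _ _)) w3vv !scalerA mulrC.
have e4c : Y w4 1 cc = (4%:R / 3%:R) *: cc by rewrite (linZ (Y_lin _ _)) w4vv !scalerA mulrC.
have eec : Y ee 1 cc = (1 / 16%:R) *: cc by rewrite (linZ (Y_lin _ _)) eevv !scalerA mulrC.
have ec3 : Y cc 1 w3 = _ := etrans (C k3 kc h3 hc) e3c.
have ec4 : Y cc 1 w4 = _ := etrans (C k4 kc h4 hc) e4c.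
have ece : Y cc 1 ee = _ := etrans (C ke kc he hc) eec.
rewrite {1 2}/V4 Y_bil4.
rewrite e33 e44 eEE e34 e43 e3e ee3 e4e ee4 e3c e4c eec ec3 ec4 ece cccc.
rewrite /V4 /mul3 /mul4 /mule /mulc.
move: (w3) (w4) (ee) (cc) => A B E D; lmod.
Qed.

Lemma V4_frm a b s t a' b' s' t' : Y (V4 a b s t) 3 (V4 a' b' s' t') = frm a b s t a' b' s' t' *: one.
Proof.
have k3 := @kill_w3 K F; have k4 := @kill_w4 K F; have ke := @kill_ee K F; have kc := cc_kill.
have h3 := @w3_hmg K F; have h4 := @w4_hmg K F; have he := @ee_hmg K F; have hc := cc_hmg.
have e33 := @w3_3 K F. have e44 := @w4_3 K F. have eEE := @ee_3 K F.
have e34 := @w34_3 K F. have e43 : Y w4 3 w3 = 0 by rewrite (skew3 h3 h4).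
have e3e := @w3e_3 K F. have ee3 : Y ee 3 w3 = _ := etrans (skew3 h3 he) e3e.
have e4e := @w4e_3 K F. have ee4 : Y ee 3 w4 = _ := etrans (skew3 h4 he) e4e.
have e3c : Y w3 3 cc = 0 by rewrite (linZ (Y_lin _ _)) w3v_3 scaler0.
have e4c : Y w4 3 cc = 0 by rewrite (linZ (Y_lin _ _)) w4v_3 scaler0.
have eec : Y ee 3 cc = 0 by rewrite (linZ (Y_lin _ _)) ev_3 scaler0.
have ec3 : Y cc 3 w3 = _ := etrans (skew3 h3 hc) e3c.
have ec4 : Y cc 3 w4 = _ := etrans (skew3 h4 hc) e4c.
have ece : Y cc 3 ee = _ := etrans (skew3 he hc) eec.
have ecc : Y cc 3 cc = (243%:R / 2048%:R) *: one.
  rewrite (linZ (Y_linl _ _)) (linZ (Y_lin _ _)) vv_3 !scalerA -expr2 kap2; congr (_ *: _).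
  by rewrite -[(-81)%:~R]/(- 81%:R : K); field.
rewrite /V4 Y_bil4.
rewrite e33 e44 eEE e34 e43 e3e ee3 e4e ee4 e3c e4c eec ec3 ec4 ece ecc /frm.
move: (one) => A; rewrite !scaler0 !scalerA; lmod.
Qed.

Definition half16 : K := 16%:R^-1.

Lemma V4_prim a b s t a' b' s' t' (q : K) :
  [/\ mul3 a b s t a' b' s' t' = q * a', mul4 a b s t a' b' s' t' = q * b', mule a b s t a' b' s' t' = q * s' &
    mulc a b s t a' b' s' t' = q * t'] -> frm a b s t a' b' s' t' = 0 -> prim (V4 a b s t) q (V4 a' b' s' t').
Proof.
move=> [e1 e2 e3 e4] e0; split.
  rewrite V4_mul e1 e2 e3 e4; have := V4_lin q a' b' s' t' 0 0 0 0; rewrite !addr0 => <-.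
  by have -> : V4 0 0 0 0 = 0 by [rewrite /V4 !scale0r !addr0]; rewrite addr0.
have hV := V4_hmg; have kV := V4_kill.
move=> n n2; have [->|n2'] := eqVneq n 2; first exact: U2_2.
have [->|n3] := eqVneq n 3; first by rewrite V4_frm e0 scale0r.
by apply: (w2_ge4 (hV _ _ _ _) (hV _ _ _ _)); lia.
Qed.

Lemma V4_conf a b s t : a^* = a -> b^* = b -> s^* = s -> t^* = t ->
  [/\ mul3 a b s t a b s t = 2%:R * a, mul4 a b s t a b s t = 2%:R * b, mule a b s t a b s t = 2%:R * s &
    mulc a b s t a b s t = 2%:R * t] -> frm a b s t a b s t = 4%:R^-1 -> conf (2%:R^-1) (V4 a b s t).
Proof.
move=> ha hb hs ht [e1 e2 e3 e4] e0; split; [exact: V4_hmg|exact: V4_adj| |].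
  rewrite V4_mul e1 e2 e3 e4; have := V4_lin 2%:R a b s t 0 0 0 0; rewrite !addr0 => <-.
  by have -> : V4 0 0 0 0 = 0 by [rewrite /V4 !scale0r !addr0]; rewrite addr0.
by rewrite V4_frm e0; congr (_ *: _); rewrite -invfM -natrM.
Qed.

Lemma realQ (m n : nat) : (m%:R / n%:R : K)^* = m%:R / n%:R. Proof. by rewrite fmorph_div /= !rmorph_nat. Qed.
Lemma realQN (m n : nat) : (- (m%:R / n%:R) : K)^* = - (m%:R / n%:R). Proof. by rewrite rmorphN /= realQ. Qed.

(* e, f, and the image of f under tau_e. *)
Definition e0 : F := V4 0 0 1 0.
Definition e1 : F := V4 (15%:R / 64%:R) (21%:R / 32%:R) (- (1%:R / 2%:R)) 1.
Definition e2 : F := V4 (15%:R / 64%:R) (21%:R / 32%:R) (- (1%:R / 2%:R)) (- 1).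

(* The decomposition of y into eigenvectors of x_(1), with eigenvalues 2, 0, 1/2
   and 1/16. *)
Definition tri x y z := exists b : F,
  [/\ conf (2%:R^-1) x /\ kill x, prim x 0 (om - x), prim x (2%:R^-1) b /\ kill b, prim x half16 (y - z) &
   y = (13%:R / 256%:R) *: x + (105%:R / 256%:R) *: (om - x) + (9%:R / 256%:R) *: b + (1 / 2%:R) *: (y - z)].

Definition chkp a b s t a' b' s' t' (q : K) : Prop :=
  [/\ mul3 a b s t a' b' s' t' = q * a', mul4 a b s t a' b' s' t' = q * b', mule a b s t a' b' s' t' = q * s' &
    mulc a b s t a' b' s' t' = q * t'].

Lemma omV4 : om = V4 1 1 0 0. Proof. by rewrite /V4 !scale1r !scale0r !addr0. Qed.

Lemma V4_cmp a b s t a' b' s' t' : a = a' -> b = b' -> s = s' -> t = t' -> V4 a b s t = V4 a' b' s' t'.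
Proof. by move=> -> -> -> ->. Qed.

Lemma triI a b s t a1 b1 s1 t1 a2 b2 s2 t2 :
  a^* = a -> b^* = b -> s^* = s -> t^* = t ->
  chkp a b s t a b s t 2%:R -> frm a b s t a b s t = 4%:R^-1 ->
  chkp a b s t (1 - a) (1 - b) (- s) (- t) 0 -> frm a b s t (1 - a) (1 - b) (- s) (- t) = 0 ->
  chkp a b s t (- 5%:R - 4%:R * a) (7%:R - 4%:R * b) (- (4%:R * s)) (- (4%:R * t)) (2%:R^-1) ->
  frm a b s t (- 5%:R - 4%:R * a) (7%:R - 4%:R * b) (- (4%:R * s)) (- (4%:R * t)) = 0 ->
  chkp a b s t (a1 - a2) (b1 - b2) (s1 - s2) (t1 - t2) half16 ->
  frm a b s t (a1 - a2) (b1 - b2) (s1 - s2) (t1 - t2) = 0 ->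
  (let y a a1 a2 om bb := a1 = (13%:R / 256%:R) * a + (105%:R / 256%:R) * (om - a) + (9%:R / 256%:R) * (bb - 4%:R * a) + (1 / 2%:R) * (a1 - a2) in
   [/\ y a a1 a2 1 (- 5%:R), y b b1 b2 1 7%:R, y s s1 s2 0 0 & y t t1 t2 0 0]) ->
  tri (V4 a b s t) (V4 a1 b1 s1 t1) (V4 a2 b2 s2 t2).
Proof.
move=> ra rb rs rt c1 f1 c2 f2 c3 f3 c4 f4 /= [y1 y2 y3 y4].
(* The eigenvector for 1/2 is -5 omega^3 + 7 omega^4 - 4 x, the same expression for x = e, f and
   f'. *)
exists (V4 (- 5%:R - 4%:R * a) (7%:R - 4%:R * b) (- (4%:R * s)) (- (4%:R * t))).
have eo : om - V4 a b s t = V4 (1 - a) (1 - b) (- s) (- t).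
  by rewrite addrC -scaleN1r omV4 V4_lin; apply: V4_cmp; ring.
have ed : V4 a1 b1 s1 t1 - V4 a2 b2 s2 t2 = V4 (a1 - a2) (b1 - b2) (s1 - s2) (t1 - t2).
  by rewrite addrC -scaleN1r V4_lin; apply: V4_cmp; ring.
split; first by split; [exact: V4_conf|exact: V4_kill].
- by rewrite eo; exact: V4_prim.
- by split; [exact: V4_prim|exact: V4_kill].
- by rewrite ed; exact: V4_prim.
rewrite eo ed -[(1 / 2%:R) *: _]addr0.
have {1}-> : (0 : F) = V4 0 0 0 0 by rewrite /V4 !scale0r !addr0.
rewrite -!addrA !V4_lin; apply: V4_cmp; [rewrite {1}y1|rewrite {1}y2|rewrite {1}y3|rewrite {1}y4]; ring.
Qed.

Ltac triT := apply: triI;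
  rewrite /chkp /mul3 /mul4 /mule /mulc /frm /half16 /=; rewrite ?realQ ?realQN ?rmorphN ?rmorph0 ?rmorph1 //;
  try (split; field); try field.

Lemma tri012 : tri e0 e1 e2. Proof. by triT. Qed.
Lemma tri021 : tri e0 e2 e1. Proof. by triT. Qed.
Lemma tri102 : tri e1 e0 e2. Proof. by triT. Qed.
Lemma tri120 : tri e1 e2 e0. Proof. by triT. Qed.
Lemma tri201 : tri e2 e0 e1. Proof. by triT. Qed.
Lemma sum_e : e0 + e1 + e2 = (15%:R / 32%:R) *: w3 + (21%:R / 16%:R) *: w4.
Proof.
transitivity (V4 (15%:R / 32%:R) (21%:R / 16%:R) 0 0); last by rewrite /V4 !scale0r !addr0.
rewrite -[e2]scale1r addrC -[e0]scale1r /e0 /e1 /e2 !V4_lin; by apply: V4_cmp; field.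
Qed.

(** * Absence of common singular vectors of weight at least two *)

Section NoSingular.
Variables (d : int) (N : F -> Prop).
Hypotheses (d4 : 4 <= d) (hN : subsp N) (Nk : forall v, N v -> kill v) (Nh : forall v, N v -> hmg d v).
Let D : K := d%:~R / 2%:R.

Definition admN x := forall v, N v -> N (Y x 1 v) /\ sing x v.

Lemma adm_split x : conf (2%:R^-1) x -> admN x -> forall v, N v -> exists v0 v1 v2,
  [/\ [/\ prim x 0 v0, prim x (2%:R^-1) v1 & prim x half16 v2], v = v0 + v1 + v2, N v0, N v1 & N v2].
Proof.
move=> cx ax v Nv; have [v0 [v1 [v2 [p0 p1 p2 e h]]]] := sing_split cx (ax v Nv).2.
have [n0 n1 n2] := h N hN (fun u Nu => (ax u Nu).1) Nv.
by exists v0, v1, v2.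
Qed.

Lemma half_real : (2%:R^-1 : K)^* = 2%:R^-1. Proof. by rewrite fmorphV /= rmorph_nat. Qed.
Lemma half16_real : half16^* = half16. Proof. by rewrite fmorphV /= rmorph_nat. Qed.

(** On N the operator x_(1) has orthogonal eigenspaces with eigenvalues 0, 1/2 and 1/16 only. *)
Lemma ip_half x : conf (2%:R^-1) x -> admN x -> forall v, N v -> ip (Y x 1 v) v <= 2%:R^-1 * ip v v.
Proof.
move=> cx ax v Nv; have [v0 [v1 [v2 [[p0 p1 p2] -> _ _ _]]]] := adm_split cx ax Nv.
have n01 : 0 != 2%:R^-1 :> K by rewrite eq_sym invr_eq0 pnatr_eq0.
have n02 : 0 != half16 :> K by rewrite eq_sym invr_eq0 pnatr_eq0.
have n12 : 2%:R^-1 != half16 :> K.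
  by apply/eqP => /(congr1 (fun z => z^-1)) /eqP; rewrite !invrK eqr_nat.
have o01 : ip v0 v1 = 0 := eig_orth cx p0.1 p1.1 half_real n01.
have o02 : ip v0 v2 = 0 := eig_orth cx p0.1 p2.1 half16_real n02.
have o12 : ip v1 v2 = 0 := eig_orth cx p1.1 p2.1 half16_real n12.
have o10 : ip v1 v0 = 0 by rewrite ip_sym o01 rmorph0.
have o20 : ip v2 v0 = 0 by rewrite ip_sym o02 rmorph0.
have o21 : ip v2 v1 = 0 by rewrite ip_sym o12 rmorph0.
rewrite !(linD (Y_lin _ _)) p0.1 p1.1 p2.1 scale0r add0r !(ipDl, ipDr, ipZl) o01 o02 o12 o10 o20 o21.
rewrite !mulr0 !(addr0, add0r) !mulrDr lerD// ?ler_wpM2r ?ip_ge0//.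
  by rewrite lerDr mulr_ge0 ?ip_ge0 ?invr_ge0 ?ler0n.
by rewrite lef_pV2 ?posrE ?ltr0n// ler_nat.
Qed.

Lemma om_N v : N v -> Y om 1 v = D *: v.
Proof. by move=> Nv; apply: om_hmg; [exact: Nk|exact: Nh]. Qed.

Lemma D2 : 2%:R <= D.
Proof. by rewrite ler_pdivlMr ?ltr0n// -natrM -[(2 * 2)%:R]/((4 : int)%:~R) ler_int. Qed.

Lemma Dr : exists2 r : K, 0 <= r & D = 2%:R + r.
Proof. by exists (D - 2%:R); rewrite ?subr_ge0 ?D2// addrC subrK. Qed.

(* The components of y of eigenvalue 1/2 and 1/16 do not contribute, by the
   fusion rules of x. *)
Lemma N_mean x y z v (t : K) : tri x y z -> N v -> prim x t v -> pv false t ->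
  ip (Y y 1 v) v = (13%:R / 256%:R * t + 105%:R / 256%:R * (D - t)) * ip v v.
Proof.
move=> [b [[cx kx] po [pb kb] pd ey]] Nv pvv ht; rewrite ey !(linD (Y_linl _ _)) !(linZ (Y_linl _ _)) (linB (Y_linl _ _)).
have f1 := fusion_half cx 1 ht pb pvv pvv.
have f2 : ip (Y (y - z) 1 v) v = 0 := @fusion K F x cx false true false t half16 t _ _ _ 1 ht erefl ht pd pvv pvv isT.
by rewrite (om_N Nv) pvv.1 !(ipDl, ipZl, ipBl, ipNl) f1 f2; ring.
Qed.

(** If v has x_(1)-eigenvalue t = 0 or 1/2, the mean of y_(1) on it is 13 t/256 + 105 (D - t)/256,
    which exceeds 1/2 since the weight D is at least 2; this contradicts [ip_half] for y. Only the
    eigenvalue 1/16 remains. *)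
Lemma N_16 x y z v : tri x y z -> admN x -> admN y -> conf (2%:R^-1) y -> N v -> Y x 1 v = half16 *: v.
Proof.
move=> ht ax ay cy Nv; have [b [[cx _] _ _ _ _]] := ht.
have [v0 [v1 [v2 [[p0 p1 p2] -> n0 n1 n2]]]] := adm_split cx ax Nv.
have small t u : pv false t -> N u -> prim x t u ->
    0 < 13%:R / 256%:R * t + 105%:R / 256%:R * (D - t) - 2%:R^-1 -> u = 0.
  move=> pt Nu pu hlt; have := ip_half cy ay Nu; rewrite (N_mean ht Nu pu pt) -subr_le0 -mulrBl => h.
  apply/eqP; rewrite -ip_eq0; have := ip_ge0 u; rewrite le_eqVlt eq_sym => /orP[//|h'].
  by have := le_lt_trans h (mulr_gt0 hlt h'); rewrite ltxx.
have r0 : v0 = 0.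
  apply: (small 0 v0) => //; first by left.
  have [r q0 ->] := Dr; have -> : 13%:R / 256%:R * 0 + 105%:R / 256%:R * (2%:R + r - 0) - 2%:R^-1 = 105%:R / 256%:R * r + 82%:R / 256%:R :> K by field.
  by apply: ltr_wpDl; rewrite ?mulr_ge0 ?divr_gt0 ?invr_ge0 ?ler0n ?ltr0n.
have r1 : v1 = 0.
  apply: (small (2%:R^-1) v1) => //; first by right.
  have [r q0 ->] := Dr; have -> : 13%:R / 256%:R * 2%:R^-1 + 105%:R / 256%:R * (2%:R + r - 2%:R^-1) - 2%:R^-1 = 105%:R / 256%:R * r + 72%:R / 512%:R :> K by field.
  by apply: ltr_wpDl; rewrite ?mulr_ge0 ?divr_gt0 ?invr_ge0 ?ler0n ?ltr0n.
by rewrite r0 r1 !add0r; exact: p2.1.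
Qed.

(** e + f + f' acts on v as 3/16. But it equals 15/32 omega + 27/32 omega^4, whose mean is at least
    15/16 times the squared norm, because D >= 2 and omega^4_(1) has nonnegative mean. *)
Lemma N_zero : admN e0 -> admN e1 -> admN e2 -> admN w4 -> forall v, N v -> v = 0.
Proof.
move=> a0 a1 a2 a4 v Nv; have [c0 [c1 c2]] : conf (2%:R^-1) e0 /\ conf (2%:R^-1) e1 /\ conf (2%:R^-1) e2.
  by split; [have [b [[]]] := tri012|split; [have [b [[]]] := tri102|have [b [[]]] := tri201]].
have E0 := N_16 tri012 a0 a1 c1 Nv; have E1 := N_16 tri102 a1 a0 c0 Nv; have E2 := N_16 tri201 a2 a0 c0 Nv.
have [c4 h4] := @conf_w4 K F.
(* On singular vectors |L_(-1) v|^2 = 2 <v, L_0 v> for the Virasoro algebra of omega^4. *)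
have pos : 0 <= ip (Y w4 1 v) v.
  have := ip_ge0 (Y w4 0 v); rewrite (conf_adjE h4) subr0 (L1Lm1 h4) (a4 v Nv).2// (lin0 (Y_lin _ _)) add0r ipMzr.
  by rewrite -mulrzr pmulr_lge0 ?ltr0z// -(conf_adjE h4 1).
have S : Y (e0 + e1 + e2) 1 v = (3%:R / 16%:R) *: v.
  have l3 a b c : Y (a + b + c) 1 v = Y a 1 v + Y b 1 v + Y c 1 v by rewrite !(linD (Y_linl _ _)).
  rewrite l3 E0 E1 E2 /half16; lmod.
have := om_N Nv; rewrite (linD (Y_linl _ _)) => ho.
move: S; rewrite sum_e (linD (Y_linl _ _)) !(linZ (Y_linl _ _)).
have -> : Y w3 1 v = D *: v - Y w4 1 v by rewrite -ho addrK.
move=> /(congr1 (fun u => ip u v)); rewrite !(ipDl, ipZl, ipBl, ipNl) => e.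
have [r r0 hD] := Dr; rewrite hD in e; set I := ip v v in e; set W := ip _ v in e pos.
have : (15%:R / 32%:R * r + 24%:R / 32%:R) * I + 27%:R / 32%:R * W = 0.
  transitivity (15%:R / 32%:R * ((2%:R + r) * I - W) + 21%:R / 16%:R * W - 3%:R / 16%:R * I); first by field.
  by rewrite e subrr.
have c0' : 0 < 15%:R / 32%:R * r + 24%:R / 32%:R.
  by apply: ltr_wpDl; rewrite ?mulr_ge0 ?divr_gt0 ?invr_ge0 ?ler0n ?ltr0n.
move/eqP; rewrite paddr_eq0 ?mulr_ge0 ?ip_ge0 ?(ltW c0') ?invr_ge0 ?ler0n// => /andP[+ _].
by rewrite mulf_eq0 gt_eqF//= ip_eq0 => /eqP.
Qed.

End NoSingular.

Lemma e0E : e0 = ee. Proof. by rewrite /e0 /V4 !scale0r scale1r !add0r addr0. Qed.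

Lemma w4V : w4 = V4 0 1 0 0. Proof. by rewrite /V4 !scale0r scale1r add0r !addr0. Qed.

Lemma V4_subsp (P : F -> Prop) : subsp P -> P e0 -> P e1 -> P e2 -> P w4 -> forall a b s t, P (V4 a b s t).
Proof.
move=> hP h0 h1 h2 h4 a b s t; rewrite e0E in h0.
have hc : P cc.
  have -> : cc = (1 / 2%:R) *: (e1 - e2); last by apply: (subspZ _ hP); exact: subspB.
  rewrite -scaleN1r /e1 /e2 addrC V4_lin -[_ *: _]addr0 (_ : 0 = V4 0 0 0 0); last by rewrite /V4 !scale0r !addr0.
  transitivity (V4 0 0 0 1); first by rewrite /V4 !scale0r scale1r !add0r.
  by rewrite V4_lin; apply: V4_cmp; field.
have h3 : P w3.
  have -> : w3 = (32%:R / 15%:R) *: (e0 + e1 + e2 - (21%:R / 16%:R) *: w4).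
    by rewrite sum_e addrK scalerA (_ : 32%:R / 15%:R * _ = 1) ?scale1r//; field.
  by apply: (subspZ _ hP); apply: subspB => //; [rewrite e0E; do 2 apply: subspD => //|exact: subspZ].
by do 3 (apply: (subspD hP); last exact: subspZ); exact: subspZ.
Qed.

Definition closedY (P : F -> Prop) := forall u v n, P u -> P v -> P (Y u n v).

(** The orthogonal complement of the four known vectors in U_2 is stable and singular for e, f, f'
    and omega^4, so [N_zero] applies to it in doubled weight 4. *)
Lemma U2_span u : kill u -> hmg 4 u -> exists a b s t, u = V4 a b s t.
Proof.
move=> ku hu; pose W v := exists a b s t, v = V4 a b s t.
have hW : subsp W.
  split; first by exists 0, 0, 0, 0; rewrite /V4 !scale0r !addr0.
  by move=> k x y [a [b [s [t ->]]]] [a' [b' [s' [t' ->]]]]; rewrite V4_lin; do 4 eexists.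
have [B hB] := deg2_fin 4.
have WB w b : W w -> cf w b != 0 -> b \in B by move=> [a [b' [s [t ->]]]] nz; apply: hB; exact: V4_hmg nz.
have [w Ww hw] := orth_proj hW WB u; suff e : u - w = 0 by move/eqP: e; rewrite subr_eq0 => /eqP ->.
pose N v := [/\ kill v, hmg 4 v & forall w', W w' -> ip v w' = 0].
have hN : subsp N.
  split; first by split; [exact: kill0|exact: hmg0|move=> w' _; exact: ip0l].
  move=> k x y [x1 x2 x3] [y1 y2 y3]; split; [exact: kill_lin|by apply: hmgD => //; exact: hmgZ|].
  by move=> w' hw'; rewrite ip_lin x3// y3// mulr0 addr0.
have Nu : N (u - w).
  have [kw hhw] : kill w /\ hmg 4 w by case: Ww => a [b [s [t ->]]]; split; [exact: V4_kill|exact: V4_hmg].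
  by split=> //; [apply: (subspB (@kill_subsp K F))|exact: hmgB].
have adm a b s t : a^* = a -> b^* = b -> s^* = s -> t^* = t -> admN N (V4 a b s t).
  move=> ra rb rs rt v [v1 v2 v3]; have aj n := V4_adj ra rb rs rt n.
  have aj' n z z' : ip (Y (V4 a b s t) n z) z' = ip z (Y (V4 a b s t) (2 - n) z').
    by rewrite aj (lin0 (Y_linl _ _)) addr0.
  split.
    split; [apply: kill_Y => //; exact: V4_kill|by apply: (hmg_eq (Y_hmg 1 (V4_hmg a b s t) v2))|].
    move=> w' [a' [b' [s' [t' ->]]]]; rewrite aj' -[2 - 1]/(1 : int) V4_mul; apply: v3; by do 4 eexists.
  move=> n n2; have [->|n2'] := eqVneq n 2; first by apply: (U2_2 (V4_kill _ _ _ _) v1 (V4_hmg _ _ _ _) v2).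
  have [->|n3] := eqVneq n 3; last by apply: (w2_ge4 (V4_hmg _ _ _ _) v2); lia.
  (* x_(3) v is a multiple of the vacuum, so its norm reduces to <v, x_(-1) 1> = <v, x>, which is
     zero. *)
  have [q e] := wt2_3 (V4_hmg a b s t) v2; apply/eqP; rewrite -ip_eq0 {2}e ipZr aj'.
  by rewrite -[2 - 3]/(-1 : int) Y_vac v3 ?mulr0//; do 4 eexists.
have r k : (k%:R : K)^* = k%:R := rmorph_nat _ k.
apply: (N_zero (d := 4) (N := N)) Nu => //; try by move=> v [].
4: rewrite w4V.
all: by apply: adm; rewrite ?realQ ?realQN ?rmorph0 ?rmorphN ?rmorph1.
Qed.

Theorem generation (P : F -> Prop) : subsp P -> P one -> closedY P -> P e0 -> P e1 -> P e2 -> P w4 ->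
  forall u, kill u -> P u.
Proof.
move=> hP P1 PY p0 p1 p2 p4; apply: (graded_ind hP) => d hlow r kr hr ho.
have PV := V4_subsp hP p0 p1 p2 p4.
have [r0|r0] := eqVneq r 0; first by rewrite r0; exact: hP.1.
have [n en d0] := hmg_odd hr r0.
have [d00|dn0] := eqVneq d 0.
  by rewrite d00 in hr; have [q ->] := hmg0_one hr; exact: subspZ.
have [d2|dn2] := eqVneq d 2; first by rewrite d2 in hr; move/eqP: r0; rewrite (kill_hmg2 kr hr).
have [d4|dn4] := eqVneq d 4.
  by rewrite d4 in hr; have [a [b [s [t ->]]]] := U2_span kr hr; exact: PV.
pose N v := [/\ kill v, hmg d v & forall w, kill w -> hmg d w -> P w -> ip v w = 0].
have hN : subsp N.
  split; first by split; [exact: kill0|exact: hmg0|move=> w' *; exact: ip0l].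
  move=> k x y [x1 x2 x3] [y1 y2 y3]; split; [exact: kill_lin|by apply: hmgD => //; exact: hmgZ|].
  by move=> w' *; rewrite ip_lin x3// y3// mulr0 addr0.
have adm a b s t : a^* = a -> b^* = b -> s^* = s -> t^* = t -> admN N (V4 a b s t).
  move=> ra rb rs rt v [v1 v2 v3]; have aj m := V4_adj ra rb rs rt m.
  have aj' m z z' : ip (Y (V4 a b s t) m z) z' = ip z (Y (V4 a b s t) (2 - m) z').
    by rewrite aj (lin0 (Y_linl _ _)) addr0.
  have hY m e z : hmg e z -> hmg (e + 2 - 2 * m) (Y (V4 a b s t) m z).
    by move=> hz; apply: (hmg_eq (Y_hmg m (V4_hmg a b s t) hz)); ring.
  have kY m z : kill z -> kill (Y (V4 a b s t) m z) by move=> ?; apply: kill_Y => //; exact: V4_kill.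
  split.
    split; [exact: kY|by apply: (hmg_eq (hY 1 _ _ v2)); ring|].
    move=> w' k1 k2 k3; rewrite aj' -[2 - 1]/(1 : int); apply: v3; [exact: kY| |exact: PY].
    by apply: (hmg_eq (hY 1 _ _ k2)); ring.
  move=> m m2; apply/eqP; rewrite -ip_eq0 aj'; apply/eqP; apply: v3; first exact: (kY _ _ (kY _ _ v1)).
    by apply: (hmg_eq (hY _ _ _ (hY m _ _ v2))); ring.
  by apply: PY => //; apply: (hlow (d + 2 - 2 * m)); [lia|exact: kY|exact: hY].
have Nr : N r by split.
have -> : r = 0; last exact: hP.1.
apply: (N_zero (d := d) (N := N)) Nr => //; try by move=> v [].
  by lia.
4: rewrite w4V.
all: by apply: adm; rewrite ?realQ ?realQN ?rmorph0 ?rmorphN ?rmorph1.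
Qed.

Lemma one_neq0 : one != 0 :> F.
Proof. by apply/eqP => /(congr1 (fun u => cf u (mset0, 0))) /eqP; rewrite cfb eqxx cf0 oner_eq0. Qed.

(** The Gram matrix of omega^3, omega^4, e, c is nondegenerate. *)
Lemma V4_0 a b s t : V4 a b s t = 0 -> [/\ a = 0, b = 0, s = 0 & t = 0].
Proof.
move=> e; have z a' b' s' t' : frm a b s t a' b' s' t' = 0.
  have := V4_frm a b s t a' b' s' t'; rewrite e (lin0 (Y_linl _ _)) => /esym/eqP.
  by rewrite scaler_eq0 (negPf one_neq0) orbF => /eqP.
have z3 := z 1 0 0 0; have z4 := z 0 1 0 0; have ze := z 0 0 1 0; have zc := z 0 0 0 1.
rewrite /frm !(mulr0, mulr1, addr0, add0r, mul0r) in z3 z4 ze zc.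
have hs : s = 0.
  (* Eliminating a and b from the three pairings leaves 81/512 times s. *)
  transitivity (512%:R / 81%:R * ((s / 4%:R + a / 16%:R + b * (3%:R / 16%:R)) - 5%:R / 32%:R * (a * (2%:R / 5%:R) + s / 16%:R)
    - 7%:R / 16%:R * (b * (3%:R / 7%:R) + s * (3%:R / 16%:R)))); first by field.
  by rewrite z3 z4 ze !mulr0 !subr0 mulr0.
rewrite hs !mul0r !addr0 in z3 z4; split=> //.
- by move/eqP: z3; rewrite mulf_eq0 mulf_eq0 invr_eq0 !(negPf (nz _)) !orbF => /eqP.
- by move/eqP: z4; rewrite mulf_eq0 mulf_eq0 invr_eq0 !(negPf (nz _)) !orbF => /eqP.
by move/eqP: zc; rewrite mulf_eq0 mulf_eq0 invr_eq0 !(negPf (nz _)) !orbF => /eqP.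
Qed.

Lemma V4_inj a b s t a' b' s' t' : V4 a b s t = V4 a' b' s' t' -> [/\ a = a', b = b', s = s' & t = t'].
Proof.
move=> e; have : V4 (a - a') (b - b') (s - s') (t - t') = 0.
  have e' : V4 a b s t - V4 a' b' s' t' = V4 (a - a') (b - b') (s - s') (t - t').
    by rewrite addrC -scaleN1r V4_lin; apply: V4_cmp; ring.
  by rewrite -e' e subrr.
by move=> /V4_0[] /eqP + /eqP + /eqP + /eqP; rewrite !subr_eq0 => /eqP-> /eqP-> /eqP-> /eqP->.
Qed.

(* Taking the form of x_(1) x = 2 x with omega gives a linear equation, so that
   the remaining quadratic equations reduce to one unknown. *)
Lemma ising_sol a b s t : chkp a b s t a b s t 2%:R -> frm a b s t a b s t = 4%:R^-1 ->
  [\/ V4 a b s t = e0, V4 a b s t = e1 | V4 a b s t = e2].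
Proof.
move=> [E3 E4 Ee Ec] f.
have L2 : a * (2%:R / 5%:R) + b * (3%:R / 7%:R) + s / 4%:R = 4%:R^-1.
  transitivity (2%:R^-1 * (2%:R / 5%:R * (2%:R * a) + 3%:R / 7%:R * (2%:R * b) + 4%:R^-1 * (2%:R * s))); first by field.
  rewrite -[RHS]f -E3 -E4 -Ee /mul3 /mul4 /mule /frm; by field.
rewrite /mul3 /mul4 /mule /mulc in E3 E4 Ee Ec.
have [t0|tn] := eqVneq t 0.
  rewrite t0 in E3 E4 Ee *; have [s0|sn] := eqVneq s 0.
    rewrite s0 in E3 E4 L2.
    have ha : a * (a - 1) = 0.
      transitivity (2%:R^-1 * ((2%:R * a * a + (a * 0 + 0 * a) * (5%:R / 24%:R) - (b * 0 + 0 * b) * (5%:R / 24%:R) + 0 * 0 * (555%:R / 2048%:R)) - 2%:R * a)); first by field.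
      by rewrite E3 subrr mulr0.
    have hb : b * (b - 1) = 0.
      transitivity (2%:R^-1 * ((2%:R * b * b - (a * 0 + 0 * a) * (7%:R / 24%:R) + (b * 0 + 0 * b) * (7%:R / 24%:R) + 0 * 0 * (147%:R / 256%:R)) - 2%:R * b)); first by field.
      by rewrite E4 subrr mulr0.
    (* Multiplied by 140 the linear equation asks for 35, while the four candidates with s = t = 0
       give 0, 60, 56 and 116. *)
    have bad (n m : nat) : n != m -> n%:R = m%:R :> K -> False by move=> nm /eqP; rewrite eqr_nat (negPf nm).
    move/eqP: ha; rewrite mulf_eq0 subr_eq0 => /orP[] /eqP ha; move/eqP: hb; rewrite mulf_eq0 subr_eq0 => /orP[] /eqP hb;
      exfalso; rewrite ha hb in L2.
    - by apply: (bad 0%N 35%N) => //; transitivity (140%:R * (0 * (2%:R / 5%:R) + 0 * (3%:R / 7%:R) + 0 / 4%:R) : K); [field|rewrite L2; field].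
    - by apply: (bad 60%N 35%N) => //; transitivity (140%:R * (0 * (2%:R / 5%:R) + 1 * (3%:R / 7%:R) + 0 / 4%:R) : K); [field|rewrite L2; field].
    - by apply: (bad 56%N 35%N) => //; transitivity (140%:R * (1 * (2%:R / 5%:R) + 0 * (3%:R / 7%:R) + 0 / 4%:R) : K); [field|rewrite L2; field].
    - by apply: (bad 116%N 35%N) => //; transitivity (140%:R * (1 * (2%:R / 5%:R) + 1 * (3%:R / 7%:R) + 0 / 4%:R) : K); [field|rewrite L2; field].
  have L3 : s + 2%:R / 3%:R * a + 4%:R / 3%:R * b = 1.
    by apply: (mulfI (mulf_neq0 (nz 1) sn)); rewrite mulr1 -[RHS]Ee; field.
  have ha : a = 5%:R / 13%:R * (s - 1).
    transitivity (70%:R / 13%:R * (a * (2%:R / 5%:R) + b * (3%:R / 7%:R) + s / 4%:R - 9%:R / 28%:R * (s + 2%:R / 3%:R * a + 4%:R / 3%:R * b) + 9%:R / 28%:R * s - s / 4%:R)); first by field.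
    by rewrite L2 L3; field.
  have hb : b = - (49%:R / 52%:R) * (s - 1).
    transitivity (3%:R / 4%:R * (s + 2%:R / 3%:R * a + 4%:R / 3%:R * b - s) - a / 2%:R); first by field.
    by rewrite L3 ha; field.
  have hs : s = 1.
    apply/eqP; rewrite -subr_eq0; apply/eqP.
    (* The combination of the equations for omega^3 and omega^4 that cancels the quadratic terms in
       s - 1; what is left is a nonzero multiple of s - 1. *)
    transitivity (- (281216%:R / 326025%:R) * (2709%:R / 2704%:R * ((2%:R * a * a + (a * s + s * a) * (5%:R / 24%:R) - (b * s + s * b) * (5%:R / 24%:R) + 0 * 0 * (555%:R / 2048%:R)) - 2%:R * a)
      - 2295%:R / 2704%:R * ((2%:R * b * b - (a * s + s * a) * (7%:R / 24%:R) + (b * s + s * b) * (7%:R / 24%:R) + 0 * 0 * (147%:R / 256%:R)) - 2%:R * b))).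
      by rewrite ha hb; field.
    by rewrite E3 E4 !subrr !mulr0 subrr mulr0.
  by constructor 1; apply: V4_cmp; rewrite ?ha ?hb ?hs ?subrr ?mulr0.
have L1 : 2%:R / 3%:R * a + 4%:R / 3%:R * b + s / 16%:R = 1.
  by apply: (mulfI (mulf_neq0 (nz 1) tn)); rewrite mulr1 -[RHS]Ec; field.
have ha : a = - (5%:R / 13%:R) - 515%:R / 416%:R * s.
  transitivity (70%:R / 13%:R * (a * (2%:R / 5%:R) + b * (3%:R / 7%:R) + s / 4%:R - 9%:R / 28%:R * (2%:R / 3%:R * a + 4%:R / 3%:R * b + s / 16%:R) + 9%:R / 448%:R * s - s / 4%:R)); first by field.
  by rewrite L2 L1; field.
have hb : b = 49%:R / 52%:R + 119%:R / 208%:R * s.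
  transitivity (3%:R / 4%:R * (2%:R / 3%:R * a + 4%:R / 3%:R * b + s / 16%:R - s / 16%:R) - a / 2%:R); first by field.
  by rewrite L1 ha; field.
have hT : t * t = 4%:R * s * s.
  transitivity (32%:R / 15%:R * (2%:R * s * s + (a * s + s * a) * (16%:R / 24%:R) + (b * s + s * b) * (32%:R / 24%:R)
   - (2%:R * s * s + (a * s + s * a) * (16%:R / 24%:R) + (b * s + s * b) * (32%:R / 24%:R) - t * t * (15%:R / 32%:R)))); first by field.
  by rewrite Ee ha hb; field.
have hs : s = - (1 / 2%:R).
  apply/eqP; rewrite -subr_eq0 opprK; apply/eqP.
  (* Again the terms in s^2 cancel between the two equations, and a nonzero multiple of s + 1/2
     remains. *)
  transitivity (35152%:R / 326025%:R * (2709%:R / 676%:R * ((2%:R * a * a + (a * s + s * a) * (5%:R / 24%:R) - (b * s + s * b) * (5%:R / 24%:R) + t * t * (555%:R / 2048%:R)) - 2%:R * a)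
      - 2295%:R / 676%:R * ((2%:R * b * b - (a * s + s * a) * (7%:R / 24%:R) + (b * s + s * b) * (7%:R / 24%:R) + t * t * (147%:R / 256%:R)) - 2%:R * b))).
    by rewrite hT ha hb; field.
  by rewrite E3 E4 !subrr !mulr0 subrr mulr0.
have a15 : a = 15%:R / 64%:R by rewrite ha hs; field.
have b21 : b = 21%:R / 32%:R by rewrite hb hs; field.
have : (t - 1) * (t + 1) = 0.
  transitivity (t * t - 1); first by ring.
  by rewrite hT hs; field.
move/eqP; rewrite mulf_eq0 subr_eq0 addr_eq0 => /orP[] /eqP ht; rewrite a15 b21 hs ht.
  by constructor 2.
by constructor 3.
Qed.

(** * Automorphisms acting on the three conformal vectors *)

Definition autF (g : F -> F) : Prop :=
  [/\ forall u, kill u -> kill (g u) /\ (g u = 0 -> u = 0),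
      forall (k : K) u v, kill u -> kill v -> g (k *: u + v) = k *: g u + g v,
      g one = one, g om = om &
      forall u v n, kill u -> kill v -> g (Y u n v) = Y (g u) n (g v)].

Lemma om_kill : kill om. Proof. exact: (subspD (@kill_subsp K F) (@kill_w3 K F) (@kill_w4 K F)). Qed.
Lemma om_hmg4 : hmg 4 om. Proof. by apply: hmgD; [exact: w3_hmg|exact: w4_hmg]. Qed.

Section AutF.
Variable g : F -> F.
Hypothesis hg : autF g.
Let gk u : kill u -> kill (g u). Proof. by case: hg => h _ _ _ _ /h[]. Qed.
Let glin k u v : kill u -> kill v -> g (k *: u + v) = k *: g u + g v.
Proof. by case: hg => _ h _ _ _; exact: h. Qed.
Let g1 : g one = one. Proof. by case: hg. Qed.
Let gom : g om = om. Proof. by case: hg. Qed.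
Let gY u v n : kill u -> kill v -> g (Y u n v) = Y (g u) n (g v).
Proof. by case: hg => _ _ _ _ h; exact: h. Qed.
Let k0 := @kill0 K F.

Lemma g0 : g 0 = 0.
Proof. by have := glin (-1) k0 k0; rewrite scaler0 addr0 scaleN1r addNr. Qed.
Lemma gZ k u : kill u -> g (k *: u) = k *: g u.
Proof. by move=> ku; have := glin k ku k0; rewrite g0 !addr0. Qed.
Lemma gD u v : kill u -> kill v -> g (u + v) = g u + g v.
Proof. by move=> ku kv; have := glin 1 ku kv; rewrite !scale1r. Qed.
Lemma g_inj u v : kill u -> kill v -> g u = g v -> u = v.
Proof.
move=> ku kv e; have kd : kill (u - v) by exact: (subspB (@kill_subsp K F)).
apply/eqP; rewrite -subr_eq0; apply/eqP; case: hg => h _ _ _ _; apply: (h _ kd).2.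
by rewrite addrC -scaleN1r glin// e scaleN1r addNr.
Qed.

(** g fixes omega, so it commutes with omega_(1), whose eigenspaces on U are the weight spaces. *)
Lemma g_hmg4 u : kill u -> hmg 4 u -> hmg 4 (g u).
Proof.
move=> ku hu; have e : Y om 1 (g u) = 2%:R *: g u.
  rewrite -{1}gom -gY//; last exact: om_kill.
  rewrite (om_hmg ku hu) gZ//; congr (_ *: _).
  by rewrite -[4%:~R]/(4%:R : K); field.
have hd d : d != 4 -> pr d (g u) = 0.
  move=> d4; have kp := kill_pr d (gk ku); have hp := @pr_hmg K F d (g u).
  have := om_hmg kp hp; rewrite -(@pr_comm K F) ?e; first last.
  - by move=> e' v hv; apply: (hmg_eq (Y_hmg 1 om_hmg4 hv)); ring.
  - exact: Y_lin.
  rewrite (linZ (@pr_lin K F d)) => /eqP; rewrite -subr_eq0 -scalerBl scaler_eq0 => /orP[|/eqP //].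
  rewrite subr_eq0 => /eqP /(congr1 (fun z => z * 2%:R)); rewrite mulfVK ?nz// -natrM => /eqP.
  by rewrite -[(2 * 2)%:R]/((4 : int)%:~R) eqr_int eq_sym (negPf d4).
have [r [_ ->]] := pr_sum (g u); apply: hmg_sum => d _.
have [->|d4] := eqVneq d 4; first exact: pr_hmg.
by rewrite hd//; exact: hmg0.
Qed.

Definition isE x := [\/ x = e0, x = e1 | x = e2].

Lemma g_isE x : kill x -> conf (2%:R^-1) x -> isE (g x).
Proof.
move=> kx cx; have [a [b [s [t e]]]] := U2_span (gk kx) (g_hmg4 kx (conf_hmg cx)).
rewrite /isE e; apply: ising_sol.
  have : Y (g x) 1 (g x) = 2%:R *: g x by rewrite -gY// (conf_1 cx) gZ.
  rewrite e V4_mul => h; have := V4_lin 2%:R a b s t 0 0 0 0; rewrite !addr0.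
  have -> : V4 0 0 0 0 = 0 by rewrite /V4 !scale0r !addr0.
  by rewrite addr0 -h => /V4_inj[*]; split.
have : Y (g x) 3 (g x) = 4%:R^-1 *: one.
  rewrite -gY// (conf_3 cx) gZ ?g1; last exact: kill_one.
  by congr (_ *: _); rewrite -invfM -natrM.
rewrite e V4_frm => /eqP; rewrite -subr_eq0 -scalerBl scaler_eq0 (negPf one_neq0) orbF subr_eq0.
by move/eqP.
Qed.
End AutF.

Lemma conf_e0 : conf (2%:R^-1) e0. Proof. by have [b [[]]] := tri012. Qed.
Lemma conf_e1 : conf (2%:R^-1) e1. Proof. by have [b [[]]] := tri102. Qed.
Lemma conf_e2 : conf (2%:R^-1) e2. Proof. by have [b [[]]] := tri201. Qed.

Lemma e01 : e0 <> e1.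
Proof. by move=> /V4_inj[_ _ _ /eqP]; rewrite eq_sym oner_eq0. Qed.
Lemma e02 : e0 <> e2.
Proof. by move=> /V4_inj[_ _ _ /eqP]; rewrite eq_sym oppr_eq0 oner_eq0. Qed.
Lemma e12 : e1 <> e2.
Proof. by move=> /V4_inj[_ _ _ /eqP]; rewrite -subr_eq0 opprK -[1 + 1]/(2%:R) pnatr_eq0. Qed.

(** The vectors of U on which g and h agree form a subalgebra. It contains omega^4 = 32/27 (e + f +
    f') - 15/27 omega, and e, f, f', omega^4 generate U. *)
Lemma aut_agree g h : autF g -> autF h -> g e0 = h e0 -> g e1 = h e1 -> g e2 = h e2 ->
  forall u, kill u -> g u = h u.
Proof.
move=> hg hh a0 a1 a2 u ku; pose P v := kill v /\ g v = h v.
have [ke0 ke1 ke2] : [/\ kill e0, kill e1 & kill e2] by split; exact: V4_kill.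
have hP : subsp P.
  split; first by split; [exact: kill0|rewrite (g0 hg) (g0 hh)].
  move=> k x y [k1 x1] [k2 y1]; split; first exact: kill_lin.
  by case: hg hh => _ lg _ _ _ [_ lh _ _ _]; rewrite lg// lh// x1 y1.
suff [] : P u by [].
apply: (generation hP) => //.
- by split; [exact: kill_one|case: hg hh => _ _ -> _ _ [_ _ -> _ _]].
- move=> x y n [k1 x1] [k2 y1]; split; first exact: kill_Y.
  by case: hg hh => _ _ _ _ Yg [_ _ _ _ Yh]; rewrite Yg// Yh// x1 y1.
have k4 := @kill_w4 K F; have ko := om_kill.
have e4 : w4 = (32%:R / 27%:R) *: (e0 + e1 + e2) + - (15%:R / 27%:R) *: om.
  rewrite sum_e -[om]/(w3 + w4); move: (w3) (w4) => A B.
  transitivity ((32%:R / 27%:R * (15%:R / 32%:R) - 15%:R / 27%:R) *: A + (32%:R / 27%:R * (21%:R / 16%:R) - 15%:R / 27%:R) *: B); last by lmod.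
  have c1 : 32%:R / 27%:R * (15%:R / 32%:R) - 15%:R / 27%:R = 0 :> K by field.
  have c2 : 32%:R / 27%:R * (21%:R / 16%:R) - 15%:R / 27%:R = 1 :> K by field.
  by rewrite c1 c2 scale0r scale1r add0r.
split=> //; have ks : kill (e0 + e1) by exact: (subspD (@kill_subsp K F)).
have ks' : kill (e0 + e1 + e2) by exact: (subspD (@kill_subsp K F)).
have ok : kill (- (15%:R / 27%:R) *: om) by exact: (subspZ _ (@kill_subsp K F)).
have E f : autF f -> f w4 = (32%:R / 27%:R) *: (f e0 + f e1 + f e2) + - (15%:R / 27%:R) *: om.
  by move=> hf; case: (hf) => _ lf _ fo _; rewrite {1}e4 lf// (gZ hf)// fo (gD hf ks ke2) (gD hf ke0 ke1).
by rewrite (E g)// (E h)// a0 a1 a2.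
Qed.

Section TauTri.
Variables x y z : F.
Hypothesis ht : tri x y z.
Let cx : conf (2%:R^-1) x. Proof. by have [b [[]]] := ht. Qed.
Let kx : kill x. Proof. by have [b [[]]] := ht. Qed.

Lemma ps_one : ps x false one.
Proof.
apply: (ps_eig (t := 0)); [exact: kill_one| |by left].
by split=> [|n n2]; rewrite Y_creative ?scale0r//; lia.
Qed.
Lemma ps_x : ps x false x.
Proof. by have := ps_X cx (-1) ps_one; rewrite Y_vac. Qed.
Lemma ps_om : ps x false om.
Proof.
have [b [_ po _ _ _]] := ht; rewrite -(subrK x om); apply: (subspD (ps_subsp _ _)); last exact: ps_x.
by apply: (ps_eig (t := 0)) => //; [apply: (subspB (@kill_subsp K F)) => //; exact: om_kill|left].
Qed.
Lemma tauf_x : tauf x x = x. Proof. by rewrite (tauf_ps cx ps_x). Qed.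
(** The odd part of y under x is (y - z)/2 and the other eigencomponents are even, so the image is y
    - (y - z). *)
Lemma tauf_y : kill y -> kill z -> tauf x y = z.
Proof.
move=> ky kz; have [b [_ po [pb kb] pd ey]] := ht.
pose A := (13%:R / 256%:R) *: x + (105%:R / 256%:R) *: (om - x) + (9%:R / 256%:R) *: b.
have hs := ps_subsp x false; have hs' := ps_subsp x true.
have hA : ps x false A.
  apply: (subspD hs); first apply: (subspD hs); apply: (subspZ _ hs).
  - exact: ps_x. - by apply: (subspB hs); [exact: ps_om|exact: ps_x].
  by apply: (ps_eig (t := 2%:R^-1)) => //; right.
have hd : ps x true ((1 / 2%:R) *: (y - z)).
  apply: (subspZ _ hs'); apply: (ps_eig (t := half16)) => //.
  exact: (subspB (@kill_subsp K F)).
rewrite {1}ey -/A (tauf_eq cx)//.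
have -> : A = y - (1 / 2%:R) *: (y - z) by rewrite {1}ey addrK.
rewrite -addrA -opprD -scalerDl (_ : 1 / 2%:R + 1 / 2%:R = 1 :> K) ?scale1r ?subKr//; by field.
Qed.

Lemma tauf_aut : autF (tauf x).
Proof.
split.
- move=> u ku; split; first exact: (tauf_kill cx kx).
  by move=> e; rewrite -(tauf_inv cx kx ku) e (tauf_ps cx (p := false)) //; exact: ps0.
- by move=> k u v ku kv; exact: (tauf_lin cx kx).
- by rewrite (tauf_ps cx ps_one).
- by rewrite (tauf_ps cx ps_om).
by move=> u v n ku kv; exact: (tauf_Y cx kx).
Qed.
End TauTri.

Lemma autF_comp g h : autF g -> autF h -> autF (g \o h).
Proof.
move=> [g1 g2 g3 g4 g5] [h1 h2 h3 h4 h5]; split.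
- move=> u ku; split=> /=; first exact: (g1 _ (h1 _ ku).1).1.
  by move=> /(g1 _ (h1 _ ku).1).2 /(h1 _ ku).2.
- by move=> k u v ku kv /=; rewrite h2// g2//; [exact: (h1 _ ku).1|exact: (h1 _ kv).1].
- by rewrite /= h3.
- by rewrite /= h4.
by move=> u v n ku kv /=; rewrite h5// g5//; [exact: (h1 _ ku).1|exact: (h1 _ kv).1].
Qed.

Lemma autF_id : autF id. Proof. by split. Qed.

Definition t0 := tauf e0. Definition t1 := tauf e1.

(** g permutes the three conformal vectors injectively; [t0] exchanges the last two and [t1] the
    first and the last, and six words in these two transpositions realize all six permutations. *)
Theorem autF_words g : autF g -> exists h, [/\ [\/ h = id, h = t0 | h = t1] \/
  [\/ h = t0 \o t1, h = t1 \o t0 | h = t0 \o t1 \o t0] & forall u, kill u -> g u = h u].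
Proof.
move=> hg; have [k0 k1 k2] : [/\ kill e0, kill e1 & kill e2] by split; exact: V4_kill.
have T00 : t0 e0 = e0 := tauf_x tri012.
have T01 : t0 e1 = e2 by exact: (tauf_y tri012). have T02 : t0 e2 = e1 by exact: (tauf_y tri021).
have T11 : t1 e1 = e1 := tauf_x tri102.
have T10 : t1 e0 = e2 by exact: (tauf_y tri102). have T12 : t1 e2 = e0 by exact: (tauf_y tri120).
have a0 : autF t0 := tauf_aut tri012. have a1 : autF t1 := tauf_aut tri102.
have i0 := g_isE hg k0 conf_e0; have i1 := g_isE hg k1 conf_e1; have i2 := g_isE hg k2 conf_e2.
have n01 : g e0 <> g e1 by move=> /(g_inj hg k0 k1) /e01.
have n02 : g e0 <> g e2 by move=> /(g_inj hg k0 k2) /e02.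
have n12 : g e1 <> g e2 by move=> /(g_inj hg k1 k2) /e12.
have fin h : autF h -> g e0 = h e0 -> g e1 = h e1 -> g e2 = h e2 -> forall u, kill u -> g u = h u.
  exact: aut_agree.
have c01 := autF_comp a0 a1; have c10 := autF_comp a1 a0; have c010 := autF_comp c01 a0.
case: i0 => E0; case: i1 => E1; try (by case: n01; rewrite E0 E1);
case: i2 => E2; try (by case: n02; rewrite E0 E2); try (by case: n12; rewrite E1 E2).
- exists id; split; first by left; constructor 1.
  by apply: fin => //; exact: autF_id.
- exists t0; split; first by left; constructor 2.
  by apply: fin; rewrite // ?E0 ?E1 ?E2.
- exists (t0 \o t1 \o t0); split; first by right; constructor 3.
  by apply: fin; rewrite //= ?E0 ?E1 ?E2 ?(T00, T10, T02, T01, T12, T11).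
- exists (t0 \o t1); split; first by right; constructor 1.
  by apply: fin; rewrite //= ?E0 ?E1 ?E2 ?(T00, T10, T02, T01, T12, T11).
- exists (t1 \o t0); split; first by right; constructor 2.
  by apply: fin; rewrite //= ?E0 ?E1 ?E2 ?(T00, T10, T02, T01, T12, T11).
exists t1; split; first by left; constructor 3.
by apply: fin; rewrite //= ?E0 ?E1 ?E2 ?(T00, T10, T02, T01, T12, T11).
Qed.

End Griess.

(** * V_L as an instance *)
Transparent heis lin_ext msetD msetB msetn mset0 seq_mset mkmalgU dotZ sgnL hcoef creation annihilation hmode Esh exp_mode cz bnorm Y ip Tf w1 w2 w3 w4 o5 ee vv.

Section Expand.
Context {K : numClosedFieldType} {F : fockData K}.
(** Brings the n-th product [Dm] into the shape of the recursion that defines [word_mode]. *)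
Lemma Yb_cons i p s be m (u : F) : Yb ((i, p) :: s) be m u =
  nsum (fun j => 'C(p + j, p)%:R *:
    (hh i (- p%:Z - 1 - j%:Z) (Yb s be (m + j%:Z) u) + (-1) ^+ p *: Yb s be (m - p%:Z - 1 - j%:Z) (hh i j%:Z u))).
Proof.
have g := good_field (good_Yb (F := F) s be).
rewrite /= /Dm -nsumMz; last first.
  by apply: finsMz; apply: (fins_comp (fun j => m + Negz p - j%:Z) 0 u g.1); exact: hh_field.
rewrite -nsumB; first last.
- by do 2 apply: finsMz; apply: (fins_comp (fun j => m + Negz p - j%:Z) 0 u g.1); exact: hh_field.
- by apply: finsMz; apply: (fins_comp (fun j => 0 + Negz p - j%:Z) m u (hh_field i).1).
apply: eq_nsum => j.
have -> : 0 + Negz p - j%:Z = - p%:Z - 1 - j%:Z by rewrite NegzE; lia.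
have -> : m + Negz p - j%:Z = m - p%:Z - 1 - j%:Z by rewrite NegzE; lia.
have -> : 0 + j%:Z = j%:Z by lia.
have -> : cz (Negz p) j = 'C(p + j, p)%:Z by [].
move: (hh i _ _) (Yb _ _ _ _) => x y; rewrite scaler_nat -pmulrn mulrnDl; congr (_ + _).
have -> : sgz1 (Negz p) = - (-1) ^+ p by rewrite /sgz1 /= exprS mulN1r.
rewrite mulrNz opprK -[(-1) ^+ p in LHS]signr_odd -[(-1) ^+ p in RHS]signr_odd -pmulrn; move: (Yb _ _ _ _) => z.
by case: (odd p); rewrite ?expr0 ?expr1 ?mulr1z ?mulrN1z ?scale1r ?scaleN1r ?mulNrn.
Qed.

Section Norm.
Variable k : K.
Definition cvecf : F := k *: v1f.
Definition fvecf : F := (13 / 2 ^+ 8) *: ef + (105 / 2 ^+ 8) *: (omf 3 + omf 4 - ef)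
  + (3 ^+ 2 / 2 ^+ 8) *: (- 5 *: omf 3 + 7 *: omf 4 - 4 *: ef) + cvecf.

Lemma cvecf_cc : cvecf = cc (64%:R * k).
Proof.
rewrite /cvecf /cc vvE; move: (v1f) => v; rewrite scalerA.
by congr (_ *: _); field.
Qed.

Lemma kap2 : Y cvecf 3 cvecf = (3 ^+ 5 / 2 ^+ 11) *: (bb F (mset0, 0)) -> (64%:R * k) ^+ 2 = - (3%:R / 16%:R).
Proof.
rewrite cvecf_cc /cc (linZ (Y_linl _ _)) (linZ (Y_lin _ _)) vv_3 !scalerA => /eqP.
rewrite -subr_eq0 -scalerBl scaler_eq0 (negPf (@one_neq0 K F)) orbF subr_eq0 => /eqP e.
have n81 : (-81)%:~R = - 81%:R :> K by [].
rewrite n81 in e.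
transitivity (- (128%:R / 81%:R) * (64%:R * k * (64%:R * k) * (- 81%:R / 128%:R))); first by field.
by rewrite e; field.
Qed.

Lemma fvecf_e1 : fvecf = e1 (64%:R * k).
Proof.
rewrite /fvecf cvecf_cc -eeE -w3E -w4E /e1 /V4; move: (cc _) => c.
move: (w3) (w4) (ee) => a b e.
have two3 (a1 b1 s1 a2 b2 s2 : K) : a1 = a2 -> b1 = b2 -> s1 = s2 -> a1 *: a + b1 *: b + s1 *: e + c = a2 *: a + b2 *: b + s2 *: e + 1 *: c.
  by move=> -> -> ->; rewrite scale1r.
rewrite -(two3 (105%:R / 256%:R - 5%:R * (9%:R / 256%:R)) (105%:R / 256%:R + 7%:R * (9%:R / 256%:R)) (13%:R / 256%:R - 105%:R / 256%:R - 4%:R * (9%:R / 256%:R))); [|by field|by field|by field].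
have -> : 2 ^+ 8 = 256%:R :> K by rewrite -natrX.
have -> : 3 ^+ 2 = 9%:R :> K by rewrite -natrX.
lmod.
Qed.
End Norm.
End Expand.

Section Instance.
Context {R : realType}.
Local Notation C := (R[i]%C).
Local Notation V := (VL R).

Definition Vbb (b : fock_basis) : V := << b >>.
Definition Vcf (u : V) (b : fock_basis) : C := u@_b.
Definition Vfs (u : V) : seq fock_basis := msupp u.

Lemma V_cf_lin b a (u v : V) : Vcf (a *: u + v) b = a * Vcf u b + Vcf v b.
Proof. by rewrite /Vcf mcoeffD mcoeffZ. Qed.
Lemma V_cfb b b' : Vcf (Vbb b) b' = (b == b')%:R.
Proof. by rewrite /Vcf /Vbb mcoeffU. Qed.
Lemma V_le_b (X : fock_basis -> V) b : \sum_(c <- Vfs (Vbb b)) Vcf (Vbb b) c *: X c = X b.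
Proof. exact: (lin_extU X b). Qed.
Lemma V_hh0 i s l : heis i 0 (Vbb (s, l)) = Vbb (s, l) *~ dotZ (alphaL i.+1) l.
Proof. by rewrite /Vbb heis0 scaler_int. Qed.
Lemma V_hhP i p s l : heis i (Posz p.+1) (Vbb (s, l)) =
     Vbb (msetB s [mset (i, p)]%mset, l) *~ (2 * p.+1 * s (i, p))%N%:Z.
Proof. by rewrite /Vbb heisP scaler_nat pmulrn. Qed.
Lemma V_hh_gr i n d l u : (forall b, Vcf u b != 0 -> deg2 b = d /\ b.2 = l) ->
     forall b, Vcf (heis i n u) b != 0 -> deg2 b = d - 2 * n /\ b.2 = l.
Proof.
move=> hu b nz; have := maps_supp (heis_maps i n) (S := [set b | deg2 b = d /\ b.2 = l]) hu nz.
by move=> [b' [/= [<- <-] [-> ->]]]; split; [ring|rewrite addr0].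
Qed.
Lemma V_GG_gr be n d l u : (forall b, Vcf u b != 0 -> deg2 b = d /\ b.2 = l) ->
     forall b, Vcf (exp_mode be n u) b != 0 -> deg2 b = d + (dotZ be be - 2 - 2 * n) /\ b.2 = l + be.
Proof.
move=> hu b nz; have := maps_supp (exp_mode_maps be n) (S := [set b | deg2 b = d /\ b.2 = l]) hu nz.
by move=> [b' [/= [<- <-] [-> ->]]].
Qed.
Lemma V_bbS i p s l : Vbb (msetD [mset (i, p)]%mset s, l) = heis i (Negz p) (Vbb (s, l)).
Proof. by rewrite /Vbb heisN. Qed.
Lemma V_cf_hP i p u t l : Vcf (heis i (Posz p.+1) u) (t, l) =
     (2 * p.+1 * (t (i, p)).+1)%:R * Vcf u (([mset (i, p)] `+` t)%mset, l).
Proof. exact: mcoeff_heisP. Qed.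

Definition FV : fockData (R[i]%C) := @FockData (R[i]%C) V (@heis R) (@exp_mode R) Vbb Vcf Vfs
  (@heis_lin R) (@exp_mode_lin R) V_cf_lin V_cfb (@malg_sum R) (@lin_ext_lin R) V_le_b V_bbS
  (@heis_comm R) V_hh0 V_hhP (@heis_field R) (@exp_mode_field R) V_hh_gr V_GG_gr (@exp_mode_heis R)
  (@exp_mode_top R) (@heis_kernel R) (@heisN_top R) V_cf_hP.

Lemma Yb_word s be m u : @Yb _ FV s be m u = word_mode s be m u.
Proof.
elim: s m u => [//|[i p] s IH] m u; rewrite Yb_cons.
by apply: eq_nsum => j; rewrite !IH.
Qed.

Lemma nprodY (u : V) n v : nprod u n v = Y (u : FV) n v.
Proof. by apply: eq_bigr => b _; rewrite Yb_word. Qed.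

Lemma nprod_Y : @nprod R = fun u n v => Y (u : FV) n v.
Proof. by apply/funext => u; apply/funext => n; apply/funext => v; exact: nprodY. Qed.

Opaque heis exp_mode Y nprod alphaL gammaL.

Lemma OmegaE i : Omega i = @Omf _ FV i :> V.
Proof. rewrite /Omega nprod_Y. reflexivity. Qed.
Lemma omegavE i : omegav i = @omf _ FV i :> V.
Proof. rewrite /omegav !OmegaE. reflexivity. Qed.
Lemma evecE : evec = @ef _ FV :> V. Proof. reflexivity. Qed.
Lemma v1vecE : v1vec = @v1f _ FV :> V.
Proof. rewrite /v1vec nprod_Y. reflexivity. Qed.
Lemma vacE : vac = bb FV (mset0, 0) :> V. Proof. reflexivity. Qed.
Lemma cvecE k : cvec k = @cvecf _ FV k :> V.
Proof. rewrite /cvec v1vecE. reflexivity. Qed.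
Lemma fvecE k : fvec k = @fvecf _ FV k :> V.
Proof. rewrite /fvec cvecE /avec /bvec /omegaU !omegavE evecE. reflexivity. Qed.
Lemma omegaUE : omegaU = @om _ FV :> V.
Proof. rewrite /omegaU !omegavE -w3E -w4E. reflexivity. Qed.

Lemma UE (u : V) : U R u <-> @kill _ FV u.
Proof. by rewrite /U /kill /= nprod_Y w1E w2E o5E -!omegavE -OmegaE. Qed.

End Instance.

(** * Miyamoto involutions *)

Opaque heis exp_mode Y nprod alphaL gammaL.

Lemma binz3 (m : int) : binz m 3 * 6 = m * (m - 1) * (m - 2).
Proof.
have := cz_rec m 2; have := cz_rec m 1; have := cz_rec m 0; rewrite cz0 /binz.
have -> : (-1) ^+ 3 = -1 :> int by [].
move: (cz m 1) (cz m 2) (cz m 3) => a b c; rewrite -[1%:Z]/(1 : int) -[2%:Z]/(2 : int) -[3%:Z]/(3 : int) mul1r sub0r mulr1 => -> h2 h3.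
have -> : -1 * c * 6 = - 2 * (c * 3) by ring.
by rewrite h3; have -> : -2 * (b * (2 - m)) = - (b * 2) * (2 - m) by [ring]; rewrite h2; ring.
Qed.

Section VirDesc.
Context {K : numClosedFieldType} {F : fockData K}.
Variable x : F.
Hypothesis hx : conf (2%:R^-1) x.

Lemma vir_comm (m n : int) (w : F) : Y x (m + 1) (Y x (n + 1) w) - Y x (n + 1) (Y x (m + 1) w) =
  (m - n)%:~R *: Y x (m + n + 1) w + (if m + n == 0 then ((m ^+ 3 - m)%:~R / 12 * (1 / 2)) *: w else 0).
Proof.
rewrite (conf_comm hx); have -> : m + 1 + (n + 1) - 1 = m + n + 1 by ring.
have -> : m + 1 - (n + 1) = m - n by ring.
rewrite scaler_int; congr (_ + _); have -> : (m + 1 + (n + 1) == 2) = (m + n == 0) by apply/eqP/eqP; lia.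
case: ifP => // _; rewrite -scaler_int scalerA; congr (_ *: _).
have e : m ^+ 3 - m = binz (m + 1) 3 * 6%:Z by rewrite -[6%:Z]/(6 : int) binz3; ring.
rewrite e intrM -[(6%:Z)%:~R]/(6%:R : K); move: (binz _ _)%:~R => B; by field.
Qed.

(** By the iterate formula the modes of a_(l) b are locally finite sums of products of modes of a
    and b. *)
Lemma stable_Y (S : F -> Prop) (a b : F) : subsp S ->
  (forall n u, S u -> S (Y a n u)) -> (forall n u, S u -> S (Y b n u)) ->
  forall l n u, S u -> S (Y (Y a l b) n u).
Proof.
move=> hS ha hb l n u Su; rewrite Y_iter /Dm; apply: (subspB hS); last apply: (subspMz _ hS).
  apply: (subsp_nsum hS) => [|j]; last by apply: (subspMz _ hS); apply: ha; exact: hb.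
  by apply: finsMz; apply: (fins_comp (fun j => 0 + l - j%:Z) n u (Y_field a).1 (Y_field b)).
apply: (subsp_nsum hS) => [|j]; last by apply: (subspMz _ hS); apply: hb; exact: ha.
by apply: finsMz; apply: (fins_comp (fun j => n + l - j%:Z) 0 u (Y_field b).1 (Y_field a)).
Qed.

Lemma desc_zero t0 u : desc x t0 0 u -> u = 0.
Proof.
apply: (desc_min (S := fun u => u = 0)) => //.
  by split=> // a u' v -> ->; rewrite scaler0 addr0.
by move=> n u' ->; rewrite (lin0 (Y_lin _ _)).
Qed.
Lemma autF_ext (g h : F -> F) : autF g -> (forall u, kill u -> h u = g u) -> autF h.
Proof.
move=> [g1 g2 g3 g4 g5] e; split.
- by move=> u ku; rewrite e//; exact: g1.
- by move=> k u v ku kv; rewrite !e//; [exact: g2|exact: kill_lin].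
- by rewrite e//; exact: kill_one.
- by rewrite e//; exact: om_kill.
by move=> u v n ku kv; rewrite !e//; [exact: g5|exact: kill_Y].
Qed.
End VirDesc.

(** * Comparison with the submodules and involutions of the statement *)

Section Transfer.
Context {R : realType}.
Local Notation C := (R[i]%C).
Local Notation V := (VL R).
Local Notation F := (FV (R := R)).
Variable x : F.
Hypotheses (hx : conf (2%:R^-1) x) (kx : kill x).

(** The states whose modes preserve S form a vertex subalgebra containing x, hence all of Vir(x). *)
Lemma Vir_stable (S : F -> Prop) : subsp S -> (forall n u, S u -> S (Y x n u)) ->
  forall a, Vir (x : V) a -> forall n u, S u -> S (Y (a : F) n u).
Proof.
move=> hS hX; pose A : set V := [set a | forall n u, S u -> S (Y (a : F) n u)].
have hA : is_subVA A.
  split.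
  - split=> [n u _|c u v hu hv n w Sw]; first by rewrite (lin0 (Y_linl n u)); exact: hS.1.
    by rewrite (Y_linl (F := F) n w c u v); apply: hS.2; [exact: hu|exact: hv].
  - move=> n u Su; rewrite vacE Y_one; case: ifP => // _; exact: hS.1.
  - move=> u v n hu hv m w Sw; rewrite nprod_Y; exact: (stable_Y hS hu hv).
move=> a ha; apply: (ha A); split; first exact: hA.
by move=> z ->; exact: hX.
Qed.

Lemma Vir_x : Vir (x : V) x.
Proof. by move=> A [_ h]; apply: h. Qed.

Lemma desc_vir t0 (w : F) : prim x t0 w -> is_vir_module (Lop (x : V)) (1 / 2) (desc x t0 w : set V).
Proof.
move=> pw; split; first exact: (desc_subsp x t0 w).
move=> m n u hu; rewrite /Lop nprod_Y; split; first exact: (desc_X hx pw).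
exact: (vir_comm hx).
Qed.

(** Both notions of submodule, over Vir(x) and over the Virasoro operators, give stability under all
    modes of x, and [desc_irr] settles irreducibility for both at once. *)
Lemma desc_Vir_submodule p t0 (w : F) : pv p t0 -> prim x t0 w -> kill w -> w != 0 ->
  Vir_submodule (U R) (x : V) t0 (desc x t0 w : set V).
Proof.
move=> ht pw kw w0; have hd := desc_subsp x t0 w; have ww := desc_w x t0 w.
have irr (W' : set V) : is_subspace W' -> W' `<=` (desc x t0 w : set V) -> (forall n (u : V), W' u -> W' (Y x n u)) ->
    W' = [set 0] \/ W' = (desc x t0 w : set V).
  move=> h1 h2 h3; have [h|h] := desc_irr hx pw (pv_real ht) h1 h3 h2.
    by left; apply/seteqP; split=> [u /h -> //|u -> ]; exact: h1.1.
  by right; apply/seteqP; split=> // u; exact: h.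
split; split.
- split; first by move=> u hu; apply/UE; apply: (ps_kill kx); exact: (ps_desc ht pw kw hu).
    exact: hd.
  have hX (n : int) (u : F) : desc x t0 w u -> desc x t0 w (Y x n u) by exact: (desc_X hx pw).
  by move=> a u n ha hu; rewrite nprod_Y; exact: (Vir_stable hd hX ha n hu).
- apply/eqP => e; have : (desc x t0 w : set V) w by [].
  by rewrite e => /eqP; rewrite (negPf w0).
- move=> W' [h1 h2 h3] hs; apply: irr => // n u hu; have := h3 x u n Vir_x hu.
  by rewrite nprod_Y.
- exact: desc_vir.
- move=> W' [h1 h2] hs; apply: irr => // n u hu; have [] := h2 (n - 1) 0 u hu.
  by rewrite /Lop nprod_Y subrK.
exists w; split; [exact: ww|exact: w0| |].
  by rewrite /Lop nprod_Y add0r; exact: pw.1.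
by move=> n n0; rewrite /Lop nprod_Y; apply: pw.2; lia.
Qed.

(** The highest weight vector of W is primary, and the span of its descendants is a nonzero
    submodule of W, hence W itself. *)
Lemma Vir_submodule_ps p t0 (W : set V) : pv p t0 -> Vir_submodule (U R) (x : V) t0 W ->
  forall u, W u -> ps (F := F) x p u.
Proof.
move=> ht [[[WU _ _] _ _] [[hs hW] irr [w [Ww w0 e0 eS]]]] u.
have pw : prim (F := F) x t0 w.
  split; first by have := e0; rewrite /Lop nprod_Y add0r.
  by move=> n n2; have := eS (n - 1) ltac:(lia); rewrite /Lop nprod_Y subrK.
have kw : kill (w : F) by apply/UE; exact: WU.
have sub : (desc x t0 w : set V) `<=` W.
  apply: (desc_min (F := F) hs) => // n v Wv; have [] := hW (n - 1) 0 v Wv.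
  by rewrite /Lop nprod_Y subrK.
have ww := desc_w (F := F) x t0 w.
case: (irr _ (desc_vir pw) sub) => e; last by rewrite -e => hu; exact: (ps_desc ht pw kw hu).
by have : (desc x t0 w : set V) w; [|rewrite e => /eqP; rewrite (negPf w0)].
Qed.

Definition tau_part (p : bool) : set V := if p then tau_odd (U R) (x : V) else tau_even (U R) (x : V).

Lemma tau_partE p (u : V) : tau_part p u <-> ps (F := F) x p u.
Proof.
have hs q := ps_subsp (F := F) x q.
have o2 : 1 / 2 = 2%:R^-1 :> C by rewrite mul1r.
have o16 : 1 / 16 = 16%:R^-1 :> C by rewrite mul1r.
split.
  case: p => h; apply: (h (ps (F := F) x _ : set V)); split; try exact: hs.
    by move=> v [W [hW Wv]]; apply: (Vir_submodule_ps (t0 := 1 / 16)) hW _ Wv; rewrite /= o16.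
  move=> v [W [[hW|hW] Wv]].
    by apply: (Vir_submodule_ps (t0 := 0)) hW _ Wv; left.
  by apply: (Vir_submodule_ps (t0 := 1 / 2)) hW _ Wv; right; rewrite o2.
have sub : is_subspace (tau_part p).
  by case: p; split=> [A hA|a v w hv hw A hA]; [exact: hA.1.1|apply: hA.1.2; [exact: hv|exact: hw]|exact: hA.1.1|apply: hA.1.2; [exact: hv|exact: hw]].
move=> hu; elim: hu => [|t0 w v v' ht pw kw hd _ IH]; first exact: sub.1.
(* A zero generator spans no irreducible module and is set aside; its descendants are zero. *)
have [w0|w0] := eqVneq w 0.
  by rewrite w0 in hd; rewrite (desc_zero hd) add0r.
have sm := desc_Vir_submodule ht pw kw w0.
have hv : tau_part p v.
  case: p {sub IH} ht sm => /= ht sm A hA; apply: hA.2; exists (desc x t0 w : set V); split; try exact: hd.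
    by rewrite o16 -ht; exact: sm.
  case: ht => e; [left|right]; move: sm; last rewrite o2; by rewrite {1}e.
by rewrite -[v]scale1r; apply: sub.2.
Qed.

Lemma tauE (v : V) : U R v -> tau (U R) (x : V) v = tauf (F := F) x v.
Proof.
move=> /UE kv; have [a [b [ha hb e]]] := psumP hx kx kv.
rewrite /tau; case: xgetP => [[c d] _ /= [hc hd ->]|no].
  have {}hc : ps (F := F) x false c by apply/(tau_partE false).
  have {}hd : ps (F := F) x true d by apply/(tau_partE true).
  by rewrite (tauf_eq hx hc hd).
by case: (no (a, b)); split=> //=; [apply/(tau_partE false)|apply/(tau_partE true)].
Qed.

End Transfer.

(** * The automorphism group of the statement *)

Section Aut.
Context {R : realType}.
Local Notation C := (R[i]%C).
Local Notation V := (VL R).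
Local Notation F := (FV (R := R)).

Lemma Aut_autF (g : V -> V) : Aut (U R) omegaU g -> autF (g : F -> F).
Proof.
move=> [[gU gi gs] gl gv go gY]; rewrite nprod_Y in gY.
have k0 : U R 0 by apply/UE; exact: kill0.
have g00 : g 0 = 0 by have := gl (-1) 0 0 k0 k0; rewrite scaler0 addr0 scaleN1r addNr.
split.
- move=> u ku0; have ku : U R u by exact/UE.
  split; first by apply/UE; exact: gU.
  by move=> e; exact: (gi u 0 (mem_set ku) (mem_set k0) (etrans e (esym g00))).
- by move=> k u v /UE ku /UE kv; exact: gl.
- exact: gv.
- by move: go; rewrite omegaUE.
by move=> u v n /UE ku /UE kv; exact: gY.
Qed.

Lemma autF_Aut (g h : V -> V) : autF (g : F -> F) -> (forall u, U R u -> U R (h u) /\ g (h u) = u) -> Aut (U R) omegaU g.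
Proof.
move=> [g1 g2 g3 g4 g5] hh; have gU u : U R u -> U R (g u) by move=> /UE /g1[] /UE.
have k0 : kill (0 : F) := kill0.
split.
- split.
  + exact: gU.
  + move=> u v /set_mem /UE ku /set_mem /UE kv e; apply: (@subr0_eq F).
    have kd : kill (u - v : F) by exact: (subspB (@kill_subsp _ F)).
    apply: (g1 _ kd).2; have := g2 (-1) v u kv ku; rewrite (scaleN1r (v : F)) (addrC _ (u : F)) => ->.
    by rewrite e (scaleN1r (g v : F)); exact: (addNr (g v : F)).
  + by move=> u Uu; exists (h u); [exact: (hh _ Uu).1|exact: (hh _ Uu).2].
- by move=> a u v /UE ku /UE kv; exact: g2.
- exact: g3.
- by rewrite omegaUE.
by move=> u v n /UE ku /UE kv; rewrite nprod_Y; exact: g5.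
Qed.

Lemma tau_Aut x y z : tri (x : F) (y : F) (z : F) -> Aut (U R) omegaU (tau (U R) (x : V)).
Proof.
move=> ht; have [b [[cx kx] _ _ _ _]] := ht.
have E (v : V) : kill (v : F) -> tau (U R) (x : V) v = tauf (F := F) x v by move=> kv; apply: (tauE cx kx); exact/UE.
apply: (@autF_Aut _ (tauf (F := F) x)); first exact: (autF_ext (tauf_aut ht) E).
move=> u /UE ku; have kt := tauf_kill cx kx ku; split; first exact/UE.
by rewrite (E _ kt); exact: (tauf_inv cx kx).
Qed.

Lemma Aut_U (g : V -> V) v : Aut (U R) omegaU g -> U R v -> U R (g v).
Proof. by move=> [[gU _ _] _ _ _ _]; exact: gU. Qed.

Lemma Aut_subgroup : is_subgroup (U R) (Aut (U R) omegaU).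
Proof.
split.
- split; [|by []|by []|by []|by []].
  by split; [move=> u hu; exact: hu|move=> u v _ _ e; exact: e|move=> u hu; exists u; [exact: hu|by []]].
- move=> g h [[gU gi gs] g2 g3 g4 g5] [[hU hi hs] h2 h3 h4 h5]; split.
  + split; first by move=> u hu; apply: gU; exact: hU.
      move=> u v hu hv e; apply: hi => //; apply: gi; [| |exact: e]; apply: mem_set; apply: hU; exact: set_mem.
    move=> u /gs[v /hs[w hw <-] <-]; by exists w.
  + by move=> a u v hu hv /=; rewrite (h2 a u v hu hv) g2; [|exact: hU|exact: hU].
  + by rewrite /= h3.
  + by rewrite /= h4.
  by move=> u v n hu hv /=; rewrite (h5 u v n hu hv) g5; [|exact: hU|exact: hU].
- move=> g h [[gU gi gs] g2 g3 g4 g5] gh hg.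
  have kk u : U R u -> h (g u) = u by move=> hu; apply: gh; exact: mem_set.
  have kk' u : U R u -> g (h u) = u by move=> hu; apply: hg; exact: mem_set.
  have hU u : U R u -> U R (h u) by move=> /gs[v hv <-]; rewrite kk.
  have inj u v : U R u -> U R v -> g u = g v -> u = v by move=> hu hv e; apply: gi; [exact: mem_set|exact: mem_set|exact: e].
  have kl a (u v : V) : U R u -> U R v -> U R (a *: u + v).
    by move=> /UE ku /UE kv; apply/UE; exact: (kill_lin (F := F) a ku kv).
  have kY (u v : V) n : U R u -> U R v -> U R (nprod u n v).
    by move=> /UE ku /UE kv; apply/UE; rewrite nprod_Y; exact: (kill_Y (F := F) n ku kv).
  have kvac : U R vac by apply/UE; exact: (@kill_one _ F).
  have kom : U R omegaU by apply/UE; rewrite omegaUE; exact: (@om_kill _ F).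
  split.
  + split; first exact: hU.
      by move=> u v /set_mem hu /set_mem hv e; rewrite -(kk' _ hu) -(kk' _ hv) e.
    by move=> u hu; exists (g u); [exact: gU|exact: kk].
  + move=> a u v hu hv; have e := kl a _ _ (hU _ hu) (hU _ hv).
    by apply: (inj _ _ (hU _ (kl a _ _ hu hv)) e); rewrite (g2 _ _ _ (hU _ hu) (hU _ hv)) (kk' _ (kl a _ _ hu hv)) (kk' _ hu) (kk' _ hv).
  + by rewrite -[in LHS]g3 kk.
  + by rewrite -[in LHS]g4 kk.
  move=> u v n hu hv; have e := kY _ _ n (hU _ hu) (hU _ hv).
  by apply: (inj _ _ (hU _ (kY _ _ n hu hv)) e); rewrite (g5 _ _ _ (hU _ hu) (hU _ hv)) (kk' _ (kY _ _ n hu hv)) (kk' _ hu) (kk' _ hv).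
move=> g h [[gU gi gs] g2 g3 g4 g5] e.
have E u : U R u -> h u = g u by move=> hu; rewrite (e u (mem_set hu)).
have kl a (u v : V) : U R u -> U R v -> U R (a *: u + v).
  by move=> /UE ku /UE kv; apply/UE; exact: (kill_lin (F := F) a ku kv).
have kY (u v : V) n : U R u -> U R v -> U R (nprod u n v).
  by move=> /UE ku /UE kv; apply/UE; rewrite nprod_Y; exact: (kill_Y (F := F) n ku kv).
have kvac : U R vac by apply/UE; exact: (@kill_one _ F).
have kom : U R omegaU by apply/UE; rewrite omegaUE; exact: (@om_kill _ F).
split.
- split; first by move=> u hu; rewrite E; [exact: gU|exact: hu].
    by move=> u v hu hv; rewrite !E; [exact: gi hu hv|exact: set_mem|exact: set_mem].
  by move=> u /gs[v hv <-]; exists v; [exact: hv|exact: E].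
- by move=> a u v hu hv; rewrite !E; [exact: g2|exact: hv|exact: hu|exact: kl].
- by rewrite E; [exact: g3|exact: kvac].
- by rewrite E; [exact: g4|exact: kom].
by move=> u v n hu hv; rewrite !E; [exact: g5|exact: hv|exact: hu|exact: kY].
Qed.

End Aut.

Theorem theorem4p13 (R : realType) (k : R[i]%C)
    (hk : nprod (cvec k) 3 (cvec k) = (3 ^+ 5 / 2 ^+ 11) *: vac) :
  Aut (U R) omegaU
  = group_gen (U R) [set tau (U R) evec; tau (U R) (fvec k)].
Proof.
(* Only the square of k is determined by the normalization, so the argument covers both signs. *)
have h2 : (64%:R * k) ^+ 2 = - (3%:R / 16%:R).
  by apply: (@kap2 _ (FV (R := R))); rewrite -cvecE -nprodY.
have eE : evec = e0 (F := FV (R := R)) (64%:R * k) :> VL R by rewrite evecE -eeE e0E.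
have fE : fvec k = e1 (F := FV (R := R)) (64%:R * k) :> VL R.
  rewrite fvecE; exact: (@fvecf_e1 _ (FV (R := R)) k).
rewrite eE fE; set x0 := e0 _; set x1 := e1 _.
have T0 : Aut (U R) omegaU (tau (U R) x0) := tau_Aut (tri012 h2).
have T1 : Aut (U R) omegaU (tau (U R) x1) := tau_Aut (tri102 h2).
apply/seteqP; split=> g hg; last first.
  by apply: (hg (Aut (U R) omegaU)); split; [exact: Aut_subgroup|move=> h [->|->]].
move=> A [hA AT]; have A0 : A (tau (U R) x0) by apply: AT; left.
have A1 : A (tau (U R) x1) by apply: AT; right.
have [h [hw hh]] := autF_words h2 (Aut_autF hg).
have [_ Ac _ Ae] := hA.
have [b0 [[cx0 kx0] _ _ _ _]] : tri (x0 : FV (R := R)) (e1 _) (e2 _) := tri012 h2.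
have [b1 [[cx1 kx1] _ _ _ _]] : tri (x1 : FV (R := R)) (e0 _) (e2 _) := tri102 h2.
have E0 (v : VL R) : U R v -> tau (U R) x0 v = tauf (F := FV (R := R)) x0 v by exact: (tauE cx0 kx0).
have E1 (v : VL R) : U R v -> tau (U R) x1 v = tauf (F := FV (R := R)) x1 v by exact: (tauE cx1 kx1).
(* A subgroup is closed under replacing a map by one with the same values on U, so words in the
   given involutions may be compared with g on U alone. *)
have fin h' : A h' -> (forall v, U R v -> h' v = h v) -> A g.
  move=> Ah e; apply: (Ae _ _ Ah) => v /set_mem hv; rewrite e; last exact: hv.
  by apply/esym/hh/UE.
case: hw => [[] e|[] e]; rewrite e in fin.
- by apply: (fin id); [case: hA|move=> v _].
- by apply: (fin _ A0) => v; exact: E0.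
- by apply: (fin _ A1) => v; exact: E1.
- by apply: (fin _ (Ac _ _ A0 A1)) => v hv /=; rewrite E0; [rewrite E1; [by []|exact: hv]|exact: (Aut_U T1 hv)].
- by apply: (fin _ (Ac _ _ A1 A0)) => v hv /=; rewrite E1; [rewrite E0; [by []|exact: hv]|exact: (Aut_U T0 hv)].
by apply: (fin _ (Ac _ _ (Ac _ _ A0 A1) A0)) => v hv /=; rewrite E0; [rewrite E1; [rewrite E0; [by []|exact: hv]|exact: (Aut_U T0 hv)]|exact: (Aut_U T1 (Aut_U T0 hv))].
Qed.
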